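(* Let $\mathfrak g^0$ be a non-regular CR symbol encoded by the pair $(\ell,\boldsymbol A)$, represented in a canonical basis by the matrices $H_\ell=\bigoplus_{i=1}^\gamma\epsilon_iN_{\lambda_i,m_i}$ and $A=\bigoplus_{i=1}^\gamma M_{\lambda_i,m_i}$. For $1\le i,j\le\gamma$ let $$d(i,j)=\begin{cases}0,& \lambda_i\ne\lambda_j,\ \text{or}\ \left(i=j\text{ and }\lambda_i^2\text{ is not a nonpositive real number}\right),\\ \min\{m_i,m_j\},& (i\ne j\text{ and }\lambda_i=\lambda_j>0)\ \text{or}\ (i=j\text{ and }\lambda_i^2<0),\\ 2\min\{m_i,m_j\},& i\ne j,\ \lambda_i=\lambda_j\ \text{and}\ (\lambda_i^2\notin\mathbb R\text{ or }\lambda_i=0),\\ 4\min\{m_i,m_j\},& i\neq j,\ \lambda_i=\lambda_j\ \text{and}\ \lambda_i^2<0,\\ \lceil m_i/2\rceil,& i=j\text{ and }\lambda_i=0,\end{cases}$$ and let $d_{\mathrm{total}}=\sum_{i\le j}d(i,j)$. Then the dimension of the algebra of infinitesimal symmetries of a $2$-nondegenerate $(2n+1)$-dimensional CR structure of hypersurface type with $1$-dimensional Levi kernel admitting a constant reduced modified CR symbol corresponding to the CR symbol $\mathfrak g^0$ is not greater than $d_{\mathrm{total}}+2n+3$ if $\boldsymbol A$ is not nilpotent, and it is not greater than $d_{\mathrm{total}}+2n+4$ if $\boldsymbol A$ is nilpotent.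
   Context: **CR structures.** $M$ is a real manifold of dimension $2n+1$, and $H\subset \mathbb{C}TM$ is a complex rank $n$ subbundle with $[H,H]\subset H$ and $H\cap\overline H=0$ (a CR structure of hypersurface type). The Levi form is $\mathcal L(X_x,Y_x)=\frac i2[X,\overline Y]_x \bmod H_x\oplus\overline H_x$ for $X,Y\in\Gamma(H)$; its kernel is the Levi kernel $K$, assumed to be a rank $1$ distribution. For $v\in K_x$ and $y\in\overline H_x/\overline K_x$ put $\mathrm{ad}_v(y)=[V,Y]_x \bmod K_x\oplus\overline H_x\in H_x/K_x$, where $V\in\Gamma(K)$, $V(x)=v$, $Y\in\Gamma(\overline H)$, $Y(x)\equiv y \bmod \overline K_x$. The structure is $2$-nondegenerate if at every $x$ no nonzero $v\in K_x$ has $\mathrm{ad}_v=0$. An infinitesimal symmetry is a vector field $Z$ on $M$ with $[Z,\Gamma(H)]\subset\Gamma(H)$. **CR symbol.** At $x\in M$ set $\mathfrak g_{-2,0}=\mathbb{C}T_xM/(H_x\oplus\overline H_x)$, $\mathfrak g_{-1,-1}=\overline H_x/\overline K_x$, $\mathfrak g_{-1,1}=H_x/K_x$, $\mathfrak g_{-1}=\mathfrak g_{-1,-1}\oplus\mathfrak g_{-1,1}$, $\mathfrak g_-=\mathfrak g_{-2,0}\oplus\mathfrak g_{-1}$. The reduced Levi form $\ell$ is the nondegenerate Hermitian form on $\mathfrak g_{-1,1}$ induced by $\mathcal L$ (with values in $\mathfrak g_{-2,0}\cong\mathbb{C}$; only the line $\mathbb{R}\ell$ is invariant). $\mathfrak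 g_-$ is a Heisenberg algebra whose nontrivial brackets are $[v,w]=i\ell(v,\overline w)$, $v\in\mathfrak g_{-1,1}$, $w\in\mathfrak g_{-1,-1}$. The bracket gives a symplectic form on $\mathfrak g_{-1}$, with conformal symplectic algebra $\mathfrak{csp}(\mathfrak g_{-1})$, which acts on $\mathfrak g_-$ by degree-zero derivations. For $v\in K_x$ let $A_v:\mathfrak g_{-1,1}\to\mathfrak g_{-1,1}$ be the antilinear operator $A_v(y)=\mathrm{ad}_v(\overline y)$; then $\{A_v: v\in K_x\}=\mathbb{C}\boldsymbol A$ for some antilinear $\boldsymbol A\ne0$, which is $\ell$-self-adjoint. Let $\mathfrak g_{0,2}$ be the set of $\varphi\in \mathfrak{csp}(\mathfrak g_{-1})$ with $\varphi|_{\mathfrak g_{-1,1}}=0$ and, for some $\lambda\in\mathbb{C}$, $\varphi(w)=\lambda\boldsymbol A(\overline w)$ for all $w\in\mathfrak g_{-1,-1}$. Complex conjugation acts on $\mathfrak{csp}(\mathfrak g_{-1})$ by $\overline\varphi(v)=\overline{\varphi(\overline v)}$; put $\mathfrak g_{0,-2}=\overline{\mathfrak g_{0,2}}$ and $\mathfrak g_{0,0}=\{v\in\mathfrak{csp}(\mathfrak g_{-1}) : v(\mathfrak g_{-1,\pm1})\subset\mathfrak g_{-1,\pm1},\ [v,\mathfrak g_{0,\pm2}]\subset\mathfrak g_{0,\pm2}\}$. The CR symbol of $H$ at $x$ is the bigraded space $\mathfrak g^0(x)=\mathfrak g_{-2,0}\oplus\mathfrak g_{-1,-1}\oplus\mathfrak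 g_{-1,1}\oplus\mathfrak g_{0,-2}\oplus\mathfrak g_{0,0}\oplus\mathfrak g_{0,2}$ with its antilinear involution; it encodes and is encoded by the pair $(\mathbb{R}\ell,\mathbb{C}\boldsymbol A)$. It is regular if it is a Lie subalgebra of $\mathfrak g_-\rtimes\mathfrak{csp}(\mathfrak g_{-1})$ (equivalently $\boldsymbol A^3\in\mathbb{C}\boldsymbol A$), and non-regular otherwise. The CR symbol is constant if $\mathfrak g^0(x)$ is isomorphic, for all $x$, to one fixed abstract symbol $\mathfrak g^0$ with components $\mathfrak g_{i,j}$. **Canonical form.** $J_{\lambda,m}$ is the $m\times m$ Jordan block with eigenvalue $\lambda$ and ones on the superdiagonal; $S_m$ is the $m\times m$ matrix with $(i,j)$ entry $1$ if $i+j=m+1$ and $0$ otherwise. For $\lambda\in\mathbb{C}$ put $M_{\lambda,k}=J_{\lambda,k}$ and $N_{\lambda,k}=S_k$ if $\lambda\in\mathbb{R}$; otherwise $M_{\lambda,k}=\begin{pmatrix}0&J_{\lambda^2,k}\\ I&0\end{pmatrix}$ and $N_{\lambda,k}=S_{2k}$. $\bigoplus$ denotes block-diagonal sum. It is known that there is a basis of $\mathfrak g_{-1,1}$ in which $\ell$ and $\boldsymbol A$ are represented by $H_\ell=\bigoplus_{i=1}^\gamma\epsilon_iN_{\lambda_i,m_i}$, $A=\bigoplus_{i=1}^\gamma M_{\lambda_i,m_i}$ with $\epsilon_i=\pm1$, positive integers $m_i$, and $\lambda_i\in\mathbb{C}$ having nonnegative real and imaginary parts; this is the canonical basis. Both matrices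 are of size $(n-1)\times(n-1)$. **Reduced modified symbol.** Assume the CR symbol is constant, and that the structure is real-analytic, so that (after shrinking $M$) one can complexify: replacing real local coordinates by complex ones gives a complexified manifold $\mathbb{C}M\supset M$ to which $H,\overline H,K,\overline K$ extend as holomorphic distributions; the spaces $\mathfrak g_{i,j}(x)$ are defined in the same way for $x\in\mathbb{C}M$. The distribution $K+\overline K$ on $\mathbb{C}M$ is involutive; let $\pi:\mathbb{C}M\to\mathcal N$ be the projection onto its leaf space. Let $\mathrm{pr}:P^0\to\mathbb{C}M$ be the bundle whose fiber over $x$ consists of the Lie algebra isomorphisms $\varphi:\mathfrak g_-\to\mathfrak g_-(x)$ with $\varphi(\mathfrak g_{i,j})=\mathfrak g_{i,j}(x)$ for $(i,j)\in\{(-1,\pm1),(-2,0)\}$ and $\varphi^{-1}\circ\mathfrak g_{0,\pm2}(x)\circ\varphi=\mathfrak g_{0,\pm2}$. For $\gamma\in\mathcal N$ let $(P^0)_\gamma=(\pi\circ\mathrm{pr})^{-1}(\gamma)$. For all $x\in\pi^{-1}(\gamma)$, the space $\mathfrak g_{-1}(x)\cong (H+\overline H)_x/(K+\overline K)_x$ is identified by $\pi_*$ with one fixed hyperplane in $T_\gamma\mathcal N$ (and similarly for $\mathfrak g_{-2,0}(x)$), so a curve $\psi(t)$ in $(P^0)_\gamma$ is a curve of isomorphisms from $\mathfrak g_-$ to a fixed space; set $\theta_0(\psi'(0))=\psi(0)^{-1}\psi'(0)\in\mathfrak{csp}(\mathfrak g_{-1})$. A reduction of $P^0$ is a maximal connected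 submanifold $\widetilde{P^0}$ of a level set of the map $\psi\mapsto\theta_0(T_\psi(P^0)_{\pi\circ\mathrm{pr}(\psi)})$ such that $\mathrm{pr}(\widetilde{P^0})=\mathbb{C}M$; the procedure may be iterated, replacing $P^0$ by $\widetilde{P^0}$ and $\theta_0$ by its restriction to the vertical tangent vectors of $\pi\circ\mathrm{pr}:\widetilde{P^0}\to\mathcal N$, and every bundle so obtained is again called a reduction of $P^0$. For a reduction $P^{0,\mathrm{red}}$ put $\mathfrak g_0^{\mathrm{red}}(\psi)=\theta_0(T_\psi(P^{0,\mathrm{red}})_{\pi\circ\mathrm{pr}(\psi)})$ and $\mathfrak g^{0,\mathrm{red}}(\psi)=\mathfrak g_-\oplus\mathfrak g_0^{\mathrm{red}}(\psi)$. $(M,H)$ admits a constant reduced modified CR symbol $\mathfrak g^{0,\mathrm{red}}$ if there is a reduction $P^{0,\mathrm{red}}$ with $\mathfrak g^{0,\mathrm{red}}(\psi)=\mathfrak g^{0,\mathrm{red}}$ for all $\psi\in P^{0,\mathrm{red}}$; it corresponds to the CR symbol $\mathfrak g^0$ if $\mathfrak g^0$ is the constant CR symbol of $(M,H)$. *)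

(* Defs.v *)
(* Conventions.  Vectors are row vectors, subspaces are row spaces of matrices
   (scope %MS), and a linear operator T is the matrix acting by v |-> v *m T.
   q = n - 1 is the dimension of g_{-1,1}, so that dim M = 2n + 1 is
   2 * q.+1 + 1 and the leaf space has dimension 2n - 1 = 2 * q + 1.
   The matrix A of an antilinear operator is taken in the usual column
   convention: y |-> A * conj y on columns, i.e. y |-> conj y *m A^T on rows. *)
From HB Require Import structures.
From mathcomp Require Import all_boot all_order all_algebra.
From mathcomp Require Import all_classical all_reals all_analysis.
From mathcomp.real_closed Require Import complex.
Set Implicit Arguments.
Unset Strict Implicit.
Unset Printing Implicit Defensive.
Import Order.TTheory GRing.Theory Num.Theory.
Import numFieldNormedType.Exports.
Local Open Scope classical_set_scope.
Local Open Scope ring_scope.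

(* R[i], presented as a numClosedFieldType: this gives it (and matrices over
   it) the normed-module structure over itself, so that [differentiable] and
   ['D_v f] below are complex (holomorphic) differentiation. *)
Definition cplx (R : realType) : numClosedFieldType := R[i]%C.

Definition toC (R : realType) (x : R) : cplx R := real_complex R x.

Definition toCmx (R : realType) m n (A : 'M[R]_(m, n)) : 'M[cplx R]_(m, n) :=
  map_mx (@toC R) A.

Definition conjmx (R : realType) m n (A : 'M[cplx R]_(m, n)) :
    'M[cplx R]_(m, n) :=
  map_mx (fun z : cplx R => z^*) A.

Fixpoint Ck (R : realType) N (k : nat) (U : set 'rV[R]_N) (f : 'rV[R]_N -> R)
    : Prop :=
  (forall x, U x -> {for x, continuous f}) /\
  (if k is k'.+1 then
     forall j : 'I_N,
       (forall x, U x -> derivable f x (delta_mx 0 j)) /\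
       Ck k' U (fun x => 'D_(delta_mx 0 j) f x)
   else True).

Definition smooth (R : realType) N (U : set 'rV[R]_N) (f : 'rV[R]_N -> R) :=
  forall k, Ck k U f.

Definition csmooth (R : realType) N (U : set 'rV[R]_N)
    (f : 'rV[R]_N -> cplx R) :=
  smooth U (fun x => complex.Re (f x)) /\ smooth U (fun x => complex.Im (f x)).

Definition holomorphic (R : realType) (V W : normedModType (cplx R))
    (U : set V) (f : V -> W) :=
  forall x, U x -> differentiable f x.

(* Real-analyticity on an open subset of R^N, as local existence of a
   holomorphic extension to C^N. *)
Definition real_analytic (R : realType) N (U : set 'rV[R]_N)
    (f : 'rV[R]_N -> cplx R) :=
  forall x, U x ->
    exists (W : set 'rV[cplx R]_N) (g : 'rV[cplx R]_N -> cplx R),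
      [/\ open W, W (toCmx x), holomorphic W g
        & forall y, W (toCmx y) -> g (toCmx y) = f y].

(* What is needed to speak of vector fields and their brackets, uniformly for
   M (points in R^N, C-valued smooth functions) and for its complexification
   (points in C^N, holomorphic functions). *)
Record calculus (R : realType) (N : nat) := Calculus {
  point : topologicalType;
  pderiv : 'I_N -> (point -> cplx R) -> point -> cplx R;
  regular : set point -> (point -> cplx R) -> Prop }.

Definition real_calculus (R : realType) N : calculus R N :=
  @Calculus R N 'rV[R]_N
    (fun j f x => ('D_(delta_mx 0 j) (fun y => complex.Re (f y)) x
                   +i* 'D_(delta_mx 0 j) (fun y => complex.Im (f y)) x)%C)
    (@csmooth R N).

Definition complex_calculus (R : realType) N : calculus R N :=
  @Calculus R N 'rV[cplx R]_N
    (fun j f x => 'D_(delta_mx 0 j) f x)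
    (fun U f => holomorphic U f).

(* The symbol encoded by (l, A), both in a basis e of g_{-1,1}: l(e_i, e_j) is
   the (i, j) entry of symH and symA is the matrix of the antilinear operator.
   g_{-1} = g_{-1,1} + g_{-1,-1} is C^(q+q), with basis (e, conj e), and
   g_{-2,0} = C. *)
Record symbol (R : realType) (q : nat) := Symbol {
  symH : 'M[cplx R]_q;
  symA : 'M[cplx R]_q }.

Section AbstractSymbol.
Variables (R : realType) (q : nat) (s : symbol R q).
Local Notation C := (cplx R).

Definition antilinear_op (y : 'rV[C]_q) : 'rV[C]_q := conjmx y *m (symA s)^T.

Definition nilpotent_op := exists k, forall y, iter k antilinear_op y = 0.

(* [v, w] = v *m sym_bracket *m w^T on g_{-1}, from [v, w] = i l(v, conj w)
   for v in g_{-1,1} and w in g_{-1,-1}. *)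
Definition sym_bracket : 'M[C]_(q + q) :=
  block_mx 0 ('i *: symH s) (- ('i *: (symH s)^T)) 0.

Definition csp : set 'M[C]_(q + q) :=
  [set T | exists c : C,
     T *m sym_bracket + sym_bracket *m T^T = c *: sym_bracket].

(* The antilinear involution of g_{-1} exchanges e_i and conj e_i. *)
Definition conj_op (T : 'M[C]_(q + q)) : 'M[C]_(q + q) :=
  let sw := block_mx 0 1%:M 1%:M 0 in sw *m conjmx T *m sw.

Definition g0p2 : set 'M[C]_(q + q) :=
  [set T | csp T /\ exists a : C, T = block_mx 0 0 (a *: (symA s)^T) 0].

Definition g0m2 : set 'M[C]_(q + q) := conj_op @` g0p2.

Definition commutator (S T : 'M[C]_(q + q)) := S *m T - T *m S.

Definition g00 : set 'M[C]_(q + q) :=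
  [set T | [/\ csp T, exists B D, T = block_mx B 0 0 D,
               forall S, g0p2 S -> g0p2 (commutator T S)
             & forall S, g0m2 S -> g0m2 (commutator T S)]].

Definition g0 : set 'M[C]_(q + q) :=
  [set T | exists X Y Z, [/\ g0m2 X, g00 Y, g0p2 Z & T = X + Y + Z]].

(* As g_- is an ideal of the semidirect product of g_- and csp(g_{-1}), the
   subspace g^0 = g_- + g_0 is a subalgebra iff g_0 is closed under brackets. *)
Definition regular_symbol :=
  forall S T, g0 S -> g0 T -> g0 (commutator S T).

End AbstractSymbol.

Definition jordan (R : realType) (a : cplx R) (k : nat) : 'M[cplx R]_k :=
  \matrix_(i, j) (if i == j then a else if i.+1 == j :> nat then 1 else 0).

Definition antidiag (R : realType) (k : nat) : 'M[cplx R]_k :=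
  \matrix_(i, j) ((i + j).+1 == k)%:R.

Definition block_size (isreal : bool) (k : nat) : nat :=
  if isreal then k else (k + k)%N.

Definition Mblock (R : realType) (a : cplx R) (isreal : bool) (k : nat) :
    'M[cplx R]_(block_size isreal k) :=
  if isreal as b return 'M[cplx R]_(block_size b k) then jordan a k
  else block_mx 0 (jordan (a ^+ 2) k) 1%:M 0.

Definition Nblock (R : realType) (isreal : bool) (k : nat) :
    'M[cplx R]_(block_size isreal k) :=
  antidiag R (block_size isreal k).

Section Canonical.
Variables (R : realType) (gamma : nat).
Variables (eps lambda : 'I_gamma -> cplx R) (m : 'I_gamma -> nat).

Local Notation isreal i := (lambda i \is Num.real).

Definition canon_size : nat := (\sum_(i < gamma) block_size (isreal i) (m i))%N.

Definition canon_symbol : symbol R canon_size :=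
  Symbol (\mxdiag_(i < gamma) (eps i *: Nblock R (isreal i) (m i)))
         (\mxdiag_(i < gamma) Mblock (lambda i) (isreal i) (m i)).

(* In the order of cplx R, 0 < z (resp. z < 0, z <= 0) means that z is a
   positive (resp. negative, nonpositive) real number. *)
Definition dij (i j : 'I_gamma) : nat :=
  if (lambda i != lambda j) || ((i == j) && ~~ (lambda i ^+ 2 <= 0)) then 0%N
  else if ((i != j) && (0 < lambda i)) || ((i == j) && (lambda i ^+ 2 < 0))
  then minn (m i) (m j)
  else if (i != j) && ((lambda i ^+ 2 \isn't Num.real) || (lambda i == 0))
  then (2 * minn (m i) (m j))%N
  else if (i != j) && (lambda i ^+ 2 < 0) then (4 * minn (m i) (m j))%N
  else uphalf (m i).

Definition dtotal : nat :=
  (\sum_(i < gamma) \sum_(j < gamma | (i <= j)%N) dij i j)%N.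

End Canonical.

Definition distribution (R : realType) N (P : topologicalType)
    (reg : set P -> (P -> cplx R) -> Prop) (U : set P) (r : nat)
    (D : P -> 'M[cplx R]_N) :=
  forall x, U x ->
    exists (V : set P) (B : P -> 'M[cplx R]_(r, N)),
      [/\ open V, V x, V `<=` U,
          forall a b, reg V (fun y => B y a b)
        & forall y, V y -> \rank (B y) = r /\ (B y == D y)%MS].

(* H, conj H, K, conj K; on the complexification, conj H and conj K are
   independent holomorphic distributions. *)
Record distributions (R : realType) (N : nat) (P : Type) := Distributions {
  dH : P -> 'M[cplx R]_N;
  dHb : P -> 'M[cplx R]_N;
  dK : P -> 'M[cplx R]_N;
  dKb : P -> 'M[cplx R]_N }.

Definition swap (R : realType) N P (D : distributions R N P) :=
  Distributions (dHb D) (dH D) (dKb D) (dK D).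

Section Pointwise.
Variables (R : realType) (N : nat) (cal : calculus R N).
Local Notation C := (cplx R).
Local Notation P := (point cal).

Definition bracket (X Y : P -> 'rV[C]_N) (x : P) : 'rV[C]_N :=
  \row_k \sum_j (X x 0 j * pderiv j (fun y => Y y 0 k) x
                 - Y x 0 j * pderiv j (fun y => X y 0 k) x).

Definition local_section (D : P -> 'M[C]_N) (x : P) (X : P -> 'rV[C]_N) :=
  exists U : set P,
    [/\ open U, U x, forall k, regular U (fun y => X y 0 k)
      & forall y, U y -> (X y <= D y)%MS].

Definition involutive (D : P -> 'M[C]_N) (U : set P) :=
  forall x, U x -> forall X Y, local_section D x X -> local_section D x Y ->
    (bracket X Y x <= D x)%MS.

Variable D : distributions R N P.

(* z represents L(v, conj w), for v in H_x and w in conj H_x. *)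
Definition levi_val (x : P) (v w z : 'rV[C]_N) :=
  exists X Y : P -> 'rV[C]_N,
    [/\ local_section (dH D) x X, local_section (dHb D) x Y, X x = v, Y x = w
      & (z - ('i / 2) *: bracket X Y x <= dH D x + dHb D x)%MS].

(* z represents ad_v(y), for v in K_x and y in conj H_x. *)
Definition ad_val (x : P) (v y z : 'rV[C]_N) :=
  exists X Y : P -> 'rV[C]_N,
    [/\ local_section (dK D) x X, local_section (dHb D) x Y, X x = v,
        (Y x - y <= dKb D x)%MS
      & (z - bracket X Y x <= dK D x + dHb D x)%MS].

End Pointwise.

Section SymbolAtPoint.
Variables (R : realType) (N q : nat) (cal : calculus R N).
Local Notation C := (cplx R).
Local Notation P := (point cal).

Variables (D : distributions R N P) (s : symbol R q) (x : P).
(* The linear map phi : g_- -> g_-(x) sending the bases of g_{-1,1}, g_{-1,-1}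
   and g_{-2,0} to the classes of the rows of E1, E2 and of t. *)
Variables (E1 E2 : 'M[C]_(q, N)) (t : 'rV[C]_N).

(* phi^-1 o g_{0,2}(x) o phi, where g_{0,2}(x) consists of the operators equal
   to ad_v, v in K_x, on g_{-1,-1}(x) and to 0 on g_{-1,1}(x). *)
Definition pullback_g0p2 : set 'M[C]_(q + q) :=
  [set T | csp s T /\
     exists (v : 'rV[C]_N) (B : 'M[C]_q),
       [/\ (v <= dK D x)%MS, T = block_mx 0 0 B 0
         & forall i, ad_val D x v (row i E2) (row i (B *m E1))]].

Definition pullback_g0m2 : set 'M[C]_(q + q) :=
  [set T | csp s T /\
     exists (v : 'rV[C]_N) (B : 'M[C]_q),
       [/\ (v <= dKb D x)%MS, T = block_mx 0 B 0 0
         & forall i, ad_val (swap D) x v (row i E1) (row i (B *m E2))]].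

(* phi is an isomorphism of bigraded Lie algebras g_- -> g_-(x) conjugating
   g_{0,2} and g_{0,-2} into their counterparts at x.  On both sides the
   bracket of g_{-1,1} and g_{-1,-1} is i times the Levi form. *)
Definition symbol_iso :=
  [/\ (E1 + dK D x == dH D x)%MS, (E2 + dKb D x == dHb D x)%MS
    & (t + (dH D x + dHb D x) == 1%:M)%MS] /\
  [/\ forall i j, levi_val D x (row i E1) (row j E2) (symH s i j *: t),
      pullback_g0p2 = g0p2 s & pullback_g0m2 = g0m2 s].

End SymbolAtPoint.

Record analytic_manifold (R : realType) (N : nat) := AnalyticManifold {
  carrier : topologicalType;
  chart : Type;
  dom : chart -> set carrier;
  coord : chart -> carrier -> 'rV[R]_N;
  coordV : chart -> 'rV[R]_N -> carrier;
  carrier_hausdorff : hausdorff_space carrier;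
  carrier_second_countable : @second_countable carrier;
  carrier_connected : connected [set: carrier];
  dom_cover : forall p, exists i, dom i p;
  dom_open : forall i, open (dom i);
  coord_open : forall i, open (coord i @` dom i);
  coordK : forall i p, dom i p -> coordV i (coord i p) = p;
  coord_continuous : forall i p, dom i p -> {for p, continuous (coord i)};
  coordV_continuous : forall i x, (coord i @` dom i) x ->
    {for x, continuous (coordV i)};
  transition_analytic : forall i j k,
    real_analytic (coord i @` (dom i `&` dom j))
      (fun x => toC (coord j (coordV i x) 0 k)) }.

Section Manifold.
Variables (R : realType) (N : nat) (M : analytic_manifold R N).

Definition image (i : chart M) : set 'rV[R]_N := coord i @` dom i.

Definition overlap (i j : chart M) : set 'rV[R]_N :=
  coord i @` (dom i `&` dom j).

Definition transition (i j : chart M) (x : 'rV[R]_N) : 'rV[R]_N :=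
  coord j (coordV i x).

(* Smooth real vector fields, by their expressions Z i in the charts i; only
   the values of Z i on image i matter. *)
Definition vector_field (Z : chart M -> 'rV[R]_N -> 'rV[R]_N) :=
  (forall i k, smooth (image i) (fun x => Z i x 0 k)) /\
  (forall i j x, overlap i j x ->
     Z j (transition i j x) = Z i x *m jacobian (transition i j) x).

End Manifold.

Section CR.
Variables (R : realType) (q : nat).
Local Notation C := (cplx R).
Local Notation N := (2 * q.+1 + 1)%N.
Local Notation rcal := (real_calculus R N).

Definition with_conj (H K : 'rV[R]_N -> 'M[C]_N) :
    distributions R N 'rV[R]_N :=
  Distributions H (fun x => conjmx (H x)) K (fun x => conjmx (K x)).

(* A real-analytic, 2-nondegenerate CR structure of hypersurface type with
   Levi kernel K of rank 1; H and K are given by their chart expressions. *)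
Record CR_structure (M : analytic_manifold R N) := CRStructure {
  crH : chart M -> 'rV[R]_N -> 'M[C]_N;
  crK : chart M -> 'rV[R]_N -> 'M[C]_N;
  cr_compatible : forall i j x, overlap i j x ->
    (crH j (transition i j x)
       == crH i x *m toCmx (jacobian (transition i j) x))%MS;
  cr_analytic : forall i,
    distribution (@real_analytic R N) (image i) q.+1 (crH i);
  cr_involutive : forall i, @involutive R N rcal (crH i) (image i);
  cr_transversal : forall i x, image i x ->
    (crH i x :&: conjmx (crH i x) == (0 : 'M[C]_N))%MS;
  cr_levi_kernel : forall i x, image i x -> forall v : 'rV[C]_N,
    (v <= crK i x)%MS <->
    (v <= crH i x)%MS /\
    (forall w : 'rV[C]_N, (w <= crH i x)%MS ->
       @levi_val R N rcal (with_conj (crH i) (crK i)) x v (conjmx w) 0);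
  cr_rank_kernel : forall i x, image i x -> \rank (crK i x) = 1%N;
  cr_2nondegenerate : forall i x, image i x -> forall v : 'rV[C]_N,
    (v <= crK i x)%MS ->
    (forall y : 'rV[C]_N, (y <= conjmx (crH i x))%MS ->
       @ad_val R N rcal (with_conj (crH i) (crK i)) x v y 0) ->
    v = 0 }.

Variables (M : analytic_manifold R N) (S : CR_structure M).

Definition cr_dist (i : chart M) := with_conj (crH S i) (crK S i).

Definition infinitesimal_symmetry (Z : chart M -> 'rV[R]_N -> 'rV[R]_N) :=
  vector_field Z /\
  forall i x, image i x -> forall X, @local_section R N rcal (crH S i) x X ->
    (@bracket R N rcal (fun y => toCmx (Z i y)) X x <= crH S i x)%MS.

Definition symmetry_dim_le (d : nat) :=
  forall (k : nat) (Z : 'I_k -> chart M -> 'rV[R]_N -> 'rV[R]_N),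
    (forall a, infinitesimal_symmetry (Z a)) ->
    (forall c : 'I_k -> R,
       (forall i x, image i x -> \sum_a c a *: Z a i x = 0) ->
       forall a, c a = 0) ->
    (k <= d)%N.

(* The isomorphisms with the fixed symbol are compatible with the antilinear
   involutions; they then also identify g_{0,0} with g_{0,0}(x). *)
Definition constant_symbol (s : symbol R q) :=
  forall i x, image i x ->
    exists (E : 'M[C]_(q, N)) (t : 'rV[C]_N),
      conjmx t = t /\
      @symbol_iso R N q rcal (cr_dist i) s x E (conjmx E) t.

End CR.

(* W is an embedded complex submanifold of V: locally the image of a
   holomorphic h admitting a holomorphic left inverse g. *)
Definition submanifold (R : realType) (V : normedModType (cplx R))
    (W : set V) :=
  exists d : nat, forall p, W p ->
    exists (U : set V) (O : set 'rV[cplx R]_d)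
      (h : 'rV[cplx R]_d -> V) (g : V -> 'rV[cplx R]_d),
      [/\ open U /\ U p, open O, holomorphic O h, holomorphic U g
        & h @` O = W `&` U /\ forall y, O y -> g (h y) = y].

(* The tangent space at p, as the velocities of holomorphic curves. *)
Definition tangent (R : realType) (V : normedModType (cplx R))
    (W : set V) (p w : V) :=
  exists c : cplx R -> V,
    [/\ \forall t \near (0 : cplx R), W (c t) /\ differentiable c t,
        c 0 = p & 'D_(1 : cplx R) c (0 : cplx R) = w].

Definition maximal_connected_submanifold (R : realType)
    (V : normedModType (cplx R)) (L W : set V) :=
  [/\ submanifold W, connected W, W `<=` L
    & forall W', submanifold W' -> connected W' -> W' `<=` L ->
        W `<=` W' -> W' = W].

Section Reduction.
Variables (R : realType) (q : nat).
Local Notation C := (cplx R).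
Local Notation N := (2 * q.+1 + 1)%N.
Local Notation ccal := (complex_calculus R N).

Variables (M : analytic_manifold R N) (S : CR_structure M).

(* A complexification of a nonempty open piece of M lying in the chart i, with
   the projection cm_pi onto the leaf space of K + conj K; the leaf space is
   cm_pi @` CM, in global coordinates. *)
Record complexification (i : chart M) := Complexification {
  CM : set 'rV[C]_N;
  cm_dist : distributions R N 'rV[C]_N;
  cm_pi : 'rV[C]_N -> 'rV[C]_(2 * q + 1);
  cm_open : open CM;
  cm_connected : connected CM;
  cm_real_point : exists x : 'rV[R]_N, CM (toCmx x);
  cm_chart : forall x, CM (toCmx x) -> image i x;
  cm_H : distribution (fun U (f : _ -> C) => holomorphic U f)
           CM q.+1 (dH cm_dist);
  cm_Hb : distribution (fun U (f : _ -> C) => holomorphic U f)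
            CM q.+1 (dHb cm_dist);
  cm_K : distribution (fun U (f : _ -> C) => holomorphic U f)
           CM 1 (dK cm_dist);
  cm_Kb : distribution (fun U (f : _ -> C) => holomorphic U f)
            CM 1 (dKb cm_dist);
  cm_extends : forall x, CM (toCmx x) ->
    [/\ (dH cm_dist (toCmx x) == crH S i x)%MS,
        (dHb cm_dist (toCmx x) == conjmx (crH S i x))%MS,
        (dK cm_dist (toCmx x) == crK S i x)%MS
      & (dKb cm_dist (toCmx x) == conjmx (crK S i x))%MS];
  cm_transversal : forall x, CM x ->
    (dH cm_dist x :&: dHb cm_dist x == (0 : 'M[C]_N))%MS;
  cm_pi_holomorphic : holomorphic CM cm_pi;
  cm_pi_kernel : forall x, CM x ->
    (kermx (jacobian cm_pi x) == dK cm_dist x + dKb cm_dist x)%MS;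
  cm_pi_fibers : forall a, connected (CM `&` [set x | cm_pi x = a]) }.

Variables (i : chart M) (c : complexification i) (s : symbol R q).

(* A point of P^0 over x is represented by (x, F), where the rows of F are the
   images in T_{pi(x)} of the leaf space of phi(e), phi(conj e), the basis of
   g_{-1} being (e, conj e).  As phi is an isomorphism of Lie algebras, F
   determines its component on g_{-2,0}. *)
Definition total : normedModType C :=
  ('rV[C]_N * 'M[C]_(q + q, 2 * q + 1))%type.

Definition P0 : set total :=
  [set psi : total | CM c psi.1 /\
     exists E1 E2 t,
       @symbol_iso R N q ccal (cm_dist c) s psi.1 E1 E2 t /\
       psi.2 = col_mx E1 E2 *m jacobian (cm_pi c) psi.1].

(* theta_0 of the vertical tangent vectors (for pi o pr) of W at psi: the
   T = psi^-1 o psi' become the T with psi' = T *m psi. *)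
Definition theta0_image (W : set total) (psi : total) : set 'M[C]_(q + q) :=
  [set T | exists w : total,
     [/\ tangent W psi w, w.1 *m jacobian (cm_pi c) psi.1 = 0
       & w.2 = T *m psi.2]].

Definition reduction_step (W W' : set total) :=
  (exists G : set 'M[C]_(q + q),
     maximal_connected_submanifold
       [set psi | W psi /\ theta0_image W psi = G] W') /\
  [set psi.1 | psi in W'] = CM c.

Inductive reduction : set total -> Prop :=
| reduction_first W : reduction_step P0 W -> reduction W
| reduction_next W W' : reduction W -> reduction_step W W' -> reduction W'.

End Reduction.

(* After shrinking M, some reduction of P^0 has g_0^red(psi) constant. *)
Definition constant_reduced_symbol (R : realType) (q : nat)
    (M : analytic_manifold R (2 * q.+1 + 1)) (S : CR_structure M)
    (s : symbol R q) (g0red : set 'M[cplx R]_(q + q)) :=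
  exists (i : chart M) (c : complexification S i) (W : set (total R q)),
    reduction c s W /\ forall psi, W psi -> theta0_image c W psi = g0red.

(* Main.v *)
(* Fix a point p of M and a frame E_j, K, conj E_j, conj K, T adapted to H.  For a
   symmetry Z let b be the matrix of [Z, .] on H/K and c the K-components of the
   [Z, E_j].  The Jacobi identities express every derivative of the germs Z, b, c
   inside the ideal they generate: this closed linear system is obtained by
   evaluating semilinear forms on the ideal (Nakayama), and the algebra that
   remains is solvable because A^3 is not a multiple of A.  So Z = 0 near p once
   Z, b and c vanish at p, hence Z = 0 on the connected manifold M.

   At p, Z takes at most 2n+1 real parameters.  If Z(p) = 0, then b lies in a real
   form of g_{0,0}; the complex dimension of g_{0,0}, counted block by block in the
   canonical basis, is at most d_total + 2, or d_total + 3 if A is nilpotent.  If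
   moreover b = 0, then c lies on a real line; when this line is attained, the
   rotation b = i Id, which always belongs to g_{0,0}, is not the linear part of any
   symmetry.  The two effects compensate each other. *)

Require Import Defs.
From HB Require Import structures.
From mathcomp Require Import all_boot all_order all_algebra.
From mathcomp Require Import ring lra zify.
From mathcomp Require Import all_classical all_reals all_analysis.
From mathcomp.real_closed Require Import complex.
Set Implicit Arguments.
Unset Strict Implicit.
Unset Printing Implicit Defensive.
Import Order.TTheory GRing.Theory Num.Theory.
Import numFieldNormedType.Exports.
Local Open Scope classical_set_scope.
Local Open Scope ring_scope.
Local Notation conjmx := Defs.conjmx.
Local Notation image := Defs.image.
Local Notation coord := Defs.coord.

(** * Symmetrized products and the non-regularity condition *)

(** Write [h] for the Levi form and [al] for [ad_K] in the frame. Lowering an index with [h] turns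
    the antilinear operator A and its cube into the symmetric matrices [S = al h] and [P S], where
    [P = al conj(al)]; non-regularity reads: [P S] is not a multiple of [S]. The compatibility
    conditions met below ask that combinations of products [u v^T + v u^T] fall on the line of [S],
    up to one extra term, so the elementary algebra of such products carries the whole argument. The
    obstacle is that the Jacobi identities express the derivatives of [b] and [c] through further
    unknowns: the components [l] and [rho] of [[Z, T]] along H, and derivatives of [conj c] along
    the conjugate directions. These have to be brought back into the ideal. Passing to the residue
    field makes this a question about vectors and matrices at one point. The linear parts [b] form a
    real space, while [g_{0,0}] is counted over the complex numbers: pairing each [b] with its
    conjugate keeps real independence when the coefficients become complex. *)

Section SymmetricProducts.
Variables (F : numFieldType) (q : nat).
Implicit Types (x y k v p r : 'cV[F]_q) (S : 'M[F]_q).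

Definition dot x y : F := (x^T *m y) 0 0.
Definition sprod x y : 'M[F]_q := x *m y^T + y *m x^T.

Lemma dotE x y : x^T *m y = (dot x y)%:M.
Proof. by rewrite [LHS]mx11_scalar. Qed.

Lemma dotC x y : dot x y = dot y x.
Proof. by rewrite /dot -{1}[y]trmxK -trmx_mul mxE. Qed.

Lemma dotDl x y v : dot (x + y) v = dot x v + dot y v.
Proof. by rewrite /dot linearD mulmxDl mxE. Qed.
Lemma dotZl a x y : dot (a *: x) y = a * dot x y.
Proof. by rewrite /dot linearZ -scalemxAl mxE. Qed.
Lemma dotDr x y v : dot v (x + y) = dot v x + dot v y.
Proof. by rewrite !(dotC v) dotDl. Qed.
Lemma dotZr a x y : dot x (a *: y) = a * dot x y.
Proof. by rewrite !(dotC x) dotZl. Qed.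
Lemma dotNl x y : dot (- x) y = - dot x y.
Proof. by rewrite -scaleN1r dotZl mulN1r. Qed.
Lemma dotNr x y : dot x (- y) = - dot x y.
Proof. by rewrite !(dotC x) dotNl. Qed.
Lemma dotBl x y v : dot (x - y) v = dot x v - dot y v.
Proof. by rewrite dotDl dotNl. Qed.
Lemma dotBr x y v : dot v (x - y) = dot v x - dot v y.
Proof. by rewrite dotDr dotNr. Qed.
Lemma dot0l x : dot 0 x = 0.
Proof. by rewrite /dot linear0 mul0mx mxE. Qed.
Lemma dot_tr (S : 'M[F]_q) x y : dot (S *m x) y = dot x (S^T *m y).
Proof. by rewrite /dot trmx_mul mulmxA. Qed.

Lemma mul_dot x y k : x *m y^T *m k = dot y k *: x.
Proof. by rewrite -mulmxA dotE mul_mx_scalar. Qed.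

Lemma sprodM x y k : sprod x y *m k = dot y k *: x + dot x k *: y.
Proof. by rewrite mulmxDl !mul_dot. Qed.

Lemma sprodC x y : sprod x y = sprod y x.
Proof. by rewrite /sprod addrC. Qed.
Lemma sprodDl x y v : sprod (x + y) v = sprod x v + sprod y v.
Proof. by rewrite /sprod linearD mulmxDl mulmxDr addrACA. Qed.
Lemma sprodZl a x y : sprod (a *: x) y = a *: sprod x y.
Proof. by rewrite /sprod linearZ -scalemxAl -scalemxAr scalerDr. Qed.
Lemma sprodNl x y : sprod (- x) y = - sprod x y.
Proof. by rewrite -scaleN1r sprodZl scaleN1r. Qed.
Lemma sprodBl x y v : sprod (x - y) v = sprod x v - sprod y v.
Proof. by rewrite sprodDl sprodNl. Qed.
Lemma sprodDr x y v : sprod v (x + y) = sprod v x + sprod v y.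
Proof. by rewrite !(sprodC v) sprodDl. Qed.
Lemma sprodZr a x y : sprod x (a *: y) = a *: sprod x y.
Proof. by rewrite !(sprodC x) sprodZl. Qed.
Lemma sprodBr x y v : sprod v (x - y) = sprod v x - sprod v y.
Proof. by rewrite !(sprodC v) sprodBl. Qed.
Lemma sprod0l x : sprod 0 x = 0.
Proof. by rewrite -[0]subr0 sprodBl subrr. Qed.

Lemma sprod_sumr v (I : Type) (s : seq I) (G : I -> 'cV[F]_q) :
  sprod v (\sum_(i <- s) G i) = \sum_(i <- s) sprod v (G i).
Proof.
elim/big_ind2: _ => [|x1 x2 y1 y2 <- <-|//]; first by rewrite sprodC sprod0l.
by rewrite sprodDr.
Qed.

Lemma mulmx_inj (A B : 'M[F]_q) : (forall k : 'cV_q, A *m k = B *m k) -> A = B.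
Proof.
move=> AB; apply/trmx_inj/row_matrixP => i.
by rewrite -!tr_col !colE AB.
Qed.

Lemma dot_neq0 x : x != 0 -> exists k, dot x k = 1.
Proof.
move=> x0.
have /existsP[i xi] : [exists i, x i 0 != 0].
  apply: contra_neqT x0 => /existsPn xz; apply/matrixP => i j.
  by rewrite ord1 !mxE; apply/eqP/negPn/xz.
exists ((x i 0)^-1 *: delta_mx i 0); rewrite dotZr dotC /dot trmx_delta -rowE mxE.
by rewrite mulVf.
Qed.

(** A vector normalised on the part of [y] transverse to [x] is corrected by a multiple of one
    normalised on [x]. Such test vectors are what the identities below are contracted with. *)
Lemma dot_sep x y : (forall a, y <> a *: x) -> exists k, dot x k = 0 /\ dot y k = 1.
Proof.
move=> yx; have [x0|x0] := eqVneq x 0.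
  have [|k yk] := @dot_neq0 y; last by exists k; rewrite x0 dot0l.
  by apply/eqP => y0; apply: (yx 0); rewrite y0 scale0r.
have [k xk] := dot_neq0 x0.
have [|k' yk'] := @dot_neq0 (y - dot y k *: x).
  by rewrite subr_eq0; apply/eqP/yx.
pose k1 := k' - dot x k' *: k.
exists k1; split; first by rewrite dotBr dotZr xk mulr1 subrr.
by rewrite -yk' dotBr dotBl dotZr dotZl mulrC.
Qed.

Lemma self_opp (a : F) : a = - a -> a = 0.
Proof. by move=> /eqP; rewrite -addr_eq0 -mulr2n mulrn_eq0 /= => /eqP. Qed.

(** Contracting with [k] such that [x.k = 1] gives [y = - (y.k) x], and contracting again gives
    [y.k = - y.k]: symmetrized products have no zero divisors in characteristic 0. *)
Lemma sprod_eq0 x y : sprod x y = 0 -> x != 0 -> y = 0.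
Proof.
move=> xy0 x0; have [k xk] := dot_neq0 x0.
have := congr1 (mulmx^~ k) xy0; rewrite /= mul0mx sprodM xk scale1r => /eqP.
rewrite addrC addr_eq0 => /eqP yE.
have : dot y k = - dot y k by rewrite {1}yE dotNl dotZl xk mulr1.
by move=> /self_opp yk; rewrite yE yk scale0r oppr0.
Qed.

(** Contraction with a [k] orthogonal to [p] and normalised on [r] writes [v] as a combination of
    [p] and [r]; a second contraction shows the coefficient of [r] to be its own opposite. *)
Lemma sprod_factor a p v r : sprod a p = sprod v r ->
  (forall t, r <> t *: p) -> exists t, v = t *: p.
Proof.
move=> e rp; have [k [pk rk]] := dot_sep rp.
have := congr1 (mulmx^~ k) e; rewrite /= !sprodM pk rk scale0r scale1r add0r => vE.
have vE' : v = dot a k *: p - dot v k *: r by rewrite vE addrK.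
have : dot v k = - dot v k.
  by rewrite {1}vE' dotBl !dotZl pk rk mulr0 mulr1 sub0r.
by move=> /self_opp vk; exists (dot a k); rewrite vE' vk scale0r subr0.
Qed.

(* S plays the role of the symmetric matrix of the antilinear operator, and P
   of its square. *)
Section NonRegular.
Variables (S P : 'M[F]_q).
Hypotheses (symS : S^T = S) (symPS : (P *m S)^T = P *m S).
Hypothesis nonreg : forall t, P *m S <> t *: S.

Lemma nonreg_neq0 : S <> 0.
Proof. by move=> S0; apply: (nonreg (t := 0)); rewrite S0 mulmx0 scaler0. Qed.

(** For [S = c t t^T], symmetry of [P S = c (P t) t^T] puts [c P t] on the line of [t], and [P S]
    becomes a multiple of [S]. *)
Lemma nonreg_not_square (t : 'cV[F]_q) c : S <> c *: (t *m t^T).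
Proof.
move=> SE; have [t0|t0] := eqVneq t 0.
  by apply: nonreg_neq0; rewrite SE t0 mul0mx scaler0.
have [e te] := dot_neq0 t0.
have PSE : P *m S = c *: (P *m t *m t^T) by rewrite SE -scalemxAr mulmxA.
move: symPS; rewrite PSE linearZ /= trmx_mul trmxK => /(congr1 (mulmx^~ e)).
rewrite -!scalemxAl !mul_dot te scale1r => cP.
apply: (@nonreg (dot (P *m t) e)).
by rewrite PSE SE scalemxAl -cP -!scalemxAl !scalerA mulrC.
Qed.

(** If [S] vanished on the hyperplane orthogonal to [t], it would have rank at most 1 and, being
    symmetric, be a multiple of [t t^T]. *)
Lemma nonreg_ker (t : 'cV[F]_q) : exists k, dot t k = 0 /\ S *m k <> 0.
Proof.
apply: contrapT => H.
have H' k : dot t k = 0 -> S *m k = 0.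
  by move=> tk; apply: contrapT => Sk; apply: H; exists k.
have [t0|t0] := eqVneq t 0.
  apply: nonreg_neq0; apply: mulmx_inj => k.
  by rewrite mul0mx H' // t0 dot0l.
have [e te] := dot_neq0 t0.
have SE : S = (S *m e) *m t^T.
  apply: mulmx_inj => k; rewrite mul_dot scalemxAr; apply/eqP.
  by rewrite -subr_eq0 -mulmxBr H' // dotBr dotZr te mulr1 subrr.
have tE : dot (S *m e) e *: t = S *m e.
  by rewrite -[in RHS]symS {2}SE trmx_mul trmxK mul_dot.
by apply: (@nonreg_not_square t (dot (S *m e) e)); rewrite scalemxAl tE.
Qed.

(** Dual to [nonreg_ker] through the symmetry of [S]: an image contained in the line of [y] makes
    [S] vanish on the vectors orthogonal to [y]. *)
Lemma nonreg_image (y : 'cV[F]_q) : exists k, forall t, S *m k <> t *: y.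
Proof.
apply: contrapT => H.
have H' k : exists t, S *m k = t *: y.
  by apply: contrapT => Hk; apply: H; exists k => t e; apply: Hk; exists t.
have [k [yk Sk]] := nonreg_ker y; apply: Sk.
apply/eqP; apply: contraT => /dot_neq0[k' Sk'].
have [t kt] := H' k'.
move: Sk'; rewrite dot_tr symS kt dotZr dotC yk mulr0 => /esym/eqP.
by rewrite oner_eq0.
Qed.

(** If some product of [d] with [S k] is a nonzero multiple of [S], cancelling [d] puts the whole
    image of [S] on one line; if all the products vanish, so does [S]. This is how the component [l]
    of [[Z, T]] is determined by [c]. *)
Lemma sprod_image_eq0 (d : 'cV[F]_q) : (forall k, exists t, sprod d (S *m k) = t *: S) -> d = 0.
Proof.
move=> H; apply/eqP; apply: contraT => d0.
have [[k [t [Hk t0]]]|H0] := pselect (exists k t, sprod d (S *m k) = t *: S /\ t != 0).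
  have [k' /(_ _) Sk'] := nonreg_image (t^-1 *: (S *m k)).
  have [t' Hk'] := H k'.
  have SE : S = sprod d (t^-1 *: (S *m k)).
    by rewrite sprodZr Hk scalerA mulVf // scale1r.
  case: (Sk' t'); apply/eqP; rewrite -subr_eq0; apply/eqP.
  by apply: sprod_eq0 d0; rewrite sprodBr Hk' sprodZr -SE subrr.
have [k Sk] := nonreg_image 0; case: (Sk 0); rewrite scaler0.
apply: sprod_eq0 d0; have [t Ht] := H k; rewrite Ht.
have [->|t0] := eqVneq t 0; first by rewrite scale0r.
by case: H0; exists k, t.
Qed.

Lemma sprod_not_square a (p x : 'cV[F]_q) : S = a *: sprod x p -> forall t, x <> t *: p.
Proof.
move=> SE t xE; apply: (@nonreg_not_square p (a * t *+ 2)).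
by rewrite SE xE sprodZl /sprod -mulr2n -scaler_nat !scalerA mulr_natr.
Qed.

Lemma asym_eq0 (x p : 'cV[F]_q) : x *m p^T = p *m x^T -> p != 0 -> exists t, x = t *: p.
Proof.
move=> e /dot_neq0[k pk]; exists (dot x k).
by have := congr1 (mulmx^~ k) e; rewrite /= !mul_dot pk scale1r.
Qed.

(** If [p] is an eigenvector of [P], either [P] is scalar or [S] is a product of [p] with a vector
    [x] that is again an eigenvector; if not, [p] and [P p] span the whole space, and the symmetry
    of [P S] leaves [P] a double eigenvalue. Every case contradicts irregularity. *)
Lemma sprod_derivation_eq0 (p : 'cV[F]_q) :
  (forall v, exists t, sprod (P *m v) p - sprod v (P *m p) = t *: S) -> p = 0.
Proof.
move=> H; apply/eqP; apply: contraT => p0.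
have [[mu Pp]|Pp] := pselect (exists mu, P *m p = mu *: p).
  have H' v : exists t, sprod (P *m v - mu *: v) p = t *: S.
    by have [t Ht] := H v; exists t; rewrite -Ht Pp sprodBl sprodZl sprodZr.
  have [[v [t [Hv t0]]]|H0] := pselect (exists v t,
      sprod (P *m v - mu *: v) p = t *: S /\ t != 0).
    have [x xE] : exists x, x = t^-1 *: (P *m v - mu *: v) by eexists.
    have SE : S = sprod x p by rewrite xE sprodZl Hv scalerA mulVf // scale1r.
    have [t' Ht'] := H' x.
    have Px : P *m x = mu *: x + t' *: x.
      apply/eqP; rewrite addrC -subr_eq -subr_eq0; apply/eqP.
      apply: (@sprod_eq0 p _ _ p0).
      by rewrite sprodBr sprodZr !(sprodC p) Ht' -SE subrr.
    have PSE : P *m S = mu *: S + t' *: (x *m p^T).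
      rewrite SE /sprod mulmxDr !mulmxA Px Pp !mulmxDl -!scalemxAl scalerDr.
      by rewrite addrAC.
    have [t'0|t'0] := eqVneq t' 0.
      by case: (@nonreg mu); rewrite PSE t'0 scale0r addr0.
    have e : x *m p^T = p *m x^T.
      move: symPS; rewrite PSE linearD !linearZ /= symS trmx_mul trmxK.
      by move=> /addrI /(scalerI t'0) ->.
    have [s xs] := asym_eq0 e p0.
    by case: (@sprod_not_square 1 p x _ s); rewrite ?scale1r.
  case: (@nonreg mu); apply/eqP; rewrite -mul_scalar_mx -subr_eq0 -mulmxBl.
  suff -> : P - mu%:M = 0 by rewrite mul0mx.
  apply: mulmx_inj => v; rewrite mul0mx mulmxBl mul_scalar_mx.
  apply: (@sprod_eq0 p _ _ p0); rewrite sprodC; have [t Ht] := H' v; rewrite Ht.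
  have [->|t0] := eqVneq t 0; first by rewrite scale0r.
  by case: H0; exists v, t.
have [r rE] : exists r, P *m p = r by eexists.
rewrite rE in H Pp *.
have rp t : r <> t *: p by move=> e; apply: Pp; exists t.
have [tr Hr] := H r.
have tr0 : tr != 0.
  apply/eqP => e; move: Hr; rewrite e scale0r => /eqP; rewrite subr_eq0 => /eqP.
  by move=> /sprod_factor /(_ rp)[t /rp].
(* Subtracting the right multiple of [r] from [v] cancels the [S] term, after which [sprod_factor]
   applies. *)
have H2 v : exists x y : F, v = x *: p + y *: r.
  have [t Ht] := H v.
  have [x Hx] : exists x : F, v - (t / tr) *: r = x *: p.
    apply: (@sprod_factor (P *m (v - (t / tr) *: r)) p _ r) => //.
    apply/eqP; rewrite -subr_eq0 mulmxBr -scalemxAr !sprodBl !sprodZl.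
    have -> : sprod (P *m v) p = t *: S + sprod v r by rewrite -Ht subrK.
    have -> : sprod (P *m r) p = tr *: S + sprod r r by rewrite -Hr subrK.
    rewrite scalerDr scalerA divfK //; apply/eqP.
    by apply/matrixP => i j; rewrite !mxE; ring.
  by exists x, (t / tr); rewrite -Hx subrK.
have [x [y Pr]] := H2 (P *m r).
have SE : tr *: S = (x *+ 2) *: (p *m p^T) + y *: sprod r p - 2 *: (r *m r^T).
  rewrite -Hr Pr sprodDl !sprodZl /sprod.
  by apply/matrixP => i j; rewrite !mxE; ring.
have PSE : tr *: (P *m S) = (x *+ 2 + y ^+ 2) *: (r *m p^T)
    + (x * y) *: (p *m p^T) - y *: (r *m r^T) - (x *+ 2) *: (p *m r^T).
  rewrite scalemxAr SE mulmxBr mulmxDr -!scalemxAr /sprod mulmxDr !mulmxA rE Pr.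
  rewrite !mulmxDl -!scalemxAl.
  by apply/matrixP => i j; rewrite !mxE; ring.
have : tr *: (P *m S) = tr *: (P *m S)^T by rewrite symPS.
rewrite -[_ *: _^T]linearZ /= PSE !linearB !linearD !linearZ /= !trmx_mul !trmxK.
move=> e.
have e4 : (x *+ 4 + y ^+ 2) *: (r *m p^T - p *m r^T) = 0.
  move/matrixP: e => e; apply/matrixP => i j; move: (e i j).
  by rewrite !mxE => /eqP; rewrite -subr_eq0 => /eqP e0; rewrite -[RHS]e0; ring.
(* The discriminant of [P] on the span of [p] and [r] vanishes; its double eigenvalue [y / 2] is the
   factor used below. *)
have xy : x *+ 4 = - y ^+ 2.
  apply/eqP; rewrite -addr_eq0; apply: contraT => n0.
  move/eqP: e4; rewrite scaler_eq0 (negPf n0) /= subr_eq0 => /eqP.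
  by move=> e'; have [t /rp] := asym_eq0 e' p0.
case: (@nonreg (y / 2)); apply: (scalerI tr0).
rewrite scalerA mulrC -scalerA SE PSE.
have -> : x *+ 2 = - (y ^+ 2 / 2).
  apply: (mulIf (_ : 2 != 0 :> F)); first by rewrite pnatr_eq0.
  by rewrite mulNr divfK ?pnatr_eq0 // -xy -mulr_natr; ring.
rewrite /sprod; apply/matrixP => i j; rewrite !mxE.
have -> : x = - (y ^+ 2) / 4.
  by rewrite -xy -[x *+ 4]mulr_natr mulfK // pnatr_eq0.
by field; rewrite ?pnatr_eq0.
Qed.

End NonRegular.
End SymmetricProducts.

(** * Exceptional directions: symmetries whose linear part is trivial on H/K *)

Section ExceptionalDirections.
Variables (C : numClosedFieldType) (q : nat).
Variables (h al Q : 'M[C]_q).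
Local Notation conjm := (map_mx Num.conj).
Let S := al *m h.
Let P := al *m conjm al.
Hypotheses (hU : h \in unitmx) (symS : S^T = S) (symPS : (P *m S)^T = P *m S).
Hypothesis symQ : Q^T = Q.
Hypothesis nonreg : forall t, P *m S <> t *: S.

(** For [p = conj c] this is [h^-1 c], the vector that the Levi form associates with the components
    [c]. *)
Definition lowered (p : 'cV[C]_q) : 'cV[C]_q := invmx h *m conjm p.

(* The equations satisfied by the conjugate p of the K-components c of a symmetry
   whose linear part is trivial on H/K. *)
Definition exceptional (p : 'cV[C]_q) :=
  (forall v, exists t,
     sprod (P *m v) p - sprod v (P *m p) = t *: S + dot (lowered p) v *: Q) /\
  (forall k, dot p k = 0 -> exists t,
     sprod (Q *m lowered p) (S *m k) - sprod (S *m lowered p) (Q *m k)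
     + dot (S *m lowered p) k *: Q = t *: S).

Lemma conjmK m n (A : 'M[C]_(m, n)) : conjm (conjm A) = A.
Proof. by apply/matrixP => i j; rewrite !mxE conjCK. Qed.

Lemma conjm_eq0 m n (A : 'M[C]_(m, n)) : conjm A = 0 -> A = 0.
Proof. by move=> /(congr1 conjm); rewrite conjmK map_mx0. Qed.

Lemma S_lowered p : S *m lowered p = al *m conjm p.
Proof. by rewrite /S /lowered mulmxA -(mulmxA al) mulmxV // mulmx1. Qed.

(** By [S_lowered] the hypothesis says that [p] is an eigenvector of the antilinear operator; its
    square is [P], and [xi] becomes [|xi|^2]. *)
Lemma P_eigen p xi : S *m lowered p = xi *: p -> P *m p = (xi^* * xi) *: p.
Proof.
rewrite S_lowered => e; have e' : conjm (al *m conjm p) = conjm (xi *: p) by rewrite e.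
move: e'; rewrite map_mxM map_mxZ conjmK => e'.
by rewrite /P -mulmxA e' -scalemxAr e scalerA.
Qed.

Lemma lowered_neq0 p : p != 0 -> lowered p != 0.
Proof.
apply: contra_neq => e; apply: conjm_eq0.
have := congr1 (mulmx h) e.
by rewrite /lowered mulmxA mulmxV // mul1mx mulmx0.
Qed.

Section OneDirection.
Variable p : 'cV[C]_q.
Hypotheses (p0 : p != 0) (Hp : exceptional p).
Local Notation n := (lowered p).

(** Otherwise the first exceptional equation would be the hypothesis of [sprod_derivation_eq0], and
    [p] would vanish. Confronted with [isotropy_rotation], this is the incompatibility that saves
    one dimension. *)
Lemma exceptional_Q t : Q <> t *: S.
Proof.
move=> QE; suff /eqP : p = 0 by apply/negP.
apply: (sprod_derivation_eq0 symS symPS nonreg) => v.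
have [t' ->] := Hp.1 v; rewrite QE; exists (t' + dot n v * t).
by rewrite scalerDl scalerA.
Qed.

Lemma exceptional_coef a t : a *: Q = t *: S -> a = 0.
Proof.
move=> e; apply/eqP; apply: contraT => a0; case: (@exceptional_Q (a^-1 * t)).
by rewrite -scalerA -e scalerA mulVf // scale1r.
Qed.

(** At [v = p] the left-hand side of the first equation vanishes, hence so does the coefficient of
    [Q]. *)
Lemma exceptional_null : dot n p = 0.
Proof.
have [t] := Hp.1 p; rewrite sprodC subrr => /esym/eqP.
by rewrite addrC addr_eq0 -scaleNr => /eqP /exceptional_coef.
Qed.

Lemma exceptional_SS : dot (S *m n) n = 0.
Proof.
have [|t] := Hp.2 n; first by rewrite dotC exceptional_null.
by rewrite sprodC subrr add0r => /exceptional_coef.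
Qed.

Let nnz : exists v, dot n v = 1. Proof. exact/dot_neq0/lowered_neq0. Qed.

Lemma exceptional_contract v : exists t,
  dot n (P *m v) *: p - dot n (P *m p) *: v - dot n v *: (P *m p)
  = t *: (S *m n) + dot n v *: (Q *m n).
Proof.
have [t e] := Hp.1 v; exists t; have := congr1 (mulmx^~ n) e.
rewrite /= mulmxBl !sprodM mulmxDl -!scalemxAl ![dot _ n]dotC exceptional_null.
by move=> <-; apply/matrixP => i j; rewrite !mxE; ring.
Qed.

(** Contracting the first equation twice with [n] gives [n.Qn = - 2 y]. If [S n] is on the line of
    [p], then [P p] is too and [y = 0]. If not, take [k] orthogonal to [p] and normalised on [S n]:
    the second equation contracted twice with [n] reads [6 y = 0]. *)
Lemma exceptional_y : dot n (P *m p) = 0.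
Proof.
set y := dot n _; have [v0 nv0] := nnz.
have Qnn : dot n (Q *m n) = - (y *+ 2).
  have [t] := exceptional_contract v0; rewrite nv0 => /(congr1 (dot n)).
  rewrite !dotBr !dotDr !dotZr [dot n (S *m n)]dotC exceptional_SS.
  rewrite exceptional_null nv0 -/y => e.
  by transitivity (t * 0 + 1 * dot n (Q *m n)); [ring | rewrite -e; ring].
apply/eqP; apply: contraT => y0.
have [xi e] : exists xi, S *m n = xi *: p.
  apply: contrapT => H.
  have [|k [pk sk]] := @dot_sep _ _ p (S *m n).
    by move=> a e; apply: H; exists a.
  have [t] := Hp.2 _ pk; rewrite sk scale1r => e.
  have := congr1 (fun A : 'M[C]_q => dot n (A *m n)) e.
  rewrite /= mulmxDl mulmxBl !sprodM -!scalemxAl.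
  have Skn : dot (S *m k) n = 1 by rewrite dot_tr symS dotC.
  rewrite dotDr dotBr !dotDr !dotZr exceptional_SS Skn ![dot _ n]dotC Qnn.
  rewrite ![dot n (S *m n)]dotC exceptional_SS.
  have -> : dot n (S *m k) = 1 by rewrite dotC.
  move=> e6; have : y *+ 6 = 0.
    by rewrite -[RHS]oppr0 -(mulr0 t) -e6; ring.
  by move=> /eqP; rewrite mulrn_eq0 /= (negPf y0).
by move: y0; rewrite /y (P_eigen e) dotZr exceptional_null mulr0 eqxx.
Qed.

Lemma exceptional_perp v : dot n v = 0 -> exists t,
  sprod (P *m v) p - sprod v (P *m p) = t *: S /\
  dot n (P *m v) *: p = t *: (S *m n).
Proof.
move=> nv; have [t e] := Hp.1 v; exists t; rewrite e nv scale0r addr0; split=> //.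
have := congr1 (mulmx^~ n) e.
rewrite /= mulmxBl !sprodM mulmxDl -!scalemxAl ![dot _ n]dotC exceptional_null.
by rewrite exceptional_y nv !scale0r !add0r !addr0 subr0.
Qed.

Lemma perp_rank1 (N : 'M[C]_q) : (forall v, dot n v = 0 -> N *m v = 0) ->
  exists y, N = y *m n^T.
Proof.
move=> H; have [v0 nv0] := nnz; exists (N *m v0); apply: mulmx_inj => v.
rewrite mul_dot scalemxAr; apply/eqP; rewrite -subr_eq0 -mulmxBr H //.
by rewrite dotBr dotZr nv0 mulr1 subrr.
Qed.

(** Both sides are the matrix of the cube of the antilinear operator; [exceptional_eigen] reads from
    it a reality constraint on [P]. *)
Lemma P_al : P *m al = al *m conjm P.
Proof. by rewrite /P map_mxM conjmK !mulmxA. Qed.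

(** Suppose [S n] is off the line of [p]. On the hyperplane orthogonal to [n] the first equation
    then loses its [S] term, so [P] is [mu Id] plus the rank one matrix [rho (S n) n^T]. Substitute
    this in [P al = al conj(P)]. If [mu] is real, two rank one matrices agree and [S n] falls on the
    line of [p]. If not, the image of [al], hence of [P], lies in the span of [p] and [S n], both
    orthogonal to [n], although [n.P v0 = mu] is nonzero. *)
Lemma exceptional_eigen : exists xi, S *m n = xi *: p.
Proof.
apply: contrapT => H.
have zp t : S *m n <> t *: p by move=> e; apply: H; exists t.
have nz : dot n (S *m n) = 0 by rewrite dotC exceptional_SS.
have H' v : dot n v = 0 -> sprod (P *m v) p = sprod v (P *m p).
  move=> nv; have [t [e1 e2]] := exceptional_perp nv.
  have t0 : t = 0.
    apply/eqP; apply: contraT => t0; case: (zp (t^-1 * dot n (P *m v))).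
    by rewrite -scalerA e2 scalerA mulVf // scale1r.
  by apply/eqP; rewrite -subr_eq0 e1 t0 scale0r.
have [[mu Pp]|Pp] := pselect (exists mu, P *m p = mu *: p); last first.
  have [|t] := sprod_factor (H' _ nz); last exact: zp.
  by move=> t e; apply: Pp; exists t.
have [|y Ny] := @perp_rank1 (P - mu%:M).
  move=> v nv; rewrite mulmxBl mul_scalar_mx; apply: (@sprod_eq0 _ _ p _ _ p0).
  by rewrite sprodC sprodBl sprodZl (H' _ nv) Pp sprodZr subrr.
have PE : P = mu%:M + y *m n^T by rewrite -Ny addrC subrK.
have zE : n^T *m S = (S *m n)^T by rewrite [RHS]trmx_mul symS.
have PSE : P *m S = mu *: S + y *m (S *m n)^T.
  by rewrite PE mulmxDl mul_scalar_mx -mulmxA zE.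
have z0 : S *m n != 0 by apply/eqP => e; apply: (zp 0); rewrite e scale0r.
have [rho yE] : exists rho, y = rho *: (S *m n).
  apply: asym_eq0 z0; move: symPS; rewrite PSE linearD linearZ /= symS.
  by rewrite trmx_mul trmxK => /addrI ->.
have rho0 : rho != 0.
  apply/eqP => e; case: (@nonreg mu).
  by rewrite PSE yE e scale0r mul0mx addr0.
have Az : al *m conjm (S *m n) = mu *: p.
  by rewrite S_lowered map_mxM conjmK mulmxA -/P Pp.
have e1 : (mu - mu^*) *: al = (rho^* * mu) *: (p *m (conjm n)^T)
   - rho *: ((S *m n) *m (n^T *m al)).
  have cP : conjm P = (mu^*)%:M + rho^* *: (conjm (S *m n) *m (conjm n)^T).
    rewrite PE yE map_mxD map_scalar_mx -(scalemxAl rho (S *m n)) map_mxZ.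
    by rewrite [conjm (_ *m n^T)]map_mxM map_trmx.
  have e : P *m al = al *m conjm P := P_al.
  have e' : mu *: al + rho *: (S *m n *m (n^T *m al))
          = mu^* *: al + (rho^* * mu) *: (p *m (conjm n)^T).
    transitivity (P *m al).
      by rewrite PE yE mulmxDl mul_scalar_mx -(scalemxAl rho (S *m n)) -scalemxAl [in LHS]mulmxA.
    rewrite e cP mulmxDr mul_mx_scalar -scalemxAr mulmxA Az.
    by rewrite -(scalemxAl mu) scalerA.
  rewrite scalerBl; apply/eqP; rewrite subr_eq -subr_eq0; apply/eqP.
  transitivity (mu *: al + rho *: (S *m n *m (n^T *m al))
    - (mu^* *: al + (rho^* * mu) *: (p *m (conjm n)^T))); last by rewrite e' subrr.
  by move: (_ *m (n^T *m al)) (p *m _) => X Y; apply/matrixP => i j; rewrite !mxE; ring.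
have w0 : n^T *m al <> 0.
  move=> e; move/eqP: z0; apply; apply: trmx_inj.
  by rewrite -zE /S mulmxA e mul0mx trmx0.
have [mumu|mumu] := eqVneq mu mu^*.
  move: e1; rewrite -mumu subrr scale0r => /esym/eqP; rewrite subr_eq0 => /eqP e1.
  have [k wk] : exists k, n^T *m al *m k = 1%:M.
    have [|k kE] := @dot_neq0 _ _ (n^T *m al)^T.
      by apply/eqP => e; apply: w0; apply: trmx_inj; rewrite e trmx0.
    by exists k; rewrite -[n^T *m al]trmxK dotE kE.
  have := congr1 (mulmx^~ k) e1.
  rewrite /= -!scalemxAl -(mulmxA (S *m n)) wk mulmx1 mul_dot scalerA.
  set b := _ * _ => e2; case: (zp (rho^-1 * b)).
  by rewrite -scalerA e2 scalerA mulVf // scale1r.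
have mu0 : mu != 0 by apply: contra_neq mumu => ->; rewrite rmorph0.
have alspan v : exists a b, al *m v = a *: p + b *: (S *m n).
  exists ((mu - mu^*)^-1 * (rho^* * mu * dot (conjm n) v)).
  exists (- ((mu - mu^*)^-1 * (rho * (n^T *m al *m v) 0 0))).
  have := congr1 (mulmx^~ v) e1; rewrite /= mulmxBl -!scalemxAl mul_dot.
  rewrite -(mulmxA (S *m n)) [n^T *m al *m v]mx11_scalar mul_mx_scalar => e2.
  rewrite -[LHS]scale1r -(mulVf (_ : mu - mu^* != 0)) ?subr_eq0 //.
  by rewrite -scalerA e2 scalerBr scaleNr !scalerA !mulrA [X in _ = _ - (_ * X) *: _]mxE eqxx mulr1n.
have [v0 nv0] := nnz; have [a [b e]] := alspan (conjm al *m v0).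
have : dot n (P *m v0) = 0.
  by rewrite /P -mulmxA e dotDr !dotZr exceptional_null nz !mulr0 addr0.
rewrite PE mulmxDl mul_scalar_mx mul_dot nv0 scale1r yE dotDr !dotZr nv0 nz.
by rewrite mulr1 mulr0 addr0 => /eqP; rewrite (negPf mu0).
Qed.

(** A normal form in which [p] is visible twice: in the rank one part of [P], which is Hermitian
    quadratic in [p], and in [Q] modulo [S], which is bilinear quadratic in [p]. Comparing the two
    scalings is what makes the direction real in [exceptional_line]. *)
Lemma exceptional_form : exists xi mu eta, [/\ S *m n = xi *: p, xi != 0, eta != 0,
   P = mu%:M + eta *: (p *m n^T) & exists t, Q = t *: S + eta *: sprod p p].
Proof.
have [xi Sn] := exceptional_eigen.
pose mu := xi^* * xi; have Pp : P *m p = mu *: p := P_eigen Sn.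
have H v : dot n v = 0 -> exists t, sprod (P *m v - mu *: v) p = t *: S.
  move=> nv; have [t [e1 e2]] := exceptional_perp nv; exists t.
  by rewrite -e1 Pp sprodBl sprodZl sprodZr.
have [|y Ny] := @perp_rank1 (P - mu%:M).
  move=> v nv; rewrite mulmxBl mul_scalar_mx; have [t e] := H _ nv.
  have [t0|t0] := eqVneq t 0.
    by apply: (@sprod_eq0 _ _ p _ _ p0); rewrite sprodC e t0 scale0r.
  (* A nonzero [t] factors [S] as the product of [x] and [p]. If [xi = 0], the equation at [x] makes
     [P S] a multiple of [x p^T], which its symmetry excludes. If not, [P v] is in the span of [x]
     and [p], and orthogonality of [v] to [n] puts [v] on the line of [p], so that [x = 0]. *)
  exfalso; have [x xE] : exists x, x = t^-1 *: (P *m v - mu *: v) by eexists.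
  have SE : S = sprod x p by rewrite xE sprodZl e scalerA mulVf // scale1r.
  have xnp := @sprod_not_square _ _ _ _ symPS nonreg 1 p x.
  rewrite scale1r in xnp; have {}xnp := xnp SE.
  have nx : dot x n = xi.
    apply/eqP; rewrite -subr_eq0; apply/eqP; move/eqP: Sn; rewrite {1}SE sprodM dotC.
    rewrite exceptional_null scale0r add0r -subr_eq0 -scalerBl scaler_eq0.
    by rewrite (negPf p0) orbF => /eqP.
  have [xi0|xi0] := eqVneq xi 0.
    have [|t' e'] := H x; first by rewrite dotC nx.
    have mu0 : mu = 0 by rewrite /mu xi0 mulr0.
    move: e'; rewrite mu0 scale0r subr0 => e'.
    have Px : P *m x = t' *: x.
      apply/eqP; rewrite -subr_eq0; apply/eqP; apply: (@sprod_eq0 _ _ p _ _ p0).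
      by rewrite sprodC sprodBl sprodZl e' -SE subrr.
    have PSE : P *m S = t' *: (x *m p^T).
      by rewrite SE /sprod mulmxDr !mulmxA Px Pp mu0 scale0r mul0mx addr0 scalemxAl.
    have [t'0|t'0] := eqVneq t' 0.
      by case: (@nonreg 0); rewrite PSE t'0 !scale0r.
    have e3 : x *m p^T = p *m x^T.
      by move: symPS; rewrite PSE linearZ /= trmx_mul trmxK => /(scalerI t'0) ->.
    by have [s /xnp] := asym_eq0 e3 p0.
  have mu0 : mu != 0 by rewrite /mu mulf_neq0 // conjC_eq0.
  have vE : mu *: v = P *m v - t *: x.
    by rewrite xE scalerA mulfV // scale1r opprB addrC subrK.
  have Pv : P *m v = dot p (invmx h *m (conjm al *m v)) *: x
                   + dot x (invmx h *m (conjm al *m v)) *: p.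
    by rewrite -sprodM -SE /S /P -!mulmxA; congr (_ *m _); rewrite !mulmxA mulmxV // mul1mx.
  move: Pv; set a := dot p _; set b := dot x _ => Pv.
  have at0 : (a - t) * xi = 0.
    have := congr1 (dot n) vE; rewrite dotZr nv mulr0 Pv dotBr dotDr !dotZr.
    by rewrite exceptional_null dotC nx mulr0 addr0 -mulrBl.
  have {}at0 : a = t.
    by apply/eqP; rewrite -subr_eq0; move/eqP: at0; rewrite mulf_eq0 (negPf xi0) orbF.
  have vp : v = (mu^-1 * b) *: p.
    rewrite -[LHS]scale1r -(mulVf mu0) -[LHS]scalerA vE Pv at0.
    by rewrite addrAC subrr add0r scalerA.
  move: xE; rewrite vp -scalemxAr Pp !scalerA [mu * _]mulrC subrr scaler0 => x0.
  by apply: (xnp 0); rewrite x0 scale0r.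
have PE : P = mu%:M + y *m n^T by rewrite -Ny addrC subrK.
have PSE : P *m S = mu *: S + xi *: (y *m p^T).
  rewrite PE mulmxDl mul_scalar_mx -mulmxA.
  have -> : n^T *m S = (S *m n)^T by rewrite [RHS]trmx_mul symS.
  by rewrite Sn linearZ /= -scalemxAr.
have xi0 : xi != 0.
  by apply/eqP => e; case: (@nonreg mu); rewrite PSE e scale0r addr0.
have [eta yE] : exists eta, y = eta *: p.
  apply: asym_eq0 p0; move: symPS; rewrite PSE linearD !linearZ /= symS.
  by rewrite trmx_mul trmxK => /addrI /(scalerI xi0) ->.
exists xi, mu, eta; split=> //.
- apply/eqP => e; case: (@nonreg mu).
  by rewrite PSE yE e scale0r mul0mx scaler0 addr0.
- by rewrite PE yE scalemxAl.
have [v0 nv0] := nnz; have [t e] := Hp.1 v0; exists (- t).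
have : Q = sprod (P *m v0) p - sprod v0 (P *m p) - t *: S.
  by rewrite e nv0 scale1r addrC addKr.
rewrite Pp PE mulmxDl mul_scalar_mx mul_dot nv0 scale1r yE sprodDl !sprodZl sprodZr.
by move=> ->; rewrite scaleNr addrC; congr (_ + _); rewrite addrC addrA addNr add0r.
Qed.

End OneDirection.

(** Equate the two normal forms. The expressions of [Q] give [p' = z p]; the rank one parts of [P]
    give [eta = eta' conj(z) z], whereas [Q] gives [eta = eta' z^2]. *)
Lemma exceptional_line p p' : p != 0 -> p' != 0 -> exceptional p -> exceptional p' ->
  exists2 z, z^* = z & p' = z *: p.
Proof.
move=> p0 p'0 Hp Hp'.
have [xi [mu [eta [Sn xi0 eta0 PE [t QE]]]]] := exceptional_form p0 Hp.
have [xi' [mu' [eta' [Sn' xi'0 eta'0 PE' [t' QE']]]]] := exceptional_form p'0 Hp'.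
have e : (t' - t) *: S = eta *: sprod p p - eta' *: sprod p' p'.
  rewrite scalerBl; apply/eqP; rewrite subr_eq -subr_eq0 -[X in _ == X](subrr Q).
  by rewrite {1}QE' QE; apply/eqP/matrixP => i j; rewrite !mxE; ring.
have nn : dot (lowered p) p = 0 := exceptional_null p0 Hp.
have [z zE] : exists z, p' = z *: p.
  apply: contrapT => H; have [|k [pk p'k]] := @dot_sep _ _ p p'.
    by move=> a e'; apply: H; exists a.
  have [tt0|tt0] := eqVneq (t' - t) 0.
    have := congr1 (mulmx^~ k) e; rewrite /= tt0 scale0r mul0mx mulmxBl -!scalemxAl.
    rewrite !sprodM pk p'k !scale0r !scale1r addr0 scaler0 sub0r => /esym/eqP.
    rewrite oppr_eq0 scaler_eq0 (negPf eta'0) /= -mulr2n -scaler_nat scaler_eq0.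
    by rewrite pnatr_eq0 (negPf p'0).
  have := congr1 (fun A : 'M[C]_q => dot (A *m lowered p) k) e.
  rewrite /= mulmxBl -!scalemxAl !sprodM Sn ![dot _ (lowered p)]dotC nn.
  rewrite !scale0r addr0 scaler0 sub0r dotNl !dotZl pk !mulr0 dotDl !dotZl p'k.
  move=> /esym/eqP; rewrite oppr_eq0 mulf_eq0 (negPf eta'0) /= mulr1 -mulr2n mulrn_eq0 /=.
  move=> /eqP p'n; have := congr1 (fun A : 'M[C]_q => A *m lowered p) e.
  rewrite /= mulmxBl -!scalemxAl !sprodM Sn ![dot _ (lowered p)]dotC nn p'n.
  rewrite !scale0r !addr0 !scaler0 subr0 scalerA => /eqP.
  by rewrite scaler_eq0 mulf_eq0 (negPf tt0) (negPf xi0) (negPf p0).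
have nE : lowered p' = z^* *: lowered p.
  by rewrite /lowered zE map_mxZ -scalemxAr.
exists z => //; have [v0 nv0] := dot_neq0 (lowered_neq0 p0).
have e1 : mu = mu'.
  apply/eqP; rewrite -subr_eq0.
  have := congr1 (mulmx^~ p) (etrans (esym PE) PE').
  rewrite /= !mulmxDl !mul_scalar_mx -!scalemxAl !mul_dot nE dotZl nn mulr0 !scale0r.
  rewrite !scaler0 !addr0 => /eqP; rewrite -subr_eq0 -scalerBl scaler_eq0.
  by rewrite (negPf p0) orbF.
have e2 : eta = eta' * (z^* * z).
  apply/eqP; rewrite -subr_eq0.
  have := congr1 (mulmx^~ v0) (etrans (esym PE) PE').
  rewrite /= e1 !mulmxDl => /addrI; rewrite -!scalemxAl !mul_dot nE dotZl nv0 mulr1 zE.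
  rewrite !scalerA => /eqP; rewrite -subr_eq0 -scalerBl scaler_eq0 (negPf p0) orbF.
  by rewrite mulr1 mulrA.
have e3 : eta = eta' * (z * z).
  have tt : t' - t = 0.
    apply/eqP; have := congr1 (mulmx^~ (lowered p)) e.
    rewrite /= mulmxBl -!scalemxAl !sprodM Sn zE ![dot _ (lowered p)]dotC dotZr nn.
    rewrite mulr0 !scale0r !addr0 !scaler0 subr0 scalerA => /eqP.
    by rewrite scaler_eq0 mulf_eq0 (negPf xi0) (negPf p0) !orbF.
  move: e; rewrite tt scale0r zE sprodZl sprodZr !scalerA -scalerBl => /esym/eqP.
  rewrite scaler_eq0 subr_eq0 => /orP[/eqP ->|/eqP]; first by rewrite ?mulrA.
  by move=> /sprod_eq0 /(_ p0) /eqP; rewrite (negPf p0).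
have z0 : z != 0 by apply: contra_neq p'0 => z0; rewrite zE z0 scale0r.
by move: e3; rewrite {1}e2 => /(mulfI eta'0) /(mulIf z0).
Qed.

End ExceptionalDirections.

(** * Duality, ideals and Nakayama's lemma over a local ring *)

Section Duality.
Variables (F : fieldType) (r : nat) (V : 'rV[F]_r -> Prop).
Hypotheses (V0 : V 0) (VD : forall a u v, V u -> V v -> V (a *: u + v)).

Lemma subspace_mulmx m (B : 'M[F]_(m, r)) (u : 'rV[F]_m) :
  (forall i, V (row i B)) -> V (u *m B).
Proof.
move=> VB; rewrite mulmx_sum_row; elim/big_rec: _ => [//|i x _ Vx].
exact: VD.
Qed.

(** A matrix of maximal rank among those with rows in [V] spans [V]; a nonzero column of its
    cokernel would annihilate [V]. *)
Lemma subspace_full :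
  (forall y : 'cV[F]_r, (forall u, V u -> u *m y = 0) -> y = 0) -> forall u, V u.
Proof.
move=> H.
pose good k := `[< exists B : 'M[F]_r, (forall i, V (row i B)) /\ \rank B = k >].
have ex0 : exists k, good k.
  exists 0%N; apply/asboolP; exists 0; split; last by rewrite mxrank0.
  by move=> i; rewrite row0.
have ub k : good k -> (k <= r)%N by move/asboolP => [B [_ <-]]; apply: rank_leq_row.
have [k /asboolP[B [VB rB]] kmax] := ex_maxnP ex0 ub.
have sub u : V u -> (u <= B)%MS.
  move=> Vu; apply: contraT => uB.
  have VX i : V (row i (col_mx u B)).
    by case: (split_ordP i) => j ->; rewrite ?rowKu ?rowKd ?row_id ?ord1 ?row_id.
  have VY i : V (row i <<col_mx u B>>%MS).
    have /submxP[D ->] : (row i <<col_mx u B>>%MS <= col_mx u B)%MS.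
      by rewrite (submx_trans (row_sub _ _)) // genmxE.
    exact: subspace_mulmx.
  have le_k : (\rank (col_mx u B) <= \rank B)%N.
    rewrite rB; apply: kmax; apply/asboolP; exists <<col_mx u B>>%MS; split=> //.
    exact: mxrank_gen.
  have sB : (B <= col_mx u B)%MS by rewrite -addsmxE addsmxSr.
  have /andP[_ sub2] : (B == col_mx u B)%MS by rewrite -mxrank_leqif_eq // eqn_leq le_k mxrankS.
  by case/negP: uB; apply: submx_trans _ sub2; rewrite -addsmxE addsmxSl.
move=> u; case: (eqVneq (\rank B) r) => [rBr|rBr].
  by have /submxP[D ->] : (u <= B)%MS; [apply: submx_full; rewrite /row_full rBr | apply: subspace_mulmx].
have /existsP[j cj] : [exists j, col j (cokermx B) != 0].
  apply: contraT => /existsPn cj; case/negP: rBr.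
  have c0 : cokermx B = 0.
    by apply/trmx_inj/row_matrixP => i; rewrite -tr_col (eqP (negPn (cj i))) !trmx0 row0.
  by move: (mxrank_coker B); rewrite c0 mxrank0 => /esym/eqP; rewrite subn_eq0 eqn_leq rank_leq_col.
case/negP: cj; apply/eqP/H => v /sub /submxP[D ->].
by rewrite -mulmxA colE (mulmxA B) mulmx_coker mul0mx mulmx0.
Qed.

End Duality.

Section Ideals.
Variables (C : fieldType) (A : comUnitRingType).
Variables (ev : {rmorphism A -> C}) (cst : {rmorphism C -> A}).
Hypothesis ev_cst : forall z, ev (cst z) = z.
Hypothesis ev_unit : forall f, ev f != 0 -> f \is a GRing.unit.

(** The inductive form lets evaluations, conjugation and derivations be pushed through a combination
    of generators by induction. *)
Inductive ideal (G : A -> Prop) : A -> Prop :=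
| ideal0 : ideal G 0
| idealMD a f g : G f -> ideal G g -> ideal G (a * f + g).

Section OneIdeal.
Variable G : A -> Prop.

Lemma ideal_gen f : G f -> ideal G f.
Proof.
by move=> Gf; rewrite -[f]mul1r -[_ * _]addr0; apply: idealMD => //; apply: ideal0.
Qed.

Lemma idealD f g : ideal G f -> ideal G g -> ideal G (f + g).
Proof.
elim=> [|a f' g' Gf' _ IH Gg]; first by rewrite add0r.
by rewrite -addrA; apply: idealMD => //; apply: IH.
Qed.

Lemma idealM a f : ideal G f -> ideal G (a * f).
Proof.
elim=> [|b f' g' Gf' _ IH]; first by rewrite mulr0; apply: ideal0.
by rewrite mulrDr mulrA; apply: idealMD.
Qed.

Lemma idealMr a f : ideal G f -> ideal G (f * a).
Proof. by rewrite mulrC; apply: idealM. Qed.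

Lemma idealN f : ideal G f -> ideal G (- f).
Proof. by rewrite -mulN1r; apply: idealM. Qed.

Lemma idealB f g : ideal G f -> ideal G g -> ideal G (f - g).
Proof. by move=> Gf Gg; apply: idealD => //; apply: idealN. Qed.

Lemma ideal_sum (I : Type) (s : seq I) (B : pred I) (F : I -> A) :
  (forall i, B i -> ideal G (F i)) -> ideal G (\sum_(i <- s | B i) F i).
Proof. by move=> H; elim/big_ind: _ => //; [apply: ideal0 | apply: idealD]. Qed.

Lemma idealMl_unit a f : a \is a GRing.unit -> ideal G (a * f) -> ideal G f.
Proof. by move=> aU Gaf; rewrite -(mulKr aU f); apply: idealM. Qed.

End OneIdeal.

Lemma ideal_sub (G G' : A -> Prop) f :
  (forall g, G g -> ideal G' g) -> ideal G f -> ideal G' f.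
Proof.
move=> H; elim=> [|a f' g' /H Gf' _ IH]; first exact: ideal0.
by apply: idealD => //; apply: idealM.
Qed.

Lemma ideal_ev0 (G : A -> Prop) f : (forall g, G g -> ev g = 0) -> ideal G f -> ev f = 0.
Proof.
move=> H; elim=> [|a f' g' /H Gf' _ IH]; first exact: rmorph0.
by rewrite rmorphD rmorphM /= Gf' IH mulr0 addr0.
Qed.

(** A linear form on [Y / m Y], where [m] is the kernel of [ev]. *)
Definition semilinear (Y : A -> Prop) (s : A -> C) :=
  (forall f g, Y f -> Y g -> s (f + g) = s f + s g) /\
  (forall a f, Y f -> s (a * f) = ev a * s f).

Section Nakayama.
Variables (G : A -> Prop) (r : nat) (y : 'I_r -> A).

Definition adjoin : A -> Prop := fun f => G f \/ exists i, f = y i.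

Lemma adjoinP f : ideal adjoin f -> exists b : 'I_r -> A, ideal G (f - \sum_i b i * y i).
Proof.
elim=> [|a g g' Hg _ [b Hb]].
  exists (fun=> 0); rewrite big1 ?subrr; first exact: ideal0.
  by move=> i _; rewrite mul0r.
case: Hg => [Gg|[i ->]].
  exists b; rewrite -addrA; apply: idealD Hb.
  exact/idealM/ideal_gen.
exists (fun j => b j + a * (j == i)%:R).
under eq_bigr do rewrite mulrDl.
rewrite big_split /= [X in _ - (_ + X)](bigD1 i) //= eqxx [X in _ - (_ + (_ + X))]big1 ?addr0; last first.
  by move=> j /negPf ->; rewrite mulr0 mul0r.
rewrite mulr1; move: Hb; congr ideal; ring.
Qed.

(* The dual form of Nakayama's lemma over the local ring A with residue field
   C: if the generators y were not in the ideal I generated by G, then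
   (I + (y)) / (I + m(y)) would be a nonzero C-vector space, hence would carry
   a nonzero linear form. *)
Lemma nakayama :
  (forall s, semilinear (ideal adjoin) s -> (forall f, ideal G f -> s f = 0) ->
     forall i, s (y i) = 0) ->
  forall i, ideal G (y i).
Proof.
move=> H.
pose mY f := exists b : 'I_r -> A, (forall i, ev (b i) = 0) /\
  ideal G (f - \sum_i b i * y i).
have mYD a f g : mY f -> mY g -> mY (a * f + g).
  move=> [b [b0 Hb]] [b' [b'0 Hb']]; exists (fun i => a * b i + b' i); split.
    by move=> i; rewrite rmorphD rmorphM /= b0 b'0 mulr0 addr0.
  under eq_bigr do rewrite mulrDl -mulrA.
  rewrite big_split /= -mulr_sumr.
  have := idealD (idealM a Hb) Hb'; congr ideal; ring.
have mY0 : mY 0.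
  exists (fun=> 0); split; first by move=> i; rewrite rmorph0.
  by rewrite big1 ?subrr; [apply: ideal0 | move=> i _; rewrite mul0r].
(* The linear relations among the classes of the [y i] modulo [I + m(y)]; the aim is that every
   vector is a relation. *)
pose V (u : 'rV[C]_r) := mY (\sum_i cst (u 0 i) * y i).
have VV : forall u, V u.
  apply: subspace_full.
  - by rewrite /V big1 // => i _; rewrite mxE rmorph0 mul0r.
  - move=> a u v Vu Vv; rewrite /V.
    under eq_bigr do rewrite !mxE rmorphD rmorphM mulrDl -mulrA.
    by rewrite big_split /= -mulr_sumr; apply: mYD.
  move=> z Hz.
  (* A vector [z] annihilating all relations defines a form on the ideal: annihilation is exactly
     independence of the chosen combination [b]. *)
  pose s f : C := \sum_i ev (xget (fun=> 0) [set b : 'I_r -> A |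
      ideal G (f - \sum_i b i * y i)] i) * z i 0.
  have sE f (b : 'I_r -> A) : ideal G (f - \sum_i b i * y i) ->
      s f = \sum_i ev (b i) * z i 0.
    move=> Hb; rewrite /s; case: xgetP => [b' _ /= Hb'|/(_ b)//].
    apply/eqP; rewrite -subr_eq0 -sumrB; apply/eqP.
    have : V (\row_i (ev (b' i) - ev (b i))).
      exists (fun i => cst (ev (b' i) - ev (b i)) - (b' i - b i)); split.
        by move=> i; rewrite rmorphB /= ev_cst rmorphB /= subrr.
      have := idealB Hb Hb'; congr ideal.
      under [X in _ = _ - X]eq_bigr do rewrite mulrBl mulrBl.
      under [X in _ = X - _]eq_bigr do rewrite mxE.
      by rewrite !sumrB; ring.
    move=> /Hz /matrixP/(_ 0 0); rewrite !mxE => e0; rewrite -[RHS]e0.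
    by apply: eq_bigr => i _; rewrite mxE mulrBl.
  have sy i : s (y i) = z i 0.
    rewrite (sE _ (fun j => (j == i)%:R)).
      rewrite (bigD1 i) //= eqxx rmorph1 mul1r big1 ?addr0 // => j /negPf ->.
      by rewrite rmorph0 mul0r.
    rewrite (bigD1 i) //= eqxx mul1r big1 ?addr0 ?subrr; first exact: ideal0.
    by move=> j /negPf ->; rewrite mul0r.
  apply/matrixP => i j; rewrite ord1 mxE -sy; apply: H.
  - split=> [f g|a f].
      move=> /adjoinP[b Hb] /adjoinP[b' Hb'].
      rewrite (sE _ _ Hb) (sE _ _ Hb') (sE _ (fun i => b i + b' i)).
        by rewrite -big_split; apply: eq_bigr => k _; rewrite rmorphD mulrDl.
      under eq_bigr do rewrite mulrDl.
      by rewrite big_split /=; have := idealD Hb Hb'; congr ideal; ring.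
    move=> /adjoinP[b Hb].
    rewrite (sE _ _ Hb) (sE _ (fun i => a * b i)).
      by rewrite mulr_sumr; apply: eq_bigr => k _; rewrite rmorphM mulrA.
    under eq_bigr do rewrite -mulrA.
    by rewrite -mulr_sumr; have := idealM a Hb; congr ideal; ring.
  move=> f Gf; rewrite (sE _ (fun=> 0)).
    by rewrite big1 // => k _; rewrite rmorph0 mul0r.
  by rewrite big1 ?subr0 // => k _; rewrite mul0r.
have /choice[b Hb] : forall i, exists b : 'I_r -> A, (forall j, ev (b j) = 0) /\
    ideal G (y i - \sum_j b j * y j).
  move=> i; have := VV (delta_mx 0 i); rewrite /V (bigD1 i) //= mxE !eqxx rmorph1 mul1r.
  rewrite big1 ?addr0 // => j /negPf ji; rewrite mxE eqxx ji rmorph0 mul0r //.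
(* [B] evaluates to the identity, so its determinant is a unit, and its inverse expresses the [y i]
   through elements of the ideal of [G]. *)
pose B : 'M[A]_r := \matrix_(i, j) ((i == j)%:R - b i j).
have BU : B \in unitmx.
  rewrite unitmxE; apply: ev_unit; rewrite -det_map_mx.
  have -> : map_mx ev B = 1%:M.
    apply/matrixP => i j; rewrite !mxE rmorphB /= (Hb i).1 subr0.
    by rewrite rmorph_nat.
  by rewrite det1 oner_neq0.
move=> i; have yE : y i = \sum_j invmx B i j * (y j - \sum_k b j k * y k).
  pose Y : 'cV[A]_r := \col_j y j.
  have : Y = invmx B *m (B *m Y) by rewrite mulKmx.
  move=> /matrixP/(_ i 0); rewrite !mxE => ->; apply: eq_bigr => j _; congr (_ * _).
  rewrite mxE; under eq_bigr do rewrite !mxE mulrBl.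
  rewrite sumrB (bigD1 j) //= eqxx mul1r big1 ?addr0 // => k /negPf.
  by rewrite eq_sym => ->; rewrite mul0r.
by rewrite yE; apply: ideal_sum => j _; apply: idealM; apply: (Hb j).2.
Qed.

End Nakayama.

Lemma nakayama_fin (G : A -> Prop) (T : finType) (y : T -> A) :
  (forall s, semilinear (ideal (fun f => G f \/ exists t, f = y t)) s ->
     (forall f, ideal G f -> s f = 0) -> forall t, s (y t) = 0) ->
  forall t, ideal G (y t).
Proof.
move=> H t; rewrite -[t]enum_rankK.
apply: (@nakayama G #|T| (fun i : 'I_#|T| => y (enum_val i))) => s [s1 s2] s0 i.
have sub f : ideal (fun f => G f \/ exists t, f = y t) f ->
    ideal (adjoin G (fun i : 'I_#|T| => y (enum_val i))) f.
  apply: ideal_sub => g [Gg|[t' ->]]; apply: ideal_gen; first by left.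
  by right; exists (enum_rank t' : 'I_#|T|); rewrite enum_rankK.
by apply: H => //; split=> [f g /sub Yf /sub Yg|a f /sub Yf]; [apply: s1 | apply: s2].
Qed.
End Ideals.

Inductive frame (q : nat) := fE of 'I_q | fK | fEb of 'I_q | fKb | fT.
Arguments fK {q}. Arguments fKb {q}. Arguments fT {q}.

Definition bar q (a : frame q) : frame q :=
  match a with fE i => fEb i | fK => fKb | fEb i => fE i | fKb => fK | fT => fT end.

Definition sumF q (V : zmodType) (f : frame q -> V) : V :=
  \sum_i f (fE i) + f fK + \sum_i f (fEb i) + f fKb + f fT.

Lemma eq_sumF q (V : zmodType) (f g : frame q -> V) : f =1 g -> sumF f = sumF g.
Proof.
move=> fg; rewrite /sumF !fg; congr (_ + _ + _ + _ + _); exact: eq_bigr.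
Qed.

Lemma sumF_bar q (V : zmodType) (f : frame q -> V) :
  sumF (fun a => f (bar a)) = sumF f.
Proof.
by rewrite /sumF /=; congr (_ + _); rewrite -[LHS]addrA [LHS]addrC addrA.
Qed.

(** * CR frames and their symmetries over a differential ring *)

Section FrameAlgebra.
Variables (C : numClosedFieldType) (A : comUnitRingType).
Variables (ev : {rmorphism A -> C}) (cj : {rmorphism A -> A}) (q : nat).
Local Notation frame := (frame q).

(* Jacobi's identity for [Z, [e_a, e_b]], where [Z, e_a] = sum_d m a d e_d and
   [e_a, e_b] = sum_d c a b d e_d. *)
Definition jacobi_id (D : frame -> A -> A) (c : frame -> frame -> frame -> A)
    (DZ : A -> A) (m : frame -> frame -> A) :=
  forall a b d, D a (m b d) - D b (m a d)
    = DZ (c a b d) + sumF (fun e => c a b e * m e d)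
      - sumF (fun e => m a e * c e b d) - sumF (fun e => m b e * c a e d).

(** Here [A] stands for the ring of germs and [ev] for evaluation at the point. [fc_EE] and [fc_EK]
    encode involutivity of H, [fc_KEb] and [fc_KKb] that K lies in the Levi kernel, and [fh_unit]
    nondegeneracy of the reduced Levi form. [fc_norm] is a normalisation imposed at the point
    only. *)
Record cr_frame := CrFrame {
  fD : frame -> A -> A;
  fc : frame -> frame -> frame -> A;
  fDD : forall a f g, fD a (f + g) = fD a f + fD a g;
  fDM : forall a f g, fD a (f * g) = fD a f * g + f * fD a g;
  fD_cj : forall a f, cj (fD a f) = fD (bar a) (cj f);
  fD_comm : forall a b f,
    fD a (fD b f) - fD b (fD a f) = sumF (fun d => fc a b d * fD d f);
  fc_alt : forall a d, fc a a d = 0;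
  fc_anti : forall a b d, fc a b d = - fc b a d;
  fc_cj : forall a b d, cj (fc a b d) = fc (bar a) (bar b) (bar d);
  fc_jacobi : forall x, jacobi_id fD fc (fD x) (fc x);
  fc_EE : forall i j, [/\ forall k, fc (fE i) (fE j) (fEb k) = 0,
    fc (fE i) (fE j) fKb = 0 & fc (fE i) (fE j) fT = 0];
  fc_EK : forall i, [/\ forall k, fc (fE i) fK (fEb k) = 0,
    fc (fE i) fK fKb = 0 & fc (fE i) fK fT = 0];
  fc_KEb : forall j, fc fK (fEb j) fT = 0;
  fc_KKb : fc fK fKb fT = 0;
  fc_norm : forall i k, ev (fc fK (fE i) (fE k)) = 0 /\ ev (fc fKb (fE i) (fE k)) = 0;
  fh_unit : (\matrix_(i, j) ev (fc (fE i) (fEb j) fT)) \in unitmx }.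

Variable F : cr_frame.
Local Notation D := (fD F).
Local Notation c := (fc F).

Definition actZ (z : frame -> A) (f : A) := sumF (fun a => z a * D a f).

(** [sz] holds the components of Z and [sm a d] those of [[Z, e_a]]. [sz_D] is the expansion of this
    bracket, solved for the derivatives of the components of Z. *)
Record cr_symmetry := CrSymmetry {
  sz : frame -> A;
  sm : frame -> frame -> A;
  sz_cj : forall a, cj (sz a) = sz (bar a);
  sm_cj : forall a d, cj (sm a d) = sm (bar a) (bar d);
  s_jacobi : jacobi_id D c (actZ sz) sm;
  sz_D : forall a d, D a (sz d) = sumF (fun b => sz b * c b a d) - sm a d;
  sm_E : forall i, [/\ forall k, sm (fE i) (fEb k) = 0,
    sm (fE i) fKb = 0 & sm (fE i) fT = 0];
  sm_K : [/\ forall k, sm fK (fEb k) = 0, sm fK fKb = 0 & sm fK fT = 0] }.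

Hypothesis cjK : involutive cj.
Hypothesis ev_cj : forall f, ev (cj f) = (ev f)^*.
Hypothesis ev_unit : forall f, ev f != 0 -> f \is a GRing.unit.

Lemma fD0 a : D a 0 = 0.
Proof. by apply: (addrI (D a 0)); rewrite -fDD !addr0. Qed.
Lemma fDN a f : D a (- f) = - D a f.
Proof. by apply/eqP; rewrite -addr_eq0 -fDD addNr fD0. Qed.
Lemma fD_sum a (I : Type) (r : seq I) (B : pred I) (G : I -> A) :
  D a (\sum_(i <- r | B i) G i) = \sum_(i <- r | B i) D a (G i).
Proof. by apply: (big_morph (D a)); [apply: fDD | apply: fD0]. Qed.
Lemma fD_sumF a (G : frame -> A) : D a (sumF G) = sumF (fun b => D a (G b)).
Proof. by rewrite /sumF !fDD !fD_sum. Qed.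

Lemma cEE i j : (forall k, c (fE i) (fE j) (fEb k) = 0) *
  (c (fE i) (fE j) fKb = 0) * (c (fE i) (fE j) fT = 0).
Proof. by have [? ? ?] := fc_EE F i j. Qed.
Lemma cEK i : (forall k, c (fE i) fK (fEb k) = 0) *
  (c (fE i) fK fKb = 0) * (c (fE i) fK fT = 0).
Proof. by have [? ? ?] := fc_EK F i. Qed.
Lemma cKE i : (forall k, c fK (fE i) (fEb k) = 0) *
  (c fK (fE i) fKb = 0) * (c fK (fE i) fT = 0).
Proof.
by split; [split=> [k|]|]; rewrite fc_anti cEK oppr0.
Qed.
Lemma cEbEb i j : (forall k, c (fEb i) (fEb j) (fE k) = 0) *
  (c (fEb i) (fEb j) fK = 0) * (c (fEb i) (fEb j) fT = 0).
Proof.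
have cjc a b d : c a b d = 0 -> c (bar a) (bar b) (bar d) = 0.
  by move=> e; rewrite -fc_cj e rmorph0.
by split; [split=> [k|]|]; [apply: (cjc (fE i) (fE j) (fEb k))
  | apply: (cjc (fE i) (fE j) fKb) | apply: (cjc (fE i) (fE j) fT)]; rewrite cEE.
Qed.
Lemma cEbKb i : (forall k, c (fEb i) fKb (fE k) = 0) *
  (c (fEb i) fKb fK = 0) * (c (fEb i) fKb fT = 0).
Proof.
have cjc a b d : c a b d = 0 -> c (bar a) (bar b) (bar d) = 0.
  by move=> e; rewrite -fc_cj e rmorph0.
by split; [split=> [k|]|]; [apply: (cjc (fE i) fK (fEb k))
  | apply: (cjc (fE i) fK fKb) | apply: (cjc (fE i) fK fT)]; rewrite cEK.
Qed.
Lemma cKbEb i : (forall k, c fKb (fEb i) (fE k) = 0) *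
  (c fKb (fEb i) fK = 0) * (c fKb (fEb i) fT = 0).
Proof. by split; [split=> [k|]|]; rewrite fc_anti cEbKb oppr0. Qed.
Lemma cKEbT : (forall j, c fK (fEb j) fT = 0) * (forall j, c (fEb j) fK fT = 0) *
  (forall j, c fKb (fE j) fT = 0) * (forall j, c (fE j) fKb fT = 0) *
  (c fK fKb fT = 0) * (c fKb fK fT = 0).
Proof.
have e j : c fKb (fE j) fT = 0.
  by rewrite -[c _ _ _]/(c (bar fK) (bar (fEb j)) (bar fT)) -fc_cj fc_KEb rmorph0.
split; [split; [split; [split; [split|]|]|]|] => // *; rewrite ?(fc_KEb, fc_KKb) //.
- by rewrite fc_anti fc_KEb oppr0.
- by rewrite fc_anti e oppr0.
- by rewrite fc_anti fc_KKb oppr0.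
Qed.

Definition czero0 := (cEE, cEK, cKE, cEbEb, cEbKb, cKbEb, cKEbT, fc_alt F).

Ltac kill_sums zs := repeat match goal with |- context [bigop ?i ?r ?f] =>
  let H := fresh in
  assert (H : bigop i r f = 0) by (apply: big1 => ? _; rewrite ?zs ?fD0 ?(mul0r, mulr0) //);
  rewrite H; clear H end.
Ltac simp0 zs := rewrite /actZ /sumF /= ?zs ?fD0 ?(mul0r, mulr0); kill_sums zs;
  rewrite ?(addr0, add0r, subr0, sub0r, oppr0).

Definition Hm : 'M[A]_q := \matrix_(i, j) c (fE i) (fEb j) fT.
Definition ALm : 'M[A]_q := \matrix_(j, k) c fK (fEb j) (fE k).
Definition hm : 'M[C]_q := map_mx ev Hm.
Definition alm : 'M[C]_q := map_mx ev ALm.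

Lemma hm_unit : hm \in unitmx.
Proof.
have := fh_unit F; congr (_ \in unitmx); by apply/matrixP => i j; rewrite !mxE.
Qed.
Lemma Hm_unit : Hm \in unitmx.
Proof.
rewrite unitmxE; apply: ev_unit; rewrite -det_map_mx -/hm.
by have := hm_unit; rewrite unitmxE unitfE.
Qed.

Lemma Hm_eq0 (u : 'I_q -> A) : (forall j, \sum_i u i * Hm i j = 0) -> forall i, u i = 0.
Proof.
move=> H i; have : (\row_k u k) *m Hm = 0.
  by apply/matrixP => a j; rewrite !mxE -[RHS](H j); apply: eq_bigr => k _; rewrite mxE.
by move=> /(congr1 (mulmx^~ (invmx Hm))); rewrite /= mulmxK ?Hm_unit // mul0mx
  => /matrixP/(_ 0 i); rewrite !mxE.
Qed.

(** This, with its conjugate, makes [K + conj K] involutive. The [T] component of Jacobi's identity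
    for [E_i, K, conj K] pairs these coefficients with the invertible Levi matrix. *)
Lemma cKKbEb k : c fK fKb (fEb k) = 0.
Proof.
have cHm i j : c (fE i) (fEb j) fT = Hm i j by rewrite mxE.
suff H i : \sum_k c fK fKb (fEb k) * Hm i k = 0.
  have : Hm *m (\col_k c fK fKb (fEb k)) = 0.
    by apply/matrixP => i j; rewrite !mxE -[RHS](H i); apply: eq_bigr => l _;
       rewrite !mxE mulrC.
  by move=> /(congr1 (mulmx (invmx Hm))); rewrite mulKmx ?Hm_unit // mulmx0
    => /matrixP/(_ k 0); rewrite !mxE.
have := fc_jacobi F (fE i) fK fKb fT; simp0 czero0.
by move=> e; rewrite [RHS]e; apply: eq_bigr => l _; rewrite mxE.
Qed.

Lemma cKKb k : (c fK fKb (fEb k) = 0) * (c fK fKb (fE k) = 0) *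
  (c fKb fK (fEb k) = 0) * (c fKb fK (fE k) = 0).
Proof.
have e : c fKb fK (fE k) = 0.
  by rewrite -[c _ _ _]/(c (bar fK) (bar fKb) (bar (fEb k))) -fc_cj cKKbEb rmorph0.
by split; [split; [split|]|] => //; rewrite ?cKKbEb // fc_anti ?e ?cKKbEb oppr0.
Qed.

Definition czero := (czero0, cKKb).

(** Self-adjointness of the antilinear operator, read from the [T] component of Jacobi's identity
    for [K, conj E_i, conj E_j]. *)
Lemma sym_ALH : (ALm *m Hm)^T = ALm *m Hm.
Proof.
apply/matrixP => i j; rewrite !mxE.
have := fc_jacobi F fK (fEb i) (fEb j) fT; simp0 czero.
move=> /eqP; rewrite eq_sym subr_eq0 => /eqP e.
transitivity (- \sum_k c fK (fEb j) (fE k) * c (fEb i) (fE k) fT).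
  by rewrite -sumrN; apply: eq_bigr => k _; rewrite !mxE [c (fEb i) _ _]fc_anti mulrN opprK.
by rewrite -e opprK; apply: eq_bigr => k _; rewrite !mxE.
Qed.

Lemma cj_Hm i j : cj (Hm i j) = - Hm j i.
Proof. by rewrite !mxE fc_cj /= fc_anti. Qed.

Lemma hmE i j : hm i j = ev (Hm i j). Proof. by rewrite mxE. Qed.
Lemma almE i j : alm i j = ev (ALm i j). Proof. by rewrite mxE. Qed.

Lemma conj_hm i j : (hm i j)^* = - hm j i.
Proof. by rewrite !hmE -ev_cj cj_Hm rmorphN. Qed.

Lemma ev_norm i k : (ev (c fK (fE i) (fE k)) = 0) * (ev (c (fE i) fK (fE k)) = 0) *
  (ev (c fKb (fE i) (fE k)) = 0) * (ev (c (fE i) fKb (fE k)) = 0) *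
  (ev (c fK (fEb i) (fEb k)) = 0) * (ev (c (fEb i) fK (fEb k)) = 0) *
  (ev (c fKb (fEb i) (fEb k)) = 0) * (ev (c (fEb i) fKb (fEb k)) = 0).
Proof.
have [e1 e2] := fc_norm F i k.
have e3 : ev (c fK (fEb i) (fEb k)) = 0.
  by rewrite -[c _ _ _]/(c (bar fKb) (bar (fE i)) (bar (fE k))) -fc_cj ev_cj e2 rmorph0.
have e4 : ev (c fKb (fEb i) (fEb k)) = 0.
  by rewrite -[c _ _ _]/(c (bar fK) (bar (fE i)) (bar (fE k))) -fc_cj ev_cj e1 rmorph0.
by do 7?[split] => //; rewrite fc_anti rmorphN ?e1 ?e2 ?e3 ?e4 oppr0.
Qed.

Definition theta := ev (c fK fT fT).

Lemma ev_thetab : ev (c fKb fT fT) = theta^*.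
Proof. by rewrite /theta -ev_cj fc_cj. Qed.

(** The normalisation of the frame removes the two sums that would not be proportional to the Levi
    form. *)
Lemma ev_DK_H i j : ev (D fK (Hm i j)) = - theta * hm i j.
Proof.
have := fc_jacobi F fK (fE i) (fEb j) fT; simp0 czero; rewrite !mxE.
set d := D _ _; set s1 := \sum_ _ _; set s2 := \sum_ _ _ => e.
have : ev d + ev (c (fE i) (fEb j) fT) * theta - ev s1 - ev s2 = 0.
  by rewrite -rmorphM -rmorphD -!rmorphB -e rmorph0.
have -> : ev s1 = 0.
  by rewrite rmorph_sum big1 // => k _; rewrite rmorphM /= ev_norm mul0r.
have -> : ev s2 = 0.
  by rewrite rmorph_sum big1 // => k _; rewrite rmorphM /= ev_norm mul0r.
by rewrite !subr0 => /eqP; rewrite addr_eq0 => /eqP ->; rewrite mulNr mulrC.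
Qed.

Lemma ev_DKb_H i j : ev (D fKb (Hm i j)) = - theta^* * hm i j.
Proof.
have -> : D fKb (Hm i j) = - cj (D fK (Hm j i)).
  by rewrite fD_cj cj_Hm /= fDN opprK.
by rewrite rmorphN /= ev_cj ev_DK_H rmorphM rmorphN /= conj_hm mulrN opprK mulNr.
Qed.

(** Along [conj K] the normalised [al] moves on its own line. Along [K] nothing of the kind holds,
    and the derivative in that direction gives the invariant [Qm]. *)
Lemma ev_DKb_AL j k : ev (D fKb (ALm j k)) = ev (c fKb fK fK) * alm j k.
Proof.
have := fc_jacobi F fKb fK (fEb j) (fE k); simp0 czero; rewrite !mxE.
set d := D _ _; set s1 := \sum_ _ _; set s2 := \sum_ _ _ => e.
have : ev d + ev s1 - ev (c fKb fK fK) * ev (c fK (fEb j) (fE k)) - ev s2 = 0.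
  by rewrite -rmorphM -rmorphD -!rmorphB -e rmorph0.
have -> : ev s1 = 0.
  by rewrite rmorph_sum big1 // => i _; rewrite rmorphM /= ev_norm mulr0.
have -> : ev s2 = 0.
  by rewrite rmorph_sum big1 // => i _; rewrite rmorphM /= ev_norm mul0r.
by rewrite addr0 subr0 => /eqP; rewrite subr_eq0 => /eqP.
Qed.

Local Notation conjm := (map_mx Num.conj).
Let S := alm *m hm.
Let P := alm *m conjm alm.
Definition Qm : 'M[C]_q := - (\matrix_(j, k) ev (D fK (ALm j k)) *m hm).

Lemma symS : S^T = S.
Proof. by rewrite /S /alm /hm -map_mxM map_trmx sym_ALH. Qed.

Lemma conjm_hm : conjm hm = - hm^T.
Proof.
by apply/matrixP => i j; rewrite [LHS]mxE conj_hm [RHS]mxE [X in _ = - X]mxE.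
Qed.

Lemma S_conj : S *m (conjm alm)^T = P *m hm^T.
Proof.
have e : conjm alm *m hm^T = hm *m (conjm alm)^T.
  have : conjm S = (conjm S)^T by rewrite map_trmx symS.
  rewrite /S map_mxM conjm_hm mulmxN [in RHS]linearN /= => /oppr_inj.
  by rewrite trmx_mul trmxK.
by rewrite /S /P -!mulmxA e.
Qed.

Lemma symPS : (P *m S)^T = P *m S.
Proof.
have PT : P^T = (conjm alm)^T *m alm^T by rewrite /P trmx_mul.
rewrite trmx_mul symS PT [LHS]mulmxA S_conj -[LHS]mulmxA; congr (_ *m _).
by rewrite -[RHS]symS /S trmx_mul.
Qed.

(** Differentiate the symmetric matrix [ALm *m Hm] along [K]; by [ev_DK_H] the terms where the
    derivative falls on [Hm] add up to a multiple of [S]. *)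
Lemma symQ : Qm^T = Qm.
Proof.
rewrite /Qm linearN /=; congr (- _).
set K := \matrix_(j, k) _.
have e : map_mx ev (map_mx (D fK) (ALm *m Hm)) = K *m hm - theta *: S.
  apply/matrixP => i j; rewrite !mxE fD_sum rmorph_sum mulr_sumr /= -sumrB.
  apply: eq_bigr => k _; rewrite fDM rmorphD !rmorphM /= ev_DK_H /theta !mxE; ring.
have : (K *m hm - theta *: S)^T = K *m hm - theta *: S.
  by rewrite -e map_trmx [(map_mx (D fK) _)^T]map_trmx sym_ALH.
by rewrite linearB linearZ /= symS => /addIr.
Qed.

(** * Infinitesimal symmetries and the ideals of their first-order data *)

Section Symmetry.
Variable Z : cr_symmetry.
Local Notation z := (sz Z).
Local Notation m := (sm Z).
Local Notation b i k := (m (fE i) (fE k)).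
Local Notation bb i k := (m (fEb i) (fEb k)).
Local Notation cc i := (m (fE i) fK).
Local Notation ccb i := (m (fEb i) fKb).
Local Notation l k := (m fT (fE k)).
Local Notation lb k := (m fT (fEb k)).
Local Notation kap := (m fK fK).
Local Notation g := (m fT fT).
Local Notation rho := (m fT fK).

Lemma mE i : (forall k, m (fE i) (fEb k) = 0) * (m (fE i) fKb = 0) * (m (fE i) fT = 0).
Proof. by have [? ? ?] := sm_E Z i. Qed.
Lemma mEb i : (forall k, m (fEb i) (fE k) = 0) * (m (fEb i) fK = 0) * (m (fEb i) fT = 0).
Proof.
have H d : m (fE i) d = 0 -> m (fEb i) (bar d) = 0.
  by move=> e; rewrite -[fEb i]/(bar (fE i)) -sm_cj e rmorph0.
by split; [split=> [k|]|]; [apply: (H (fEb k)) | apply: (H fKb) | apply: (H fT)];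
   rewrite mE.
Qed.
(** A symmetry preserves the Levi kernel: the [T] component of Jacobi's identity for
    [Z, K, conj E_j] pairs these coefficients with the invertible Levi matrix. *)
Lemma mK_E k : m fK (fE k) = 0.
Proof.
have [e1 e2 e3] := sm_K Z.
have e4 : m fKb fT = 0 by rewrite -[fKb]/(bar fK) -[fT]/(bar fT) -sm_cj e3 rmorph0.
apply: (Hm_eq0 (u := fun k => m fK (fE k))) => j.
have := s_jacobi Z fK (fEb j) fT; simp0 (czero, mEb, mE, e1, e2, e3, e4).
move=> /esym/eqP; rewrite oppr_eq0 => /eqP e; rewrite -[RHS]e.
by apply: eq_bigr => i _; rewrite mxE.
Qed.
Lemma mK : (forall k, m fK (fE k) = 0) * (forall k, m fK (fEb k) = 0) *
  (m fK fKb = 0) * (m fK fT = 0) *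
  (forall k, m fKb (fE k) = 0) * (forall k, m fKb (fEb k) = 0) *
  (m fKb fK = 0) * (m fKb fT = 0).
Proof.
have [e1 e2 e3] := sm_K Z.
have H d : m fK d = 0 -> m fKb (bar d) = 0.
  by move=> e; rewrite -[fKb]/(bar fK) -sm_cj e rmorph0.
do 7?[split] => //; try exact: mK_E.
- by move=> k; apply: (H (fEb k)).
- by move=> k; apply: (H (fE k)); exact: mK_E.
- exact: (H fKb).
- exact: (H fT).
Qed.
Definition mzero := (czero, mE, mEb, mK).

(** Three nested families: Z with its linear part [b], then also the K-components [c], then also the
    components [l] of [[Z, T]], each together with its conjugates. The middle ideal is the one to be
    proved stable; differentiating the smallest one first lands in the largest. *)
Inductive gen0 : A -> Prop :=
| gen0_z x : gen0 (z x) | gen0_b i k : gen0 (b i k) | gen0_bb i k : gen0 (bb i k).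
Inductive gen1 : A -> Prop :=
| gen1_0 f : gen0 f -> gen1 f | gen1_c i : gen1 (cc i) | gen1_cb i : gen1 (ccb i).
Inductive geny : A -> Prop :=
| geny_1 f : gen1 f -> geny f | geny_l i : geny (l i) | geny_lb i : geny (lb i).
Local Notation I0 := (ideal gen0).
Local Notation I1 := (ideal gen1).
Local Notation Y1 := (ideal geny).

Hypothesis nonreg : forall t, P *m S <> t *: S.

Lemma alm_neq0 : exists j k, alm j k != 0.
Proof.
apply: contrapT => H; apply: (nonreg_neq0 nonreg).
rewrite /S (_ : alm = 0) ?mul0mx //; apply/matrixP => j k; rewrite [RHS]mxE.
by apply/eqP; apply: contrapT => /negP al0; apply: H; exists j, k.
Qed.

Lemma hm_neq0 : exists i j, hm i j != 0.
Proof.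
apply: contrapT => H; apply: (nonreg_neq0 nonreg).
rewrite /S (_ : hm = 0) ?mulmx0 //; apply/matrixP => j k; rewrite [RHS]mxE.
by apply/eqP; apply: contrapT => /negP al0; apply: H; exists j, k.
Qed.

Lemma I01 f : I0 f -> I1 f.
Proof. by apply: ideal_sub => g' Hg; apply/ideal_gen/gen1_0. Qed.
Lemma I1Y f : I1 f -> Y1 f.
Proof. by apply: ideal_sub => g' Hg; apply/ideal_gen/geny_1. Qed.
Lemma I0Y f : I0 f -> Y1 f. Proof. by move=> /I01/I1Y. Qed.

Ltac igen := apply: ideal_gen;
  solve [constructor | constructor; constructor | constructor; constructor; constructor].
Ltac iauto leaf := match goal with
  | |- ideal _ 0 => apply: ideal0
  | |- ideal _ (_ + _) => apply: idealD; iauto leaf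
  | |- ideal _ (- _) => apply: idealN; iauto leaf
  | |- ideal _ (\sum_(_ <- _ | _) _) => apply: ideal_sum => ? _; iauto leaf
  | |- ideal _ (_ * _) => first [apply: idealM; iauto leaf | apply: idealMr; iauto leaf]
  | |- ideal _ ?x => first [igen | leaf | is_var x; unfold x; iauto leaf]
  end.
Ltac noleaf := fail.

Lemma actZ0 : actZ z 0 = 0. Proof. by rewrite /actZ; simp0 mzero. Qed.
Definition azero := (actZ0, mzero).
Ltac simpA := rewrite /sumF /= ?azero ?fD0 ?(mul0r, mulr0); kill_sums azero;
  rewrite ?(addr0, add0r, subr0, sub0r, oppr0).

Lemma I0_actZ f : I0 (actZ z f).
Proof. rewrite /actZ /sumF; iauto noleaf. Qed.

Lemma identA i j : \sum_k b i k * Hm k j + \sum_k bb j k * Hm i k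
  = g * Hm i j + actZ z (Hm i j).
Proof.
have := s_jacobi Z (fE i) (fEb j) fT; simpA.
set s1 := \sum_ _ _; set s2 := \sum_ _ _ => e.
have -> : \sum_k b i k * Hm k j = s1 by apply: eq_bigr => k _; rewrite mxE.
have -> : \sum_k bb j k * Hm i k = s2 by apply: eq_bigr => k _; rewrite mxE.
rewrite [Hm i j]mxE -[LHS]addr0 [X in _ + X = _]e; ring.
Qed.

Lemma identB j k : \sum_i ALm j i * b i k - \sum_i bb j i * ALm i k
  - kap * ALm j k + actZ z (ALm j k) = 0.
Proof.
have := s_jacobi Z fK (fEb j) (fE k); simpA.
set s1 := \sum_ _ _; set s2 := \sum_ _ _ => e.
have -> : \sum_i ALm j i * b i k = s1 by apply: eq_bigr => i _; rewrite mxE.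
have -> : \sum_i bb j i * ALm i k = s2 by apply: eq_bigr => i _; rewrite mxE.
rewrite [ALm j k]mxE [RHS]e; ring.
Qed.

(** Some entry of the Levi matrix is a unit of the ring, so [identA] can be solved for [g]; [I0_kap]
    solves [identB] for [kap] in the same way. *)
Lemma I0_g : I0 g.
Proof.
have [i [j h0]] := hm_neq0; apply: (@idealMl_unit _ _ (Hm i j)).
  by apply: ev_unit; rewrite -hmE.
have -> : Hm i j * g = \sum_k b i k * Hm k j + \sum_k bb j k * Hm i k - actZ z (Hm i j).
  by rewrite identA; ring.
iauto ltac:(apply: I0_actZ).
Qed.

Lemma I0_kap : I0 kap.
Proof.
have [j [k a0]] := alm_neq0; apply: (@idealMl_unit _ _ (ALm j k)).
  by apply: ev_unit; rewrite -almE.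
have -> : ALm j k * kap = \sum_i ALm j i * b i k - \sum_i bb j i * ALm i k
   + actZ z (ALm j k).
  by apply/eqP; rewrite -subr_eq0 -oppr_eq0 -[X in _ == X](identB j k); apply/eqP; ring.
iauto ltac:(apply: I0_actZ).
Qed.

Lemma ideal_cj (G : A -> Prop) f : (forall f, G f -> ideal G (cj f)) -> ideal G f -> ideal G (cj f).
Proof.
move=> H; elim=> [|a f' g' Gf' _ IH]; first by rewrite rmorph0; apply: ideal0.
by rewrite rmorphD rmorphM; apply: idealD => //; apply/idealM/H.
Qed.

Lemma I0_cj f : I0 f -> I0 (cj f).
Proof.
by apply: ideal_cj => _ [x|i k|i k]; rewrite ?sz_cj ?sm_cj /=; igen.
Qed.
Lemma I1_cj f : I1 f -> I1 (cj f).
Proof.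
apply: ideal_cj => _ [h Hh|i|i]; [|by rewrite sm_cj /=; igen..].
by apply/I01/I0_cj/ideal_gen.
Qed.
Lemma Y1_cj f : Y1 f -> Y1 (cj f).
Proof.
apply: ideal_cj => _ [h Hh|i|i]; [|by rewrite sm_cj /=; igen..].
by apply/I1Y/I1_cj/ideal_gen.
Qed.

Lemma I0_kapb : I0 (m fKb fKb).
Proof. by rewrite -[fKb]/(bar fK) -sm_cj; apply/I0_cj/I0_kap. Qed.

Ltac leaf0 := solve [apply: I0_actZ | apply: I0_g | apply: I0_kap | apply: I0_kapb].
Ltac by_ident e := rewrite e; ring.

Lemma D_b_Eb i j k : I0 (D (fEb j) (b i k)
  - (cc i * ALm j k - Hm i j * l k + ccb j * c (fE i) fKb (fE k))).
Proof.
have := s_jacobi Z (fE i) (fEb j) (fE k); simpA.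
set s1 := \sum_ _ _; set s2 := \sum_ _ _; set s3 := \sum_ _ _ => e.
rewrite [X in I0 X](_ : _ = - actZ z (c (fE i) (fEb j) (fE k)) - s1 + s2 + s3).
  iauto leaf0.
by rewrite -[D _ _]opprK e !mxE; ring.
Qed.

Lemma D_b_K i k : I0 (D fK (b i k)).
Proof.
have := s_jacobi Z (fE i) fK (fE k); simpA => e.
rewrite -[D _ _]opprK e; iauto leaf0.
Qed.
Lemma D_b_Kb i k : I0 (D fKb (b i k)).
Proof.
have := s_jacobi Z (fE i) fKb (fE k); simpA => e.
rewrite -[D _ _]opprK e; iauto leaf0.
Qed.

Lemma D_bb_E i j k : I0 (D (fE j) (bb i k)
  - (ccb i * cj (ALm j k) + Hm j i * lb k + cc j * c (fEb i) fK (fEb k))).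
Proof.
have := I0_cj (D_b_Eb i j k).
by rewrite rmorphB rmorphD rmorphB !rmorphM fD_cj !sm_cj fc_cj cj_Hm /= mulNr opprK.
Qed.
Lemma D_bb_K i k : I0 (D fK (bb i k)).
Proof. by have := I0_cj (D_b_Kb i k); rewrite fD_cj sm_cj. Qed.
Lemma D_bb_Kb i k : I0 (D fKb (bb i k)).
Proof. by have := I0_cj (D_b_K i k); rewrite fD_cj sm_cj. Qed.

Lemma D_g_E i : I0 (D (fE i) g - (- (cc i * c fK fT fT) - \sum_j lb j * Hm i j)).
Proof.
have := s_jacobi Z (fE i) fT fT; simpA.
set s1 := \sum_ _ _; set s2 := \sum_ _ _ => e.
have -> : \sum_j lb j * Hm i j = s2 by apply: eq_bigr => j _; rewrite mxE.
rewrite [X in I0 X](_ : _ = actZ z (c (fE i) fT fT) - s1).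
  iauto leaf0.
by rewrite e; ring.
Qed.

Lemma D_g_Eb i : I0 (D (fEb i) g - (- (ccb i * c fKb fT fT) + \sum_j l j * Hm j i)).
Proof.
have := I0_cj (D_g_E i).
rewrite rmorphB rmorphB rmorphN rmorphM fD_cj !sm_cj fc_cj rmorph_sum /=.
congr (I0 (_ - (_ + _))); rewrite -sumrN; apply: eq_bigr => j _.
by rewrite rmorphM sm_cj cj_Hm /= mulrN opprK.
Qed.

Lemma D_kap_Eb j : I0 (D (fEb j) kap - (- \sum_i ALm j i * cc i + ccb j * c fK fKb fK)).
Proof.
have := s_jacobi Z fK (fEb j) fK; simpA.
set s1 := \sum_ _ _; set s2 := \sum_ _ _ => e.
have -> : \sum_i ALm j i * cc i = s1 by apply: eq_bigr => i _; rewrite mxE.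
rewrite [X in I0 X](_ : _ = - actZ z (c fK (fEb j) fK) + s2).
  iauto leaf0.
by rewrite -[D _ _]opprK e; ring.
Qed.

Lemma sumF_ringD (f h : frame -> A) : sumF (fun x => f x + h x) = sumF f + sumF h.
Proof. by rewrite /sumF !big_split /=; ring. Qed.

(** Commuting [e_x] past Z costs the derivative of [f] along [[Z, e_x]], and [Z (e_x f)] is already
    in the ideal. *)
Lemma D_actZ x f : I0 (D x (actZ z f) + sumF (fun y => m x y * D y f)).
Proof.
rewrite /actZ fD_sumF -sumF_ringD.
have : forall y, I0 (D x (z y * D y f) + m x y * D y f).
  move=> y; rewrite fDM sz_D /sumF.
  rewrite [X in I0 X](_ : _ = sumF (fun b' => z b' * c b' x y) * D y f + z y * D x (D y f)).
    by rewrite /sumF; iauto leaf0.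
  rewrite /sumF; ring.
by move=> H; rewrite /sumF; iauto ltac:(apply: H).
Qed.

Lemma D_actZ_E k f : I0 (D (fE k) (actZ z f) + cc k * D fK f).
Proof.
have := D_actZ (fE k) f; simpA => H.
rewrite [X in I0 X](_ : _ = (D (fE k) (actZ z f) + (\sum_i b k i * D (fE i) f + cc k * D fK f))
   - \sum_i b k i * D (fE i) f); last by ring.
iauto ltac:(exact: H).
Qed.

Lemma D_actZ_Eb k f : I0 (D (fEb k) (actZ z f) + ccb k * D fKb f).
Proof.
have := D_actZ (fEb k) f; simpA => H.
rewrite [X in I0 X](_ : _ = (D (fEb k) (actZ z f) + (\sum_i bb k i * D (fEb i) f + ccb k * D fKb f))
   - \sum_i bb k i * D (fEb i) f); last by ring.
iauto ltac:(exact: H).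
Qed.

Lemma I0_sub f f' : I0 (f - f') -> Y1 f' -> Y1 f.
Proof. by move=> H H'; rewrite -(subrK f' f); apply: idealD => //; apply: I0Y. Qed.

Lemma Y_D_z x y : x <> fT -> Y1 (D x (z y)).
Proof.
move=> xT; rewrite sz_D; apply: idealB.
  by apply: I0Y; rewrite /sumF; iauto leaf0.
case: x y xT => [i||i||] [k||k||] // _; rewrite ?mzero;
  try (by apply: ideal0); try igen; try (apply: I0Y; solve [igen | leaf0]).
Qed.

Lemma Y_D_b_Eb i j k : Y1 (D (fEb j) (b i k)).
Proof. apply: I0_sub (D_b_Eb i j k) _; iauto leaf0. Qed.
Lemma Y_D_bb_E i j k : Y1 (D (fE j) (bb i k)).
Proof. apply: I0_sub (D_bb_E i j k) _; iauto leaf0. Qed.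
Lemma Y_D_g_E i : Y1 (D (fE i) g).
Proof. apply: I0_sub (D_g_E i) _; iauto leaf0. Qed.

Lemma D_identA x i j :
  \sum_k D x (b i k) * Hm k j + \sum_k b i k * D x (Hm k j)
  + (\sum_k D x (bb j k) * Hm i k + \sum_k bb j k * D x (Hm i k))
  = D x g * Hm i j + g * D x (Hm i j) + D x (actZ z (Hm i j)).
Proof.
move: (identA i j); move: (actZ z (Hm i j)) => W /(congr1 (D x)).
rewrite !fDD !fD_sum fDM => <-.
by rewrite -!big_split /=; apply: eq_bigr => k _; rewrite !fDM; ring.
Qed.

Lemma D_identB x j k :
  \sum_i D x (ALm j i) * b i k + \sum_i ALm j i * D x (b i k)
  - (\sum_i D x (bb j i) * ALm i k + \sum_i bb j i * D x (ALm i k))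
  - (D x kap * ALm j k + kap * D x (ALm j k)) + D x (actZ z (ALm j k)) = 0.
Proof.
move: (identB j k); move: (actZ z (ALm j k)) => W /(congr1 (D x)).
rewrite !(fDD, fDN) fDM !fD_sum fD0 => e; rewrite -[RHS]e.
by rewrite -!big_split /=; congr (_ - _ - _ + _); apply: eq_bigr => i _; rewrite fDM.
Qed.

(** Jacobi's identity for [Z, E_i, E_j] sees only an antisymmetrisation of these derivatives.
    Differentiating [identA] along [E_j] gives them all, because [Hm] is invertible and the
    derivatives of [conj b] along [E_j] are known from [D_bb_E]. *)
Lemma Y_D_b_E i j k : Y1 (D (fE j) (b i k)).
Proof.
pose u k := D (fE j) (b i k).
have uH k' : Y1 (\sum_k u k * Hm k k').
  rewrite [X in Y1 X](_ : _ = (D (fE j) g * Hm i k' + g * D (fE j) (Hm i k')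
     + D (fE j) (actZ z (Hm i k'))) - \sum_k (b i k * D (fE j) (Hm k k'))
     - (\sum_k D (fE j) (bb k' k) * Hm i k + \sum_k bb k' k * D (fE j) (Hm i k))).
    have Ya : Y1 (D (fE j) (actZ z (Hm i k'))).
      rewrite -[D _ _](addrK (cc j * D fK (Hm i k'))).
      by apply: idealB; [apply/I0Y/D_actZ_E | iauto leaf0].
    iauto ltac:(solve [exact: Ya | apply: Y_D_g_E | apply: Y_D_bb_E
      | apply: I0Y; leaf0]).
  by rewrite -D_identA; ring.
have -> : D (fE j) (b i k) = \sum_k' (\sum_l u l * Hm l k') * invmx Hm k' k.
  have : (\row_l u l) *m Hm *m invmx Hm = \row_l u l by rewrite mulmxK // Hm_unit.
  move=> /matrixP/(_ 0 k); rewrite [RHS]mxE -/(u k) => <-; rewrite mxE.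
  apply: eq_bigr => k' _; rewrite mxE; congr (_ * _); apply: eq_bigr => l _; by rewrite mxE.
by apply: ideal_sum => k' _; apply: idealMr.
Qed.

Lemma Y_D_bb_Eb i j k : Y1 (D (fEb j) (bb i k)).
Proof. by have := Y1_cj (Y_D_b_E i j k); rewrite fD_cj sm_cj. Qed.

Lemma D_I0_Y x f : x <> fT -> I0 f -> Y1 (D x f).
Proof.
move=> xT; elim=> [|a f' g' Gf' Hg' IH]; first by rewrite fD0; apply: ideal0.
rewrite fDD fDM; apply: idealD => //; apply: idealD.
  by apply/I0Y/idealM/ideal_gen.
apply: idealM; case: Gf' => [y|i k|i k]; first exact: Y_D_z.
- case: x xT {IH} => [j||j||] xT; last (by case: xT); first [exact: Y_D_b_E | exact: Y_D_b_Eb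
    | by apply: I0Y; first [exact: D_b_K | exact: D_b_Kb]].
- case: x xT {IH} => [j||j||] xT; last (by case: xT); first [exact: Y_D_bb_E | exact: Y_D_bb_Eb
    | by apply: I0Y; first [exact: D_bb_K | exact: D_bb_Kb]].
Qed.

(** [A_Eb], [A_E], [B_Eb] and [B_E] are [identA] and [identB] differentiated along H and its
    conjugate, modulo the ideal of Z and [b]: linear relations between [c], [l] and the derivatives
    of [b]. *)
Lemma A_Eb i j k : I0 (\sum_x D (fEb j) (b i x) * Hm x k
    + \sum_x D (fEb j) (bb k x) * Hm i x
  - ((- (ccb j * c fKb fT fT) + \sum_x l x * Hm x j) * Hm i k - ccb j * D fKb (Hm i k))).
Proof.
set R := - _ + _; set s1 := \sum_ _ _; set s2 := \sum_ _ _.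
rewrite [X in I0 X](_ : _ = (D (fEb j) g - R) * Hm i k + g * D (fEb j) (Hm i k)
  + (D (fEb j) (actZ z (Hm i k)) + ccb j * D fKb (Hm i k))
  - \sum_x b i x * D (fEb j) (Hm x k) - \sum_x bb k x * D (fEb j) (Hm i x)).
  iauto ltac:(solve [exact: D_g_Eb | exact: D_actZ_Eb | leaf0]).
have -> : s1 = D (fEb j) g * Hm i k + g * D (fEb j) (Hm i k)
   + D (fEb j) (actZ z (Hm i k)) - \sum_x b i x * D (fEb j) (Hm x k)
   - (s2 + \sum_x bb k x * D (fEb j) (Hm i x)).
  by rewrite -D_identA -/s1 -/s2; ring.
ring.
Qed.

Lemma A_E i j k : I0 (\sum_x D (fE j) (b i x) * Hm x k
    + \sum_x D (fE j) (bb k x) * Hm i x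
  - ((- (cc j * c fK fT fT) - \sum_x lb x * Hm j x) * Hm i k - cc j * D fK (Hm i k))).
Proof.
set R := - _ - _; set s1 := \sum_ _ _; set s2 := \sum_ _ _.
rewrite [X in I0 X](_ : _ = (D (fE j) g - R) * Hm i k + g * D (fE j) (Hm i k)
  + (D (fE j) (actZ z (Hm i k)) + cc j * D fK (Hm i k))
  - \sum_x b i x * D (fE j) (Hm x k) - \sum_x bb k x * D (fE j) (Hm i x)).
  iauto ltac:(solve [exact: D_g_E | exact: D_actZ_E | leaf0]).
have -> : s1 = D (fE j) g * Hm i k + g * D (fE j) (Hm i k)
   + D (fE j) (actZ z (Hm i k)) - \sum_x b i x * D (fE j) (Hm x k)
   - (s2 + \sum_x bb k x * D (fE j) (Hm i x)).
  by rewrite -D_identA -/s1 -/s2; ring.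
ring.
Qed.

Lemma B_Eb i j k : I0 (\sum_x ALm j x * D (fEb i) (b x k)
    - \sum_x D (fEb i) (bb j x) * ALm x k
  - (D (fEb i) kap * ALm j k + ccb i * D fKb (ALm j k))).
Proof.
set s1 := \sum_ _ _; set s2 := \sum_ _ _.
rewrite [X in I0 X](_ : _ = kap * D (fEb i) (ALm j k)
  - (D (fEb i) (actZ z (ALm j k)) + ccb i * D fKb (ALm j k))
  - \sum_x D (fEb i) (ALm j x) * b x k + \sum_x bb j x * D (fEb i) (ALm x k)).
  iauto ltac:(solve [exact: D_actZ_Eb | leaf0]).
have := D_identB (fEb i) j k; rewrite -/s1 -/s2.
by set t1 := \sum_ _ _; set t2 := \sum_ _ _ => e; rewrite -[LHS]subr0 -[X in _ - X = _]e; ring.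
Qed.

Lemma B_E i j k : I0 (\sum_x ALm j x * D (fE i) (b x k)
    - \sum_x D (fE i) (bb j x) * ALm x k
  - (D (fE i) kap * ALm j k + cc i * D fK (ALm j k))).
Proof.
set s1 := \sum_ _ _; set s2 := \sum_ _ _.
rewrite [X in I0 X](_ : _ = kap * D (fE i) (ALm j k)
  - (D (fE i) (actZ z (ALm j k)) + cc i * D fK (ALm j k))
  - \sum_x D (fE i) (ALm j x) * b x k + \sum_x bb j x * D (fE i) (ALm x k)).
  iauto ltac:(solve [exact: D_actZ_E | leaf0]).
have := D_identB (fE i) j k; rewrite -/s1 -/s2.
by set t1 := \sum_ _ _; set t2 := \sum_ _ _ => e; rewrite -[LHS]subr0 -[X in _ - X = _]e; ring.
Qed.

Section FirstOrder.
Variable s : A -> C.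
Hypotheses (sY : semilinear ev Y1 s) (s0 : forall f, I0 f -> s f = 0).

Lemma s_eq f f' : I0 (f - f') -> Y1 f' -> s f = s f'.
Proof.
by move=> H H'; rewrite -(subrK f' f) sY.1 ?(s0 H) ?add0r //; apply: I0Y.
Qed.
Lemma sM a f : Y1 f -> s (a * f) = ev a * s f. Proof. exact: sY.2. Qed.
Lemma sMr a f : Y1 f -> s (f * a) = s f * ev a.
Proof. by rewrite mulrC [RHS]mulrC; apply: sY.2. Qed.
Lemma sD f f' : Y1 f -> Y1 f' -> s (f + f') = s f + s f'. Proof. exact: sY.1. Qed.
Lemma sN f : Y1 f -> s (- f) = - s f.
Proof. by move=> H; rewrite -mulN1r sM // rmorphN rmorph1 mulN1r. Qed.
Lemma sB f f' : Y1 f -> Y1 f' -> s (f - f') = s f - s f'.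
Proof. by move=> H H'; rewrite sD ?sN //; apply: idealN. Qed.
Lemma s_sum (G : 'I_q -> A) : (forall i, Y1 (G i)) -> s (\sum_i G i) = \sum_i s (G i).
Proof.
move=> H; suff [] : s (\sum_i G i) = \sum_i s (G i) /\ Y1 (\sum_i G i) by [].
apply: (big_ind2 (fun f t => s f = t /\ Y1 f)); last by [].
  by split; [apply/s0/ideal0 | apply: ideal0].
by move=> f t f' t' [<- Yf] [<- Yf']; split; [apply: sD | apply: idealD].
Qed.

(** From here on, identities are evaluated by a form [s] killing the ideal of Z and [b]. Such an [s]
    need not commute with conjugation, so [cv] and [pv], its values on [c] and [conj c], are
    independent vectors; likewise [lv] and [lbv]. *)
Definition cv : 'cV[C]_q := \col_i s (cc i).
Definition pv : 'cV[C]_q := \col_i s (ccb i).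
Definition lv : 'cV[C]_q := \col_i s (l i).
Definition lbv : 'cV[C]_q := \col_i s (lb i).

Definition Bb j : 'M[C]_q := \matrix_(i, k) s (D (fEb j) (b i k)).
Definition BBe j : 'M[C]_q := \matrix_(i, k) s (D (fE j) (bb i k)).
Definition Be j : 'M[C]_q := \matrix_(i, k) s (D (fE j) (b i k)).
Definition BBb j : 'M[C]_q := \matrix_(i, k) s (D (fEb j) (bb i k)).

Lemma Y_cc i : Y1 (cc i). Proof. igen. Qed.
Lemma Y_ccb i : Y1 (ccb i). Proof. igen. Qed.
Lemma Y_l i : Y1 (l i). Proof. igen. Qed.
Lemma Y_lb i : Y1 (lb i). Proof. igen. Qed.
Hint Resolve Y_cc Y_ccb Y_l Y_lb Y_D_b_Eb Y_D_b_E Y_D_bb_Eb Y_D_bb_E idealD idealB idealM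
  idealMr idealN : core.

Lemma BbE j : Bb j = cv *m row j alm - col j hm *m lv^T.
Proof.
apply/matrixP => i k; rewrite mxE (s_eq (D_b_Eb i j k)); last by auto.
rewrite sD ?sB; [|by auto 6..].
rewrite (sMr _ (Y_cc i)) (sM _ (Y_l k)) (sMr _ (Y_ccb j)).
by rewrite ev_norm mulr0 addr0 !mxE !big_ord1 !mxE.
Qed.

Lemma BBeE j : BBe j = pv *m conjm (row j alm) + (row j hm)^T *m lbv^T.
Proof.
apply/matrixP => i k; rewrite mxE (s_eq (D_bb_E i j k)); last by auto 6.
rewrite !sD; [|by auto 6..].
rewrite (sMr _ (Y_ccb i)) (sM _ (Y_lb k)) (sMr _ (Y_cc j)).
by rewrite ev_norm mulr0 addr0 ev_cj !mxE !big_ord1 !mxE.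
Qed.

Lemma Bb_A j : Bb j *m hm + hm *m (BBb j)^T = dot lv (col j hm) *: hm.
Proof.
apply/matrixP => i k.
have Yl : Y1 (\sum_x l x * Hm x j) by apply: ideal_sum => ? _; auto.
have Y2 : Y1 (- (ccb j * c fKb fT fT) + \sum_x l x * Hm x j) by auto.
have := s0 (A_Eb i j k).
rewrite sB; last 2 first.
- by apply: idealD; apply: ideal_sum => ? _; auto.
- by auto.
rewrite sD; [|by apply: ideal_sum => ? _; auto..].
rewrite sB; [|by auto..].
rewrite !s_sum; [|by auto..].
rewrite (sMr _ (Y_ccb j)) (sMr _ Y2) sD ?sN; [|by auto..].
rewrite (sMr _ (Y_ccb j)) s_sum ?ev_DKb_H ?ev_thetab; [|by auto..] => /eqP.
rewrite subr_eq0 => /eqP e; rewrite !mxE.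
transitivity (\sum_x s (D (fEb j) (b i x) * Hm x k) + \sum_x s (D (fEb j) (bb k x) * Hm i x)).
  by congr (_ + _); apply: eq_bigr => x _; rewrite sMr // !mxE // mulrC.
rewrite e hmE.
have -> : \sum_x s (l x * Hm x j) = dot lv (col j hm).
  by rewrite /dot mxE; apply: eq_bigr => x _; rewrite sMr // !mxE.
rewrite [in LHS]mxE; ring.
Qed.

Lemma Be_A j : Be j *m hm + hm *m (BBe j)^T = - (dot (row j hm)^T lbv) *: hm.
Proof.
apply/matrixP => i k.
have Yl : Y1 (\sum_x lb x * Hm j x) by apply: ideal_sum => ? _; auto.
have Y2 : Y1 (- (cc j * c fK fT fT) - \sum_x lb x * Hm j x) by auto.
have := s0 (A_E i j k).
rewrite sB; last 2 first.
- by apply: idealD; apply: ideal_sum => ? _; auto.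
- by auto.
rewrite sD; [|by apply: ideal_sum => ? _; auto..].
rewrite sB; [|by auto..].
rewrite !s_sum; [|by auto..].
rewrite (sMr _ (Y_cc j)) (sMr _ Y2) sB ?sN; [|by auto..].
rewrite (sMr _ (Y_cc j)) s_sum ?ev_DK_H -?/theta; [|by auto..] => /eqP.
rewrite subr_eq0 => /eqP e; rewrite !mxE.
transitivity (\sum_x s (D (fE j) (b i x) * Hm x k) + \sum_x s (D (fE j) (bb k x) * Hm i x)).
  by congr (_ + _); apply: eq_bigr => x _; rewrite sMr // !mxE // mulrC.
rewrite e hmE.
have -> : \sum_x s (lb x * Hm j x) = dot (row j hm)^T lbv.
  by rewrite /dot mxE; apply: eq_bigr => x _; rewrite sMr // !mxE mulrC.
rewrite [in LHS]mxE; ring.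
Qed.

Lemma s_kap_Eb i : Y1 (D (fEb i) kap). Proof. exact: D_I0_Y I0_kap. Qed.
Lemma s_kap_E i : Y1 (D (fE i) kap). Proof. exact: D_I0_Y I0_kap. Qed.
Hint Resolve s_kap_Eb s_kap_E : core.

Lemma Bb_B j : alm *m Bb j - BBb j *m alm
  = (s (D (fEb j) kap) + pv j 0 * ev (c fKb fK fK)) *: alm.
Proof.
apply/matrixP => i k; have := s0 (B_Eb j i k).
rewrite sB; last 2 first.
- by apply: idealB; apply: ideal_sum => ? _; auto.
- by auto.
rewrite sB; [|by apply: ideal_sum => ? _; auto..].
rewrite sD; [|by auto..].
rewrite !s_sum; [|by auto..].
rewrite (sMr _ (Y_ccb j)) (sMr _ (s_kap_Eb j)) ev_DKb_AL => /eqP.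
rewrite subr_eq0 => /eqP e.
transitivity (\sum_x s (ALm i x * D (fEb j) (b x k)) - \sum_x s (D (fEb j) (bb i x) * ALm x k)).
  rewrite !mxE; congr (_ - _); apply: eq_bigr => x _; last by rewrite sMr // !mxE.
  by rewrite sM // !mxE.
rewrite e [RHS]mxE almE [pv j 0]mxE; ring.
Qed.

Definition Km : 'M[C]_q := \matrix_(j, k) ev (D fK (ALm j k)).

Lemma Be_B j : alm *m Be j - BBe j *m alm = s (D (fE j) kap) *: alm + cv j 0 *: Km.
Proof.
apply/matrixP => i k; have := s0 (B_E j i k).
rewrite sB; last 2 first.
- by apply: idealB; apply: ideal_sum => ? _; auto.
- by auto.
rewrite sB; [|by apply: ideal_sum => ? _; auto..].
rewrite sD; [|by auto..].
rewrite !s_sum; [|by auto..].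
rewrite (sMr _ (Y_cc j)) (sMr _ (s_kap_E j)) => /eqP.
rewrite subr_eq0 => /eqP e.
transitivity (\sum_x s (ALm i x * D (fE j) (b x k)) - \sum_x s (D (fE j) (bb i x) * ALm x k)).
  rewrite !mxE; congr (_ - _); apply: eq_bigr => x _; last by rewrite sMr // !mxE.
  by rewrite sM // !mxE.
by rewrite e [RHS]mxE [(_ *: alm) _ _]mxE [(_ *: Km) _ _]mxE almE [cv j 0]mxE [Km i k]mxE.
Qed.

Lemma QmE : Qm = - (Km *m hm). Proof. by []. Qed.

(* For symmetric X = xi *m hm the relation Bb_A turns commutation with xi into
   a symmetrization. *)
Lemma BBb_sym j (X : 'M[C]_q) : (X *m hm)^T = X *m hm ->
  BBb j *m (X *m hm) = dot lv (col j hm) *: (X *m hm) - (X *m Bb j *m hm)^T.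
Proof.
move=> symX.
have e : BBb j *m hm^T = dot lv (col j hm) *: hm^T - hm^T *m (Bb j)^T.
  have := congr1 trmx (Bb_A j); rewrite linearD linearZ /= !trmx_mul trmxK => <-.
  by rewrite addrAC subrr add0r.
have XT : hm^T *m X^T = X *m hm by rewrite -symX trmx_mul.
rewrite -XT mulmxA e mulmxBl -scalemxAl -!mulmxA XT.
by congr (_ - _); rewrite !trmx_mul mulmxA.
Qed.

Local Notation n := (invmx hm *m cv).

Lemma Bb_sym j (X : 'M[C]_q) :
  X *m Bb j *m hm = (X *m cv) *m (S *m delta_mx j 0)^T
    - (X *m hm *m delta_mx j 0) *m (hm^T *m lv)^T.
Proof.
have -> : (S *m delta_mx j 0)^T = row j alm *m hm.
  by rewrite trmx_mul trmx_delta symS -row_mul -rowE.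
have -> : (hm^T *m lv)^T = lv^T *m hm by rewrite trmx_mul trmxK.
by rewrite BbE mulmxBr mulmxBl colE !mulmxA.
Qed.

(** Used twice: for [X = al] it determines [l], and for [X = Km], the derivative of [al] along [K],
    it produces the second exceptional equation. *)
Lemma commutator_sym j (X : 'M[C]_q) : (X *m hm)^T = X *m hm ->
  (X *m Bb j - BBb j *m X) *m hm
  = sprod (X *m cv) (S *m delta_mx j 0) - sprod (X *m hm *m delta_mx j 0) (hm^T *m lv)
    - dot lv (col j hm) *: (X *m hm).
Proof.
move=> symX; rewrite mulmxBl -[_ *m X *m hm]mulmxA BBb_sym // Bb_sym.
have trB (u v u' v' : 'cV[C]_q) :
    (u *m v^T - u' *m v'^T)^T = v *m u^T - v' *m u'^T.
  by apply/matrixP => i k; rewrite !mxE !big_ord1 !mxE; congr (_ - _); rewrite mulrC.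
rewrite trB /sprod; move: (X *m cv) (X *m hm *m _) (S *m _) (hm^T *m lv) => u v u' v'.
by apply/matrixP => i k; rewrite !mxE; ring.
Qed.

(** By [Bb_B] the left-hand side of [commutator_sym] for [X = al] is a multiple of [S]. Hence the
    products of [al c - h^T l] with the columns of [S] lie on the line of [S], and [sprod_image_eq0]
    applies. *)
Lemma first_order_lv : hm^T *m lv = alm *m cv.
Proof.
apply/eqP; rewrite -subr_eq0 -oppr_eq0 opprB; apply/eqP.
apply: (sprod_image_eq0 symS symPS nonreg).
have H j : exists t, sprod (alm *m cv - hm^T *m lv) (S *m delta_mx j 0) = t *: S.
  have := commutator_sym j symS; rewrite Bb_B -scalemxAl -/S => e.
  exists (s (D (fEb j) kap) + pv j 0 * ev (c fKb fK fK) + dot lv (col j hm)).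
  by rewrite sprodBl [X in _ - X]sprodC [RHS]scalerDl e subrK.
move=> k; have /choice[t Ht] := H; exists (\sum_j k j 0 * t j).
have -> : S *m k = \sum_j k j 0 *: (S *m delta_mx j 0).
  rewrite {1}[k]matrix_sum_delta mulmx_sumr; apply: eq_bigr => j _.
  by rewrite big_ord1 scalemxAr.
rewrite scaler_suml sprod_sumr; apply: eq_bigr => j _.
by rewrite sprodZr Ht scalerA.
Qed.

(** Conjugating [s] exchanges [cv] with [pv] and [lv] with [lbv] up to conjugation, so each
    first-order relation has a mirror image. *)
Lemma semilinear_conj : semilinear ev Y1 (fun f => (s (cj f))^*).
Proof.
split=> [f f' /Y1_cj Yf /Y1_cj Yf'|a f /Y1_cj Yf].
  by rewrite rmorphD sD // rmorphD.
by rewrite rmorphM sM // rmorphM /= ev_cj conjCK.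
Qed.

End FirstOrder.

Section FirstOrder2.
Variable s : A -> C.
Hypotheses (sY : semilinear ev Y1 s) (s0 : forall f, I0 f -> s f = 0).

Lemma first_order_lbv : - (hm *m lbv s) = conjm alm *m pv s.
Proof.
have H0 f : I0 f -> (s (cj f))^* = 0 by move=> /I0_cj /s0 ->; rewrite conjC0.
have := first_order_lv (semilinear_conj sY) H0.
have -> : lv (fun f => (s (cj f))^*) = conjm (lbv s).
  by apply/matrixP => i j; rewrite !mxE sm_cj.
have -> : cv (fun f => (s (cj f))^*) = conjm (pv s).
  by apply/matrixP => i j; rewrite !mxE sm_cj.
move=> /(congr1 conjm); rewrite !map_mxM !conjmK => <-.
by rewrite -map_trmx conjm_hm linearN /= trmxK mulNmx.
Qed.

(** Eliminate [Be] between [Be_A] and [Be_B]: [BBe] is explicit, and [first_order_lbv] removes [lbv]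
    from it. The relation is obtained for the rows of [h], which span. With [s = ev] it becomes the
    first exceptional equation. *)
Lemma first_order_E2 (v : 'cV[C]_q) : exists t,
  sprod (P *m v) (pv s) - sprod v (P *m pv s) = t *: S
    + dot (invmx hm *m cv s) v *: Qm.
Proof.
set p := pv s; set nn := invmx hm *m cv s.
pose w j := (row j hm)^T.
have wE j : w j = hm^T *m delta_mx j 0 by rewrite /w tr_row colE.
have H j : exists t, sprod (P *m w j) p - sprod (w j) (P *m p) = t *: S + dot nn (w j) *: Qm.
  have cj0 : dot nn (w j) = cv s j 0.
    rewrite wE -dot_tr /nn mulKVmx ?hm_unit //.
    by rewrite /dot -colE !mxE.
  have rS : conjm (row j alm) *m S = (P *m w j)^T.
    rewrite wE mulmxA -S_conj trmx_mul trmx_delta [(_ *m _)^T]trmx_mul trmxK symS.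
    by rewrite [RHS]mulmxA -rowE map_row.
  have lS : (lbv s)^T *m S = - (P *m p)^T.
    rewrite -{1}symS -trmx_mul -linearN /=; congr (_^T).
    by rewrite /S /P -!mulmxA -mulmxN -first_order_lbv opprK.
  have BS : BBe s j *m S = p *m (P *m w j)^T - w j *m (P *m p)^T.
    by rewrite BBeE // mulmxDl -(mulmxA (pv s)) -(mulmxA (row j hm)^T) rS lS mulmxN.
  have A1 := Be_A sY s0 j; have B1 := Be_B sY s0 j.
  have e : alm *m (Be s j *m hm) = - (dot (w j) (lbv s)) *: S - S *m (BBe s j)^T.
    have -> : Be s j *m hm = - (dot (w j) (lbv s)) *: hm - hm *m (BBe s j)^T.
      by rewrite -A1 addrK.
    by rewrite mulmxBr -scalemxAr mulmxA.
  have e2 : S *m (BBe s j)^T = (BBe s j *m S)^T by rewrite trmx_mul symS.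
  have := congr1 (mulmx^~ hm) B1.
  rewrite /= mulmxBl mulmxDl -!scalemxAl -(mulmxA alm) -(mulmxA (BBe s j)) e e2 -/S BS cj0 QmE.
  have trB (x1 x2 x3 x4 : 'cV[C]_q) :
    (x1 *m x2^T - x3 *m x4^T)^T = x2 *m x1^T - x4 *m x3^T.
    by apply/matrixP => i k; rewrite !mxE !big_ord1 !mxE; congr (_ - _); rewrite mulrC.
  rewrite trB; move: (Km *m hm) (P *m w j) (P *m p) => K1 u1 u2 e3.
  exists (- (dot (w j) (lbv s) + s (D (fE j) kap))).
  move/eqP: e3; rewrite -subr_eq0 => /eqP e4.
  apply/eqP; rewrite -subr_eq0 -oppr_eq0 -[X in _ == X]e4 /sprod; apply/eqP.
  by apply/matrixP => i k; rewrite !mxE; ring.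
have /choice[t Ht] := H; pose x := invmx hm^T *m v.
have vE : v = \sum_j x j 0 *: w j.
  have -> : v = hm^T *m x by rewrite mulKVmx // unitmx_tr hm_unit.
  rewrite {1}[x]matrix_sum_delta mulmx_sumr; apply: eq_bigr => j _.
  by rewrite big_ord1 -scalemxAr wE.
exists (\sum_j x j 0 * t j); rewrite vE mulmx_sumr.
rewrite sprodC sprod_sumr [X in _ - X]sprodC sprod_sumr -sumrB.
have -> : dot nn (\sum_j x j 0 *: w j) = \sum_j x j 0 * dot nn (w j).
  by rewrite /dot mulmx_sumr summxE; apply: eq_bigr => j _; rewrite -scalemxAr mxE.
rewrite !scaler_suml -big_split /=; apply: eq_bigr => j _.
rewrite -scalemxAr !sprodZr -scalerBr sprodC [X in _ - X]sprodC Ht.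
by rewrite scalerDr !scalerA.
Qed.

End FirstOrder2.

Variable cst : {rmorphism C -> A}.
Hypothesis ev_cst : forall x, ev (cst x) = x.

(** The forms to be tested kill [c] and [conj c], so [cv = pv = 0]; the first-order relations then
    give [lv = lbv = 0], since [h] is invertible. *)
Lemma I1_l_lb (t : 'I_q + 'I_q) : I1 (match t with inl i => l i | inr i => lb i end).
Proof.
move: t; apply: (nakayama_fin ev_cst ev_unit) => s [s1 s2] s0.
pose y (t : 'I_q + 'I_q) := match t with inl i => l i | inr i => lb i end.
have sub f : Y1 f -> ideal (fun f => gen1 f \/ exists t, f = y t) f.
  apply: ideal_sub => _ [f' H|i|i]; apply: ideal_gen; first by left.
    by right; exists (inl i).
  by right; exists (inr i).
have sY : semilinear ev Y1 s.
  by split=> [f f' /sub Yf /sub Yf'|a f /sub Yf]; [apply: s1 | apply: s2].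
have s0' f : I0 f -> s f = 0 by move=> /I01; apply: s0.
have cv0 : cv s = 0 by apply/matrixP => i j; rewrite !mxE s0 //; igen.
have pv0 : pv s = 0 by apply/matrixP => i j; rewrite !mxE s0 //; igen.
have lv0 : lv s = 0.
  have := first_order_lv sY s0'; rewrite cv0 mulmx0 => /(congr1 (mulmx (invmx hm^T))).
  by rewrite mulKmx ?mulmx0 // unitmx_tr hm_unit.
have lbv0 : lbv s = 0.
  have := first_order_lbv sY s0'; rewrite pv0 mulmx0 => /(congr1 (mulmx (invmx hm))).
  rewrite mulmxN mulKmx ?hm_unit // mulmx0 => /eqP; rewrite oppr_eq0.
  by move/eqP.
case=> i.
  by have /matrixP/(_ i 0) := lv0; rewrite !mxE.
by have /matrixP/(_ i 0) := lbv0; rewrite !mxE.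
Qed.

Lemma I1_l i : I1 (l i). Proof. exact: (I1_l_lb (inl i)). Qed.
Lemma I1_lb i : I1 (lb i). Proof. exact: (I1_l_lb (inr i)). Qed.
Lemma Y_I1 f : Y1 f -> I1 f.
Proof.
by apply: ideal_sub => _ [f' H|i|i]; [apply: ideal_gen | apply: I1_l | apply: I1_lb].
Qed.

Ltac leaf1 := solve [apply: I1_l | apply: I1_lb | apply: I01; leaf0].

(** The new unknown is [rho], the [K] component of [[Z, T]]. It enters here through the Levi form
    and in [D_l_Eb] through [al], with opposite signs; confronting the two eliminates it. *)
Lemma D_cc_Eb i j : I1 (D (fEb j) (cc i) + Hm i j * rho).
Proof.
have := s_jacobi Z (fE i) (fEb j) fK; simpA.
set s1 := \sum_ _ _; set s2 := \sum_ _ _; set s3 := \sum_ _ _ => e.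
rewrite [X in I1 X](_ : _ = - actZ z (c (fE i) (fEb j) fK) - s1
  - c (fE i) (fEb j) fK * kap + (s2 + cc i * c fK (fEb j) fK)
  + (s3 + ccb j * c (fE i) fKb fK)).
  iauto leaf1.
by rewrite -[D _ _]opprK e !mxE; ring.
Qed.

Lemma D_l_Eb k j : I1 (D (fEb j) (l k) - ALm j k * rho).
Proof.
have := s_jacobi Z (fEb j) fT (fE k); simpA.
set s1 := \sum_ _ _; set s2 := \sum_ _ _; set s3 := \sum_ _ _ => e.
rewrite [X in I1 X](_ : _ = actZ z (c (fEb j) fT (fE k)) + (s1 + c (fEb j) fT fT * l k)
  - (s2 + ccb j * c fKb fT (fE k)) - s3 - g * c (fEb j) fT (fE k)).
  iauto leaf1.
by rewrite e !mxE [c (fEb j) fK _]fc_anti; ring.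
Qed.

(** One more prolongation. For a form [s] killing [I1], the composite of [s] with the derivation
    along [conj E_j] is again a form to which the first-order relations apply. [first_order_lv]
    becomes [2 s(rho) S = 0]. Once [s(rho) = 0], [first_order_E2] has no [Q] term, and
    [sprod_derivation_eq0] kills the derivatives of [conj c]. *)
Lemma I1_rho_Dccb (t : option ('I_q * 'I_q)) :
  I1 (match t with None => rho | Some ij => D (fEb ij.2) (ccb ij.1) end).
Proof.
move: t; apply: (nakayama_fin ev_cst ev_unit) => s.
set Y2 := ideal _ => -[s1 s2] s0.
have I1Y2 f : I1 f -> Y2 f.
  by apply: ideal_sub => f' H; apply: ideal_gen; left.
have Yrho : Y2 rho by apply: ideal_gen; right; exists None.
have s3 f f' : I1 (f - f') -> Y2 f' -> s f = s f'.
  by move=> H H'; rewrite -(subrK f' f) s1 ?(s0 _ H) ?add0r //; apply: I1Y2.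
have Ysub f f' : I1 (f - f') -> Y2 f' -> Y2 f.
  by move=> H H'; rewrite -(subrK f' f); apply: idealD => //; apply: I1Y2.
have DY j f : I1 f -> Y2 (D (fEb j) f).
  elim=> [|a f' g' Gf' Hg' IH]; first by rewrite fD0; apply: ideal0.
  rewrite fDD fDM; apply: idealD => //; apply: idealD.
    by apply/I1Y2/idealM/ideal_gen.
  apply: idealM; case: Gf' => [h Hh|i|i].
  - by apply/I1Y2/Y_I1/D_I0_Y => //; apply: ideal_gen.
  - apply: (@Ysub _ (- (Hm i j * rho))); first by rewrite opprK; apply: D_cc_Eb.
    by apply/idealN/idealM.
  - by apply: ideal_gen; right; exists (Some (i, j)).
pose sj j f := s (D (fEb j) f).
(* The Leibniz term [D(a) f] is killed because [f] belongs to [I1] by [Y_I1]; this is what makes the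
   composite semilinear. *)
have sjY j : semilinear ev Y1 (sj j).
  split=> [f f' /Y_I1/DY Yf /Y_I1/DY Yf'|a f Yf].
    by rewrite /sj fDD s1.
  rewrite /sj fDM s1; last 2 first.
  - by apply/I1Y2/idealM/Y_I1.
  - by apply/idealM/DY/Y_I1.
  by rewrite s0 ?add0r ?s2 //; [apply/DY/Y_I1 | apply/idealM/Y_I1].
have sj0 j f : I0 f -> sj j f = 0 by move=> H; apply/s0/Y_I1/D_I0_Y.
have cvE j : cv (sj j) = - s rho *: (hm *m delta_mx j 0).
  apply/matrixP => i k; rewrite [LHS]mxE /sj (@s3 (D (fEb j) (cc i)) (- (Hm i j * rho))); last 2 first.
  - by rewrite opprK; apply: D_cc_Eb.
  - by apply/idealN/idealM.
  rewrite -mulNr s2 // rmorphN -colE ord1 !mxE; ring.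
have lvE j : lv (sj j) = s rho *: (alm^T *m delta_mx j 0).
  apply/matrixP => i k; rewrite [LHS]mxE /sj (@s3 (D (fEb j) (l i)) (ALm j i * rho)); last 2 first.
  - exact: D_l_Eb.
  - exact: idealM.
  by rewrite s2 // -colE ord1 !mxE mulrC.
have rho0 : s rho = 0.
  apply: contrapT => r0; apply: (nonreg_neq0 nonreg).
  have Sj j : S *m (delta_mx j 0 : 'cV[C]_q) = 0.
    have := first_order_lv (sjY j) (@sj0 j); rewrite cvE lvE -!scalemxAr scaleNr.
    rewrite !mulmxA -trmx_mul -/S symS => /eqP; rewrite -addr_eq0 -mulr2n -scaler_nat.
    by rewrite !scaler_eq0 pnatr_eq0 /= => /orP[/eqP //|/eqP].
  apply: mulmx_inj => k; rewrite mul0mx {1}[k]matrix_sum_delta mulmx_sumr big1 // => j _.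
  by rewrite big_ord1 -scalemxAr Sj scaler0.
have pv0 j : pv (sj j) = 0.
  apply: (sprod_derivation_eq0 symS symPS nonreg) => v.
  have [t ->] := first_order_E2 (sjY j) (@sj0 j) v; exists t.
  by rewrite cvE rho0 oppr0 scale0r mulmx0 dot0l scale0r addr0.
case=> [[i j]|] //=.
by have /matrixP/(_ i 0) := pv0 j; rewrite !mxE.
Qed.

Lemma I1_rho : I1 rho. Proof. exact: (I1_rho_Dccb None). Qed.
Lemma D_ccb_Eb i j : I1 (D (fEb j) (ccb i)). Proof. exact: (I1_rho_Dccb (Some (i, j))). Qed.
Lemma D_cc_E i j : I1 (D (fE j) (cc i)).
Proof. by have := I1_cj (D_ccb_Eb i j); rewrite fD_cj sm_cj. Qed.
Lemma I1_cc_Eb i j : I1 (D (fEb j) (cc i)).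
Proof.
rewrite -[D _ _](addrK (Hm i j * rho)); apply: idealB; first exact: D_cc_Eb.
exact/idealM/I1_rho.
Qed.
Lemma D_ccb_E i j : I1 (D (fE j) (ccb i)).
Proof. by have := I1_cj (I1_cc_Eb i j); rewrite fD_cj sm_cj. Qed.

(** Jacobi's identity relates it to the derivative of [kap] along [E_i], and [kap] lies in the ideal
    of Z and [b]. *)
Lemma D_cc_K i : I1 (D fK (cc i)).
Proof.
have := s_jacobi Z (fE i) fK fK; simpA => e.
have -> : D fK (cc i) = D (fE i) kap - (D (fE i) kap - D fK (cc i)) by ring.
rewrite e; apply: idealB; first exact/Y_I1/D_I0_Y/I0_kap.
iauto leaf1.
Qed.
Lemma D_cc_Kb i : I1 (D fKb (cc i)).
Proof.
have := s_jacobi Z (fE i) fKb fK; simpA => e.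
rewrite -[D _ _]opprK e; iauto leaf1.
Qed.
Lemma D_ccb_K i : I1 (D fK (ccb i)).
Proof. by have := I1_cj (D_cc_Kb i); rewrite fD_cj sm_cj. Qed.
Lemma D_ccb_Kb i : I1 (D fKb (ccb i)).
Proof. by have := I1_cj (D_cc_K i); rewrite fD_cj sm_cj. Qed.

Lemma D_I1_hor x f : x <> fT -> I1 f -> I1 (D x f).
Proof.
move=> xT; elim=> [|a f' g' Gf' Hg' IH]; first by rewrite fD0; apply: ideal0.
rewrite fDD fDM; apply: idealD => //; apply: idealD; first exact/idealM/ideal_gen.
apply: idealM; case: Gf' => [h Hh|i|i].
- by apply/Y_I1/D_I0_Y => //; apply: ideal_gen.
- case: x xT {IH} => [j||j||] xT; last (by case: xT);
  by [apply: D_cc_E | apply: I1_cc_Eb | apply: D_cc_K | apply: D_cc_Kb].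
- case: x xT {IH} => [j||j||] xT; last (by case: xT);
  by [apply: D_ccb_E | apply: D_ccb_Eb | apply: D_ccb_K | apply: D_ccb_Kb].
Qed.

(* The ideal generated by the 1-jet of Z modulo its vanishing components is
   stable under all derivations: Z solves a closed linear system. *)
Theorem symmetry_closed x f : I1 f -> I1 (D x f).
Proof.
case: x => [i||i||]; try by apply: D_I1_hor.
(* The remaining direction [T] is reached through [[E_i, conj E_j]], whose [T] component is a unit
   for a suitable pair. *)
move=> If; have [i [j h0]] := hm_neq0.
apply: (@idealMl_unit _ _ (Hm i j)); first by apply: ev_unit; rewrite -hmE.
have := fD_comm F (fE i) (fEb j) f; rewrite /sumF.
set s1 := \sum_ _ _; set s2 := \sum_ _ _; set X := c _ _ fK * _; set Y := c _ _ fKb * _ => e.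
rewrite [X in I1 X](_ : _ = D (fE i) (D (fEb j) f) - D (fEb j) (D (fE i) f)
   - s1 - X - s2 - Y); last by rewrite e !mxE; ring.
have HH x : x <> fT -> I1 (D x f) by move=> xT; apply: D_I1_hor.
have H2 x y : x <> fT -> y <> fT -> I1 (D x (D y f)).
  by move=> xT yT; do 2 apply: D_I1_hor => //.
rewrite /X /Y; iauto ltac:(solve [by apply: HH | by apply: H2]).
Qed.

Section AtPoint.
Hypothesis z0 : forall x, ev (z x) = 0.
Definition bv : 'M[C]_q := \matrix_(i, k) ev (b i k).
Definition ccv : 'cV[C]_q := \col_i ev (cc i).

Lemma ev_actZ f : ev (actZ z f) = 0.
Proof.
rewrite /actZ /sumF !rmorphD !rmorph_sum /= !rmorphM /= !z0 !mul0r.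
by rewrite !big1 ?addr0 // => i _; rewrite rmorphM /= z0 mul0r.
Qed.

Lemma ev_bb i k : ev (bb i k) = (bv i k)^*.
Proof. by rewrite mxE -ev_cj sm_cj. Qed.

Lemma isotropy_h : bv *m hm + hm *m (conjm bv)^T = ev g *: hm.
Proof.
apply/matrixP => i j; move: (identA i j) (ev_actZ (Hm i j)); move: (actZ _ _) => W /(congr1 ev) + eW.
rewrite !rmorphD /= eW addr0 !rmorph_sum rmorphM /= => e.
rewrite [RHS]mxE hmE -e !mxE; congr (_ + _); apply: eq_bigr => k _; rewrite rmorphM /=.
  by rewrite !mxE.
by rewrite ev_bb !mxE mulrC.
Qed.

Lemma isotropy_al : alm *m bv - conjm bv *m alm = ev kap *: alm.
Proof.
apply/matrixP => j k; move: (identB j k) (ev_actZ (ALm j k)); move: (actZ _ _) => W /(congr1 ev) + eW.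
rewrite rmorphD rmorphB rmorphB rmorphM /= eW addr0 rmorph0 !rmorph_sum /=.
move=> /eqP; rewrite subr_eq0 => /eqP e; rewrite [RHS]mxE almE -e !mxE.
congr (_ - _); apply: eq_bigr => i _; rewrite rmorphM /=.
  by rewrite !mxE.
by rewrite ev_bb !mxE.
Qed.

Lemma ev_DK_b i k : ev (D fK (b i k)) = 0.
Proof.
have := s_jacobi Z (fE i) fK (fE k); simpA => e.
rewrite -[D _ _]opprK e; apply: (@ideal_ev0 _ _ ev (fun f => ev f = 0)) => //.
iauto ltac:(apply: ideal_gen; solve [apply: ev_actZ | by rewrite ev_norm]).
Qed.

Lemma ev_DK_bb i k : ev (D fK (bb i k)) = 0.
Proof.
have := s_jacobi Z (fEb i) fK (fEb k); simpA => e.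
rewrite -[D _ _]opprK e; apply: (@ideal_ev0 _ _ ev (fun f => ev f = 0)) => //.
iauto ltac:(apply: ideal_gen; solve [apply: ev_actZ | by rewrite ev_norm]).
Qed.

Inductive genz : A -> Prop := genz_z x : genz (z x).
(** Sharper than [D_actZ]: since [[Z, K]] is [kap K], the ideal of the components of Z alone
    suffices. *)
Lemma D_actZ_K f : ideal genz (D fK (actZ z f) + kap * D fK f).
Proof.
have -> : kap * D fK f = sumF (fun x => m fK x * D x f) by simpA.
rewrite /actZ fD_sumF -sumF_ringD.
have : forall y, ideal genz (D fK (z y * D y f) + m fK y * D y f).
  move=> y; rewrite fDM sz_D.
  rewrite [X in ideal genz X](_ : _ = sumF (fun b' => z b' * c b' fK y) * D y f
     + z y * D fK (D y f)); last by rewrite /sumF; ring.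
  by rewrite /sumF; iauto noleaf.
by move=> H; rewrite /sumF; iauto ltac:(apply: H).
Qed.

Lemma ev_DK_actZ f : ev (D fK (actZ z f)) = - (ev kap * ev (D fK f)).
Proof.
apply/eqP; rewrite -addr_eq0 -rmorphM -rmorphD; apply/eqP.
by apply: ideal_ev0 (D_actZ_K f) => _ [x].
Qed.

(** For [b = x Id] with [x] imaginary, [isotropy_al] gives [kap = 2 x]. Differentiating [identB]
    along [K] then makes [- 2 x] times the derivative of [al] a multiple of [al]. *)
Lemma isotropy_rotation x : bv = x%:M -> x^* = - x -> x != 0 -> exists t, Qm = t *: S.
Proof.
move=> bx xi x0; have := isotropy_al.
have cb : conjm bv = (- x)%:M by rewrite bx map_scalar_mx /= xi.
rewrite cb bx mul_mx_scalar mul_scalar_mx scaleNr opprK -scalerDl.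
have [j [k a0]] := alm_neq0 => /matrixP/(_ j k) e.
have kx : ev kap = x + x by apply: (mulIf a0); move: e; rewrite !mxE => <-.
suff e2 : exists t, Km = t *: alm.
  have [t e3] := e2; exists (- t); rewrite QmE e3 -scalemxAl scaleNr //.
have H : forall j k, - (x + x) * Km j k = ev (D fK kap) * alm j k.
  move=> j' k'; have := congr1 ev (D_identB fK j' k').
  have := ev_DK_actZ (ALm j' k'); move: (D fK (actZ _ _)) => W eW.
  rewrite !(rmorphD, rmorphB, rmorphN) /= !rmorphM eW rmorph0 !rmorph_sum /=.
  have -> : \sum_i ev (D fK (ALm j' i) * b i k') = x * Km j' k'.
    rewrite (bigD1 k') //= big1 ?addr0.
      rewrite rmorphM /= mulrC; have := congr1 (fun M : 'M[C]_q => M k' k') bx.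
      by rewrite !mxE eqxx mulr1n => ->.
    move=> i /negPf ik; rewrite rmorphM /=.
    have := congr1 (fun M : 'M[C]_q => M i k') bx.
    by rewrite !mxE ik => ->; rewrite mulr0.
  have -> : \sum_i ev (bb j' i * D fK (ALm i k')) = - x * Km j' k'.
    rewrite (bigD1 j') //= big1 ?addr0.
      by rewrite rmorphM /= ev_bb -xi bx !mxE eqxx mulr1n.
    move=> i /negPf ik; rewrite rmorphM /= ev_bb bx !mxE eq_sym ik.
    by rewrite conjC0 mul0r.
  rewrite !big1; [|by move=> i _; rewrite rmorphM /= ?ev_DK_b ?ev_DK_bb ?mul0r ?mulr0..].
  rewrite kx => e3; apply/eqP; rewrite -subr_eq0 -[X in _ == X]e3; apply/eqP.
  rewrite almE /Km !mxE; ring.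
have xx0 : - (x + x) != 0 by rewrite oppr_eq0 -mulr2n mulrn_eq0.
exists ((- (x + x))^-1 * ev (D fK kap)); apply/matrixP => j' k'.
by rewrite [RHS]mxE -mulrA -H mulKf.
Qed.

Section ZeroIsotropy.
Hypothesis bv0 : bv = 0.

Lemma gen0_ev f : gen0 f -> ev f = 0.
Proof.
case=> [x|i k|i k]; rewrite ?z0 //.
  by have := congr1 (fun M : 'M[C]_q => M i k) bv0; rewrite !mxE.
by rewrite ev_bb bv0 mxE conjC0.
Qed.

Lemma ev_I0 f : I0 f -> ev f = 0.
Proof. exact: ideal_ev0 gen0_ev. Qed.

Lemma ev_semilinear : semilinear ev Y1 ev.
Proof. by split=> [f f' _ _|a f _]; rewrite ?rmorphD ?rmorphM. Qed.

Let p := conjm ccv.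

Lemma ev_pv : pv ev = p.
Proof. by apply/matrixP => i j; rewrite !mxE -ev_cj sm_cj. Qed.

Lemma lowered_p : lowered hm p = invmx hm *m ccv.
Proof. by rewrite /lowered conjmK. Qed.

Section Tangent.
Variable k : 'cV[C]_q.
Hypothesis pk : dot p k = 0.
(** Along this direction Z vanishes to second order: the derivative of its [conj K] component is
    [- p.k], which is 0 by assumption, and those of the other components vanish since [b = 0]. *)
Definition pder f := \sum_j k j 0 * ev (D (fEb j) f).

Lemma pderD f f' : pder (f + f') = pder f + pder f'.
Proof. by rewrite -big_split; apply: eq_bigr => j _; rewrite fDD rmorphD mulrDr. Qed.
Lemma pderM f f' : pder (f * f') = ev f * pder f' + ev f' * pder f.
Proof.
rewrite /pder !mulr_sumr -big_split; apply: eq_bigr => j _.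
rewrite fDM rmorphD !rmorphM /=; ring.
Qed.
Lemma pderN f : pder (- f) = - pder f.
Proof. by rewrite /pder -sumrN; apply: eq_bigr => j _; rewrite fDN rmorphN mulrN. Qed.
Lemma pder0 : pder 0 = 0.
Proof. by rewrite /pder big1 // => j _; rewrite fD0 rmorph0 mulr0. Qed.
Lemma pder_sum (G : 'I_q -> A) : pder (\sum_i G i) = \sum_i pder (G i).
Proof. by apply: (big_morph pder pderD pder0). Qed.

Definition null f := ev f = 0 /\ pder f = 0.
Lemma nullD f f' : null f -> null f' -> null (f + f').
Proof. by move=> [e1 e2] [e3 e4]; rewrite /null rmorphD pderD e1 e2 e3 e4 !addr0. Qed.
Lemma null_ideal f : ideal null f -> null f.
Proof.
elim=> [|a f' g' [e1 e2] _ IH]; first by split; rewrite ?rmorph0 ?pder0.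
by apply: nullD => //; split; rewrite ?rmorphM ?pderM /= e1 ?e2 ?mulr0 ?mul0r ?addr0.
Qed.
Lemma null_mul f f' : ev f = 0 -> ev f' = 0 -> null (f * f').
Proof. by move=> e1 e2; rewrite /null rmorphM pderM e1 e2 !mul0r addr0. Qed.

Lemma null_z x : null (z x).
Proof.
split; first exact: z0.
have e j : ev (D (fEb j) (z x)) = - ev (m (fEb j) x).
  rewrite sz_D rmorphB /=.
  rewrite (_ : ev (sumF _) = 0) ?sub0r // /sumF !rmorphD !rmorph_sum /= !rmorphM /= !z0 !mul0r.
  by rewrite !big1 ?addr0 // => i _; rewrite rmorphM /= z0 mul0r.
rewrite /pder; case: x e => [i||i||] e; try by rewrite big1 // => j _; rewrite e mzero rmorph0 oppr0 mulr0.
  rewrite big1 // => j _; rewrite e (gen0_ev (gen0_bb _ _)) ?oppr0 ?mulr0 //.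
transitivity (- dot p k); last by rewrite pk oppr0.
rewrite /dot mxE -sumrN; apply: eq_bigr => j _.
by rewrite e -ev_pv !mxE mulrN mulrC.
Qed.

Lemma null_actZ f : null (actZ z f).
Proof.
apply: null_ideal; rewrite /actZ /sumF.
iauto ltac:(apply: ideal_gen; apply: null_z).
Qed.

Lemma ev_kap0 : ev kap = 0. Proof. exact/ev_I0/I0_kap. Qed.

Lemma null_DK_b i j : null (D fK (b i j)).
Proof.
have := s_jacobi Z (fE i) fK (fE j); simpA => e.
rewrite -[D _ _]opprK e; apply: null_ideal.
iauto ltac:(apply: ideal_gen; solve [apply: null_actZ
  | apply: null_mul; rewrite ?ev_norm ?ev_kap0 // gen0_ev //; constructor]).
Qed.
Lemma null_DK_bb i j : null (D fK (bb i j)).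
Proof.
have := s_jacobi Z (fEb i) fK (fEb j); simpA => e.
rewrite -[D _ _]opprK e; apply: null_ideal.
iauto ltac:(apply: ideal_gen; solve [apply: null_actZ
  | apply: null_mul; rewrite ?ev_norm ?ev_kap0 // gen0_ev //; constructor]).
Qed.

Lemma pder_DK_actZ f : pder (D fK (actZ z f)) = - (pder kap * ev (D fK f)).
Proof.
have : null (D fK (actZ z f) + kap * D fK f).
  apply: null_ideal; apply: ideal_sub (D_actZ_K f) => _ [x].
  by apply: ideal_gen; apply: null_z.
move=> [_]; rewrite pderD pderM ev_kap0 mul0r add0r => /eqP.
by rewrite addr_eq0 => /eqP ->; rewrite mulrC.
Qed.

Lemma ev_DK_kap : ev (D fK kap) = 0.
Proof.
apply: ev_I0; suff H f : I0 f -> I0 (D fK f) by apply/H/I0_kap.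
elim=> [|a f' g' Gf' Hg' IH]; first by rewrite fD0; apply: ideal0.
rewrite fDD fDM; apply: idealD => //; apply: idealD; first exact/idealM/ideal_gen.
apply: idealM; case: Gf' => [y|i j|i j]; [|exact: D_b_K|exact: D_bb_K].
rewrite sz_D; apply: idealB; first by rewrite /sumF; iauto leaf0.
by case: y => [i||i||]; rewrite ?mzero; [apply: ideal0|apply: I0_kap|apply: ideal0..].
Qed.

Definition pb : 'M[C]_q := \matrix_(i, j) pder (b i j).
Definition pbb : 'M[C]_q := \matrix_(i, j) pder (bb i j).

(** Differentiate [identB] along [K], then along [k]. The terms in Z, in [D_K b] and in [D_K conj b]
    are null to first order in this direction; what survives couples the derivative of [al] along
    [K] with the derivatives of [b] and [conj b] along [k]. *)
Lemma tangent_relation : exists t, Km *m pb - pbb *m Km = t *: alm + (pder kap *+ 2) *: Km.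
Proof.
exists (pder (D fK kap)); apply/matrixP => i j.
have := congr1 pder (D_identB fK i j).
have := pder_DK_actZ (ALm i j); move: (D fK (actZ _ _)) => W eW.
rewrite !(pderD, pderN) eW !pder_sum pder0 !pderM ev_DK_kap ev_kap0.
have -> : \sum_x pder (D fK (ALm i x) * b x j) = (Km *m pb) i j.
  rewrite mxE; apply: eq_bigr => x _; rewrite pderM (gen0_ev (gen0_b _ _)) mul0r addr0.
  by rewrite !mxE.
have -> : \sum_x pder (bb i x * D fK (ALm x j)) = (pbb *m Km) i j.
  rewrite mxE; apply: eq_bigr => x _; rewrite pderM (gen0_ev (gen0_bb _ _)) mul0r add0r.
  by rewrite mulrC !mxE.
have H1 x y : ev (D fK (b x y)) = 0 := (null_DK_b x y).1.
have H2 x y : ev (D fK (bb x y)) = 0 := (null_DK_bb x y).1.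
have -> : \sum_x pder (ALm i x * D fK (b x j)) = 0.
  by apply: big1 => x _; rewrite pderM H1 (null_DK_b _ _).2 mulr0 mul0r addr0.
have -> : \sum_x pder (D fK (bb i x) * ALm x j) = 0.
  by apply: big1 => x _; rewrite pderM H2 (null_DK_bb _ _).2 mulr0 mul0r addr0.
rewrite [(Km *m pb - pbb *m Km) i j]mxE [(- (pbb *m Km)) i j]mxE => e.
rewrite [RHS]mxE [X in _ = X + _]mxE [X in _ = _ + X]mxE almE.
apply/eqP; rewrite -subr_eq0 -[X in _ == X]e; apply/eqP.
rewrite [Km i j]mxE; ring.
Qed.

End Tangent.

(** The first equation is [first_order_E2] for [s = ev]; the second is [tangent_relation] rewritten
    by [commutator_sym] with [X = Km]. *)
Lemma isotropy_exceptional : exceptional hm alm Qm p.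
Proof.
have sE := ev_semilinear; have eI0 := ev_I0.
split=> [v|k pk].
  by have := first_order_E2 sE eI0 v; rewrite ev_pv lowered_p.
have [t e] := tangent_relation pk; exists (- t).
rewrite lowered_p; set nn := invmx hm *m ccv.
have pbE : pb k = \sum_j k j 0 *: Bb ev j.
  by apply/matrixP => i j; rewrite mxE summxE; apply: eq_bigr => x _; rewrite !mxE.
have pbbE : pbb k = \sum_j k j 0 *: BBb ev j.
  by apply/matrixP => i j; rewrite mxE summxE; apply: eq_bigr => x _; rewrite !mxE.
pose sk := dot (S *m nn) k.
(* In [D_kap_Eb] the term carried by [ccb] sums to a multiple of [p.k] and disappears. *)
have dkap : pder k kap = - sk.
  have := fun j => s_eq sE eI0 (D_kap_Eb j) => H.
  rewrite /pder /sk /dot [X in _ = - X]mxE.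
  transitivity (\sum_j k j 0 * (- (S *m nn) j 0 + p j 0 * ev (c fK fKb fK))).
    apply: eq_bigr => j _; rewrite H; last first.
      by apply: idealD; [apply/idealN/ideal_sum => x _; apply/idealM/Y_cc | apply/idealMr/Y_ccb].
    rewrite rmorphD rmorphN rmorphM rmorph_sum /= -ev_pv /nn; congr (_ * (- _ + _)).
      rewrite /S mulmxA -(mulmxA alm) mulmxV ?hm_unit // mulmx1 mxE.
      by apply: eq_bigr => x _; rewrite rmorphM !mxE.
    by rewrite !mxE.
  under eq_bigr do rewrite mulrDr mulrN mulrA.
  rewrite big_split /= sumrN -mulr_suml.
  have -> : \sum_i k i 0 * p i 0 = 0.
    by rewrite -[RHS]pk /dot [RHS]mxE; apply: eq_bigr => x _; rewrite [p^T _ _]mxE mulrC.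
  by rewrite mul0r addr0; congr (- _); apply: eq_bigr => x _; rewrite [(S *m nn)^T _ _]mxE mulrC.
have lvE : hm^T *m lv ev = S *m nn.
  rewrite (first_order_lv sE eI0) /nn /S mulmxA -(mulmxA alm) mulmxV ?hm_unit // mulmx1.
  by congr (_ *m _); apply/matrixP => i j; rewrite !mxE.
have symK : (Km *m hm)^T = Km *m hm by have := symQ; rewrite QmE linearN /= => /oppr_inj.
have com j := commutator_sym sE eI0 j symK.
have KE : Km *m hm = - Qm by rewrite QmE opprK.
have KcE : Km *m cv ev = - (Qm *m nn).
  rewrite -mulNmx -KE /nn mulmxA -(mulmxA Km) mulmxV ?hm_unit // mulmx1.
  by congr (_ *m _); apply/matrixP => i j; rewrite !mxE.
have e1 : (Km *m pb k - pbb k *m Km) *m hm =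
    - sprod (Qm *m nn) (S *m k) + sprod (Qm *m k) (S *m nn) + sk *: Qm.
  have kE M : M *m k = \sum_j k j 0 *: (M *m delta_mx j 0 : 'cV[C]_q).
    rewrite {1}[k]matrix_sum_delta mulmx_sumr; apply: eq_bigr => j _.
    by rewrite big_ord1 scalemxAr.
  have -> : (Km *m pb k - pbb k *m Km) *m hm
      = \sum_j k j 0 *: ((Km *m Bb ev j - BBb ev j *m Km) *m hm).
    rewrite pbE pbbE mulmx_sumr mulmx_suml -sumrB mulmx_suml; apply: eq_bigr => j _.
    by rewrite -scalemxAr -!scalemxAl -scalerBr -scalemxAl.
  rewrite !kE sprod_sumr [X in _ = _ + X + _]sprodC sprod_sumr /sk.
  have -> : dot (S *m nn) k = \sum_j k j 0 * dot (lv ev) (col j hm).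
    rewrite -lvE /dot mxE; apply: eq_bigr => j _; rewrite mulrC mxE; congr (_ * _).
    rewrite [(hm^T *m _) _ _]mxE mxE; apply: eq_bigr => x _; rewrite !mxE; exact: mulrC.
  rewrite scaler_suml -sumrN -!big_split /=; apply: eq_bigr => j _.
  rewrite com KE lvE KcE (mulNmx Qm (delta_mx j 0)).
  move: (Qm *m nn) (Qm *m delta_mx j 0) (S *m nn) (S *m delta_mx j 0) => u1 u2 u3 u4.
  rewrite !sprodNl !sprodZr (sprodC u2 u3); move: (sprod _ _) (sprod _ _) => U V.
  by apply/matrixP => x y; rewrite !mxE; ring.
move: e1; rewrite e mulmxDl -!scalemxAl KE -/S dkap => e1.
apply/eqP; rewrite -subr_eq0; apply/eqP.
move/eqP: e1; rewrite -subr_eq0 => /eqP e1; rewrite -[RHS]e1 -/sk [sprod (S *m nn) _]sprodC.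
move: (sprod _ _) (sprod _ _) => U V.
by apply/matrixP => i j; rewrite !mxE; ring.
Qed.

End ZeroIsotropy.
End AtPoint.

End Symmetry.
End FrameAlgebra.

(** * Vector fields over a ring with commuting derivations, and moving frames *)

Section SumF.
Variable q : nat.
Implicit Types V : zmodType.
Lemma sumFD V (f g : frame q -> V) : sumF (fun a => f a + g a) = sumF f + sumF g.
Proof.
rewrite /sumF !big_split /=; move: (\sum_i f (fE i)) (\sum_i g (fE i)) => a b.
move: (\sum_i f (fEb i)) (\sum_i g (fEb i)) (f fK) (f fKb) (f fT) (g fK) (g fKb) (g fT).
move=> c d k kb t k' kb' t'.
by rewrite [a + b + _]addrACA [_ + _ + (c + d)]addrACA [_ + _ + (kb + kb')]addrACA [LHS]addrACA.
Qed.
Lemma sumF_morph (V W : zmodType) (h : V -> W) (f : frame q -> V) : (forall x y, h (x + y) = h x + h y) -> h 0 = 0 ->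
  h (sumF f) = sumF (fun a => h (f a)).
Proof. by move=> hD h0; rewrite /sumF !hD !(big_morph h hD h0). Qed.
Lemma sumF0 V : sumF (fun _ : frame q => 0 : V) = 0.
Proof. by rewrite /sumF !big1 // !addr0. Qed.
Lemma sumFN V (f : frame q -> V) : sumF (fun a => - f a) = - sumF f.
Proof. by rewrite [RHS](sumF_morph (h := -%R)) ?oppr0 //; apply: opprD. Qed.
End SumF.

Section VectorFields.
Variables (A : comUnitRingType) (N : nat) (dd : 'I_N -> A -> A).
Hypothesis ddD : forall j f g, dd j (f + g) = dd j f + dd j g.
Hypothesis ddM : forall j f g, dd j (f * g) = dd j f * g + f * dd j g.
Hypothesis dd_comm : forall i j f, dd i (dd j f) = dd j (dd i f).
Local Notation vect := 'rV[A]_N.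
Implicit Types (X Y Z : vect) (f g : A).

Definition actV X f : A := \sum_j X 0 j * dd j f.
Definition br X Y : vect := \row_k (actV X (Y 0 k) - actV Y (X 0 k)).

Lemma dd0 j : dd j 0 = 0.
Proof. by apply: (addrI (dd j 0)); rewrite -ddD !addr0. Qed.
Lemma actVD X f g : actV X (f + g) = actV X f + actV X g.
Proof. by rewrite /actV -big_split; apply: eq_bigr => j _; rewrite ddD mulrDr. Qed.
Lemma actV0 X : actV X 0 = 0.
Proof. by rewrite /actV big1 // => j _; rewrite dd0 mulr0. Qed.
Lemma actVN X f : actV X (- f) = - actV X f.
Proof. by apply/eqP; rewrite -addr_eq0 -actVD addNr actV0. Qed.
Lemma actVB X f g : actV X (f - g) = actV X f - actV X g.
Proof. by rewrite actVD actVN. Qed.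
Lemma actV_sum X I (r : seq I) (P : pred I) (F : I -> A) :
  actV X (\sum_(i <- r | P i) F i) = \sum_(i <- r | P i) actV X (F i).
Proof. by apply: (big_morph (actV X)); [apply: actVD|apply: actV0]. Qed.
Lemma actVM X f g : actV X (f * g) = actV X f * g + f * actV X g.
Proof.
rewrite /actV mulr_suml mulr_sumr -big_split; apply: eq_bigr => j _.
by rewrite ddM mulrDr mulrA mulrCA.
Qed.
Lemma actDV X Y f : actV (X + Y) f = actV X f + actV Y f.
Proof. by rewrite /actV -big_split; apply: eq_bigr => j _; rewrite mxE mulrDl. Qed.
Lemma actZV g X f : actV (g *: X) f = g * actV X f.
Proof. by rewrite /actV mulr_sumr; apply: eq_bigr => j _; rewrite mxE mulrA. Qed.
Lemma act0V f : actV 0 f = 0.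
Proof. by rewrite /actV big1 // => j _; rewrite mxE mul0r. Qed.

Lemma actV_br X Y f : actV X (actV Y f) - actV Y (actV X f) = actV (br X Y) f.
Proof.
have H (X' Y' : vect) : actV X' (actV Y' f) = \sum_j actV X' (Y' 0 j) * dd j f
   + \sum_j \sum_k Y' 0 j * (X' 0 k * dd k (dd j f)).
  rewrite [actV Y' f]/actV actV_sum -big_split; apply: eq_bigr => j _; rewrite actVM mulr_sumr.
  by [].
rewrite !H [X in _ + X - _]exchange_big /= opprD addrACA -sumrB.
rewrite [X in _ + X](_ : _ = 0) ?addr0.
  by apply: eq_bigr => j _; rewrite mxE mulrBl.
apply/eqP; rewrite subr_eq0; apply/eqP; apply: eq_bigr => j _; apply: eq_bigr => k _.
by rewrite dd_comm mulrCA.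
Qed.

Lemma br_anti X Y : br X Y = - br Y X.
Proof. by apply/rowP => k; rewrite !mxE opprB. Qed.
Lemma br_alt X : br X X = 0.
Proof. by apply/rowP => k; rewrite !mxE subrr. Qed.
Lemma brDr X Y Z : br X (Y + Z) = br X Y + br X Z.
Proof. by apply/rowP => k; rewrite !mxE actVD actDV opprD addrACA. Qed.
Lemma br0r X : br X 0 = 0.
Proof. by apply: (addrI (br X 0)); rewrite -brDr !addr0. Qed.
Lemma brZr X f Y : br X (f *: Y) = actV X f *: Y + f *: br X Y.
Proof. by apply/rowP => k; rewrite !mxE actVM actZV mulrBr addrA. Qed.
Lemma br_sumr X I (r : seq I) (F : I -> vect) :
  br X (\sum_(i <- r) F i) = \sum_(i <- r) br X (F i).
Proof. by apply: (big_morph (br X)); [apply: brDr | apply: br0r]. Qed.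

Lemma br_jacobi X Y Z : br X (br Y Z) = br (br X Y) Z + br Y (br X Z).
Proof.
apply/rowP => k; rewrite !mxE !actVB -!actV_br.
ring.
Qed.

Variables (q : nat) (e : frame q -> vect) (W : frame q -> 'cV[A]_N).
Definition co d X : A := (X *m W d) 0 0.
Hypothesis e_co : forall X, X = sumF (fun d => co d X *: e d).
Hypothesis co_e : forall (x : frame q -> A) d, co d (sumF (fun a => x a *: e a)) = x d.

Lemma coD d X Y : co d (X + Y) = co d X + co d Y.
Proof. by rewrite /co mulmxDl mxE. Qed.
Lemma coZ d f X : co d (f *: X) = f * co d X.
Proof. by rewrite /co -scalemxAl mxE. Qed.
Lemma co0 d : co d 0 = 0.
Proof. by rewrite /co mul0mx mxE. Qed.
Lemma coN d X : co d (- X) = - co d X.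
Proof. by rewrite /co mulNmx mxE. Qed.
Lemma co_sumF d (F : frame q -> vect) : co d (sumF F) = sumF (fun a => co d (F a)).
Proof. by apply: sumF_morph; [apply: coD | apply: co0]. Qed.

Definition ec a b d := co d (br (e a) (e b)).
Definition em Z a d := co d (br Z (e a)).

Lemma br_sumF X (x : frame q -> A) d :
  co d (br X (sumF (fun a => x a *: e a))) = actV X (x d) + sumF (fun a => x a * co d (br X (e a))).
Proof.
rewrite (sumF_morph (h := br X)); [|exact: brDr|exact: br0r].
rewrite (eq_sumF (fun a => brZr X (x a) (e a))) sumFD coD co_e co_sumF.
by congr (_ + _); apply: eq_sumF => a; rewrite coZ.
Qed.

Lemma frame_jacobi Z : jacobi_id (fun a => actV (e a)) ec (actV Z) (em Z).
Proof.
move=> a b d.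
have E X Y : co d (br X Y) = actV X (co d Y) + sumF (fun x => co x Y * co d (br X (e x))).
  by rewrite {1}[Y]e_co br_sumF.
have := congr1 (co d) (br_jacobi Z (e a) (e b)); rewrite coD.
rewrite (E Z (br _ _)) (E (e a) (br Z _)) [br (br Z (e a)) _]br_anti coN (E (e b)).
have <- : - sumF (fun e0 => em Z a e0 * ec e0 b d) = sumF (fun e0 => em Z a e0 * co d (br (e b) (e e0))).
  by rewrite -sumFN; apply: eq_sumF => x; rewrite /ec br_anti coN mulrN opprK.
rewrite -/(ec a b d) -/(em Z a d) -/(em Z b d).
rewrite -[sumF (fun x => _ * co d (br Z _))]/(sumF (fun e0 => ec a b e0 * em Z e0 d)).
rewrite -[sumF (fun x => _ * co d (br (e a) _))]/(sumF (fun e0 => em Z b e0 * ec a e0 d)) => ->.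
have alg (x y z t : A) : y - x = - (x - t) + (y + z) - t - z by ring.
exact: alg.
Qed.

Lemma actV_co Z f : actV Z f = sumF (fun a => co a Z * actV (e a) f).
Proof.
rewrite {1}[Z]e_co (sumF_morph (h := actV^~ f)) /=; [|by move=> *; rewrite actDV|exact: act0V].
by apply: eq_sumF => a; rewrite actZV.
Qed.

Lemma co_deriv Z a d : actV (e a) (co d Z) = sumF (fun b => co b Z * ec b a d) - em Z a d.
Proof.
rewrite /em br_anti coN [X in br (e a) X]e_co br_sumF opprK.
rewrite (eq_sumF (g := fun b => - (co b Z * co d (br (e a) (e b))))); last first.
  by move=> b; rewrite /ec br_anti coN mulrN.
by rewrite sumFN addrC addrK.
Qed.

Variables (cj : {rmorphism A -> A}).
Hypothesis dd_cj : forall j f, cj (dd j f) = dd j (cj f).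
Hypothesis e_cj : forall a, map_mx cj (e a) = e (bar a).

Lemma barK : involutive (@bar q). Proof. by case. Qed.

Lemma actV_cj X f : cj (actV X f) = actV (map_mx cj X) (cj f).
Proof. by rewrite /actV rmorph_sum; apply: eq_bigr => j _; rewrite rmorphM mxE dd_cj. Qed.
Lemma br_cj X Y : map_mx cj (br X Y) = br (map_mx cj X) (map_mx cj Y).
Proof. by apply/rowP => k; rewrite !mxE rmorphB !actV_cj. Qed.
Lemma co_cj d X : cj (co d X) = co (bar d) (map_mx cj X).
Proof.
rewrite {2}[X]e_co (sumF_morph (h := map_mx cj)); [|exact: map_mxD|exact: map_mx0].
rewrite (eq_sumF (g := fun a => cj (co (bar (bar a)) X) *: e (bar a))); last first.
  by move=> a; rewrite map_mxZ e_cj barK.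
by rewrite (sumF_bar (fun a => cj (co (bar a) X) *: e a)) co_e barK.
Qed.
Lemma ec_cj a b d : cj (ec a b d) = ec (bar a) (bar b) (bar d).
Proof. by rewrite /ec co_cj br_cj !e_cj. Qed.

Section Build.
Variables (C : numClosedFieldType) (ev : {rmorphism A -> C}).
Hypothesis H_EE : forall i j, [/\ forall k, ec (fE i) (fE j) (fEb k) = 0,
    ec (fE i) (fE j) fKb = 0 & ec (fE i) (fE j) fT = 0].
Hypothesis H_EK : forall i, [/\ forall k, ec (fE i) fK (fEb k) = 0,
    ec (fE i) fK fKb = 0 & ec (fE i) fK fT = 0].
Hypothesis H_KEb : forall j, ec fK (fEb j) fT = 0.
Hypothesis H_KKb : ec fK fKb fT = 0.
Hypothesis H_norm : forall i k, ev (ec fK (fE i) (fE k)) = 0 /\ ev (ec fKb (fE i) (fE k)) = 0.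
Hypothesis H_unit : (\matrix_(i, j) ev (ec (fE i) (fEb j) fT)) \in unitmx.

Definition build_frame : cr_frame ev cj q.
Proof.
refine (@CrFrame C A ev cj q (fun a => actV (e a)) ec _ _ _ _ _ _ _ _ H_EE H_EK H_KEb H_KKb H_norm H_unit).
- by move=> a f g; apply: actVD.
- by move=> a f g; apply: actVM.
- by move=> a f; rewrite actV_cj e_cj.
- by move=> a b f; rewrite actV_br actV_co.
- by move=> a d; rewrite /ec br_alt co0.
- by move=> a b d; rewrite /ec br_anti coN.
- by move=> a b d; apply: ec_cj.
- by move=> x; apply: frame_jacobi.
Defined.

Variable Z : vect.
Hypothesis Z_cj : map_mx cj Z = Z.
Hypothesis Z_E : forall i, [/\ forall k, em Z (fE i) (fEb k) = 0,
    em Z (fE i) fKb = 0 & em Z (fE i) fT = 0].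
Hypothesis Z_K : [/\ forall k, em Z fK (fEb k) = 0, em Z fK fKb = 0 & em Z fK fT = 0].

Definition build_symmetry : cr_symmetry build_frame.
Proof.
refine (@CrSymmetry C A ev cj q build_frame (fun a => co a Z) (em Z) _ _ _ _ Z_E Z_K).
- by move=> a; rewrite co_cj Z_cj.
- by move=> a d; rewrite /em co_cj br_cj Z_cj e_cj.
- move=> a b d; rewrite [LHS]frame_jacobi; congr (_ + _ - _ - _); exact: actV_co.
- exact: co_deriv.
Defined.
End Build.
End VectorFields.

(** * Smooth functions of real variables *)

Section Smooth.
Variables (R : realType) (N : nat).
Local Notation T := 'rV[R]_N.
Local Notation "'d_ j f" := (fun x => 'D_(delta_mx 0 j) f x) (at level 10, j at level 8, f at level 8).
Implicit Types (U : set T) (f g : T -> R).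

Lemma Ck_cont k U f : Ck k U f -> forall x, U x -> {for x, continuous f}.
Proof. by case: k => [|k] []. Qed.

Lemma CkS k U f : Ck k.+1 U f -> Ck k U f.
Proof.
elim: k f => [|k IH] f [cf df]; split => // j.
by have [d1 d2] := df j; split => //; apply: IH.
Qed.

Lemma Ck_sub k U V f : V `<=` U -> Ck k U f -> Ck k V f.
Proof.
move=> VU; elim: k f => [|k IH] f [cf df]; split=> //; try by move=> x /VU; apply: cf.
by move=> j; have [d1 d2] := df j; split=> [x /VU|]; [apply: d1 | apply: IH].
Qed.

Lemma cont_ext U f g : open U -> (forall x, U x -> f x = g x) ->
  (forall x, U x -> {for x, continuous f}) -> forall x, U x -> {for x, continuous g}.
Proof.
move=> oU fg cf x Ux; rewrite /prop_for /continuous_at -fg //.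
have nfg : {near x, f =1 g}.
  by near do apply: fg; apply: open_nbhs_nbhs; split.
by apply: cvg_trans (cf x Ux); apply: near_eq_cvg nfg.
Unshelve. all: by end_near.
Qed.

Lemma Ck_ext k U f g : open U -> (forall x, U x -> f x = g x) -> Ck k U f -> Ck k U g.
Proof.
move=> oU; elim: k f g => [|k IH] f g fg [cf df].
  by split=> //; apply: cont_ext cf.
have nfg x : U x -> {near x, f =1 g}.
  by move=> Ux; apply: filterS (open_nbhs_nbhs (conj oU Ux)) => y; apply: fg.
split; first exact: cont_ext cf.
move=> j; have [d1 d2] := df j; split=> [x Ux|].
  by apply: near_eq_derivable (nfg x Ux) _; apply: d1.
by apply: IH d2 => x Ux; apply: near_eq_derive; apply: nfg.
Qed.

Lemma Ck_cst k U (a : R) : Ck k U (fun=> a).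
Proof.
elim: k a => [|k IH] a; split => //; try (by move=> x _; apply: cst_continuous).
move=> j; split=> [x _|]; first exact: derivable_cst.
suff e0 : (fun x : T => 'D_(delta_mx 0 j) (fun=> a) x) = fun=> 0 by rewrite e0; apply: IH.
by apply/funext => x; exact: derive_cst.
Qed.

Lemma Ck_D k U f g : open U -> Ck k U f -> Ck k U g -> Ck k U (fun x => f x + g x).
Proof.
move=> oU; elim: k f g => [|k IH] f g [cf df] [cg dg]; split=> //.
- by move=> x Ux; apply: (cvgD (cf x Ux) (cg x Ux)).
- by move=> x Ux; apply: (cvgD (cf x Ux) (cg x Ux)).
move=> j; have [d1 d2] := df j; have [e1 e2] := dg j; split=> [x Ux|].
  by apply: derivableD; [apply: d1 | apply: e1].
apply: Ck_ext (IH _ _ d2 e2) => // x Ux.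
by rewrite -[RHS]/('D__ (f + g) x) deriveD //; [apply: d1 | apply: e1].
Qed.

Lemma Ck_M k U f g : open U -> Ck k U f -> Ck k U g -> Ck k U (fun x => f x * g x).
Proof.
move=> oU; elim: k f g => [|k IH] f g Cf Cg; have [cf df] := Cf; have [cg dg] := Cg; split=> //.
- by move=> x Ux; apply: (cvgM (cf x Ux) (cg x Ux)).
- by move=> x Ux; apply: (cvgM (cf x Ux) (cg x Ux)).
move=> j; have [d1 d2] := df j; have [e1 e2] := dg j; split=> [x Ux|].
  by apply: derivableM; [apply: d1 | apply: e1].
apply: Ck_ext (Ck_D oU (IH _ _ (CkS Cf) e2) (IH _ _ (CkS Cg) d2)) => // x Ux.
by rewrite -[RHS]/('D__ (f * g) x) deriveM //; [apply: d1 | apply: e1].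
Qed.

Lemma Ck_V k U f : open U -> (forall x, U x -> f x != 0) -> Ck k U f ->
  Ck k U (fun x => (f x)^-1).
Proof.
move=> oU nf; elim: k => [|k IH] Cf; have [cf df] := Cf; split=> //.
- by move=> x Ux; apply: (cvgV (nf x Ux) (cf x Ux)).
- by move=> x Ux; apply: (cvgV (nf x Ux) (cf x Ux)).
move=> j; have [d1 d2] := df j; split=> [x Ux|].
  by apply: derivableV; [apply: nf | apply: d1].
have CV := IH (CkS Cf).
apply: Ck_ext (Ck_M oU (Ck_cst k U (-1)) (Ck_M oU (Ck_M oU CV CV) d2)) => // x Ux.
rewrite deriveV; [|exact: nf|exact: d1].
by rewrite /GRing.scale/= mulN1r -exprVn expr2 mulNr.
Qed.

Lemma derive_coord (i j : 'I_N) (x : T) :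
  is_derive x (delta_mx 0 j : T) (fun y : T => y 0 i) ((delta_mx 0 j : T) 0 i).
Proof.
have di : derivable (id : T -> T) x (delta_mx 0 j) by apply: derivable_id.
split; first by move/derivable_mxP: di; apply.
by rewrite -[in RHS](derive_id x (delta_mx 0 j)) (derive_mx di) mxE.
Qed.

Lemma Ck_coord k U (i : 'I_N) : Ck k U (fun y : T => y 0 i).
Proof.
case: k => [|k]; split => //; try by move=> x _; apply: coord_continuous.
move=> j; split=> [x _|].
  by have [] := derive_coord i j x.
rewrite (_ : (fun x => _) = fun=> (delta_mx 0 j : T) 0 i); first exact: Ck_cst.
by apply/funext => x; have [] := derive_coord i j x.
Qed.

Lemma derive_line f (j : 'I_N) x (h : R) :
  derivable f (h *: delta_mx 0 j + x) (delta_mx 0 j) ->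
  is_derive h 1 (fun t : R => f (t *: delta_mx 0 j + x)) ('D_(delta_mx 0 j) f (h *: delta_mx 0 j + x)).
Proof.
set v := delta_mx 0 j => df.
have e : (fun t : R => t^-1 *: (f ((t *: 1 + h) *: v + x) - f (h *: v + x)))
   = (fun t => t^-1 *: (f (t *: v + (h *: v + x)) - f (h *: v + x))).
  by apply/funext => t; rewrite [t *: 1]mulr1 scalerDl addrA.
by split; rewrite /derivable /derive /= e.
Qed.

Lemma MVT_line U f (j : 'I_N) x (a : R) : 0 <= a ->
  (forall t, 0 <= t <= a -> U (t *: delta_mx 0 j + x)) -> Ck 1 U f ->
  exists2 t, 0 <= t <= a & f (a *: delta_mx 0 j + x) - f x = 'D_(delta_mx 0 j) f (t *: delta_mx 0 j + x) * a.
Proof.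
move=> a0 aU [cf df]; have [d1 _] := df j.
have [t||c] := @MVT_segment R (fun t => f (t *: delta_mx 0 j + x))
   (fun t => 'D_(delta_mx 0 j) f (t *: delta_mx 0 j + x)) 0 a a0.
- rewrite in_itv /= => /andP[t0 ta]; apply: derive_line.
  by apply: d1; apply: aU; rewrite !ltW.
- apply: derivable_within_continuous => t; rewrite in_itv /= => ta.
  by have [] := @derive_line f j x t (d1 _ (aU _ ta)).
by rewrite in_itv /= scale0r add0r subr0 => ca ->; exists c.
Qed.

(** Boxes are used rather than balls because the mean value arguments move one coordinate at a
    time. *)
Lemma box_sub (U : set T) (x : T) : nbhs x U ->
  exists2 r : R, 0 < r & forall y : T, (forall j, `|y 0 j - x 0 j| <= r) -> U y.
Proof.
move=> /nbhs_ballP[e /= e0 He].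
exists (e / 2) => [|y Hy]; first by rewrite divr_gt0.
apply: He; rewrite -ball_normE /= -[X in _ < X]/(e); apply: le_lt_trans (_ : e / 2 < e); last first.
  by rewrite ltr_pdivrMr // ltr_pMr // ltr1n.
rewrite [leLHS]mx_normrE; apply/bigmax_leP; split=> [|[a b] _]; first by rewrite divr_ge0 // ltW.
by rewrite !mxE ord1 distrC.
Qed.

(** The second difference over a square of side [r] does not change when [i] and [j] are exchanged;
    writing it as either mixed derivative at a nearby point is what proves [schwarz]. *)
Lemma double_MVT U f (i j : 'I_N) (x : T) (r : R) : 0 < r ->
  (forall y : T, (forall k, `|y 0 k - x 0 k| <= r + r) -> U y) -> Ck 2 U f -> 
  exists2 y : T, (forall k, `|y 0 k - x 0 k| <= r + r) &
  f (r *: delta_mx 0 j + (r *: delta_mx 0 i + x)) - f (r *: delta_mx 0 j + x)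
   - f (r *: delta_mx 0 i + x) + f x
   = 'd_ j ('d_ i f) y * r ^+ 2.
Proof.
move=> r0 rU Cf.
have box s t k : 0 <= s <= r -> 0 <= t <= r ->
   `|(s *: delta_mx 0 j + (t *: delta_mx 0 i + x) : T) 0 k - x 0 k| <= r + r.
  move=> /andP[s0 sr] /andP[t0 tr]; rewrite !mxE eqxx /= addrA addrK.
  have b (u : R) (B : bool) : 0 <= u <= r -> `|u * B%:R| <= r.
    by move=> /andP[u0 ur]; case: B; rewrite ?mulr1 ?mulr0 ?normr0 ?ger0_norm // ltW.
  by apply: le_trans (ler_normD _ _) _; apply: lerD; apply: b; apply/andP.
have [cf df] := Cf; have [d1 d2] := df i.
have Ub s t : 0 <= s <= r -> 0 <= t <= r -> U (s *: delta_mx 0 j + (t *: delta_mx 0 i + x)).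
  by move=> hs ht; apply: rU => k; apply: box.
have r0' : (0 : R) <= 0 <= r by rewrite lexx ltW.
have rr' : 0 <= r <= r by rewrite lexx ltW.
have swp t : t *: delta_mx 0 i + (r *: delta_mx 0 j + x) = r *: delta_mx 0 j + (t *: delta_mx 0 i + x).
  by rewrite addrCA.
have D1 t : 0 <= t <= r -> is_derive t 1 (fun t => f (t *: delta_mx 0 i + (r *: delta_mx 0 j + x)) - f (t *: delta_mx 0 i + x))
   ('d_ i f (t *: delta_mx 0 i + (r *: delta_mx 0 j + x)) - 'd_ i f (t *: delta_mx 0 i + x)).
  move=> ht; apply: is_deriveB; apply: derive_line; apply: d1; first by rewrite swp; apply: Ub.
  by have := Ub 0 t r0' ht; rewrite scale0r add0r.
have [t||c] := @MVT_segment R (fun t => f (t *: delta_mx 0 i + (r *: delta_mx 0 j + x)) - f (t *: delta_mx 0 i + x))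
   (fun t => 'd_ i f (t *: delta_mx 0 i + (r *: delta_mx 0 j + x)) - 'd_ i f (t *: delta_mx 0 i + x)) 0 r (ltW r0).
- by rewrite in_itv /= => /andP[t0 tr]; apply: D1; rewrite !ltW.
- apply: derivable_within_continuous => t; rewrite in_itv /= => tr.
  by have [] := D1 t tr.
rewrite in_itv /= => hc; rewrite subr0 !scale0r !add0r swp => e1.
have [|s hs e2] := @MVT_line U ('d_ i f) j (c *: delta_mx 0 i + x) r (ltW r0) _ d2.
  by move=> s hs; apply: Ub.
exists (s *: delta_mx 0 j + (c *: delta_mx 0 i + x)) => [k|]; first exact: box.
have alg (a b c' d : R) : a - b - c' + d = a - c' - (b - d) by ring.
rewrite expr2 mulrA -e2; apply: etrans (alg _ _ _ _) _; apply: etrans e1 _.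
by rewrite swp.
Qed.

Lemma schwarz U f (i j : 'I_N) (x : T) : open U -> U x -> Ck 2 U f ->
  'd_ i ('d_ j f) x = 'd_ j ('d_ i f) x.
Proof.
move=> oU Ux Cf; apply/eqP; rewrite -subr_eq0 -normr_le0.
apply/ler_addgt0Pr => e e0; rewrite add0r.
have half k l : \forall y \near x, `|'d_ k ('d_ l f) x - 'd_ k ('d_ l f) y| <= e / 2.
  have [_ df] := Cf; have [_ [_ d2]] := df l; have [_ [d3 _]] := d2 k.
  by have /cvgrPdist_le := d3 x Ux; apply; rewrite divr_gt0.
have Un : \forall y \near x, U y by apply: open_nbhs_nbhs.
have [r r0 Hr] := box_sub (filterI Un (filterI (half i j) (half j i))).
have r20 : 0 < r / 2 by rewrite divr_gt0.
have box (y : T) : (forall k, `|y 0 k - x 0 k| <= r / 2 + r / 2) -> forall k, `|y 0 k - x 0 k| <= r.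
  by move=> h k; apply: le_trans (h k) _; rewrite -splitr.
have [|y1 /box/Hr[_ [h1 h2]] e1] := @double_MVT U f i j x (r / 2) r20 _ Cf.
  by move=> y /box/Hr[].
have [|y2 /box/Hr[_ [h3 h4]] e2] := @double_MVT U f j i x (r / 2) r20 _ Cf.
  by move=> y /box/Hr[].
have e3 : 'd_ j ('d_ i f) y1 = 'd_ i ('d_ j f) y2.
  have rn : (r / 2) ^+ 2 != 0 by rewrite expf_neq0 // gt_eqF.
  apply: (mulIf rn); apply: etrans (esym e1) (etrans _ e2).
  rewrite [_ *: delta_mx 0 j + (_ + x)]addrCA; move: (f _) (f (_ *: delta_mx 0 j + x)) (f _) (f x).
  by move=> a b c d; rewrite -!addrA; congr (_ + _); rewrite !addrA [- b + _]addrC.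
have -> : 'd_ i ('d_ j f) x - 'd_ j ('d_ i f) x
  = ('d_ i ('d_ j f) x - 'd_ i ('d_ j f) y2) - ('d_ j ('d_ i f) x - 'd_ j ('d_ i f) y1).
  have alg (a b c : R) : a - b = a - c - (b - c) by ring.
  by rewrite e3 -alg.
by apply: le_trans (ler_normB _ _) _; rewrite [leRHS]splitr; apply: lerD h3 h2.
Qed.

(* Along each coordinate edge of a box the increment is at most [K * r]. *)
Lemma box_bound U f (x : T) (r K : R) : 0 <= r -> 0 <= K ->
  (forall y : T, (forall j, `|y 0 j - x 0 j| <= r) -> U y) -> Ck 1 U f -> f x = 0 ->
  (forall j (y : T), (forall k, `|y 0 k - x 0 k| <= r) -> `|'d_ j f y| <= K) ->
  forall y : T, (forall j, `|y 0 j - x 0 j| <= r) -> `|f y| <= N%:R * (K * r).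
Proof.
move=> r0 K0 rU Cf fx df y hy.
pose z n : T := \row_j (if (j < n)%N then y 0 j else x 0 j).
suff H n : (n <= N)%N -> `|f (z n)| <= n%:R * (K * r).
  suff -> : y = z N by apply: H.
  by apply/rowP => j; rewrite mxE ltn_ord.
elim: n => [_|n IH nN].
  by rewrite (_ : z 0%N = x) ?fx ?normr0 ?mul0r //; apply/rowP => j; rewrite mxE.
pose j := Ordinal nN; pose a := y 0 j - x 0 j.
have zE : z n.+1 = a *: delta_mx 0 j + z n.
  apply/rowP => k; rewrite !mxE eqxx /= ltnS leq_eqVlt -[k == j]/(k == n :> nat).
  case: eqVneq => [kn|_]; last by rewrite mulr0 add0r.
  have -> : k = j by apply: val_inj.
  by rewrite ltnn mulr1 subrK.
have znj : (z n) 0 j = x 0 j by rewrite mxE ltnn.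
have box b k : `|b| <= `|a| -> `|(b *: delta_mx 0 j + z n : T) 0 k - x 0 k| <= r.
  move=> ba; have [->|kj] := eqVneq k j.
    by rewrite 2!mxE znj mxE !eqxx mulr1 addrK (le_trans ba (hy j)).
  rewrite !mxE eqxx (negPf kj) mulr0 add0r; case: ifP => _; first exact: hy.
  by rewrite subrr normr0.
suff : `|f (z n.+1) - f (z n)| <= K * r.
  move=> h; rewrite -[f _](subrK (f (z n))); apply: le_trans (ler_normD _ _) _.
  by rewrite mulrSr mulrDl mul1r addrC lerD // IH // ltnW.
have fin t b : `|t| <= `|a| -> `|b| <= `|a| ->
    `|'d_ j f (t *: delta_mx 0 j + z n) * b| <= K * r.
  move=> ta ba; rewrite normrM ler_pM //; first by apply: df => k; apply: box.
  exact: le_trans ba (hy j).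
have [a0|a0] := leP 0 a.
  have [|t /andP[t0 ta]] := @MVT_line U f j (z n) a a0 _ Cf.
    by move=> t /andP[t0 ta]; apply: rU => k; apply: box; rewrite !ger0_norm.
  by rewrite zE => ->; apply: fin => //; rewrite !ger0_norm.
have sh t : t *: delta_mx 0 j + z n.+1 = (t + a) *: delta_mx 0 j + z n.
  by rewrite zE addrA scalerDl.
have na0 : 0 <= - a by rewrite oppr_ge0 ltW.
have bd t : 0 <= t <= - a -> `|t + a| <= `|a|.
  move=> /andP[t0 ta]; rewrite [X in _ <= X]ltr0_norm // ler0_norm; lra.
have [|t /bd ta] := @MVT_line U f j (z n.+1) (- a) na0 _ Cf.
  by move=> t /bd ta; apply: rU => k; rewrite sh; apply: box.
rewrite !sh addNr scale0r add0r distrC => ->; apply: fin => //; by rewrite normrN.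
Qed.

(* Iterating [box_bound] on a small box halves the bound on the [u k] at each step. *)
Lemma unique_continuation (I : finType) (u : I -> T -> R) (V : set T) (x : T) (K : R) :
  nbhs x V -> (forall k, Ck 1 V (u k)) -> (forall k, u k x = 0) ->
  (forall k j y (M : R), V y -> (forall l, `|u l y| <= M) -> `|'d_ j (u k) y| <= K * M) ->
  \forall y \near x, forall k, u k y = 0.
Proof.
move=> nV Cu ux0 uK.
have bd : \forall y \near x, forall k, `|u k y| <= 1.
  suff H (s : seq I) : \forall y \near x, forall k, k \in s -> `|u k y| <= 1.
    by apply: filterS (H (enum I)) => y h k; apply: h; rewrite mem_enum.
  elim: s => [|k s IH]; first by apply: filterE.
  have Vx : V x by apply: nbhs_singleton.
  have /cvgrPdist_le/(_ 1 ltr01) := Ck_cont (Cu k) Vx; rewrite ux0 => h.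
  apply: filterS (filterI h IH) => y [h1 h2] l; rewrite inE => /orP[/eqP ->|/h2 //].
  by move: h1; rewrite /= sub0r normrN.
have [r r0 Hr] := box_sub (filterI nV bd).
pose K' := Num.max K 0; have K0 : 0 <= K' by rewrite le_max lexx orbT.
(* The radius makes [N * K' * e] at most 1/2; the summand 1 keeps the denominator positive when [K']
   is 0. *)
pose e := Num.min r (N%:R * K' * 2 + 1)^-1.
have d0 : 0 < N%:R * K' * 2 + 1 by rewrite ltr_wpDl // mulr_ge0 // mulr_ge0.
have e0 : 0 < e by rewrite lt_min r0 invr_gt0.
have er : e <= r by rewrite ge_min lexx.
have eK : N%:R * (K' * e) <= 2^-1.
  rewrite mulrA; apply: le_trans (_ : N%:R * K' * (N%:R * K' * 2 + 1)^-1 <= _).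
    by apply: ler_wpM2l; [rewrite mulr_ge0 | rewrite ge_min lexx orbT].
  by rewrite ler_pdivrMr //; lra.
have H n k (y : T) : (forall j, `|y 0 j - x 0 j| <= e) -> `|u k y| <= 2^-1 ^+ n.
  elim: n k y => [|n IH] k y hy.
    by rewrite expr0; apply: (Hr y _).2 => j; apply: le_trans (hy j) er.
  have rV (y' : T) : (forall j, `|y' 0 j - x 0 j| <= e) -> V y'.
    by move=> h; apply: (Hr y' _).1 => j; apply: le_trans (h j) er.
  have p0 : 0 <= 2^-1 ^+ n :> R by rewrite exprn_ge0 // invr_ge0.
  have KM0 : 0 <= K' * 2^-1 ^+ n by rewrite mulr_ge0.
  have dM j (y' : T) : (forall j0, `|y' 0 j0 - x 0 j0| <= e) -> `|'d_ j (u k) y'| <= K' * 2^-1 ^+ n.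
    move=> hy'; apply: le_trans (uK k j y' _ (rV _ hy') (fun l => IH l _ hy')) _.
    by rewrite ler_wpM2r // le_max lexx.
  apply: le_trans (box_bound (ltW e0) KM0 rV (Cu k) (ux0 k) dM hy) _.
  have -> : N%:R * (K' * 2^-1 ^+ n * e) = N%:R * (K' * e) * 2^-1 ^+ n.
    by rewrite -!mulrA; congr (_ * (_ * _)); rewrite mulrC.
  by rewrite exprS; apply: ler_wpM2r.
have box0 : \forall y \near x, forall j, `|(y : T) 0 j - x 0 j| <= e.
  apply/nbhs_ballP; exists e => //= y; rewrite -ball_normE /= => h j.
  rewrite distrC; apply: le_trans (ltW h); rewrite [leRHS]mx_normrE.
  by apply: le_trans (le_bigmax _ _ (0, j)); rewrite !mxE.
apply: filterS box0 => y hy k; apply/eqP; rewrite -normr_le0.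
apply/ler_addgt0Pr => d dgt0; rewrite add0r.
have [n hn] : exists n, 2^-1 ^+ n <= d.
  have dV : 0 <= d^-1 by rewrite invr_ge0 ltW.
  have hn := archi_boundP dV; exists (Num.bound d^-1).
  apply: le_trans (_ : (d^-1)^-1 <= d); last by rewrite invrK.
  rewrite exprVn lef_pV2 ?posrE ?exprn_gt0 ?invr_gt0 //.
  apply: le_trans (ltW hn) _.
  by rewrite -natrX ler_nat; apply: ltnW; apply: ltn_expl.
exact: le_trans (H n k y hy) hn.
Qed.
End Smooth.

(** * Germs of smooth functions *)

Section Germs.
Variables (R : realType) (N : nat).
Local Notation T := 'rV[R]_N.
Local Notation C := (cplx R).
Implicit Types (p : T) (f g : T -> C).

Definition smooth_near p f := exists U : set T, [/\ open U, U p & csmooth U f].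

Lemma smoothD U (f g : T -> R) : open U -> smooth U f -> smooth U g -> smooth U (fun x => f x + g x).
Proof. by move=> oU sf sg k; apply: Ck_D. Qed.
Lemma smoothM U (f g : T -> R) : open U -> smooth U f -> smooth U g -> smooth U (fun x => f x * g x).
Proof. by move=> oU sf sg k; apply: Ck_M. Qed.
Lemma smoothN U (f : T -> R) : open U -> smooth U f -> smooth U (fun x => - f x).
Proof.
move=> oU sf k; apply: Ck_ext (Ck_M oU (Ck_cst k U (-1)) (sf k)) => // x _.
by rewrite mulN1r.
Qed.
Lemma smooth_cst (U : set T) (a : R) : smooth U (fun=> a).
Proof. by move=> k; apply: Ck_cst. Qed.

Lemma csmoothD U f g : open U -> csmooth U f -> csmooth U g -> csmooth U (f + g).
Proof.
move=> oU [f1 f2] [g1 g2]; split=> k.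
  by apply: Ck_ext (smoothD oU f1 g1 k) => // x _; rewrite /= fctE; case: (f x); case: (g x).
by apply: Ck_ext (smoothD oU f2 g2 k) => // x _; rewrite /= fctE; case: (f x); case: (g x).
Qed.
Lemma csmoothN U f : open U -> csmooth U f -> csmooth U (- f).
Proof.
move=> oU [f1 f2]; split=> k.
  by apply: Ck_ext (smoothN oU f1 k) => // x _; rewrite /= fctE; case: (f x).
by apply: Ck_ext (smoothN oU f2 k) => // x _; rewrite /= fctE; case: (f x).
Qed.
Lemma csmoothM U f g : open U -> csmooth U f -> csmooth U g -> csmooth U (f * g).
Proof.
move=> oU [f1 f2] [g1 g2]; split=> k.
  apply: Ck_ext (smoothD oU (smoothM oU f1 g1) (smoothN oU (smoothM oU f2 g2)) k) => // x _.
  by rewrite /= fctE; case: (f x); case: (g x).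
apply: Ck_ext (smoothD oU (smoothM oU f1 g2) (smoothM oU f2 g1) k) => // x _.
by rewrite /= fctE; case: (f x); case: (g x).
Qed.
Lemma csmooth_cst (U : set T) (z : C) : csmooth U (fun=> z).
Proof. by split; apply: smooth_cst. Qed.
Lemma csmooth_conj U f : open U -> csmooth U f -> csmooth U (fun x => (f x)^*).
Proof.
move=> oU [f1 f2]; split=> k.
  by apply: Ck_ext (f1 k) => // x _; case: (f x).
by apply: Ck_ext (smoothN oU f2 k) => // x _; case: (f x).
Qed.
Lemma csmoothV U f : open U -> (forall x, U x -> f x != 0) -> csmooth U f -> csmooth U (fun x => (f x)^-1).
Proof.
move=> oU nf [f1 f2].
have s2 := smoothD oU (smoothM oU f1 f1) (smoothM oU f2 f2).
have sV : smooth U (fun x => (complex.Re (f x) * complex.Re (f x) + complex.Im (f x) * complex.Im (f x))^-1).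
  move=> k; apply: Ck_V => // x Ux; have := nf x Ux; apply: contraNneq.
  case: (f x) => a b /= /eqP; rewrite -!expr2 paddr_eq0 ?sqr_ge0 // !sqrf_eq0.
  by move=> /andP[/eqP -> /eqP ->].
split=> k.
  apply: Ck_ext (smoothM oU f1 sV k) => // x _.
  by case: (f x) => a b; rewrite /= -!expr2.
apply: Ck_ext (smoothM oU (smoothN oU f2) sV k) => // x _.
by case: (f x) => a b; rewrite /= -!expr2 mulNr.
Qed.
Definition cd (j : 'I_N) f : T -> C := fun x =>
  ('D_(delta_mx 0 j) (fun y => complex.Re (f y)) x
    +i* 'D_(delta_mx 0 j) (fun y => complex.Im (f y)) x)%C.
Lemma csmooth_cd j U f : csmooth U f -> csmooth U (cd j f).
Proof.
by move=> [f1 f2]; split=> k; [have [_ h] := f1 k.+1 | have [_ h] := f2 k.+1]; have [] := h j.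
Qed.
Lemma csmooth_sub U V f : V `<=` U -> csmooth U f -> csmooth V f.
Proof. by move=> VU [f1 f2]; split=> k; apply: Ck_sub VU _. Qed.
Lemma csmooth_ext U f g : open U -> (forall x, U x -> f x = g x) -> csmooth U f -> csmooth U g.
Proof. by move=> oU fg [f1 f2]; split=> k; [apply: Ck_ext (f1 k)|apply: Ck_ext (f2 k)] => // x Ux; rewrite fg. Qed.

Lemma smooth_near_bin (op : (T -> C) -> (T -> C) -> T -> C) p f g :
  (forall U f g, open U -> csmooth U f -> csmooth U g -> csmooth U (op f g)) ->
  smooth_near p f -> smooth_near p g -> smooth_near p (op f g).
Proof.
move=> H [U [oU Up sf]] [V [oV Vp sg]]; exists (U `&` V); split; [exact: openI| by split|].
by apply: H; [exact: openI|apply: csmooth_sub sf|apply: csmooth_sub sg] => x [].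
Qed.
Lemma snD p f g : smooth_near p f -> smooth_near p g -> smooth_near p (f + g).
Proof. by apply: smooth_near_bin => U f' g'; apply: csmoothD. Qed.
Lemma snM p f g : smooth_near p f -> smooth_near p g -> smooth_near p (f * g).
Proof. by apply: smooth_near_bin => U f' g'; apply: csmoothM. Qed.
Lemma snN p f : smooth_near p f -> smooth_near p (- f).
Proof. by move=> [U [oU Up sf]]; exists U; split=> //; apply: csmoothN. Qed.
Lemma sn_cst p (z : C) : smooth_near p (fun=> z).
Proof. by exists setT; split; [exact: openT | | apply: csmooth_cst]. Qed.
Lemma sn_conj p f : smooth_near p f -> smooth_near p (fun x => (f x)^*).
Proof. by move=> [U [oU Up sf]]; exists U; split=> //; apply: csmooth_conj. Qed.
Lemma sn_cd j p f : smooth_near p f -> smooth_near p (cd j f).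
Proof. by move=> [U [oU Up sf]]; exists U; split=> //; apply: csmooth_cd. Qed.
Lemma sn_near p f : smooth_near p f -> \forall x \near p, smooth_near x f.
Proof.
move=> [U [oU Up sf]]; have nU : \forall x \near p, U x by apply: open_nbhs_nbhs.
by apply: filterS nU => x Ux; exists U.
Qed.

Lemma near_openP p (P : T -> Prop) : (\forall x \near p, P x) ->
  exists U : set T, [/\ open U, U p & forall x, U x -> P x].
Proof.
move=> h; exists (interior P); split; [exact: open_interior | exact: h|].
by move=> x; apply: interior_subset.
Qed.

Lemma sn_ext p f g : (\forall x \near p, f x = g x) -> smooth_near p f -> smooth_near p g.
Proof.
move=> /near_openP[V [oV Vp fg]] [U [oU Up sf]]; exists (U `&` V); split; [exact: openI|by split|].
have oUV := openI oU oV; apply: (csmooth_ext (f := f)) => // [x [_ /fg] //|].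
by apply: csmooth_sub sf => x [].
Qed.

Lemma near_neq0 p f : smooth_near p f -> f p != 0 -> \forall x \near p, f x != 0.
Proof.
move=> [U [oU Up [f1 f2]]]; case e : (f p) => [a b] ab.
have [a0|a0] := eqVneq a 0.
  have b0 : b != 0 by apply: contra ab => /eqP ->; rewrite a0.
  have h : \forall x \near p, complex.Im (f x) != 0.
    by apply: (cvgr_neq0 _ (Ck_cont (f2 0%N) Up)); rewrite e.
  by apply: filterS h => x; apply: contraNneq => ->.
have h : \forall x \near p, complex.Re (f x) != 0.
  by apply: (cvgr_neq0 _ (Ck_cont (f1 0%N) Up)); rewrite e.
by apply: filterS h => x; apply: contraNneq => ->.
Qed.

Lemma snV p f : smooth_near p f -> f p != 0 -> smooth_near p (fun x => (f x)^-1).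
Proof.
move=> sf fp; have [V [oV Vp fV]] := near_openP (near_neq0 sf fp).
have [U [oU Up sf']] := sf; exists (U `&` V); split; [exact: openI|by split|].
by apply: csmoothV; [exact: openI|move=> x [_ /fV]|apply: csmooth_sub sf' => x []].
Qed.

Lemma cd_near j p f g : (\forall x \near p, f x = g x) -> \forall x \near p, cd j f x = cd j g x.
Proof.
move=> /near_openP[V [oV Vp fg]].
have nV : \forall x \near p, V x by apply: open_nbhs_nbhs.
apply: filterS nV => x Vx; have nVx : \forall y \near x, V y by apply: open_nbhs_nbhs.
congr (_ +i* _)%C; apply: near_eq_derive; apply: filterS nVx => y /fg -> //.
Qed.

(** The choice depends only on the class of [f] near [p], so that equality of germs is plain
    equality of representatives. *)
Definition germ_rep p f : T -> C := xget 0 [set g | \forall x \near p, f x = g x].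

Lemma germ_repP p f : \forall x \near p, f x = germ_rep p f x.
Proof.
have h : [set g : T -> C | \forall x \near p, f x = g x] f by apply: filterE.
exact: (xgetPex 0 (ex_intro _ f h)).
Qed.

Lemma germ_rep_eq p f g : (\forall x \near p, f x = g x) -> germ_rep p f = germ_rep p g.
Proof.
move=> fg; congr (xget 0 _); apply/seteqP; split=> h /= fh.
  by apply: filterS (filterI fg fh) => x [-> ->].
by apply: filterS (filterI fg fh) => x [-> ->].
Qed.

(* Germs at [p] of smooth functions, each given by a canonical representative. *)
Record germ p := Germ { gfun : T -> C;
  gfunP : smooth_near p gfun /\ germ_rep p gfun = gfun }.

Lemma germ_eq p (a b : germ p) : (\forall x \near p, gfun a x = gfun b x) -> a = b.
Proof.
case: a b => [f [sf ff]] [g [sg gg]] /= /germ_rep_eq.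
move=> e; have fg : f = g := etrans (esym ff) (etrans e gg).
clear e.
by case: _ / fg in sg gg *; congr Germ; apply: Prop_irrelevance.
Qed.

Lemma germ_of_proof p f : smooth_near p f ->
  smooth_near p (germ_rep p f) /\ germ_rep p (germ_rep p f) = germ_rep p f.
Proof.
move=> sf; split; first exact: sn_ext (germ_repP p f) sf.
by apply/esym/germ_rep_eq/germ_repP.
Qed.

Definition mkg p f : germ p :=
  match pselect (smooth_near p f) with
  | left sf => Germ (germ_of_proof sf)
  | right _ => Germ (germ_of_proof (sn_cst p 0))
  end.

Lemma mkgP p f : smooth_near p f -> \forall x \near p, gfun (mkg p f) x = f x.
Proof.
move=> sf; rewrite /mkg; case: pselect => // sf' /=.
by apply: filterS (germ_repP p f) => x.
Qed.

Lemma mkg_eq p f g : smooth_near p f -> (\forall x \near p, f x = g x) -> mkg p f = mkg p g.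
Proof.
move=> sf fg; have sg := sn_ext fg sf; apply: germ_eq.
by apply: filterS (filterI fg (filterI (mkgP sf) (mkgP sg))) => x [e [-> ->]].
Qed.

Lemma mkg_inj p f g : smooth_near p f -> smooth_near p g -> mkg p f = mkg p g ->
  \forall x \near p, f x = g x.
Proof.
move=> sf sg e; have := mkgP sf; rewrite e => h.
by apply: filterS (filterI h (mkgP sg)) => x [<- <-].
Qed.

Lemma gfunK p (a : germ p) : mkg p (gfun a) = a.
Proof. by apply: germ_eq; apply: mkgP; have [] := gfunP a. Qed.

Lemma gfun_smooth p (a : germ p) : smooth_near p (gfun a).
Proof. by have [] := gfunP a. Qed.

HB.instance Definition _ p := gen_eqMixin (germ p).
HB.instance Definition _ p := gen_choiceMixin (germ p).

Definition g_add p (a b : germ p) := mkg p (gfun a + gfun b).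
Definition g_opp p (a : germ p) := mkg p (- gfun a).
Definition g_mul p (a b : germ p) := mkg p (gfun a * gfun b).

Lemma g_addE p f g : smooth_near p f -> smooth_near p g ->
  g_add (mkg p f) (mkg p g) = mkg p (f + g).
Proof.
move=> sf sg; apply: mkg_eq; first by apply: snD; apply: gfun_smooth.
by apply: filterS (filterI (mkgP sf) (mkgP sg)) => x [e1 e2]; rewrite fctE /= e1 e2.
Qed.
Lemma g_mulE p f g : smooth_near p f -> smooth_near p g ->
  g_mul (mkg p f) (mkg p g) = mkg p (f * g).
Proof.
move=> sf sg; apply: mkg_eq; first by apply: snM; apply: gfun_smooth.
by apply: filterS (filterI (mkgP sf) (mkgP sg)) => x [e1 e2]; rewrite fctE /= e1 e2.
Qed.
Lemma g_oppE p f : smooth_near p f -> g_opp (mkg p f) = mkg p (- f).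
Proof.
move=> sf; apply: mkg_eq; first by apply: snN; apply: gfun_smooth.
by apply: filterS (mkgP sf) => x e1; rewrite fctE /= e1.
Qed.
Lemma germ_ind p (P : germ p -> Prop) : (forall f, smooth_near p f -> P (mkg p f)) -> forall a, P a.
Proof. by move=> h a; rewrite -(gfunK a); apply: h; apply: gfun_smooth. Qed.

Lemma g_addA p : associative (@g_add p).
Proof.
elim/germ_ind=> f sf; elim/germ_ind=> g sg; elim/germ_ind=> h sh.
by rewrite !g_addE //; [rewrite addrA | apply: snD | apply: snD].
Qed.
Lemma g_addC p : commutative (@g_add p).
Proof. by move=> a b; rewrite /g_add addrC. Qed.
Lemma g_add0 p : left_id (mkg p 0) (@g_add p).
Proof. by elim/germ_ind=> f sf; rewrite g_addE ?add0r //; apply: sn_cst. Qed.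
Lemma g_addN p : left_inverse (mkg p 0) (@g_opp p) (@g_add p).
Proof. by elim/germ_ind=> f sf; rewrite g_oppE // g_addE ?addNr //; apply: snN. Qed.
HB.instance Definition _ p := GRing.isZmodule.Build (germ p) (@g_addA p) (@g_addC p) (@g_add0 p) (@g_addN p).

Lemma g_mulA p : associative (@g_mul p).
Proof.
elim/germ_ind=> f sf; elim/germ_ind=> g sg; elim/germ_ind=> h sh.
by rewrite !g_mulE //; [rewrite mulrA | apply: snM | apply: snM].
Qed.
Lemma g_mulC p : commutative (@g_mul p).
Proof.
move=> a b; congr (mkg p _); apply/funext => x; exact: mulrC.
Qed.
Lemma g_mul1 p : left_id (mkg p 1) (@g_mul p).
Proof. by elim/germ_ind=> f sf; rewrite g_mulE ?mul1r //; apply: sn_cst. Qed.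
Lemma g_mulD p : left_distributive (@g_mul p) (@g_add p).
Proof.
elim/germ_ind=> f sf; elim/germ_ind=> g sg; elim/germ_ind=> h sh.
rewrite g_addE // !g_mulE //; last exact: snD.
by rewrite g_addE ?mulrDl //; apply: snM.
Qed.
Lemma g_one p : mkg p 1 != mkg p 0.
Proof.
apply/eqP => /mkg_inj h; have /nbhs_singleton /eqP := h (sn_cst p 1) (sn_cst p 0).
by rewrite /= oner_eq0.
Qed.
HB.instance Definition _ p := GRing.Zmodule_isComNzRing.Build (germ p)
  (@g_mulA p) (@g_mulC p) (@g_mul1 p) (@g_mulD p) (@g_one p).

Definition gev p (a : germ p) : C := gfun a p.
Lemma gevE p f : smooth_near p f -> gev (mkg p f) = f p.
Proof. by move=> sf; apply: nbhs_singleton (mkgP sf). Qed.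

Definition g_unit p : pred (germ p) := fun a => gev a != 0.
Definition g_inv p (a : germ p) := if gev a != 0 then mkg p (fun x => (gfun a x)^-1) else a.
Lemma g_mulV p : {in @g_unit p, left_inverse 1 (@g_inv p) *%R}.
Proof.
move=> a; rewrite unfold_in /g_unit /g_inv => au; rewrite au.
have sV := snV (gfun_smooth a) au.
rewrite -[X in _ * X]gfunK -[LHS]/(g_mul _ _) g_mulE //; last exact: gfun_smooth.
apply: mkg_eq; first by apply: snM => //; apply: gfun_smooth.
by apply: filterS (near_neq0 (gfun_smooth a) au) => x h; rewrite fctE /= mulVf.
Qed.
Lemma gevM p (a b : germ p) : gev (a * b) = gev a * gev b.
Proof.
elim/germ_ind: a => f sf; elim/germ_ind: b => g sg.
rewrite -[mkg p f * _]/(g_mul _ _) g_mulE // !gevE //; exact: snM.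
Qed.
Lemma gev1 p : gev (1 : germ p) = 1. Proof. by rewrite gevE //; apply: sn_cst. Qed.
Lemma g_unitPl p (a b : germ p) : b * a = 1 -> g_unit a.
Proof.
move=> /(congr1 (@gev p)); rewrite gevM gev1 => e; apply/eqP => a0.
by move: e; rewrite a0 mulr0 => /esym/eqP; rewrite oner_eq0.
Qed.
Lemma g_inv_out p : {in [predC @g_unit p], @g_inv p =1 id}.
Proof. by move=> a; rewrite inE unfold_in /g_unit negbK /g_inv => /eqP ->; rewrite eqxx. Qed.
HB.instance Definition _ p := GRing.ComNzRing_hasMulInverse.Build (germ p)
  (@g_mulV p) (@g_unitPl p) (@g_inv_out p).

Lemma gev_unit p (a : germ p) : gev a != 0 -> a \is a GRing.unit.
Proof. by []. Qed.

Lemma derivable_smooth (j : 'I_N) U (f : T -> R) x : smooth U f -> U x -> derivable f x (delta_mx 0 j).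
Proof. by move=> sf Ux; have [_ /(_ j)[h _]] := sf 1%N; apply: h. Qed.

Lemma cdD j U f g x : csmooth U f -> csmooth U g -> U x -> cd j (f + g) x = cd j f x + cd j g x.
Proof.
move=> [f1 f2] [g1 g2] Ux; rewrite /cd.
rewrite (_ : (fun y => complex.Re _) = (fun y => complex.Re (f y)) + (fun y => complex.Re (g y))); last first.
  by apply/funext => y; rewrite !fctE; case: (f y); case: (g y).
rewrite (_ : (fun y => complex.Im _) = (fun y => complex.Im (f y)) + (fun y => complex.Im (g y))); last first.
  by apply/funext => y; rewrite !fctE; case: (f y); case: (g y).
by rewrite !deriveD //; apply: derivable_smooth; eauto.
Qed.

(** The real and imaginary parts of a complex product are both of this shape, with [s = -1] and
    [s = 1]. *)
Lemma derive_MDM (a b c d : T -> R) (x v : T) (s : R) :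
  derivable a x v -> derivable b x v -> derivable c x v -> derivable d x v ->
  'D_v (a * b + s *: (c * d)) x
  = a x * 'D_v b x + b x * 'D_v a x + s * (c x * 'D_v d x + d x * 'D_v c x).
Proof.
move=> da db dc dd; have dab := derivableM da db; have dcd := derivableM dc dd.
rewrite deriveD; [|exact: dab|exact: derivableZ].
by rewrite deriveZ // (deriveM da db) (deriveM dc dd).
Qed.

Lemma cdM j U f g x : csmooth U f -> csmooth U g -> U x ->
  cd j (f * g) x = cd j f x * g x + f x * cd j g x.
Proof.
move=> [f1 f2] [g1 g2] Ux; rewrite /cd.
have dfr := derivable_smooth (j := j) f1 Ux; have dfi := derivable_smooth (j := j) f2 Ux.
have dgr := derivable_smooth (j := j) g1 Ux; have dgi := derivable_smooth (j := j) g2 Ux.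
have := derive_MDM (-1) dfr dgr dfi dgi; have := derive_MDM 1 dfr dgi dfi dgr.
rewrite (_ : _ + _ = (fun y => complex.Im (f y * g y))); last first.
  by apply/funext => y; rewrite !fctE scale1r; case: (f y); case: (g y).
move=> ->; rewrite (_ : _ + _ = (fun y => complex.Re (f y * g y))); last first.
  by apply/funext => y; rewrite !fctE scaleN1r; case: (f y); case: (g y).
move=> ->; move: ('D__ _ x) ('D__ _ x) ('D__ _ x) ('D__ _ x) => a b c d.
case: (f x) (g x) => a' b' [c' d']; apply/eqP; rewrite eq_complex /=.
by apply/andP; split; apply/eqP; ring.
Qed.

Lemma cd_conj j U f x : csmooth U f -> U x -> cd j (fun y => (f y)^*) x = (cd j f x)^*.
Proof.
move=> [f1 f2] Ux; rewrite /cd.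
rewrite (_ : (fun y => complex.Re (f y)^* ) = (fun y => complex.Re (f y))); last first.
  by apply/funext => y; case: (f y).
rewrite (_ : (fun y => complex.Im (f y)^* ) = - (fun y => complex.Im (f y))); last first.
  by apply/funext => y; rewrite fctE; case: (f y).
by rewrite deriveN //; apply: derivable_smooth; eauto.
Qed.

Lemma cd_comm i j U f x : open U -> csmooth U f -> U x -> cd i (cd j f) x = cd j (cd i f) x.
Proof.
move=> oU [f1 f2] Ux.
exact: (congr2 (fun a b => (a +i* b)%C) (schwarz i j oU Ux (f1 2%N)) (schwarz i j oU Ux (f2 2%N))).
Qed.

Lemma cd_cst j (z : C) x : cd j (fun=> z) x = 0.
Proof. by congr (_ +i* _)%C; rewrite derive_cst. Qed.

Lemma csmooth_coord (U : set T) (j : 'I_N) : csmooth U (fun y : T => toC (y 0 j)).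
Proof. by split=> k; [apply: Ck_coord | apply: Ck_cst]. Qed.

Lemma cd_coord i j x : cd i (fun y : T => toC (y 0 j)) x = (j == i)%:R.
Proof.
have e1 : 'D_(delta_mx 0 i) (fun y : T => y 0 j) x = (j == i)%:R.
  by have [_ ->] := derive_coord j i x; rewrite mxE eqxx.
rewrite /cd e1 (_ : 'D__ _ x = 0); last exact: derive_cst.
by case: (j == i).
Qed.

Definition gd (j : 'I_N) p (a : germ p) : germ p := mkg p (cd j (gfun a)).
Definition gcj p (a : germ p) : germ p := mkg p (fun x => (gfun a x)^*).
Definition gcst p (z : C) : germ p := mkg p (fun=> z).
Definition gcoord p (j : 'I_N) : germ p := mkg p (fun y => toC (y 0 j)).

Lemma gdE j p f : smooth_near p f -> gd j (mkg p f) = mkg p (cd j f).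
Proof.
by move=> sf; apply: mkg_eq; [apply: sn_cd (gfun_smooth _) | apply: cd_near (mkgP sf)].
Qed.
Lemma gcjE p f : smooth_near p f -> gcj (mkg p f) = mkg p (fun x => (f x)^*).
Proof.
move=> sf; apply: mkg_eq; first by apply: sn_conj (gfun_smooth _).
by apply: filterS (mkgP sf) => x ->.
Qed.
Lemma germD p f g : smooth_near p f -> smooth_near p g -> mkg p f + mkg p g = mkg p (f + g).
Proof. exact: g_addE. Qed.
Lemma germM p f g : smooth_near p f -> smooth_near p g -> mkg p f * mkg p g = mkg p (f * g).
Proof. exact: g_mulE. Qed.
Lemma sn_coord p (j : 'I_N) : smooth_near p (fun y => toC (y 0 j)).
Proof. by exists setT; split; [exact: openT | | apply: csmooth_coord]. Qed.

Lemma sn2 p f g : smooth_near p f -> smooth_near p g ->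
  exists U : set T, [/\ open U, U p, csmooth U f, csmooth U g & \forall x \near p, U x].
Proof.
move=> [U [oU Up sf]] [V [oV Vp sg]]; exists (U `&` V).
have oUV := openI oU oV; split=> //; try by [apply: csmooth_sub sf => x []|apply: csmooth_sub sg => x []].
exact: open_nbhs_nbhs.
Qed.

Lemma gdD j p (a b : germ p) : gd j (a + b) = gd j a + gd j b.
Proof.
elim/germ_ind: a => f sf; elim/germ_ind: b => g sg.
rewrite germD // !gdE //; last exact: snD.
rewrite germD; try exact: sn_cd.
have [U [oU Up Uf Ug nU]] := sn2 sf sg.
apply: mkg_eq; first by apply/sn_cd/snD.
by apply: filterS nU => x Ux; rewrite (cdD j Uf Ug Ux).
Qed.
Lemma gdM j p (a b : germ p) : gd j (a * b) = gd j a * b + a * gd j b.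
Proof.
elim/germ_ind: a => f sf; elim/germ_ind: b => g sg.
have s1 := sn_cd j sf; have s2 := sn_cd j sg.
rewrite germM // !gdE //; last exact: snM.
rewrite !germM // germD; try exact: snM.
have [U [oU Up Uf Ug nU]] := sn2 sf sg.
apply: mkg_eq; first by apply/sn_cd/snM.
by apply: filterS nU => x Ux; rewrite (cdM j Uf Ug Ux).
Qed.
Lemma gd_cj j p (a : germ p) : gd j (gcj a) = gcj (gd j a).
Proof.
elim/germ_ind: a => f sf; have s1 := sn_cd j sf; have s2 := sn_conj sf.
rewrite gcjE // !gdE // gcjE //; have [U [oU Up Uf _ nU]] := sn2 sf sf.
apply: mkg_eq; first exact/sn_cd.
by apply: filterS nU => x Ux; rewrite (cd_conj j Uf Ux).
Qed.
Lemma gd_comm i j p (a : germ p) : gd i (gd j a) = gd j (gd i a).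
Proof.
elim/germ_ind: a => f sf; have s1 := sn_cd j sf; have s2 := sn_cd i sf.
rewrite (gdE j sf) (gdE i sf) (gdE i s1) (gdE j s2); have [U [oU Up Uf _ nU]] := sn2 sf sf.
apply: mkg_eq; first exact/sn_cd.
by apply: filterS nU => x Ux; apply: cd_comm oU Uf Ux.
Qed.
Lemma gd_cst j p z : gd j (gcst p z) = 0.
Proof.
rewrite gdE; last exact: sn_cst.
by apply: mkg_eq; [apply/sn_cd/sn_cst | apply: filterE => x; apply: cd_cst].
Qed.
Lemma gd_coord i j p : gd i (gcoord p j) = (j == i)%:R.
Proof.
have -> : (j == i)%:R = mkg p (fun=> (j == i)%:R) by case: (j == i).
rewrite gdE; last exact: sn_coord.
by apply: mkg_eq; [apply/sn_cd/sn_coord | apply: filterE => x; apply: cd_coord].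
Qed.

Lemma gev_is_zmod p : zmod_morphism (@gev p).
Proof.
elim/germ_ind=> f sf; elim/germ_ind=> g sg.
by rewrite -[- mkg p g]/(g_opp _) g_oppE // germD // ?gevE //; try apply: snD => //; apply: snN.
Qed.
Lemma gev_is_monoid p : monoid_morphism (@gev p).
Proof. by split=> [|a b]; [apply: gev1 | apply: gevM]. Qed.
HB.instance Definition _ p := GRing.isZmodMorphism.Build (germ p) C (@gev p) (@gev_is_zmod p).
HB.instance Definition _ p := GRing.isMonoidMorphism.Build (germ p) C (@gev p) (@gev_is_monoid p).

Lemma gcst_is_zmod p : zmod_morphism (@gcst p).
Proof.
move=> a b; rewrite /gcst -[- mkg p _]/(g_opp _) g_oppE ?germD //; try exact: sn_cst.
Qed.
Lemma gcst_is_monoid p : monoid_morphism (@gcst p).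
Proof. by split=> // a b; rewrite /gcst germM //; apply: sn_cst. Qed.
HB.instance Definition _ p := GRing.isZmodMorphism.Build C (germ p) (@gcst p) (@gcst_is_zmod p).
HB.instance Definition _ p := GRing.isMonoidMorphism.Build C (germ p) (@gcst p) (@gcst_is_monoid p).

Lemma gcj_is_zmod p : zmod_morphism (@gcj p).
Proof.
elim/germ_ind=> f sf; elim/germ_ind=> g sg.
have s1 := sn_conj sf; have s2 := sn_conj sg; have s3 := snN sg; have s4 := snN s2.
rewrite -![- _]/(g_opp _) g_oppE // germD // !gcjE //; last exact: snD.
rewrite g_oppE // germD //; congr (mkg p _); apply/funext => x; exact: rmorphB.
Qed.
Lemma gcj_is_monoid p : monoid_morphism (@gcj p).
Proof.
split=> [|a b].
  rewrite -[1]/(mkg p (fun=> 1)) gcjE; last exact: sn_cst.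
  by congr (mkg p _); apply/funext => x; apply: rmorph1.
elim/germ_ind: a => f sf; elim/germ_ind: b => g sg.
have s1 := sn_conj sf; have s2 := sn_conj sg.
rewrite germM // !gcjE //; last exact: snM.
by rewrite germM //; congr (mkg p _); apply/funext => x; apply: rmorphM.
Qed.
HB.instance Definition _ p := GRing.isZmodMorphism.Build (germ p) (germ p) (@gcj p) (@gcj_is_zmod p).
HB.instance Definition _ p := GRing.isMonoidMorphism.Build (germ p) (germ p) (@gcj p) (@gcj_is_monoid p).

Lemma gev_cj p (a : germ p) : gev (gcj a) = (gev a)^*.
Proof. by elim/germ_ind: a => f sf; rewrite gcjE // !gevE //; apply: sn_conj. Qed.
Lemma gev_cst p z : gev (gcst p z) = z.
Proof. by rewrite gevE //; apply: sn_cst. Qed.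
End Germs.

(** * Coframes, germs of vector fields and adapted frames *)

Section Coframe.
Variable q : nat.
Definition fidx (d : frame q) : 'I_((q + 1) + (q + 1) + 1) :=
  match d with
  | fE i => lshift _ (lshift _ (lshift _ i))
  | fK => lshift _ (lshift _ (rshift _ 0))
  | fEb i => lshift _ (rshift _ (lshift _ i))
  | fKb => lshift _ (rshift _ (rshift _ 0))
  | fT => rshift _ 0
  end.
Definition frow (A : pzRingType) (x : frame q -> A) : 'rV[A]_((q + 1) + (q + 1) + 1) :=
  row_mx (row_mx (row_mx (\row_i x (fE i)) (x fK)%:M) (row_mx (\row_i x (fEb i)) (x fKb)%:M)) (x fT)%:M.
Definition fmat (A : pzRingType) N (e : frame q -> 'rV[A]_N) : 'M[A]_((q + 1) + (q + 1) + 1, N) :=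
  col_mx (col_mx (col_mx (\matrix_i e (fE i)) (e fK)) (col_mx (\matrix_i e (fEb i)) (e fKb))) (e fT).

Lemma frow_fidx (A : pzRingType) (x : frame q -> A) d : frow x 0 (fidx d) = x d.
Proof.
by rewrite /frow; case: d => [i||i||] /=;
  rewrite ?(row_mxEl, row_mxEr) ?mxE ?eqxx ?mulr1n.
Qed.

Lemma frowP (A : pzRingType) (v : 'rV[A]_((q + 1) + (q + 1) + 1)) : v = frow (fun d => v 0 (fidx d)).
Proof.
apply/rowP => k; case: (split_ordP k) => [k1 ->|k1 ->]; rewrite /frow ?(row_mxEl, row_mxEr).
  case: (split_ordP k1) => [k2 ->|k2 ->]; rewrite ?(row_mxEl, row_mxEr);
  case: (split_ordP k2) => [k3 ->|k3 ->]; rewrite ?(row_mxEl, row_mxEr) !mxE ?ord1 ?eqxx ?mulr1n //.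
by rewrite !mxE ?ord1 eqxx mulr1n.
Qed.

Lemma frow_fmat (A : comPzRingType) N (x : frame q -> A) (e : frame q -> 'rV[A]_N) :
  frow x *m fmat e = sumF (fun d => x d *: e d).
Proof.
have rs (y : 'I_q -> A) (f : 'I_q -> 'rV[A]_N) : (\row_i y i) *m (\matrix_i f i) = \sum_i y i *: f i.
  by rewrite mulmx_sum_row; apply: eq_bigr => i _; rewrite mxE rowK.
by rewrite /frow /fmat !mul_row_col !rs !mul_scalar_mx /sumF addrA.
Qed.

(** Spanning at the point makes the matrix of the frame invertible after evaluation, hence over the
    local ring; the coframe consists of the columns of its inverse. *)
Lemma coframe_exists (C : fieldType) (A : comUnitRingType) (ev : {rmorphism A -> C}) N
    (e : frame q -> 'rV[A]_N) :
  (forall f, ev f != 0 -> f \is a GRing.unit) -> N = ((q + 1) + (q + 1) + 1)%N ->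
  (forall v : 'rV[C]_N, exists x, v = sumF (fun d => x d *: map_mx ev (e d))) ->
  exists W : frame q -> 'cV[A]_N,
    (forall X, X = sumF (fun d => co W d X *: e d)) /\
    (forall x d, co W d (sumF (fun a => x a *: e a)) = x d).
Proof.
move=> evu eN; case: _ / (esym eN) in e * => span.
have evF : map_mx ev (fmat e) = fmat (fun d => map_mx ev (e d)).
  rewrite /fmat !map_col_mx; congr (col_mx (col_mx (col_mx _ _) (col_mx _ _)) _).
    by apply/matrixP => i j; rewrite !mxE.
  by apply/matrixP => i j; rewrite !mxE.
have /choice[x xE] : forall j, exists x, delta_mx 0 j = sumF (fun d => x d *: map_mx ev (e d)).
  by move=> j; apply: span.
have BM : (\matrix_j frow (x j)) *m map_mx ev (fmat e) = 1%:M.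
  apply/row_matrixP => j; rewrite row_mul rowK evF frow_fmat -xE.
  by rewrite row1.
have uM : fmat e \in unitmx.
  rewrite unitmxE; apply: evu; rewrite -det_map_mx -unitfE -unitmxE.
  by have [] := mulmx1_unit BM.
exists (fun d => col (fidx d) (invmx (fmat e))).
have coE d X : co (fun d => col (fidx d) (invmx (fmat e))) d X = (X *m invmx (fmat e)) 0 (fidx d).
  by rewrite /co !mxE; apply: eq_bigr => k _; rewrite mxE.
split=> [X|y d].
  rewrite -frow_fmat (_ : frow _ = X *m invmx (fmat e)) ?mulmxKV //.
  by rewrite [RHS]frowP; congr frow; apply/funext => d; rewrite coE.
by rewrite coE -frow_fmat mulmxK // frow_fidx.
Qed.
End Coframe.

(** When the [d] components of both fields vanish identically, no derivative of a coefficient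
    reaches the [d] component of the bracket. This is the tensoriality behind the Levi form and
    [ad]. *)
Lemma frame_tensor (A : comUnitRingType) N (dd : 'I_N -> A -> A)
   (ddD : forall j f g, dd j (f + g) = dd j f + dd j g)
   (ddM : forall j f g, dd j (f * g) = dd j f * g + f * dd j g) q (e : frame q -> 'rV[A]_N) W
   (e_co : forall X, X = sumF (fun d => co W d X *: e d))
   (co_e : forall (x : frame q -> A) d, co W d (sumF (fun a => x a *: e a)) = x d) X Y d :
   co W d X = 0 -> co W d Y = 0 ->
   co W d (br dd X Y) = sumF (fun b => co W b Y * sumF (fun a => co W a X * ec dd e W a b d)).
Proof.
move=> X0 Y0.
have E X' Y' : co W d Y' = 0 -> co W d (br dd X' Y') = sumF (fun x => co W x Y' * co W d (br dd X' (e x))).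
  by move=> Y0'; rewrite {1}[Y']e_co br_sumF // Y0' actV0 // add0r.
rewrite E //; apply: eq_sumF => b; congr (_ * _).
rewrite br_anti coN E // -sumFN; apply: eq_sumF => a.
by rewrite /ec br_anti coN mulrN opprK.
Qed.

Section GermVectors.
Variables (R : realType) (N : nat).
Local Notation T := 'rV[R]_N.
Local Notation C := (cplx R).
Local Notation vf := (T -> 'rV[C]_N).
Local Notation rcal := (real_calculus R N).
Local Notation gbr p := (br (fun j => @gd R N j p)).
Implicit Types (p y : T) (X Y : vf) (D : T -> 'M[C]_N).

Definition smoothv p X := forall k, smooth_near p (fun y => X y 0 k).
Definition mkv p X : 'rV[germ p]_N := \row_k mkg p (fun y => X y 0 k).
Definition funv p (v : 'rV[germ p]_N) : vf := fun y => \row_k gfun (v 0 k) y.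

Lemma mkvP p X : smoothv p X -> \forall y \near p, funv (mkv p X) y = X y.
Proof.
move=> sX; have h : \forall y \near p, forall k, gfun (mkv p X 0 k) y = X y 0 k.
  suff H (s : seq 'I_N) : \forall y \near p, forall k, k \in s -> gfun (mkv p X 0 k) y = X y 0 k.
    by apply: filterS (H (enum 'I_N)) => y h k; apply: h; rewrite mem_enum.
  elim: s => [|k s IH]; first by apply: filterE.
  apply: filterS (filterI (mkgP (sX k)) IH) => y [h1 h2] l; rewrite inE => /orP[/eqP ->|/h2 //].
  by rewrite mxE.
by apply: filterS h => y hy; apply/rowP => k; rewrite mxE hy.
Qed.

Lemma funvK p (v : 'rV[germ p]_N) : mkv p (funv v) = v.
Proof.
apply/rowP => k; rewrite mxE -[RHS]gfunK; congr (mkg p _); apply/funext => y.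
by rewrite mxE.
Qed.

Lemma funv_smooth p (v : 'rV[germ p]_N) : smoothv p (funv v).
Proof.
move=> k; rewrite (_ : (fun y => _) = gfun (v 0 k)); first exact: gfun_smooth.
by apply/funext => y; rewrite mxE.
Qed.

Lemma sn_sum p (I : finType) (F : I -> T -> C) : (forall i, smooth_near p (F i)) ->
  smooth_near p (fun y => \sum_i F i y).
Proof.
move=> sF; have H (s : seq I) : smooth_near p (fun y => \sum_(i <- s) F i y).
  elim: s => [|i s IH].
    rewrite (_ : (fun y => _) = fun=> 0); first exact: sn_cst.
    by apply/funext => y; rewrite big_nil.
  rewrite (_ : (fun y => _) = F i + (fun y => \sum_(i <- s) F i y)); first exact: snD.
  by apply/funext => y; rewrite big_cons.
exact: H.
Qed.

Lemma mkg_sum p (I : finType) (F : I -> T -> C) : (forall i, smooth_near p (F i)) ->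
  \sum_i mkg p (F i) = mkg p (fun y => \sum_i F i y).
Proof.
move=> sF; suff H (s : seq I) : smooth_near p (fun y => \sum_(i <- s) F i y) /\
     \sum_(i <- s) mkg p (F i) = mkg p (fun y => \sum_(i <- s) F i y) by have [] := H (index_enum I).
elim: s => [|i s [IH1 IH2]].
  rewrite (_ : (fun y => _) = fun=> 0); last by apply/funext => y; rewrite big_nil.
  by split; [exact: sn_cst | rewrite big_nil].
rewrite (_ : (fun y => _) = F i + (fun y => \sum_(i <- s) F i y)); last first.
  by apply/funext => y; rewrite big_cons.
by split; [exact: snD | rewrite big_cons IH2 germD].
Qed.

Lemma mkv_br p X Y : smoothv p X -> smoothv p Y ->
  smoothv p (@bracket R N rcal X Y) /\ gbr p (mkv p X) (mkv p Y) = mkv p (@bracket R N rcal X Y).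
Proof.
move=> sX sY.
have E X' Y' k : smoothv p X' -> smoothv p Y' ->
    smooth_near p (fun y => \sum_j X' y 0 j * cd j (fun y => Y' y 0 k) y) /\
    actV (fun j => @gd R N j p) (mkv p X') (mkv p Y' 0 k)
    = mkg p (fun y => \sum_j X' y 0 j * cd j (fun y => Y' y 0 k) y).
  move=> sX' sY'; have s j : smooth_near p (fun y => X' y 0 j * cd j (fun y => Y' y 0 k) y).
    by apply: snM => //; apply: sn_cd.
  split; first exact: sn_sum.
  rewrite -mkg_sum //; apply: eq_bigr => j _; rewrite !mxE gdE // germM //.
  exact: sn_cd.
have bE k : (fun y => @bracket R N rcal X Y y 0 k) =
   (fun y => \sum_j X y 0 j * cd j (fun y => Y y 0 k) y)
   - (fun y => \sum_j Y y 0 j * cd j (fun y => X y 0 k) y).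
  by apply/funext => y; rewrite mxE sumrB.
split=> [k|]; first by rewrite bE; apply: snD; [|apply: snN]; have [] := E _ _ k sX sY; have [] := E _ _ k sY sX.
apply/rowP => k; rewrite [LHS]mxE [RHS]mxE bE.
have [s1 ->] := E _ _ k sX sY; have [s2 ->] := E _ _ k sY sX.
by rewrite -[- mkg p _]/(g_opp _) g_oppE // germD //; apply: snN.
Qed.

Lemma mkv_eval p X : smoothv p X -> map_mx (@gev R N p) (mkv p X) = X p.
Proof. by move=> sX; apply/rowP => k; rewrite !mxE gevE. Qed.

Lemma mkv_inj p X Y : smoothv p X -> smoothv p Y -> mkv p X = mkv p Y -> \forall y \near p, X y = Y y.
Proof.
move=> sX sY e; have := mkvP sX; rewrite e => h.
by apply: filterS (filterI h (mkvP sY)) => y [<- <-].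
Qed.

Lemma mkv_eq p X Y : smoothv p X -> (\forall y \near p, X y = Y y) -> mkv p X = mkv p Y.
Proof.
move=> sX h; apply/rowP => k; rewrite !mxE; apply: mkg_eq => //.
by apply: filterS h => y ->.
Qed.

Lemma smoothv_near p X : smoothv p X -> \forall y \near p, smoothv y X.
Proof.
move=> sX; suff H (s : seq 'I_N) : \forall y \near p, forall k, k \in s -> smooth_near y (fun z => X z 0 k).
  by apply: filterS (H (enum 'I_N)) => y h k; apply: h; rewrite mem_enum.
elim: s => [|k s IH]; first by apply: filterE.
by apply: filterS (filterI (sn_near (sX k)) IH) => y [h1 h2] l; rewrite inE => /orP[/eqP ->|/h2].
Qed.

Lemma smoothv_csmooth p X : smoothv p X ->
  exists U : set T, [/\ open U, U p & forall k, csmooth U (fun y => X y 0 k)].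
Proof.
move=> sX; suff H (s : seq 'I_N) : exists U : set T, [/\ open U, U p & forall k, k \in s -> csmooth U (fun y => X y 0 k)].
  by have [U [oU Up h]] := H (enum 'I_N); exists U; split=> // k; apply: h; rewrite mem_enum.
elim: s => [|k s [U [oU Up h]]]; first by exists setT; split=> //; exact: openT.
have [V [oV Vp h']] := sX k; exists (U `&` V); split; [exact: openI|by split|] => l.
rewrite inE => /orP[/eqP ->|/h]; first by apply: csmooth_sub h' => y [].
by apply: csmooth_sub => y [].
Qed.

Lemma local_sectionP D p X : @local_section R N rcal D p X <->
  smoothv p X /\ \forall y \near p, (X y <= D y)%MS.
Proof.
split=> [[U [oU Up sX XD]]|[sX /near_openP[V [oV Vp XD]]]].
  split=> [k|]; first by exists U; split=> //; apply: sX.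
  have nU : \forall y \near p, U y by apply: open_nbhs_nbhs.
  by apply: filterS nU.
have [U [oU Up sX']] := smoothv_csmooth sX.
exists (U `&` V); split; [exact: openI|by split| |by move=> y [_ /XD]].
by move=> k; apply: csmooth_sub (sX' k) => y [].
Qed.

Lemma mkv_conj p X : smoothv p X -> map_mx (@gcj R N p) (mkv p X) = mkv p (fun y => conjmx (X y)).
Proof.
move=> sX; apply/rowP => k; rewrite !mxE gcjE //; congr (mkg p _); apply/funext => y.
by rewrite mxE.
Qed.
Lemma smoothv_conj p X : smoothv p X -> smoothv p (fun y => conjmx (X y)).
Proof.
move=> sX k; rewrite (_ : (fun y => _) = (fun y => (X y 0 k)^*)); first exact: sn_conj.
by apply/funext => y; rewrite mxE.
Qed.
End GermVectors.

Definition feq q (a b : frame q) :=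
  match a, b with
  | fE i, fE j => i == j | fK, fK => true | fEb i, fEb j => i == j
  | fKb, fKb => true | fT, fT => true | _, _ => false
  end.

Lemma sumF_delta q (A : pzRingType) (V : lmodType A) (G : frame q -> V) a :
  sumF (fun b => (feq a b)%:R *: G b) = G a.
Proof.
have z (f : 'I_q -> V) : \sum_i 0 *: f i = 0 by rewrite big1 // => i _; rewrite scale0r.
have s i (f : 'I_q -> V) : \sum_j (i == j)%:R *: f j = f i.
  rewrite (bigD1 i) //= eqxx scale1r big1 ?addr0 // => j.
  by rewrite eq_sym => /negPf ->; rewrite scale0r.
by case: a => [i||i||]; rewrite /sumF /= ?(scale0r, scale1r, z, s, addr0, add0r).
Qed.

Lemma sum_sumF q (V : zmodType) (I : finType) (F : I -> frame q -> V) :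
  \sum_j sumF (F j) = sumF (fun d => \sum_j F j d).
Proof.
by rewrite /sumF !big_split /=; congr (_ + _ + _ + _ + _); exact: exchange_big.
Qed.

Section Adapted.
Variables (R : realType) (N q : nat).
Local Notation T := 'rV[R]_N.
Local Notation C := (cplx R).
Local Notation vf := (T -> 'rV[C]_N).
Local Notation rcal := (real_calculus R N).
Local Notation gbr p := (br (fun j => @gd R N j p)).
Implicit Types (p y : T) (X Y : vf) (H : T -> 'M[C]_N).

Lemma near_forall p (I : finType) (P : I -> T -> Prop) :
  (forall i, \forall y \near p, P i y) -> \forall y \near p, forall i, P i y.
Proof.
move=> h; suff H (s : seq I) : \forall y \near p, forall i, i \in s -> P i y.
  by apply: filterS (H (enum I)) => y h' k; apply: h'; rewrite mem_enum.
elim: s => [|k s IH]; first by apply: filterE.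
by apply: filterS (filterI (h k) IH) => y [h1 h2] l; rewrite inE => /orP[/eqP ->|/h2].
Qed.

Lemma near_frame p (P : frame q -> T -> Prop) :
  (forall d, \forall y \near p, P d y) -> \forall y \near p, forall d, P d y.
Proof.
move=> h; have h1 := near_forall (fun i => h (fE i)); have h2 := near_forall (fun i => h (fEb i)).
by apply: filterS (filterI (filterI h1 h2) (filterI (h fK) (filterI (h fKb) (h fT)))) => y [[? ?] [? [? ?]]] [].
Qed.

(** These relations carry identities from the ring of germs to pointwise identities near the point,
    and back. *)
Definition repv p (v : 'rV[germ p]_N) X := smoothv p X /\ v = mkv p X.
Definition repg p (a : germ p) (f : T -> C) := smooth_near p f /\ a = mkg p f.

Lemma repv_fun p (v : 'rV[germ p]_N) : repv v (funv v).
Proof. by split; [apply: funv_smooth | rewrite funvK]. Qed.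
Lemma repg_fun p (a : germ p) : repg a (gfun a).
Proof. by split; [apply: gfun_smooth | rewrite gfunK]. Qed.
Lemma repg_ext p (a : germ p) f g : f =1 g -> repg a f -> repg a g.
Proof. by move=> /funext ->. Qed.
Lemma repgD p (a b : germ p) f g : repg a f -> repg b g -> repg (a + b) (fun y => f y + g y).
Proof. by move=> [sf ->] [sg ->]; split; [apply: snD | rewrite germD]. Qed.
Lemma repgM p (a b : germ p) f g : repg a f -> repg b g -> repg (a * b) (fun y => f y * g y).
Proof. by move=> [sf ->] [sg ->]; split; [apply: snM | rewrite germM]. Qed.
Lemma repg_cst p z : repg (gcst p z) (fun=> z).
Proof. by split; [apply: sn_cst |]. Qed.
Lemma repg_sum p (I : finType) (a : I -> germ p) f : (forall i, repg (a i) (f i)) ->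
  repg (\sum_i a i) (fun y => \sum_i f i y).
Proof.
move=> h; split; first by apply: sn_sum => i; have [] := h i.
rewrite -mkg_sum; last by move=> i; have [] := h i.
by apply: eq_bigr => i _; have [] := h i.
Qed.
Lemma repv_coord p (v : 'rV[germ p]_N) X k : repv v X -> repg (v 0 k) (fun y => X y 0 k).
Proof. by move=> [sX ->]; split; [apply: sX | rewrite mxE]. Qed.
Lemma coord_repv p (v : 'rV[germ p]_N) X : (forall k, repg (v 0 k) (fun y => X y 0 k)) -> repv v X.
Proof. by move=> h; split=> [k|]; [have [] := h k | apply/rowP => k; rewrite mxE; have [] := h k]. Qed.
Lemma repvD p (v w : 'rV[germ p]_N) X Y : repv v X -> repv w Y -> repv (v + w) (fun y => X y + Y y).
Proof.
move=> hX hY; apply: coord_repv => k; rewrite mxE.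
by apply: repg_ext (repgD (repv_coord k hX) (repv_coord k hY)) => y; rewrite mxE.
Qed.
Lemma repvZ p (a : germ p) (v : 'rV[germ p]_N) f X : repg a f -> repv v X -> repv (a *: v) (fun y => f y *: X y).
Proof.
move=> hf hX; apply: coord_repv => k; rewrite mxE.
by apply: repg_ext (repgM hf (repv_coord k hX)) => y; rewrite mxE.
Qed.
Lemma repv_sum p (I : finType) (v : I -> 'rV[germ p]_N) (X : I -> vf) : (forall i, repv (v i) (X i)) ->
  repv (\sum_i v i) (fun y => \sum_i X i y).
Proof.
move=> h; apply: coord_repv => k; rewrite summxE.
by apply: repg_ext (repg_sum (fun i => repv_coord k (h i))) => y; rewrite summxE.
Qed.
Lemma repv_sumF p (v : frame q -> 'rV[germ p]_N) (X : frame q -> vf) : (forall d, repv (v d) (X d)) ->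
  repv (sumF v) (fun y => sumF (X^~ y)).
Proof. by move=> h; rewrite /sumF; do !apply: repvD => //; apply: repv_sum. Qed.

Lemma repv_near p (v : 'rV[germ p]_N) X Y : repv v X -> repv v Y -> \forall y \near p, X y = Y y.
Proof. by move=> [sX vX] [sY vY]; apply: mkv_inj => //; rewrite -vX. Qed.
Lemma repg_near p (a : germ p) f g : repg a f -> repg a g -> \forall y \near p, f y = g y.
Proof. by move=> [sf af] [sg ag]; apply: mkg_inj => //; rewrite -af. Qed.
Lemma repg_ev p (a : germ p) f : repg a f -> gev a = f p.
Proof. by move=> [sf ->]; apply: gevE. Qed.
Lemma repv_ev p (v : 'rV[germ p]_N) X : repv v X -> map_mx (@gev R N p) v = X p.
Proof. by move=> [sf ->]; apply: mkv_eval. Qed.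
Lemma repv_mk p X : smoothv p X -> repv (mkv p X) X. Proof. by []. Qed.
Lemma repv_br p (v w : 'rV[germ p]_N) X Y : repv v X -> repv w Y ->
  repv (gbr p v w) (@bracket R N rcal X Y).
Proof. by move=> [sX ->] [sY ->]; have [] := mkv_br sX sY. Qed.

Definition colg p (w : T -> 'cV[C]_N) : 'cV[germ p]_N := \col_k mkg p (fun y => w y k 0).
Lemma repg_co p (v : 'rV[germ p]_N) X (W : frame q -> T -> 'cV[C]_N) d :
  (forall k, smooth_near p (fun y => W d y k 0)) -> repv v X ->
  repg (co (fun d => colg p (W d)) d v) (fun y => (X y *m W d y) 0 0).
Proof.
move=> sW hX; apply: repg_ext (_ : repg _ (fun y => \sum_k X y 0 k * W d y k 0)) => [y|].
  by rewrite mxE.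
rewrite /co mxE; apply: repg_sum => k; apply: repgM; first exact: repv_coord.
by rewrite mxE; split.
Qed.

Variables (H : T -> 'M[C]_N) (t : 'rV[C]_N).

Definition fr (E : 'I_q -> vf) (K : vf) (d : frame q) : vf := fun y =>
  match d with
  | fE i => E i y | fK => K y
  | fEb i => conjmx (E i y) | fKb => conjmx (K y) | fT => t
  end.

(** The coframe [W] is dual to the frame on all of [U], so that components of brackets can be
    compared at nearby points and not only as germs at the centre. *)
Record adapted (U : set T) (E : 'I_q -> vf) (K : vf) (W : frame q -> T -> 'cV[C]_N) : Prop := Adapted {
  ad_open : open U;
  ad_smE : forall y, U y -> forall i, smoothv y (E i);
  ad_smK : forall y, U y -> smoothv y K;
  ad_smW : forall y, U y -> forall d k, smooth_near y (fun z => W d z k 0);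
  ad_E : forall y, U y -> forall i, (E i y <= H y)%MS;
  ad_K : forall y, U y -> (K y <= H y)%MS;
  ad_rank : forall y, U y -> \rank (H y) = q.+1;
  ad_span : forall y, U y -> forall v, v = sumF (fun d => (v *m W d y) 0 0 *: fr E K d y);
  ad_dual : forall y, U y -> forall x d, (sumF (fun a => x a *: fr E K a y) *m W d y) 0 0 = x d }.

Hypothesis conj_t : conjmx t = t.

Lemma fr_smooth p E K : (forall i, smoothv p (E i)) -> smoothv p K -> forall d, smoothv p (fr E K d).
Proof.
move=> sE sK [i||i||]; [exact: sE|exact: sK|exact: smoothv_conj (sE i)|exact: smoothv_conj sK|].
by move=> k; exact: (sn_cst p (t 0 k)).
Qed.

Lemma cmxK m n : involutive (@Defs.conjmx R m n).
Proof. by move=> M; apply/matrixP => i j; rewrite !mxE conjCK. Qed.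

Lemma fr_cj E K d y : conjmx (fr E K d y) = fr E K (bar d) y.
Proof. by case: d => [i||i||] //=; rewrite cmxK. Qed.

Lemma adapted_exists p E K : N = ((q + 1) + (q + 1) + 1)%N ->
  (forall i, smoothv p (E i)) -> smoothv p K ->
  (\forall y \near p, [/\ forall i, (E i y <= H y)%MS, (K y <= H y)%MS & \rank (H y) = q.+1]) ->
  (forall v, exists x, v = sumF (fun d => x d *: fr E K d p)) ->
  exists U W, U p /\ adapted U E K W.
Proof.
move=> eN sE sK nH span; have sfr := fr_smooth sE sK.
have [|||W [e_co co_e]] := @coframe_exists q C (germ p) (@gev R N p) N (fun d => mkv p (fr E K d)).
- exact: gev_unit.
- by [].
- by move=> v; have [x xE] := span v; exists x; rewrite {1}xE; apply: eq_sumF => d; rewrite mkv_eval.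
pose Wf d (y : T) : 'cV[C]_N := \col_k gfun (W d k 0) y.
have sW d k : smooth_near p (fun y => Wf d y k 0).
  rewrite (_ : (fun y => _) = gfun (W d k 0)); first exact: gfun_smooth.
  by apply/funext => y; rewrite mxE.
have WE d : W d = colg p (Wf d).
  apply/colP => k; rewrite mxE -[LHS]gfunK; congr (mkg p _).
  by apply/funext => y; rewrite mxE.
have coE d v : co W d v = co (fun d => colg p (Wf d)) d v by rewrite /co WE.
(* Read on basis vectors, the germ identities of the coframe become finitely many pointwise ones,
   valid on a common neighbourhood. *)
have n1 : \forall y \near p, forall j, delta_mx 0 j = sumF (fun d => Wf d y j 0 *: fr E K d y).
  apply: near_forall => j; have sj : smoothv p (fun=> delta_mx 0 j) by move=> k; apply: sn_cst.
  apply: (@repv_near p (mkv p (fun=> delta_mx 0 j))); first exact: repv_mk.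
  rewrite [mkv p _]e_co; apply: repv_sumF => d; apply: repvZ; last by apply: repv_mk.
  rewrite coE; apply: repg_ext (repg_co _ (repv_mk sj)) => // y.
  by rewrite -rowE mxE.
have n2 : \forall y \near p, forall a d, (fr E K a y *m Wf d y) 0 0
     = (feq a d)%:R.
  apply: near_frame => a; apply: near_frame => d.
  apply: (@repg_near p (co W d (mkv p (fr E K a)))).
    by rewrite coE; apply: repg_co => //; apply: repv_mk.
  have -> : mkv p (fr E K a) = sumF (fun b => (feq a b)%:R *: mkv p (fr E K b)).
    by rewrite sumF_delta.
  rewrite co_e.
  have -> : (feq a d)%:R = gcst p (feq a d)%:R by rewrite rmorph_nat.
  exact: repg_cst.
have n3 : \forall y \near p, forall d k, smooth_near y (fun z => Wf d z k 0).
  apply: near_frame => d; apply: near_forall => k; exact: sn_near.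
have n4 := near_forall (fun i => smoothv_near (sE i)).
have n5 := smoothv_near sK.
have [U [oU Up hU]] := near_openP (filterI (filterI n1 n2) (filterI n3 (filterI n4 (filterI n5 nH)))).
exists U, Wf; split=> //; split=> //.
- by move=> y /hU[_ [_ []]].
- by move=> y /hU[_ [_ [_ []]]].
- by move=> y /hU[_ []].
- by move=> y /hU[_ [_ [_ [_ []]]]].
- by move=> y /hU[_ [_ [_ [_ []]]]].
- by move=> y /hU[_ [_ [_ [_ []]]]].
- move=> y /hU[[h1 _] _] v; rewrite {1}[v]row_sum_delta.
  transitivity (\sum_j sumF (fun d => (v 0 j * Wf d y j 0) *: fr E K d y)).
    apply: eq_bigr => j _; rewrite {1}(h1 j) (sumF_morph (h := *:%R (v 0 j))).
    + by apply: eq_sumF => d; rewrite scalerA.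
    + exact: scalerDr.
    + exact: scaler0.
  by rewrite sum_sumF; apply: eq_sumF => d; rewrite -scaler_suml mxE.
- move=> y /hU[[_ h2] _] x d.
  rewrite (sumF_morph (h := fun v => (v *m Wf d y) 0 0)) /=; last 2 first.
  + by move=> u v; rewrite mulmxDl mxE.
  + by rewrite mul0mx mxE.
  rewrite -[RHS](sumF_delta (fun d => x d : C^o) d); apply: eq_sumF => a.
  by rewrite -scalemxAl mxE h2 [RHS]mulrC; case: a d => [i||i||] [j||j||] //=; rewrite eq_sym; case: eqVneq => // ->.
Qed.
End Adapted.

Definition inH q (d : frame q) := match d with fE _ | fK => true | _ => false end.

Section AdaptedPoint.
Variables (R : realType) (N q : nat).
Local Notation T := 'rV[R]_N.
Local Notation C := (cplx R).
Local Notation vf := (T -> 'rV[C]_N).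
Local Notation rcal := (real_calculus R N).
Local Notation dd p := (fun j => @gd R N j p).
Implicit Types (p y : T) (X Y : vf).
Variables (H : T -> 'M[C]_N) (t : 'rV[C]_N).
Hypothesis conj_t : conjmx t = t.
Local Notation Hb := (fun x => conjmx (H x)).
Variables (U : set T) (E : 'I_q -> vf) (K : vf) (W : frame q -> T -> 'cV[C]_N).
Hypothesis ad : adapted H t U E K W.
Local Notation fra := (fr t E K).

Lemma ad_smfr y : U y -> forall d, smoothv y (fra d).
Proof.
by move=> Uy; apply: fr_smooth; [move=> i; apply: (ad_smE ad Uy) | exact: (ad_smK ad Uy)].
Qed.

Lemma ad_near y : U y -> \forall z \near y, U z.
Proof. by move=> Uy; apply: open_nbhs_nbhs; split=> //; exact: ad_open ad. Qed.

Definition eg y d : 'rV[germ y]_N := mkv y (fra d).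
Definition Wg y d : 'cV[germ y]_N := colg y (W d).

Lemma repv_eq y (v w : 'rV[germ y]_N) X Y : repv v X -> repv w Y ->
  (\forall z \near y, X z = Y z) -> v = w.
Proof. by move=> [sX ->] [sY ->] h; apply: mkv_eq. Qed.
Lemma repg_eq y (a b : germ y) f g : repg a f -> repg b g ->
  (\forall z \near y, f z = g z) -> a = b.
Proof. by move=> [sX ->] [sY ->] h; apply: mkg_eq. Qed.

Lemma rep_co y (v : 'rV[germ y]_N) X d : U y -> repv v X ->
  repg (co (Wg y) d v) (fun z => (X z *m W d z) 0 0).
Proof. by move=> Uy hX; apply: repg_co => //; apply: (ad_smW ad Uy). Qed.

Lemma eg_co y : U y -> forall v, v = sumF (fun d => co (Wg y) d v *: eg y d).
Proof.
move=> Uy v; apply: (repv_eq (repv_fun v)).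
  by apply: repv_sumF => d; apply: repvZ (rep_co _ Uy (repv_fun v)) (repv_mk (ad_smfr Uy d)).
by apply: filterS (ad_near Uy) => z Uz; apply: (ad_span ad Uz).
Qed.

Lemma co_eg y : U y -> forall (x : frame q -> germ y) d, co (Wg y) d (sumF (fun a => x a *: eg y a)) = x d.
Proof.
move=> Uy x d; apply: (repg_eq _ (repg_fun (x d))).
  apply: rep_co => //; apply: repv_sumF => a; apply: repvZ (repg_fun _) (repv_mk (ad_smfr Uy a)).
by apply: filterS (ad_near Uy) => z Uz; apply: (ad_dual ad Uz (fun a => gfun (x a) z)).
Qed.

Lemma eg_cj y : U y -> forall a, map_mx (@gcj R N y) (eg y a) = eg y (bar a).
Proof.
move=> Uy a; rewrite /eg mkv_conj; last exact: ad_smfr.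
by congr (mkv y _); apply/funext => z; apply: fr_cj.
Qed.

Definition coef z (v : 'rV[C]_N) d : C := (v *m W d z) 0 0.

Lemma coef_sumF z x d : U z -> coef z (sumF (fun a => x a *: fra a z)) d = x d.
Proof. by move=> Uz; apply: (ad_dual ad Uz). Qed.

Lemma spanC z v : U z -> v = sumF (fun d => coef z v d *: fra d z).
Proof. by move=> Uz; apply: (ad_span ad Uz). Qed.

Lemma cmxZ m n a (M : 'M[C]_(m, n)) : conjmx (a *: M) = a^* *: conjmx M.
Proof. by apply/matrixP => i j; rewrite !mxE rmorphM. Qed.
Lemma cmxD m n (M M' : 'M[C]_(m, n)) : conjmx (M + M') = conjmx M + conjmx M'.
Proof. by apply/matrixP => i j; rewrite !mxE rmorphD. Qed.

Lemma coef_conj z v d : U z -> coef z (conjmx v) (bar d) = (coef z v d)^*.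
Proof.
move=> Uz; rewrite {1}[v](spanC v Uz).
rewrite (sumF_morph (h := @Defs.conjmx R 1 N)); [|exact: cmxD|exact: map_mx0].
rewrite (eq_sumF (g := fun a => (fun b => (coef z v (bar b))^*) (bar a) *: fra (bar a) z)); last first.
  by move=> a /=; rewrite cmxZ (fr_cj conj_t) barK.
have e := sumF_bar (fun b => (coef z v (bar b))^* *: fra b z).
apply: etrans (congr1 (fun u => coef z u (bar d)) e) _.
by rewrite (coef_sumF (fun b => (coef z v (bar b))^* ) (bar d) Uz) barK.
Qed.

Definition HB z : 'M[C]_(q + 1, N) := col_mx (\matrix_i E i z) (K z).

Lemma HB_mul z (x : 'rV[C]_(q + 1)) : x *m HB z = sumF (fun d => match d with
   | fE i => x 0 (lshift 1 i) | fK => x 0 (rshift q 0) | _ => 0 end *: fra d z).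
Proof.
rewrite /HB -[x]hsubmxK mul_row_col /sumF /= !scale0r !addr0.
have -> : \sum_(i < q) 0 *: conjmx (E i z) = 0 by apply: big1 => i _; rewrite scale0r.
rewrite addr0; congr (_ + _).
  by rewrite mulmx_sum_row; apply: eq_bigr => i _; rewrite rowK row_mxEl.
rewrite row_mxEr [X in X *m _](_ : _ = ((rsubmx x) 0 0)%:M) ?mul_scalar_mx //.
by apply/matrixP => a b; rewrite !ord1 !mxE eqxx mulr1n.
Qed.

Lemma H_HB z : U z -> (H z == HB z)%MS.
Proof.
move=> Uz; have sub : (HB z <= H z)%MS.
  rewrite col_mx_sub (ad_K ad Uz) andbT; apply/row_subP => i; rewrite rowK.
  exact: (ad_E ad Uz).
have rk : \rank (HB z) = (q + 1)%N.
  apply/eqP; change (row_free (HB z)); apply: inj_row_free => x /eqP; rewrite HB_mul => /eqP x0.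
  apply/rowP => k; rewrite mxE.
  have c0 d : coef z 0 d = 0 by rewrite /coef mul0mx mxE.
  case: (split_ordP k) => i ->.
    by have := c0 (fE i); rewrite -x0 coef_sumF.
  by rewrite ord1; have := c0 fK; rewrite -x0 coef_sumF.
rewrite sub andbT; have [_ <-] := mxrank_leqif_sup sub.
by apply/eqP; rewrite (ad_rank ad Uz); apply: etrans rk (addn1 q).
Qed.

Lemma sub_coef z v d : U z -> (v <= H z)%MS -> ~~ inH d -> coef z v d = 0.
Proof.
move=> Uz; rewrite (eqmxP (H_HB Uz)) => /submxP[x ->]; rewrite HB_mul coef_sumF //.
by case: d.
Qed.

Lemma sub_coefb z v d : U z -> (v <= conjmx (H z))%MS -> ~~ inH (bar d) -> coef z v d = 0.
Proof.
move=> Uz vH nd; have -> : v = conjmx (conjmx v) by rewrite cmxK.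
rewrite -[d]barK coef_conj // (sub_coef Uz _ nd) ?conjC0 //.
have -> : H z = conjmx (conjmx (H z)) by rewrite cmxK.
by rewrite map_submx.
Qed.

Lemma cofD z v w d : coef z (v + w) d = coef z v d + coef z w d.
Proof. by rewrite /coef mulmxDl mxE. Qed.
Lemma cofZ z a v d : coef z (a *: v) d = a * coef z v d.
Proof. by rewrite /coef -scalemxAl mxE. Qed.

Lemma sub_coefT z v : U z -> (v <= H z + conjmx (H z))%MS -> coef z v fT = 0.
Proof.
move=> Uz /sub_addsmxP[[x y] /= ->]; rewrite cofD (@sub_coef z) // ?submxMl //.
by rewrite (@sub_coefb z) ?addr0 // submxMl.
Qed.

Lemma coef_sub z v : U z -> (forall d, ~~ inH d -> coef z v d = 0) -> (v <= H z)%MS.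
Proof.
move=> Uz h; rewrite (spanC v Uz) /sumF (h fKb) // (h fT) // !scale0r !addr0.
rewrite [X in _ + X]big1; last by move=> i _; rewrite h // scale0r.
rewrite addr0; apply: addmx_sub; last exact: scalemx_sub (ad_K ad Uz).
by apply: summx_sub => i _; exact: scalemx_sub (ad_E ad Uz i).
Qed.

Lemma coef_subT z v : U z -> coef z v fT = 0 -> (v <= H z + conjmx (H z))%MS.
Proof.
move=> Uz h; rewrite (spanC v Uz) /sumF h scale0r addr0.
have sE i : (E i z <= H z)%MS by apply: (ad_E ad Uz).
have sK : (K z <= H z)%MS by apply: (ad_K ad Uz).
have sEb i : (conjmx (E i z) <= conjmx (H z))%MS by rewrite map_submx.
have sKb : (conjmx (K z) <= conjmx (H z))%MS by rewrite map_submx.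
rewrite -!addrA addrA; apply: addmx_sub_adds; apply: addmx_sub.
- by apply: summx_sub => i _; exact: scalemx_sub (sE i).
- exact: scalemx_sub sK.
- by apply: summx_sub => i _; exact: scalemx_sub (sEb i).
- exact: scalemx_sub sKb.
Qed.

Lemma sec_co y v X d : U y -> repv v X -> (\forall z \near y, (X z <= H z)%MS) -> ~~ inH d ->
  co (Wg y) d v = 0.
Proof.
move=> Uy hX XH nd; have r0 : repg (0 : germ y) (fun=> 0) by split=> //; apply: sn_cst.
apply: (repg_eq (rep_co d Uy hX) r0).
by apply: filterS (filterI XH (ad_near Uy)) => z [zH Uz]; apply: sub_coef.
Qed.

Lemma sec_cob y v X d : U y -> repv v X -> (\forall z \near y, (X z <= conjmx (H z))%MS) -> ~~ inH (bar d) ->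
  co (Wg y) d v = 0.
Proof.
move=> Uy hX XH nd; have r0 : repg (0 : germ y) (fun=> 0) by split=> //; apply: sn_cst.
apply: (repg_eq (rep_co d Uy hX) r0).
by apply: filterS (filterI XH (ad_near Uy)) => z [zH Uz]; apply: sub_coefb.
Qed.

Definition ecg y a b d : germ y := ec (dd y) (eg y) (Wg y) a b d.
Definition ecf a b d z : C := coef z (@bracket R N rcal (fra a) (fra b) z) d.

Lemma rep_ec y a b d : U y -> repg (ecg y a b d) (ecf a b d).
Proof.
move=> Uy; apply: rep_co => //; apply: repv_br; apply: repv_mk; exact: ad_smfr.
Qed.

Lemma co_ev y v X d : U y -> repv v X -> gev (co (Wg y) d v) = coef y (X y) d.
Proof. by move=> Uy hX; rewrite (repg_ev (rep_co d Uy hX)). Qed.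

Lemma tensor y X Y d : U y -> smoothv y X -> smoothv y Y ->
  co (Wg y) d (mkv y X) = 0 -> co (Wg y) d (mkv y Y) = 0 ->
  coef y (@bracket R N rcal X Y y) d =
  sumF (fun b => coef y (Y y) b * sumF (fun a => coef y (X y) a * ecf a b d y)).
Proof.
move=> Uy sX sY X0 Y0.
have := frame_tensor (@gdD R N ^~ y) (@gdM R N ^~ y) (eg_co Uy) (co_eg Uy) X0 Y0.
move=> /(congr1 (@gev R N y)).
rewrite (co_ev d Uy (repv_br (repv_mk sX) (repv_mk sY))) => ->.
rewrite (sumF_morph (h := @gev R N y)); [|exact: rmorphD|exact: rmorph0].
apply: eq_sumF => b; rewrite rmorphM /= (co_ev b Uy (repv_mk sY)); congr (_ * _).
rewrite (sumF_morph (h := @gev R N y)); [|exact: rmorphD|exact: rmorph0].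
apply: eq_sumF => a; rewrite rmorphM /= (co_ev a Uy (repv_mk sX)); congr (_ * _).
exact: (repg_ev (rep_ec a b d Uy)).
Qed.

Lemma tensorT y X Y : U y -> @local_section R N rcal H y X -> @local_section R N rcal Hb y Y ->
  coef y (@bracket R N rcal X Y y) fT =
  sumF (fun b => coef y (Y y) b * sumF (fun a => coef y (X y) a * ecf a b fT y)).
Proof.
move=> Uy /local_sectionP[sX XH] /local_sectionP[sY YH]; apply: tensor => //.
  exact: sec_co Uy (repv_mk sX) XH _.
exact: sec_cob Uy (repv_mk sY) YH _.
Qed.

Lemma coef_fr z a d : U z -> coef z (fra a z) d = (feq a d)%:R.
Proof.
move=> Uz; rewrite -{1}(sumF_delta (fra^~ z) a) coef_sumF //.
Qed.
End AdaptedPoint.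

(** * The Levi form and the Levi kernel in a chart *)

Section Chart.
Variables (R : realType) (q : nat).
Local Notation C := (cplx R).
Local Notation N := (2 * q.+1 + 1)%N.
Local Notation T := 'rV[R]_N.
Local Notation vf := (T -> 'rV[C]_N).
Local Notation rcal := (real_calculus R N).
Local Notation dd p := (fun j => @gd R N j p).
Local Notation gbr p := (br (dd p)).
Variables (M : analytic_manifold R N) (S : CR_structure M) (i : chart M).
Local Notation H := (crH S i).
Local Notation Kd := (crK S i).
Local Notation Hb := (fun x => conjmx (H x)).
Implicit Types (E : 'I_q -> vf) (K : vf) (W : frame q -> T -> 'cV[C]_N) (U : set T).
Implicit Types (p y z : T) (X Y : vf) (t : 'rV[C]_N).

Lemma N_frame : N = ((q + 1) + (q + 1) + 1)%N.
Proof. lia. Qed.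

Lemma image_near p : image i p -> \forall y \near p, image i y.
Proof. by move=> ip; apply: open_nbhs_nbhs; split=> //; apply: coord_open. Qed.

Lemma rank_H y : image i y -> \rank (H y) = q.+1.
Proof.
move=> iy; have [V [B [_ Vy _ _ h]]] := cr_analytic S iy.
by have [rB eB] := h y Vy; rewrite -(eqmx_rank eB).
Qed.

Lemma near_near p (P : T -> Prop) : (\forall y \near p, P y) -> \forall y \near p, \forall z \near y, P z.
Proof.
move=> /near_openP[V [oV Vp h]]; have nV : \forall y \near p, V y by apply: open_nbhs_nbhs.
apply: filterS nV => y Vy; have nVy : \forall z \near y, V z by apply: open_nbhs_nbhs.
by apply: filterS nVy => z /h.
Qed.

Lemma local_section_near (D : T -> 'M[C]_N) p X : @local_section R N rcal D p X ->
  \forall y \near p, @local_section R N rcal D y X.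
Proof.
move=> /local_sectionP[sX XD].
apply: filterS (filterI (smoothv_near sX) (near_near XD)) => y [h1 h2].
by apply/local_sectionP; split.
Qed.

Lemma bracket_H p X Y : image i p -> @local_section R N rcal H p X -> @local_section R N rcal H p Y ->
  \forall y \near p, (@bracket R N rcal X Y y <= H y)%MS.
Proof.
move=> ip sX sY.
apply: filterS (filterI (image_near ip) (filterI (local_section_near sX) (local_section_near sY))) => y [iy [h1 h2]].
exact: (cr_involutive iy).
Qed.

Lemma kernel_line p (v : 'rV[C]_N) : image i p -> v != 0 -> (v <= Kd p)%MS -> (Kd p <= v)%MS.
Proof.
move=> ip v0 vK; have [_ <-] := mxrank_leqif_sup vK.
by rewrite (cr_rank_kernel S ip) rank_rV v0.
Qed.

Lemma levi_coef t U E K W p X Y (z : 'rV[C]_N) : conjmx t = t -> adapted H t U E K W -> U p ->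
  (z - ('i / 2) *: @bracket R N rcal X Y p <= H p + conjmx (H p))%MS ->
  coef W p z fT = ('i / 2) * coef W p (@bracket R N rcal X Y p) fT.
Proof.
move=> ct ad Up /(sub_coefT ct ad Up); rewrite cofD -scaleNr cofZ mulNr => /eqP.
by rewrite subr_eq0 => /eqP.
Qed.

(** A value of the Levi form comes with unspecified extensions [X] and [Y]; tensoriality replaces
    their bracket by that of the frame fields. *)
Lemma tensorT_fr t U E K W p X Y a b : conjmx t = t -> adapted H t U E K W -> U p ->
  @local_section R N rcal H p X -> @local_section R N rcal Hb p Y ->
  X p = fr t E K a p -> Y p = fr t E K b p ->
  coef W p (@bracket R N rcal X Y p) fT = ecf t E K W a b fT p.
Proof.
move=> ct ad Up sX sY Xp Yp; rewrite (tensorT ct ad Up sX sY) Xp Yp.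
rewrite (eq_sumF (g := fun b' => (feq b b')%:R *: (sumF (fun a' => (feq a a')%:R *: (ecf t E K W a' b' fT p : C^o)) : C^o))).
  by rewrite !sumF_delta.
move=> b'; rewrite (coef_fr ad) //; congr (_ * _); apply: eq_sumF => a'.
by rewrite (coef_fr ad).
Qed.

Lemma kernel_bracket t U E K W p a : conjmx t = t -> adapted H t U E K W -> U p -> image i p ->
  (K p <= Kd p)%MS -> inH (bar a) -> ecf t E K W fK a fT p = 0.
Proof.
move=> ct ad Up ip KK na.
have aH : (fr t E K (bar a) p <= H p)%MS.
  by case: a na => [j||j||] //= _; [apply: (ad_E ad Up)|apply: (ad_K ad Up)].
have [_ /(_ _ aH)[X [Y [sX sY Xp Yp b0]]]] := (cr_levi_kernel S ip (K p)).1 KK.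
have Yp' : Y p = fr t E K a p by rewrite Yp (fr_cj ct) barK.
rewrite -(tensorT_fr (a := fK) ct ad Up sX sY Xp Yp').
have /eqP := levi_coef ct ad Up b0; rewrite {1}/coef mul0mx mxE eq_sym mulf_eq0.
by rewrite mulf_eq0 invr_eq0 pnatr_eq0 (negPf (neq0Ci _)) /= => /eqP.
Qed.

Variables (s : symbol R q).
Hypothesis Hs_unit : symH s \in unitmx.

Section Point.
Variables (p : T) (E0 : 'M[C]_(q, N)) (t : 'rV[C]_N).
Hypothesis ip : image i p.
Hypothesis ct : conjmx t = t.
Hypothesis iso : @symbol_iso R N q rcal (cr_dist S i) s p E0 (conjmx E0) t.

(** The sections are the extensions contained in the known values of the Levi form. *)
Lemma initial_sections : exists (E : 'I_q -> vf) (K : vf),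
  [/\ forall j, @local_section R N rcal H p (E j), @local_section R N rcal H p K,
      forall j, E j p = row j E0, K p != 0 & (K p <= Kd p)%MS].
Proof.
have [_ [lv _ _]] := iso.
have /choice[E HE] : forall j, exists X, @local_section R N rcal H p X /\ X p = row j E0.
  by move=> j; have [X [Y [sX _ Xp _ _]]] := lv j j; exists X.
have /rowV0Pn[v vK v0] : Kd p != 0 by rewrite -mxrank_eq0 (cr_rank_kernel S ip).
have [vH /(_ 0 (sub0mx _ _))[K [Y [sK _ Kp _ _]]]] := (cr_levi_kernel S ip v).1 vK.
exists E, K; split=> //; try by [move=> j; have [] := HE j | rewrite Kp].
Qed.

Lemma span_at (e : 'I_q -> 'rV[C]_N) (k : 'rV[C]_N) : (forall j, e j = row j E0) -> k != 0 -> (k <= Kd p)%MS ->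
  forall v, exists x, v = sumF (fun d => x d *: match d with
     | fE j => e j | fK => k | fEb j => conjmx (e j) | fKb => conjmx k | fT => t end).
Proof.
move=> eE k0 kK v; have [[hE hEb ht] _] := iso.
have Kk := kernel_line ip k0 kK.
have H1 w : (w <= H p)%MS -> exists x (b : C), w = \sum_j x j *: e j + b *: k.
  rewrite -(eqmxP hE) => /sub_addsmxP[[x y'] /= ->].
  have : (y' *m Kd p <= k)%MS by apply: submx_trans (submxMl _ _) Kk.
  move=> /sub_rVP[b ->]; exists (fun j => x 0 j), b; congr (_ + _).
  by rewrite mulmx_sum_row; apply: eq_bigr => j _; rewrite eE.
have : (v <= t + (H p + conjmx (H p)))%MS by rewrite (eqmxP ht) submx1.
move=> /sub_addsmxP[[a w] /= ->].
have : (w *m (H p + conjmx (H p))%MS <= H p + conjmx (H p))%MS by apply: submxMl.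
move=> /sub_addsmxP[[w1 w2] /= ->].
have [x [b ->]] := H1 _ (submxMl w1 (H p)).
have [x' [b' e']] := H1 _ (submxMl (conjmx w2) (H p)).
have -> : w2 *m conjmx (H p) = conjmx (\sum_j x' j *: e j + b' *: k).
  by rewrite -e' [RHS]map_mxM -/(Defs.conjmx _) cmxK.
exists (fun d => match d with fE j => x j | fK => b | fEb j => (x' j)^* | fKb => b'^* | fT => a 0 0 end).
rewrite /sumF cmxD cmxZ [X in _ + (_ + (X + _))](_ : _ = \sum_j (x' j)^* *: conjmx (e j)); last first.
  apply/rowP => c; rewrite !mxE !summxE rmorph_sum; apply: eq_bigr => j _.
  by rewrite !mxE rmorphM.
rewrite [a]mx11_scalar mul_scalar_mx !mxE eqxx mulr1n [LHS]addrC; congr (_ + _).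
by rewrite !addrA.
Qed.

(** The factor [-2i] is the inverse of the [i/2] in the definition of the Levi form. *)
Lemma levi_at U E K W : adapted H t U E K W -> U p -> (forall j, E j p = row j E0) ->
  forall j k, ecf t E K W (fE j) (fEb k) fT p = - 2 * 'i * symH s j k.
Proof.
move=> ad Up eE j k; have [_ [lv _ _]] := iso.
have [X [Y [sX sY Xp Yp b0]]] := lv j k.
have Xp' : X p = fr t E K (fE j) p by rewrite Xp -eE.
have Yp' : Y p = fr t E K (fEb k) p by rewrite Yp /= eE; apply/rowP => c; rewrite !mxE.
rewrite -(tensorT_fr ct ad Up sX sY Xp' Yp').
have := levi_coef ct ad Up b0; rewrite cofZ.
rewrite -[X in coef W p X fT]/(fr t E K fT p) (coef_fr ad) //= mulr1.
move: (coef _ _ _ _) (symH s j k) => b h ->.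
rewrite mulrA [_ * ('i / 2)](_ : _ = 1) ?mul1r //.
by rewrite -mulrA [X in _ * X]mulrA -expr2 sqrCi mulN1r mulNr mulrN opprK divff // pnatr_eq0.
Qed.
End Point.
End Chart.

Lemma sumF_kernel q (A : pzRingType) (k : 'I_q -> A) (c : frame q -> A) :
  sumF (fun a => match a with fE j => - k j | fK => 1 | _ => 0 end * c a)
  = c fK - \sum_j k j * c (fE j).
Proof.
have z0 : \sum_(j < q) 0 * c (fEb j) = 0 by apply: big1 => j _; rewrite mul0r.
rewrite /sumF z0 !mul0r !addr0 mul1r addrC -sumrN; congr (_ + _).
by apply: eq_bigr => j _; rewrite mulNr.
Qed.

Lemma sumF_inH q (A : pzRingType) (V : lmodType A) (x : frame q -> A) (v : frame q -> V) :
  (forall d, ~~ inH d -> x d = 0) ->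
  sumF (fun d => x d *: v d) = \sum_j x (fE j) *: v (fE j) + x fK *: v fK.
Proof.
move=> x0; rewrite /sumF (x0 fKb) // (x0 fT) // !scale0r !addr0 [X in _ + X]big1 ?addr0 // => j _.
by rewrite x0 // scale0r.
Qed.

Section Chart.
Variables (R : realType) (q : nat).
Local Notation C := (cplx R).
Local Notation N := (2 * q.+1 + 1)%N.
Local Notation T := 'rV[R]_N.
Local Notation vf := (T -> 'rV[C]_N).
Local Notation rcal := (real_calculus R N).
Local Notation dd p := (fun j => @gd R N j p).
Local Notation gbr p := (br (dd p)).
Variables (M : analytic_manifold R N) (S : CR_structure M) (i : chart M).
Local Notation H := (crH S i).
Local Notation Kd := (crK S i).
Local Notation Hb := (fun x => conjmx (H x)).
Implicit Types (E : 'I_q -> vf) (K : vf) (W : frame q -> T -> 'cV[C]_N) (U : set T).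
Implicit Types (p y z : T) (X Y : vf) (t : 'rV[C]_N).

Variables (s : symbol R q).
Hypothesis Hs_unit : symH s \in unitmx.

Section Point.
Variables (p : T) (E0 : 'M[C]_(q, N)) (t : 'rV[C]_N).
Hypothesis ip : image i p.
Hypothesis ct : conjmx t = t.
Hypothesis iso : @symbol_iso R N q rcal (cr_dist S i) s p E0 (conjmx E0) t.

Lemma near_unit y m (Mg : 'M[germ y]_m) (Mf : T -> 'M[C]_m) :
  (forall j k, repg (Mg j k) (fun z => Mf z j k)) -> map_mx (@gev R N y) Mg \in unitmx ->
  Mg \in unitmx /\ \forall z \near y, Mf z \in unitmx.
Proof.
move=> rM uM; have uMg : Mg \in unitmx.
  by rewrite unitmxE; apply: gev_unit; rewrite -[gev _]det_map_mx -unitfE -unitmxE.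
split=> //.
have h : \forall z \near y, forall j l, \sum_k Mf z j k * gfun (invmx Mg k l) z = (j == l)%:R.
  apply: near_forall => j; apply: near_forall => l.
  apply: (@repg_near _ _ y ((Mg *m invmx Mg) j l)).
    by rewrite mxE; apply: repg_sum => k; apply: repgM => //; apply: repg_fun.
  rewrite mulmxV // mxE.
  have -> : (j == l)%:R = gcst y (j == l)%:R by rewrite rmorph_nat.
  exact: repg_cst.
apply: filterS h => z hz.
have /mulmx1_unit[] // : Mf z *m (\matrix_(k, l) gfun (invmx Mg k l) z) = 1%:M.
by apply/matrixP => j l; rewrite !mxE -hz; apply: eq_bigr => k _; rewrite mxE.
Qed.

Lemma co_egd U E K W y a d : adapted H t U E K W -> U y -> co (Wg W y) d (eg t E K y a) = (feq a d)%:R.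
Proof.
move=> ad Uy; rewrite -{1}(sumF_delta (eg t E K y) a).
exact: (co_eg ad Uy (fun b => (feq a b)%:R)).
Qed.

Section Kernel.
Variables (E : 'I_q -> vf).
Hypothesis sE : forall j, @local_section R N rcal H p (E j).
Hypothesis Ep : forall j, E j p = row j E0.

Lemma adapted_at K : @local_section R N rcal H p K -> K p != 0 -> (K p <= Kd p)%MS ->
  exists U W, U p /\ adapted H t U E K W.
Proof.
move=> sK K0 KK; have sE' j : smoothv p (E j) by have /local_sectionP[] := sE j.
have [sK' KH] := (local_sectionP H p K).1 sK.
suff nH : \forall y \near p, [/\ forall j, (E j y <= H y)%MS, (K y <= H y)%MS & \rank (H y) = q.+1].
  exact: (adapted_exists (N_frame q) sE' sK' nH (span_at ip iso Ep K0 KK)).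
have EH : \forall y \near p, forall j, (E j y <= H y)%MS.
  by apply: near_forall => j; have /local_sectionP[] := sE j.
apply: filterS (filterI (image_near ip) (filterI EH KH)) => y [iy [h1 h2]].
by split=> //; apply: rank_H.
Qed.

Lemma levi_matrix_unit K U W : adapted H t U E K W -> U p ->
  map_mx (@gev R N p) (\matrix_(j, k) ecg t E K W p (fE j) (fEb k) fT) \in unitmx.
Proof.
move=> ad Up; rewrite (_ : map_mx _ _ = (- 2 * 'i) *: symH s).
  rewrite unitmxZ // unitfE mulf_eq0 oppr_eq0 pnatr_eq0 /=; exact: neq0Ci.
apply/matrixP => j k; rewrite !mxE (repg_ev (rep_ec ad _ _ _ Up)).
exact: (levi_at ct iso ad Up Ep).
Qed.

(** The structure gives [crK] point by point, so a smooth section has to be built. Subtract from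
    [K0] the combination [kap] of the [E_j] that restores Levi-orthogonality to every [conj E_k]; it
    exists because the Levi matrix of the [E_j] is invertible near [p], and it vanishes at [p]. *)
Lemma kernel_section K0 : @local_section R N rcal H p K0 -> K0 p != 0 -> (K0 p <= Kd p)%MS ->
  exists K, [/\ @local_section R N rcal H p K, K p = K0 p & \forall z \near p, (K z <= Kd z)%MS].
Proof.
move=> sK0 nK0 KK0; have [U [W [Up ad]]] := adapted_at sK0 nK0 KK0.
pose Hg := \matrix_(j, k) ecg t E K0 W p (fE j) (fEb k) fT.
pose Hf z := \matrix_(j, k) ecf t E K0 W (fE j) (fEb k) fT z.
have [uH _] : Hg \in unitmx /\ (\forall z \near p, Hf z \in unitmx).
  apply: near_unit (levi_matrix_unit ad Up) => j k; rewrite mxE.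
  by apply: repg_ext (rep_ec ad (fE j) (fEb k) fT Up) => z; rewrite mxE.
pose r := \row_k ecg t E K0 W p fK (fEb k) fT; pose kap := r *m invmx Hg.
have kapH k : \sum_j kap 0 j * ecg t E K0 W p (fE j) (fEb k) fT = ecg t E K0 W p fK (fEb k) fT.
  transitivity ((kap *m Hg) 0 k); first by rewrite [RHS]mxE; apply: eq_bigr => j _; rewrite [Hg j k]mxE.
  by rewrite mulmxKV // mxE.
have kap0 j : gev (kap 0 j) = 0.
  have : map_mx (@gev R N p) kap = 0.
    rewrite map_mxM (_ : map_mx _ r = 0) ?mul0mx //; apply/rowP => k; rewrite !mxE.
    apply: etrans (repg_ev (rep_ec ad fK (fEb k) fT Up)) _.
    exact: (kernel_bracket ct ad Up ip KK0).
  by move=> /rowP/(_ j); rewrite !mxE.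
pose x d := match d with fE j => - kap 0 j | fK => 1 | _ => 0 end : germ p.
pose Kg := sumF (fun d => x d *: eg t E K0 p d).
have coKg d : co (Wg W p) d Kg = x d by apply: (co_eg ad Up).
have rK := repv_fun Kg.
have sK := funv_smooth Kg.
have Kp : funv Kg p = K0 p.
  rewrite -(repv_ev rK) (sumF_morph (h := map_mx (@gev R N p))); [|exact: map_mxD|exact: map_mx0].
  rewrite (eq_sumF (g := fun d => (feq fK d)%:R *: fr t E K0 d p)); first by rewrite sumF_delta.
  move=> d; rewrite map_mxZ (mkv_eval (ad_smfr ad Up d)); congr (_ *: _).
  case: d => [j||j||] /=; try exact: rmorph0; last exact: rmorph1.
  by apply: etrans (rmorphN _ _) _; rewrite -[RHS]oppr0; congr (- _); exact: kap0.
have KH : \forall z \near p, (funv Kg z <= H z)%MS.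
  have h : \forall z \near p, forall d, coef W z (funv Kg z) d = gfun (x d) z.
    apply: near_frame => d; apply: (@repg_near _ _ p (x d)); last exact: repg_fun.
    by have := rep_co ad d Up rK; rewrite coKg.
  have h0 : \forall z \near p, gfun (0 : germ p) z = 0.
    by apply: (@repg_near _ _ p 0); [exact: repg_fun | split=> //; apply: sn_cst].
  apply: filterS (filterI h (filterI h0 (ad_near ad Up))) => z [hz [h0z Uz]].
  by apply: (coef_sub ad Uz) => -[j||j||] //= _; rewrite hz.
have sKl : @local_section R N rcal H p (funv Kg) by apply/local_sectionP.
have brT k : co (Wg W p) fT (gbr p Kg (eg t E K0 p (fEb k))) = 0.
  rewrite (frame_tensor (@gdD R N ^~ p) (@gdM R N ^~ p) (eg_co ad Up) (co_eg ad Up)); last 2 first.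
  - by rewrite coKg.
  - by rewrite (co_egd _ _ ad Up).
  rewrite (eq_sumF (g := fun b => (feq (fEb k) b)%:R *: (sumF (fun a => x a * ecg t E K0 W p a b fT) : (germ p)^o))); last first.
    by move=> b; rewrite (co_egd _ _ ad Up); congr (_ * _); apply: eq_sumF => a; rewrite coKg.
  apply: etrans (sumF_delta (V := (germ p)^o) (fun b => sumF (fun a => x a * ecg t E K0 W p a b fT)) (fEb k)) _.
  apply: etrans (sumF_kernel (kap 0) (fun a => ecg t E K0 W p a (fEb k) fT)) _.
  by apply/eqP; rewrite subr_eq0; apply/eqP; rewrite kapH.
have brT' : \forall z \near p, forall k, coef W z (@bracket R N rcal (funv Kg) (fr t E K0 (fEb k)) z) fT = 0.
  apply: near_forall => k; apply: (@repg_near _ _ p 0); last by split=> //; apply: sn_cst.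
  have := rep_co ad fT Up (repv_br rK (repv_mk (ad_smfr ad Up (fEb k)))).
  by rewrite [co _ _ _]brT.
have [U' [W' [Up' ad']]] : exists U W, U p /\ adapted H t U E (funv Kg) W.
  by apply: adapted_at sKl _ _; rewrite Kp.
exists (funv Kg); split=> //.
pose Hf' z := \matrix_(j, k) ecf t E (funv Kg) W' (fE j) (fEb k) fT z.
have [_ uH'] : (\matrix_(j, k) ecg t E (funv Kg) W' p (fE j) (fEb k) fT) \in unitmx /\ (\forall z \near p, Hf' z \in unitmx).
  apply: near_unit (levi_matrix_unit ad' Up') => j k; rewrite mxE.
  by apply: repg_ext (rep_ec ad' (fE j) (fEb k) fT Up') => z; rewrite mxE.
apply: filterS (filterI uH' (filterI brT' (filterI (ad_near ad Up) (filterI (ad_near ad' Up') (image_near ip))))).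
move=> z [uz [bz [Uz [Uz' iz]]]].
have /rowV0Pn[v vK v0] : Kd z != 0 by rewrite -mxrank_eq0 (cr_rank_kernel S iz).
have [vH lv] := (cr_levi_kernel S iz v).1 vK.
pose F' := fr t E (funv Kg).
(* The vector [v] is a nonzero kernel vector at [z]. The invertible Levi matrix annihilates its
   components along the [E_j], so [v] is proportional to the section just built. *)
have eq0 k : \sum_j coef W' z v (fE j) * Hf' z j k = 0.
  have [X [Y [sX sY Xz Yz b0]]] := lv _ (ad_E ad' Uz' k).
  have : coef W' z (@bracket R N rcal X Y z) fT = 0.
    have /eqP := levi_coef ct ad' Uz' b0; rewrite {1}/coef mul0mx mxE eq_sym mulf_eq0.
    by rewrite mulf_eq0 invr_eq0 pnatr_eq0 (negPf (neq0Ci _)) /= => /eqP.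
  rewrite (tensorT ct ad' Uz' sX sY) Xz (Yz : Y z = F' (fEb k) z).
  pose G b : C^o := sumF (fun a => coef W' z v a * ecf t E (funv Kg) W' a b fT z).
  rewrite (eq_sumF (g := fun b => (feq (fEb k) b)%:R *: G b)); last first.
    by move=> b; rewrite (coef_fr ad' _ _ Uz').
  have kk : ecf t E (funv Kg) W' fK (fEb k) fT z = 0.
    by apply: (sub_coefT ct ad' Uz'); apply: (coef_subT ad Uz); apply: bz.
  rewrite sumF_delta => G0; have := sumF_inH (V := C^o) (fun a => ecf t E (funv Kg) W' a (fEb k) fT z) (fun d => @sub_coef _ _ _ _ _ _ _ _ _ ad' z v d Uz' vH).
  move=> /(etrans (esym G0)); rewrite kk scaler0 addr0 => e0.
  by rewrite -[RHS](esym e0); apply: eq_bigr => j _; rewrite mxE.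
have c0 j : coef W' z v (fE j) = 0.
  have : (\row_j coef W' z v (fE j)) *m Hf' z = 0.
    by apply/rowP => k; rewrite !mxE -[RHS](eq0 k); apply: eq_bigr => l _; rewrite mxE.
  by move=> /(congr1 (mulmx^~ (invmx (Hf' z)))); rewrite mulmxK // mul0mx => /rowP/(_ j); rewrite !mxE.
have vE : v = coef W' z v fK *: funv Kg z.
  rewrite {1}(spanC ad' v Uz') sumF_inH; last by move=> d; apply: (sub_coef ad' Uz' vH).
  by rewrite big1 ?add0r // => j _; rewrite c0 scale0r.
have cn0 : coef W' z v fK != 0 by apply: contraNneq v0 => e0; rewrite vE e0 scale0r.
have -> : funv Kg z = (coef W' z v fK)^-1 *: v by rewrite {2}vE scalerA mulVf // scale1r.
exact: scalemx_sub.
Qed.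
End Kernel.
End Point.
End Chart.

(** * Normalisation of the frame at a point *)

Section Perturb.
Variables (A : comUnitRingType) (C : fieldType) (ev : {rmorphism A -> C}) (cst : {rmorphism C -> A}).
Variables (N : nat) (dd : 'I_N -> A -> A) (x : 'I_N -> A).
Hypothesis ddD : forall j f g, dd j (f + g) = dd j f + dd j g.
Hypothesis ddM : forall j f g, dd j (f * g) = dd j f * g + f * dd j g.
Hypothesis dd_cst : forall j c, dd j (cst c) = 0.
Hypothesis dd_x : forall i j, dd i (x j) = (j == i)%:R.
Hypothesis ev_cst : forall c, ev (cst c) = c.

(** It vanishes at the point and has differential [w]: coefficients of this kind change brackets at
    the point without changing the fields there. *)
Definition affine (w : 'I_N -> C) : A := \sum_j cst (w j) * (x j - cst (ev (x j))).

Lemma ev_affine w : ev (affine w) = 0.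
Proof. by rewrite rmorph_sum big1 // => j _; rewrite rmorphM rmorphB !ev_cst subrr mulr0. Qed.

Lemma dd_affine w l : dd l (affine w) = cst (w l).
Proof.
have ddn : dd l 0 = 0 by apply: (addrI (dd l 0)); rewrite -ddD !addr0.
rewrite /affine (big_morph (dd l) (ddD l) ddn) (bigD1 l) //= big1 => [|j jl].
  by rewrite addr0 ddM dd_cst mul0r add0r -rmorphN ddD dd_cst dd_x eqxx addr0 mulr1.
by rewrite ddM dd_cst mul0r add0r -rmorphN ddD dd_cst dd_x (negPf jl) addr0 mulr0.
Qed.

Lemma ev_actV_affine X w : ev (actV dd X (affine w)) = \sum_j ev (X 0 j) * w j.
Proof. by rewrite rmorph_sum; apply: eq_bigr => j _; rewrite rmorphM dd_affine ev_cst. Qed.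

Lemma ev_actV_cstM X f c : ev (actV dd X (f * cst c)) = ev (actV dd X f) * c.
Proof.
rewrite (actVM ddM) [actV dd X (cst c)]big1 => [|j _]; last by rewrite dd_cst mulr0.
by rewrite mulr0 addr0 rmorphM ev_cst.
Qed.

Definition affine2 w1 c1 w2 c2 := affine w1 * cst c1 + affine w2 * cst c2.
Lemma ev_affine2 w1 c1 w2 c2 : ev (affine2 w1 c1 w2 c2) = 0.
Proof. by rewrite rmorphD !rmorphM !ev_affine !mul0r addr0. Qed.
Lemma ev_actV_affine2 X w1 c1 w2 c2 : ev (actV dd X (affine2 w1 c1 w2 c2))
  = (\sum_j ev (X 0 j) * w1 j) * c1 + (\sum_j ev (X 0 j) * w2 j) * c2.
Proof. by rewrite (actVD ddD) rmorphD !ev_actV_cstM !ev_actV_affine. Qed.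

(** As the [g k] vanish at the point, only their derivatives along [X] are felt. *)
Lemma ev_br_perturb m X e (f : 'I_m -> 'rV[A]_N) g : (forall k, ev (g k) = 0) ->
  map_mx ev (br dd X (e + \sum_k g k *: f k))
  = map_mx ev (br dd X e) + \sum_k ev (actV dd X (g k)) *: map_mx ev (f k).
Proof.
move=> g0; rewrite (brDr ddD) (br_sumr ddD) map_mxD; congr (_ + _).
rewrite (big_morph (map_mx ev) (@map_mxD _ _ ev 1 N) (map_mx0 _ _ _)).
by apply: eq_bigr => k _; rewrite (brZr ddM) map_mxD !map_mxZ g0 scale0r addr0.
Qed.
End Perturb.

Section Chart.
Variables (R : realType) (q : nat).
Local Notation C := (cplx R).
Local Notation N := (2 * q.+1 + 1)%N.
Local Notation T := 'rV[R]_N.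
Local Notation vf := (T -> 'rV[C]_N).
Local Notation rcal := (real_calculus R N).
Local Notation dd p := (fun j => @gd R N j p).
Local Notation gbr p := (br (dd p)).
Variables (M : analytic_manifold R N) (S : CR_structure M) (i : chart M).
Local Notation H := (crH S i).
Local Notation Kd := (crK S i).
Local Notation Hb := (fun x => conjmx (H x)).
Implicit Types (E : 'I_q -> vf) (K : vf) (W : frame q -> T -> 'cV[C]_N) (U : set T).
Implicit Types (p y z : T) (X Y : vf) (t : 'rV[C]_N).

Variables (s : symbol R q).
Hypothesis Hs_unit : symH s \in unitmx.

Section Point.
Variables (p : T) (E0 : 'M[C]_(q, N)) (t : 'rV[C]_N).
Hypothesis ip : image i p.
Hypothesis ct : conjmx t = t.
Hypothesis iso : @symbol_iso R N q rcal (cr_dist S i) s p E0 (conjmx E0) t.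

Lemma coef_same U U' E E' K W W' v d : adapted H t U E K W -> adapted H t U' E' K W' -> U p -> U' p ->
  (forall j, E j p = E' j p) -> coef W' p v d = coef W p v d.
Proof.
move=> ad ad' Up Up' EE; rewrite {1}(spanC ad v Up).
rewrite (eq_sumF (g := fun a => coef W p v a *: fr t E' K a p)); last first.
  by case=> [j||j||] //=; rewrite EE.
exact: (coef_sumF ad' _ d Up').
Qed.

(** Add to [E_j] multiples of the [E_k] by functions vanishing at [p] whose derivatives along [K]
    and [conj K] are the opposites of the unwanted coefficients. Both derivatives can be prescribed
    at once because the differentials are taken from the dual coframe. *)
Lemma normalized_sections (E : 'I_q -> vf) (K : vf) :
  (forall j, @local_section R N rcal H p (E j)) -> (forall j, E j p = row j E0) ->
  @local_section R N rcal H p K -> K p != 0 -> (K p <= Kd p)%MS ->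
  exists E', [/\ forall j, @local_section R N rcal H p (E' j), forall j, E' j p = row j E0
    & forall U W, adapted H t U E' K W -> U p -> forall a, a = fK \/ a = fKb ->
        forall j k, ecf t E' K W a (fE j) (fE k) p = 0].
Proof.
move=> sE Ep sK nK KK; have [U [W [Up ad]]] := adapted_at ip iso sE Ep sK nK KK.
pose g j k : germ p := @affine2 (germ p) C (@gev R N p) (@gcst R N p) N (@gcoord R N p)
   (fun l => W fK p l 0) (- ecf t E K W fK (fE j) (fE k) p)
   (fun l => W fKb p l 0) (- ecf t E K W fKb (fE j) (fE k) p).
have g0 j k : gev (g j k) = 0 by apply: ev_affine2; apply: gev_cst.
pose Eg j := eg t E K p (fE j) + \sum_k g j k *: eg t E K p (fE k).
pose F j z := E j z + \sum_k gfun (g j k) z *: E k z.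
have rF j : repv (Eg j) (F j).
  apply: repvD; first exact: repv_mk (ad_smfr ad Up (fE j)).
  apply: repv_sum => k; apply: repvZ (repg_fun _) (repv_mk (ad_smfr ad Up (fE k))).
have Fp j : F j p = E j p.
  rewrite /F big1 ?addr0 // => k _.
  by rewrite -[gfun _ p]/(gev (g j k)) g0 scale0r.
exists F; split=> [j|j|].
- apply/local_sectionP; split; first by have [] := rF j.
  apply: filterS (ad_near ad Up) => z Uz; apply: addmx_sub; first exact: (ad_E ad Uz).
  by apply: summx_sub => k _; exact: scalemx_sub (ad_E ad Uz k).
- by rewrite Fp.
move=> U' W' ad' Up' a aK j k.
have sa : smoothv p (fr t E K a) by apply: (ad_smfr ad Up).
have E1 : @bracket R N rcal (fr t E K a) (F j) p = @bracket R N rcal (fr t E K a) (E j) p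
   + \sum_k (coef W p (fr t E K a p) fK * - ecf t E K W fK (fE j) (fE k) p
     + coef W p (fr t E K a p) fKb * - ecf t E K W fKb (fE j) (fE k) p) *: E k p.
  rewrite -(repv_ev (repv_br (repv_mk sa) (rF j))).
  rewrite (ev_br_perturb (@gdD R N ^~ p) (@gdM R N ^~ p)); last exact: g0.
  rewrite (repv_ev (repv_br (repv_mk sa) (repv_mk (ad_smfr ad Up (fE j))))); congr (_ + _).
  apply: eq_bigr => l _; rewrite (mkv_eval (ad_smfr ad Up (fE l))); congr (_ *: _).
  apply: etrans (ev_actV_affine2 (@gdD R N ^~ p) (@gdM R N ^~ p) (@gd_cst R N ^~ p)
     (fun a b => @gd_coord R N a b p) (@gev_cst R N p) _ _ _ _ _) _.
  congr (_ * _ + _ * _); rewrite /coef mxE; apply: eq_bigr => l' _;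
    by congr (_ * _); rewrite mxE; apply: gevE; apply: sa.
have aE : fr t F K a = fr t E K a by case: aK => ->.
rewrite /ecf aE [fr t F K _]/= E1 (coef_same _ _ ad ad') // cofD.
rewrite (_ : coef W p (\sum_l _) (fE k) = \sum_l (coef W p (fr t E K a p) fK * - ecf t E K W fK (fE j) (fE l) p
     + coef W p (fr t E K a p) fKb * - ecf t E K W fKb (fE j) (fE l) p) * coef W p (E l p) (fE k)); last first.
  rewrite /coef mulmx_suml summxE; apply: eq_bigr => l _; by rewrite -scalemxAl mxE.
rewrite (bigD1 k) //= big1 ?addr0 => [|l lk]; last first.
  by rewrite -[E l p]/(fr t E K (fE l) p) (coef_fr ad (fE l) (fE k) Up) /= (negPf lk) mulr0.
rewrite -[E k p]/(fr t E K (fE k) p) !(coef_fr ad) //= eqxx mulr1.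
by case: aK => ->; rewrite /= ?mul1r ?mul0r ?addr0 ?add0r subrr.
Qed.
End Point.
End Chart.

(** * Differentially closed, finitely generated ideals of smooth germs *)

Lemma ideal_seqP (A : comUnitRingType) (s : seq A) f : ideal (fun g => g \in s) f ->
  exists b : 'I_(size s) -> A, f = \sum_l b l * s`_l.
Proof.
elim=> [|a g h gs _ [b ->]].
  by exists (fun _ => 0); rewrite big1 // => l _; rewrite mul0r.
have is_ : (index g s < size s)%N by rewrite index_mem.
exists (fun l => (l == Ordinal is_)%:R * a + b l).
under [RHS]eq_bigr do rewrite mulrDl -mulrA.
rewrite [RHS]big_split /=; congr (_ + _).
rewrite (bigD1 (Ordinal is_)) //= (eqxx (Ordinal is_)) mul1r nth_index // big1 ?addr0 // => l ln.
by rewrite (negPf ln) mul0r.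
Qed.

Section GermODE.
Variables (R : realType) (N : nat).
Local Notation T := 'rV[R]_N.
Local Notation C := (cplx R).

Lemma smooth_near_bound (p : T) (f : T -> C) : smooth_near p f ->
  exists B : R, 0 <= B /\ \forall y \near p, `|complex.Re (f y)| <= B /\ `|complex.Im (f y)| <= B.
Proof.
move=> [U [oU Up [f1 f2]]].
have bd (u : T -> R) : smooth U u -> \forall y \near p, `|u y| <= `|u p| + 1.
  move=> su; have /cvgrPdist_le/(_ 1 ltr01) h := Ck_cont (su 0%N) Up.
  apply: filterS h => y h; rewrite -[u y](subrK (u p)) addrC.
  by apply: le_trans (ler_normD _ _) _; rewrite lerD2l distrC.
exists (Num.max (`|complex.Re (f p)| + 1) (`|complex.Im (f p)| + 1)); split.
  by rewrite le_max addr_ge0.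
by apply: filterS (filterI (bd _ f1) (bd _ f2)) => y [h1 h2]; rewrite !le_max h1 h2 orbT.
Qed.

(** Stability under derivation is a linear differential system whose coefficients are bounded near
    [p]. Real and imaginary parts are taken as separate unknowns, whence the factor 2 in the
    constant handed to [unique_continuation]. *)
Theorem germ_ideal_eq0 (p : T) (s : seq (germ p)) : (forall f : germ p, f \in s -> gev f = 0) ->
  (forall j (f : germ p), f \in s -> ideal (fun g => g \in s) (gd j f)) -> forall f : germ p, f \in s -> f = 0.
Proof.
move=> s0 sI; pose n := size s; pose u (k : 'I_n * bool) (y : T) : R :=
  if k.2 then complex.Re (gfun s`_k.1 y) else complex.Im (gfun s`_k.1 y).
have ms (k : 'I_n) : s`_k \in s by rewrite mem_nth.
have /choice[b bE] : forall jk : 'I_N * 'I_n, exists b : 'I_n -> germ p, gd jk.1 s`_jk.2 = \sum_l b l * s`_l.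
  by move=> [j k]; apply/ideal_seqP/sI/ms.
have /choice[B HB] : forall jkl : ('I_N * 'I_n) * 'I_n, exists B : R, 0 <= B /\
   \forall y \near p, `|complex.Re (gfun (b jkl.1 jkl.2) y)| <= B /\ `|complex.Im (gfun (b jkl.1 jkl.2) y)| <= B.
  by move=> [jk l]; apply: smooth_near_bound; apply: gfun_smooth.
pose B0 := \sum_jkl B jkl.
have BB jkl : B jkl <= B0.
  rewrite /B0 (bigD1 jkl) //= lerDl sumr_ge0 // => x _; by have [] := HB x.
have nB : \forall y \near p, forall jkl : ('I_N * 'I_n) * 'I_n,
    `|complex.Re (gfun (b jkl.1 jkl.2) y)| <= B0 /\ `|complex.Im (gfun (b jkl.1 jkl.2) y)| <= B0.
  apply: near_forall => jkl; have [_ h] := HB jkl.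
  by apply: filterS h => y [h1 h2]; split; [apply: le_trans h1 _ | apply: le_trans h2 _]; apply: BB.
have nE : \forall y \near p, forall jk : 'I_N * 'I_n,
    cd jk.1 (gfun s`_jk.2) y = \sum_l gfun (b jk l) y * gfun s`_l y.
  apply: near_forall => jk; apply: (@repg_near _ _ p (gd jk.1 s`_jk.2)).
    by split; [apply: sn_cd; apply: gfun_smooth | rewrite -{1}[s`_jk.2]gfunK gdE //; apply: gfun_smooth].
  by rewrite bE; apply: repg_sum => l; apply: repgM; apply: repg_fun.
have nS : \forall y \near p, forall k : 'I_n, smooth_near y (gfun s`_k).
  by apply: near_forall => k; apply: sn_near; apply: gfun_smooth.
have /choice[Uk HU] : forall k : 'I_n, exists U : set T, [/\ open U, U p & csmooth U (gfun s`_k)].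
  by move=> k; apply: gfun_smooth.
have nU : \forall y \near p, forall k, Uk k y.
  by apply: near_forall => k; have [oU Up _] := HU k; apply: open_nbhs_nbhs.
have [V [oV Vp hV]] := near_openP (filterI nU (filterI nB nE)).
have nV : nbhs p V by apply: open_nbhs_nbhs.
have Vsub k : V `<=` Uk k by move=> y /hV[].
have C1 k : Ck 1 V (u k).
  case: k => k [|]; have [_ _ [f1 f2]] := HU k; rewrite /u /=.
    by apply: Ck_sub (f1 1%N); apply: Vsub.
  by apply: Ck_sub (f2 1%N); apply: Vsub.
have u0 k : u k p = 0.
  have := s0 _ (ms k.1); rewrite /gev /u => ->; by case: k.2.
have B00 : 0 <= B0 by apply: sumr_ge0 => x _; have [] := HB x.
have bd := @unique_continuation R N _ u V p (n%:R * (2 * B0)) nV C1 u0 _.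
have {bd} zero : \forall y \near p, forall k, u k y = 0.
  apply: bd => -[k c] j y M Vy HM; have [_ [hB /(_ (j, k)) hE]] := hV y Vy.
  have {hE} hE : cd j (gfun s`_k) y = \sum_l gfun (b (j, k) l) y * gfun s`_l y := hE.
  have M0 : 0 <= M by apply: le_trans (HM (k, c)).
  have sumB (F : 'I_n -> R) : (forall l, `|F l| <= 2 * B0 * M) -> `|\sum_l F l| <= n%:R * (2 * B0) * M.
    move=> hF; apply: le_trans (ler_norm_sum _ _ _) _.
    apply: le_trans (ler_sum _ (fun l _ => hF l)) _.
    by rewrite sumr_const card_ord -[_ *+ n]mulr_natl !mulrA lexx.
  have ReS (F : 'I_n -> C) : complex.Re (\sum_l F l) = \sum_l complex.Re (F l).
    by apply: (big_morph (fun z : C => complex.Re z)) => // -[? ?] [? ?].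
  have ImS (F : 'I_n -> C) : complex.Im (\sum_l F l) = \sum_l complex.Im (F l).
    by apply: (big_morph (fun z : C => complex.Im z)) => // -[? ?] [? ?].
  have pb (x x' : R) : `|x| <= B0 -> `|x'| <= M -> `|x * x'| <= B0 * M.
    by move=> h h'; rewrite normrM ler_pM.
  have re : 'D_(delta_mx 0 j) (u (k, true)) y = complex.Re (cd j (gfun s`_k) y) by [].
  have im : 'D_(delta_mx 0 j) (u (k, false)) y = complex.Im (cd j (gfun s`_k) y) by [].
  case: c; [rewrite re hE ReS | rewrite im hE ImS]; apply: sumB => l.
    have := HM (l, true); have := HM (l, false); have [] := hB ((j, k), l); rewrite /u /=.
    case: (gfun (b (j, k) l) y) => a a'; case: (gfun s`_l y) => c c' /= h1 h2 h3 h4.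
    apply: le_trans (ler_normB _ _) _; rewrite -mulrA mulr2n mulrDl mul1r.
    by apply: lerD; apply: pb.
  have := HM (l, true); have := HM (l, false); have [] := hB ((j, k), l); rewrite /u /=.
  case: (gfun (b (j, k) l) y) => a a'; case: (gfun s`_l y) => c c' /= h1 h2 h3 h4.
  apply: le_trans (ler_normD _ _) _; rewrite -mulrA mulr2n mulrDl mul1r.
  by apply: lerD; [apply: pb | apply: pb].
move=> f fs; have is_ : (index f s < size s)%N by rewrite index_mem.
pose k := Ordinal is_; have -> : f = s`_k by rewrite nth_index.
rewrite -[s`_k]gfunK; apply: mkg_eq; first exact: gfun_smooth.
apply: filterS zero => y h; have := h (k, true); have := h (k, false); rewrite /u /=.
by case: (gfun _ y) => a a' /= -> ->.
Qed.
End GermODE.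

Lemma ideal_sumF (A : comUnitRingType) (G : A -> Prop) q (F : frame q -> A) :
  (forall a, ideal G (F a)) -> ideal G (sumF F).
Proof.
move=> h; rewrite /sumF; apply: idealD => //; apply: idealD => //.
apply: idealD; last by apply: ideal_sum => l _; apply: h.
by apply: idealD => //; apply: ideal_sum => l _; apply: h.
Qed.

(** * Symmetries in an adapted frame *)

Section Gens.
Variables (A : eqType) (q : nat) (z : frame q -> A) (b bb : 'I_q -> 'I_q -> A) (c cb : 'I_q -> A).
Let qs := enum 'I_q.
(** The generators [gen1] arranged as a list, the form required by [germ_ideal_eq0]. *)
Definition gens : seq A := [seq z (fE j) | j <- qs] ++ [seq z (fEb j) | j <- qs]
  ++ [:: z fK; z fKb; z fT] ++ [seq b j k | j <- qs, k <- qs] ++ [seq bb j k | j <- qs, k <- qs]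
  ++ [seq c j | j <- qs] ++ [seq cb j | j <- qs].
Let mq j : j \in qs. Proof. by rewrite mem_enum. Qed.
Lemma gens_z a : z a \in gens.
Proof.
rewrite !mem_cat; case: a => [j||j||].
- by rewrite (map_f (fun j => z (fE j)) (mq j)).
- by rewrite !inE eqxx !orbT.
- by rewrite (map_f (fun j => z (fEb j)) (mq j)) !orbT.
- by rewrite !inE eqxx !orbT.
- by rewrite !inE eqxx !orbT.
Qed.
Lemma gens_b j k : b j k \in gens.
Proof. by rewrite !mem_cat (allpairs_f b (mq j) (mq k)) !orbT. Qed.
Lemma gens_bb j k : bb j k \in gens.
Proof. by rewrite !mem_cat (allpairs_f bb (mq j) (mq k)) !orbT. Qed.
Lemma gens_c j : c j \in gens. Proof. by rewrite !mem_cat (map_f c (mq j)) !orbT. Qed.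
Lemma gens_cb j : cb j \in gens. Proof. by rewrite !mem_cat (map_f cb (mq j)) !orbT. Qed.
Lemma gens_ind f : f \in gens -> forall P : A -> Prop, (forall a, P (z a)) -> (forall j k, P (b j k)) ->
  (forall j k, P (bb j k)) -> (forall j, P (c j)) -> (forall j, P (cb j)) -> P f.
Proof.
move=> H P Pz Pb Pbb Pc Pcb; move: H; rewrite !mem_cat.
move=> /orP[/mapP[j _ ->]|] //; move=> /orP[/mapP[j _ ->]|] //.
move=> /orP[|]; first by rewrite !inE => /orP[/eqP ->|/orP[]/eqP ->].
move=> /orP[/allpairsP[[j k] [_ _ ->]]|] //; move=> /orP[/allpairsP[[j k] [_ _ ->]]|] //.
by move=> /orP[/mapP[j _ ->]|/mapP[j _ ->]].
Qed.
End Gens.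

Section Chart.
Variables (R : realType) (q : nat).
Local Notation C := (cplx R).
Local Notation N := (2 * q.+1 + 1)%N.
Local Notation T := 'rV[R]_N.
Local Notation vf := (T -> 'rV[C]_N).
Local Notation rcal := (real_calculus R N).
Local Notation dd p := (fun j => @gd R N j p).
Local Notation gbr p := (br (dd p)).
Variables (M : analytic_manifold R N) (S : CR_structure M) (i : chart M).
Local Notation H := (crH S i).
Local Notation Kd := (crK S i).
Local Notation Hb := (fun x => conjmx (H x)).
Implicit Types (E : 'I_q -> vf) (K : vf) (W : frame q -> T -> 'cV[C]_N) (U : set T).
Implicit Types (p y z : T) (X Y : vf) (t : 'rV[C]_N).

Variables (s : symbol R q).
Hypothesis Hs_unit : symH s \in unitmx.

Section Point.
Variables (p : T) (E0 : 'M[C]_(q, N)) (t : 'rV[C]_N).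
Hypothesis ip : image i p.
Hypothesis ct : conjmx t = t.
Hypothesis iso : @symbol_iso R N q rcal (cr_dist S i) s p E0 (conjmx E0) t.

Lemma frame_at : exists U (E : 'I_q -> vf) (K : vf) W,
  [/\ adapted H t U E K W, U p, forall j, E j p = row j E0,
   \forall z \near p, (K z <= Kd z)%MS
   & forall a, a = fK \/ a = fKb -> forall j k, ecf t E K W a (fE j) (fE k) p = 0].
Proof.
have [E [K0 [sE sK0 Ep nK0 KK0]]] := initial_sections ip iso.
have [K [sK Kp KK]] := kernel_section Hs_unit ip ct iso sE Ep sK0 nK0 KK0.
have nK : K p != 0 by rewrite Kp.
have KKp : (K p <= Kd p)%MS by rewrite Kp.
have [E' [sE' Ep' norm]] := normalized_sections ip iso sE Ep sK nK KKp.
have [U [W [Up ad]]] := adapted_at ip iso sE' Ep' sK nK KKp.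
by exists U, E', K, W; split=> // a aK j k; apply: norm ad Up a aK j k.
Qed.

Section Frame.
Variables (U : set T) (E : 'I_q -> vf) (K : vf) (W : frame q -> T -> 'cV[C]_N).
Hypotheses (ad : adapted H t U E K W) (Up : U p) (Ep : forall j, E j p = row j E0).
Hypothesis KK : \forall z \near p, (K z <= Kd z)%MS.
Hypothesis norm : forall a, a = fK \/ a = fKb -> forall j k, ecf t E K W a (fE j) (fE k) p = 0.
Local Notation e := (eg t E K p).
Local Notation w := (Wg W p).
Local Notation c := (ec (dd p) e w).
Let rfr d : repv (e d) (fr t E K d) := repv_mk (ad_smfr ad Up d).

Lemma section_fr d : inH d -> @local_section R N rcal H p (fr t E K d).
Proof.
move=> hd; apply/local_sectionP; split; first exact: (ad_smfr ad Up d).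
apply: filterS (ad_near ad Up) => z Uz; case: d hd => [j||j||] //= _; [exact: (ad_E ad Uz)|exact: (ad_K ad Uz)].
Qed.

Lemma c_HH a b d : inH a -> inH b -> ~~ inH d -> c a b d = 0.
Proof.
move=> ha hb nd; apply: (sec_co ad Up (repv_br (rfr a) (rfr b))) => //.
exact: bracket_H (ip) (section_fr ha) (section_fr hb).
Qed.

Lemma c_KT a : inH (bar a) -> c fK a fT = 0.
Proof.
move=> ha; have r0 : repg (0 : germ p) (fun=> 0) by split=> //; apply: sn_cst.
apply: (repg_eq (rep_ec ad fK a fT Up) r0).
apply: filterS (filterI KK (filterI (ad_near ad Up) (image_near ip))) => z [Kz [Uz iz]].
exact: (kernel_bracket ct ad Uz iz Kz ha).
Qed.

Lemma f_EE j k : [/\ forall l, c (fE j) (fE k) (fEb l) = 0, c (fE j) (fE k) fKb = 0 & c (fE j) (fE k) fT = 0].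
Proof. by split=> [l||]; apply: c_HH. Qed.
Lemma f_EK j : [/\ forall l, c (fE j) fK (fEb l) = 0, c (fE j) fK fKb = 0 & c (fE j) fK fT = 0].
Proof. by split=> [l||]; apply: c_HH. Qed.
Lemma f_KEb j : c fK (fEb j) fT = 0. Proof. exact: c_KT. Qed.
Lemma f_KKb : c fK fKb fT = 0. Proof. exact: c_KT. Qed.
Lemma f_norm j k : gev (c fK (fE j) (fE k)) = 0 /\ gev (c fKb (fE j) (fE k)) = 0.
Proof.
split; [apply: etrans (repg_ev (rep_ec ad fK (fE j) (fE k) Up)) _
  | apply: etrans (repg_ev (rep_ec ad fKb (fE j) (fE k) Up)) _]; apply: norm; by [left|right].
Qed.
Lemma f_unit : (\matrix_(j, k) gev (c (fE j) (fEb k) fT)) \in unitmx.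
Proof.
have := levi_matrix_unit Hs_unit ct iso Ep ad Up; congr (_ \in unitmx).
by apply/matrixP => j k; rewrite !mxE.
Qed.

Definition crF : cr_frame (@gev R N p) (@gcj R N p) q :=
  build_frame (@gdD R N ^~ p) (@gdM R N ^~ p) (fun a b => @gd_comm R N a b p)
    (eg_co ad Up) (co_eg ad Up) (fun a f => esym (@gd_cj R N a p f)) (eg_cj ct ad Up)
    f_EE f_EK f_KEb f_KKb f_norm f_unit.

Lemma hm_crF : hm crF = (- 2 * 'i) *: symH s.
Proof.
apply/matrixP => j k; rewrite !mxE.
apply: etrans (repg_ev (rep_ec ad (fE j) (fEb k) fT Up)) _.
exact: (levi_at ct iso ad Up Ep).
Qed.

Hypothesis cspA : csp s (block_mx 0 0 (symA s)^T 0).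

(** The isomorphism at [p] presents [symA] as [ad_v] with [v] in the kernel line, so [v = mu K].
    Tensoriality computes [ad_v] in the frame; the extension of [conj E_j] is known only modulo
    [conj K], which is harmless because [[K, conj K]] has no component along the [E_k]. *)
Lemma alm_crF : exists mu : C, (symA s)^T = mu *: alm crF.
Proof.
have [_ [_ pb _]] := iso.
have : g0p2 s (block_mx 0 0 (symA s)^T 0) by split=> //; exists 1; rewrite scale1r.
rewrite -pb => -[_ [v [B [vK /eq_block_mx[_ _ <- _] adv]]]].
have Kp : (K p <= Kd p)%MS := nbhs_singleton KK.
have nK : K p != 0.
  apply/eqP => K0; have := coef_fr ad fK fK Up; rewrite /= K0 /coef mul0mx mxE.
  by move=> /esym/eqP; rewrite oner_eq0.
have /sub_rVP[mu vE] : (v <= K p)%MS := submx_trans vK (kernel_line ip nK Kp).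
exists mu; apply/matrixP => j k; rewrite [RHS]mxE.
have [X [Y [/local_sectionP[sX XK] sY Xp Yp b0]]] := adv j.
have [sY' YH] := (local_sectionP _ _ _).1 sY.
have X0 : co w (fE k) (mkv p X) = 0.
  have r0 : repg (0 : germ p) (fun=> 0) by split=> //; apply: sn_cst.
  apply: (repg_eq (rep_co ad (fE k) Up (repv_mk sX)) r0).
  apply: filterS (filterI XK (filterI KK (filterI (ad_near ad Up) (image_near ip)))) => z [Xz [Kz [Uz iz]]].
  have nKz : K z != 0.
    apply/eqP => K0; have := coef_fr ad fK fK Uz; rewrite /= K0 /coef mul0mx mxE.
    by move=> /esym/eqP; rewrite oner_eq0.
  have /sub_rVP[a ->] := submx_trans Xz (kernel_line iz nKz Kz).
  by rewrite -scalemxAl mxE -[(_ *m _) 0 0]/(coef W z (fr t E K fK z) (fE k)) (coef_fr ad) //= mulr0.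
have Y0 : co w (fE k) (mkv p Y) = 0.
  exact: (sec_cob ct ad Up (repv_mk sY') YH).
have := tensor ad Up sX sY' X0 Y0; rewrite Xp vE => br0.
have bK b : sumF (fun a => coef W p (mu *: K p) a * ecf t E K W a b (fE k) p) = mu * ecf t E K W fK b (fE k) p.
  rewrite -[RHS]/(mu *: (ecf t E K W fK b (fE k) p : C^o)).
  rewrite -(sumF_delta (fun a => ecf t E K W a b (fE k) p : C^o) fK).
  rewrite [RHS](sumF_morph (h := *:%R mu)); [|exact: scalerDr|exact: scaler0].
  apply: eq_sumF => a; rewrite cofZ -[K p]/(fr t E K fK p) (coef_fr ad) //.
  by rewrite scalerA.
have {br0} := etrans br0 (eq_sumF (fun b => congr1 (fun x => coef W p (Y p) b * x) (bK b))).
have [beta YE] : exists beta, Y p = fr t E K (fEb j) p + beta *: fr t E K fKb p.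
  have Kbp : (dKb (cr_dist S i) p <= conjmx (K p))%MS.
    by rewrite map_submx; apply: kernel_line ip nK Kp.
  have /sub_rVP[beta YE] := submx_trans Yp Kbp.
  exists beta; rewrite -[Y p](subrK (row j (conjmx E0))) YE addrC; congr (_ + _).
  by rewrite /= Ep; apply/rowP => l; rewrite !mxE.
rewrite YE => br0.
have KKb0 : ecf t E K W fK fKb (fE k) p = 0.
  rewrite -(repg_ev (rep_ec ad fK fKb (fE k) Up)).
  have -> : ecg t E K W p fK fKb (fE k) = 0 by have [[[_ e0] _] _] := cKKb crF (@gev_unit R N p) k; exact: e0.
  exact: rmorph0.
have br1 : coef W p (@bracket R N rcal X Y p) (fE k) = mu * ecf t E K W fK (fEb j) (fE k) p.
  rewrite br0 -(sumF_delta (fun b => mu * ecf t E K W fK b (fE k) p : C^o) (fEb j)).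
  rewrite -[RHS]addr0 -[X in _ = _ + X](_ : beta * (mu * ecf t E K W fK fKb (fE k) p) = 0); last by rewrite KKb0 !mulr0.
  rewrite -[X in _ = _ + beta * X](sumF_delta (fun b => mu * ecf t E K W fK b (fE k) p : C^o) fKb).
  rewrite -[X in _ = _ + X]/(beta *: (_ : C^o)) [X in _ = _ + X](sumF_morph (h := *:%R beta)); [|exact: scalerDr|exact: scaler0].
  rewrite -sumFD; apply: eq_sumF => b; rewrite cofD cofZ !(coef_fr ad) // mulrDl.
  by rewrite -[X in _ + X = _]mulrA.
have lhs : coef W p (row j ((symA s)^T *m E0)) (fE k) = (symA s)^T j k.
  have -> : row j ((symA s)^T *m E0) = \sum_l (symA s)^T j l *: fr t E K (fE l) p.
    by rewrite row_mul mulmx_sum_row; apply: eq_bigr => l _; rewrite [row j _ 0 l]mxE /= Ep.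
  rewrite /coef mulmx_suml summxE (bigD1 k) //= big1 ?addr0 => [|l lk].
    by rewrite -scalemxAl mxE -[X in _ * X]/(coef W p (fr t E K (fE k) p) (fE k)) (coef_fr ad) //= eqxx mulr1.
  by rewrite -scalemxAl mxE -[X in _ * X]/(coef W p (fr t E K (fE l) p) (fE k)) (coef_fr ad) //= (negPf lk) mulr0.
rewrite -lhs [alm crF j k]mxE [ALm crF j k]mxE.
apply: etrans _ (esym (congr1 ( *%R mu) (repg_ev (rep_ec ad fK (fEb j) (fE k) Up)))).
rewrite -br1; apply/eqP; rewrite -subr_eq0; apply/eqP.
rewrite -mulN1r -cofZ -cofD scaleN1r.
move: b0 => /sub_addsmxP[[x y] /= ->]; rewrite cofD.
have -> : coef W p (x *m Kd p) (fE k) = 0.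
  have /sub_rVP[a ->] := submx_trans (submxMl x (Kd p)) (kernel_line ip nK Kp).
  by rewrite cofZ -[K p]/(fr t E K fK p) (coef_fr ad) //= mulr0.
by rewrite add0r; apply: (sub_coefb ct ad Up (submxMl _ _)).
Qed.

Section Symmetry.
Variable Zr : T -> 'rV[R]_N.
Hypothesis Z_smooth : forall k, smooth (image i) (fun x => Zr x 0 k).
Hypothesis Z_sym : forall x, image i x -> forall X, @local_section R N rcal H x X ->
  (@bracket R N rcal (fun y => toCmx (Zr y)) X x <= H x)%MS.
Local Notation Zc := (fun y => toCmx (Zr y)).

Lemma Z_smoothv : smoothv p Zc.
Proof.
move=> k; exists (image i); split; [exact: coord_open|exact: ip|].
split=> n; first by apply: Ck_ext (Z_smooth k n) => [|x _]; [exact: coord_open | rewrite mxE].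
by apply: Ck_ext (Ck_cst n (image i) 0) => [|x _]; [exact: coord_open | rewrite mxE].
Qed.
Let rZ := repv_mk Z_smoothv.

Lemma Z_conj : map_mx (@gcj R N p) (mkv p Zc) = mkv p Zc.
Proof.
rewrite (mkv_conj Z_smoothv); congr (mkv p _); apply/funext => y; apply/rowP => k.
by rewrite !mxE; apply/eqP; rewrite eq_complex /= oppr0 !eqxx.
Qed.

Lemma Z_H a d : inH a -> ~~ inH d -> em (dd p) e w (mkv p Zc) a d = 0.
Proof.
move=> ha nd; apply: (sec_co ad Up (repv_br rZ (rfr a))) => //.
apply: filterS (filterI (local_section_near (section_fr ha)) (image_near ip)) => y [sy iy].
exact: Z_sym.
Qed.

Lemma Z_E j : [/\ forall k, em (dd p) e w (mkv p Zc) (fE j) (fEb k) = 0,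
  em (dd p) e w (mkv p Zc) (fE j) fKb = 0 & em (dd p) e w (mkv p Zc) (fE j) fT = 0].
Proof. by split=> [k||]; apply: Z_H. Qed.
Lemma Z_K : [/\ forall k, em (dd p) e w (mkv p Zc) fK (fEb k) = 0,
  em (dd p) e w (mkv p Zc) fK fKb = 0 & em (dd p) e w (mkv p Zc) fK fT = 0].
Proof. by split=> [k||]; apply: Z_H. Qed.

Definition crZ : cr_symmetry crF :=
  build_symmetry (@gdD R N ^~ p) (@gdM R N ^~ p) (fun a b => @gd_comm R N a b p)
    (eg_co ad Up) (co_eg ad Up) (fun a f => esym (@gd_cj R N a p f)) (eg_cj ct ad Up)
    f_EE f_EK f_KEb f_KKb f_norm f_unit Z_conj Z_E Z_K.

Lemma sz_ev a : gev (sz crZ a) = coef W p (Zc p) a.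
Proof. exact: (repg_ev (rep_co ad a Up rZ)). Qed.
Lemma sm_ev a d : gev (sm crZ a d) = coef W p (@bracket R N rcal Zc (fr t E K a) p) d.
Proof. exact: (repg_ev (rep_co ad d Up (repv_br rZ (rfr a)))). Qed.

Hypothesis nonreg : forall x : C, alm crF *m map_mx Num.conj (alm crF) *m (alm crF *m hm crF)
   <> x *: (alm crF *m hm crF).

Lemma gd_frame j f : gd j f = sumF (fun a => co w a (delta_mx 0 j) * fD crF a f).
Proof.
apply: etrans _ (actV_co (dd p) (eg_co ad Up) (delta_mx 0 j) f).
rewrite /actV (bigD1 j) //= mxE !eqxx mul1r big1 ?addr0 // => l lj.
by rewrite mxE (negPf lj) andbF mul0r.
Qed.

(** [symmetry_closed] gives stability in the frame directions; the coordinate derivatives are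
    combinations of these by [gd_frame], and [germ_ideal_eq0] concludes. *)
Theorem symmetry_zero_near : (forall a, gev (sz crZ a) = 0) -> bv crZ = 0 -> ccv crZ = 0 ->
  \forall y \near p, Zr y = 0.
Proof.
move=> z0 b0 c0.
have bE j k : gev (sm crZ (fE j) (fE k)) = 0 by have /matrixP/(_ j k) := b0; rewrite !mxE.
have cE j : gev (sm crZ (fE j) fK) = 0 by have /matrixP/(_ j 0) := c0; rewrite !mxE.
have cjE a d : gev (sm crZ a d) = 0 -> gev (sm crZ (bar a) (bar d)) = 0.
  by move=> h; rewrite -sm_cj gev_cj h conjC0.
pose gs : seq (germ p) := gens (sz crZ) (fun j k => sm crZ (fE j) (fE k)) (fun j k => sm crZ (fEb j) (fEb k))
  (fun j => sm crZ (fE j) fK) (fun j => sm crZ (fEb j) fKb).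
have gsP f : f \in gs <-> gen1 crZ f.
  split; last first.
    by case=> [g []|j|j]; [apply: gens_z|move=> j k; apply: gens_b|move=> j k; apply: gens_bb|apply: gens_c|apply: gens_cb].
  by move=> /gens_ind; apply=> *; [exact/gen1_0/gen0_z|exact/gen1_0/gen0_b|exact/gen1_0/gen0_bb|exact: gen1_c|exact: gen1_cb].
have gs0 : forall f : germ p, f \in gs -> f = 0.
  have g0 f : f \in gs -> gev f = 0.
    move=> /gsP Gf; case: Gf => [g Gg|j|j]; last 2 first.
    - exact: cE.
    - exact: (cjE (fE j) fK (cE j)).
    case: Gg => [a|j k|j k]; [exact: z0|exact: bE|exact: (cjE (fE j) (fE k) (bE j k))].
  apply: (germ_ideal_eq0 g0) => j f /gsP Gf.
  have I a : ideal (fun g => g \in gs) (fD crF a f).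
    apply: (@ideal_sub _ (gen1 crZ)) => [g /gsP Hg|]; first exact: ideal_gen.
    apply: (symmetry_closed (@gev_cj R N p) (@gev_unit R N p) nonreg (@gev_cst R N p)).
    exact: ideal_gen.
  have I' a : ideal (fun g => g \in gs) (co w a (delta_mx 0 j) * fD crF a f) := idealM _ (I a).
  rewrite gd_frame; exact: (ideal_sumF I').
have sz0 a : sz crZ a = 0 by apply/gs0/gsP/gen1_0/gen0_z.
have Z0 : mkv p Zc = 0.
  rewrite [LHS](eg_co ad Up) -(sumF0 q ('rV[germ p]_N)); apply: eq_sumF => a.
  by rewrite [co _ _ _]sz0 scale0r.
have r0 : repv (0 : 'rV[germ p]_N) (fun=> 0).
  split=> [k|]; last by apply/rowP => k; rewrite !mxE; congr (mkg p _); apply/funext => y; rewrite mxE.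
  by rewrite (_ : (fun y => _) = fun=> 0); [apply: sn_cst | apply/funext => y; rewrite mxE].
have := repv_near (Y := fun=> 0) rZ; rewrite Z0 => /(_ r0) h.
apply: filterS h => y /rowP h; apply/rowP => k; have := h k.
by rewrite !mxE => /(congr1 (fun z : C => complex.Re z)).
Qed.
End Symmetry.
End Frame.
End Point.
End Chart.

(** * Linear algebra of the canonical blocks *)

Section Jordan.
Variable R : realType.
Local Notation C := (cplx R).
Local Notation J := (@jordan R).

Lemma mulJ m n (a : C) (X : 'M[C]_(m, n)) (r r' : 'I_m) c : r.+1 = r' :> nat ->
  (J a m *m X) r c = a * X r c + X r' c.
Proof.
move=> rr; have rn : r' != r by apply/eqP => e; move: rr; rewrite e; lia.
rewrite mxE (bigD1 r) //= mxE eqxx; congr (_ + _).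
rewrite (bigD1 r') //= mxE eq_sym (negPf rn) rr eqxx mul1r big1 ?addr0 // => k /andP[kr kr'].
rewrite mxE eq_sym (negPf kr); case: eqP => [e|]; last by rewrite mul0r.
by move: kr'; rewrite -val_eqE /= -rr e eqxx.
Qed.

Lemma mulJ_last m n (a : C) (X : 'M[C]_(m, n)) (r : 'I_m) c : r.+1 = m ->
  (J a m *m X) r c = a * X r c.
Proof.
move=> rm; rewrite mxE (bigD1 r) //= mxE eqxx big1 ?addr0 // => k kr.
rewrite mxE eq_sym (negPf kr); case: eqP => [e|]; last by rewrite mul0r.
by have := ltn_ord k; rewrite -e rm ltnn.
Qed.

Lemma mulJr m n (a : C) (X : 'M[C]_(m, n)) r (c c' : 'I_n) : c'.+1 = c :> nat ->
  (X *m J a n) r c = X r c * a + X r c'.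
Proof.
move=> cc; have cn : c' != c by apply/eqP => e; move: cc; rewrite e; lia.
rewrite mxE (bigD1 c) //= mxE eqxx; congr (_ + _).
rewrite (bigD1 c') //= mxE (negPf cn) cc eqxx mulr1 big1 ?addr0 // => k /andP[kc kc'].
rewrite mxE (negPf kc); case: eqP => [e|]; last by rewrite mulr0.
by move: kc'; rewrite -val_eqE /=; move: e; rewrite -cc; lia.
Qed.

Lemma mulJr0 m n (a : C) (X : 'M[C]_(m, n)) r (c : 'I_n) : c = 0%N :> nat ->
  (X *m J a n) r c = X r c * a.
Proof.
move=> c0; rewrite mxE (bigD1 c) //= mxE eqxx big1 ?addr0 // => k kc.
by rewrite mxE (negPf kc) c0 mulr0.
Qed.

(** Each column of [U] is the image of the next one under [L - a], so vanishing propagates to the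
    left from the last column. In [first_row0] it propagates downwards from the first row. *)
Lemma last_col0 m n (a : C) (U : 'M[C]_(m, n)) (L : 'M[C]_m) :
  U *m J a n = L *m U -> (forall r (c : 'I_n), c.+1 = n -> U r c = 0) -> U = 0.
Proof.
move=> e h; suff H k : forall c : 'I_n, (c + k.+1 = n)%N -> forall r, U r c = 0.
  apply/matrixP => r c; rewrite [RHS]mxE; apply: (H (n - c.+1)%N); have := ltn_ord c; lia.
elim: k => [|k IH] c ck r; first by apply: h; lia.
have c1n : (c.+1 < n)%N by lia.
have z r' : U r' (Ordinal c1n) = 0 by apply: IH => /=; lia.
have := congr1 (fun Z : 'M[C]_(m, n) => Z r (Ordinal c1n)) e.
rewrite (@mulJr _ _ _ _ _ _ c) // z mul0r add0r => ->.
by rewrite mxE big1 // => l _; rewrite z mulr0.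
Qed.

Lemma first_row0 m n (a : C) (U : 'M[C]_(m, n)) (L : 'M[C]_n) :
  U *m L = J a m *m U -> (forall (r : 'I_m) c, r = 0%N :> nat -> U r c = 0) -> U = 0.
Proof.
move=> e h; suff H k : forall r : 'I_m, r = k :> nat -> forall c, U r c = 0.
  by apply/matrixP => r c; rewrite [RHS]mxE; apply: (H r).
elim: k => [|k IH] r rk c; first exact: h.
have km : (k < m)%N by have := ltn_ord r; lia.
have := congr1 (fun Z : 'M[C]_(m, n) => Z (Ordinal km) c) e.
rewrite (@mulJ _ _ _ _ _ r) // (IH (Ordinal km)) // mulr0 add0r => <-.
by rewrite mxE big1 // => l _; rewrite IH // mul0r.
Qed.

(** From left to right, the invertible [L - a] kills each column once the previous one is 0. *)
Lemma sylvester m n (a : C) (U : 'M[C]_(m, n)) (L : 'M[C]_m) :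
  L - a%:M \in unitmx -> U *m J a n = L *m U -> U = 0.
Proof.
move=> uL e; have col0 (c : 'I_n) : (forall r, (U *m J a n) r c = U r c * a) -> forall r, U r c = 0.
  move=> h r; have z : (L - a%:M) *m col c U = 0.
    apply/colP => r'; rewrite mulmxBl mul_scalar_mx (_ : L *m col c U = col c (U *m J a n)); last by rewrite e !colE mulmxA.
    transitivity ((U *m J a n) r' c - a * U r' c); last by rewrite h mulrC subrr mxE.
    by rewrite [LHS]mxE; congr (_ + _); [rewrite mxE | rewrite !mxE].
  have /colP/(_ r) := congr1 (mulmx (invmx (L - a%:M))) z.
  by rewrite mulKmx // mulmx0 !mxE.
suff H k : forall c : 'I_n, c = k :> nat -> forall r, U r c = 0.
  by apply/matrixP => r c; rewrite [RHS]mxE; apply: (H c).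
elim: k => [|k IH] c ck; first by apply: col0 => r; apply: mulJr0.
have kn : (k < n)%N by have := ltn_ord c; lia.
by apply: col0 => r; rewrite (@mulJr _ _ _ _ _ _ (Ordinal kn)) // (IH (Ordinal kn)) // addr0.
Qed.

Lemma jordan_sub m (a b : C) : J a m - b%:M = J (a - b) m.
Proof.
apply/matrixP => i j; rewrite !mxE; case: (i == j); first by rewrite mulr1n.
by rewrite mulr0n subr0.
Qed.

Lemma jordan_unit m (a : C) : a != 0 -> J a m \in unitmx.
Proof.
move=> a0; rewrite -unitmx_tr unitmxE det_trig.
  by rewrite unitfE; apply/prodf_neq0 => i _; rewrite !mxE eqxx.
apply/is_trig_mxP => i j ij; rewrite !mxE; case: eqP => [e|_]; first by move: ij; rewrite e ltnn.
by case: eqP => // e; move: ij; rewrite -e; lia.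
Qed.

Lemma sylvesterJ m n (a b : C) (U : 'M[C]_(m, n)) : a != b -> U *m J a n = J b m *m U -> U = 0.
Proof. by move=> ab; apply: sylvester; rewrite jordan_sub jordan_unit // subr_eq0 eq_sym. Qed.

Lemma conj_jordan m (a : C) : conjmx (J a m) = J a^* m.
Proof. by apply/matrixP => i j; rewrite !mxE; case: ifP => // _; case: ifP => _; rewrite ?conjC1 ?conjC0. Qed.

(** The case [z = 1] covers the commutant of a Jordan block, and [z = -1] with [a = 0] the matrices
    anticommuting with a nilpotent block: constant diagonals, up to alternating signs in the second
    case. *)
Lemma toeplitz m (a : C) (U : 'M[C]_m) (z : C) : U *m J a m = z *: (J a m *m U) -> z * z = 1 -> 
  (z = 1 \/ a = 0) -> forall (r c r' c' : 'I_m), r.+1 = r' -> c.+1 = c' -> U r' c' = z * U r c.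
Proof.
move=> e zz za r c r' c' rr cc; have := congr1 (fun Z : 'M[C]_m => Z r c') e.
rewrite [RHS]mxE (@mulJr _ _ _ _ _ _ c) // (@mulJ _ _ _ _ _ r') // => e1.
have : U r c = z * U r' c'.
  case: za => [z1|a0]; last by move: e1; rewrite a0 mulr0 mul0r !add0r.
  move: e1; rewrite z1 !mul1r mulrC => /addrI //.
by move=> ->; rewrite mulrA zz mul1r.
Qed.

Lemma toeplitz_row m (a : C) (U : 'M[C]_m) (z : C) : U *m J a m = z *: (J a m *m U) -> z * z = 1 ->
  (z = 1 \/ a = 0) -> forall (r0 c0 r c : 'I_m), r0 = 0%N :> nat -> (r + c0 = c)%N -> U r c = z ^+ r * U r0 c0.
Proof.
move=> e zz za r0 c0 r c r00 rc.
suff H k : forall r' c' : 'I_m, r' = k :> nat -> (k + c0 = c')%N -> U r' c' = z ^+ k * U r0 c0.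
  by apply: H.
elim: k => [|k IH] r' c' r'k c'k.
  by rewrite expr0 mul1r; congr (U _ _); apply: val_inj => /=; rewrite ?r'k ?r00 // -c'k.
have km : (k < m)%N by have := ltn_ord r'; lia.
have kcm : (k + c0 < m)%N by have := ltn_ord c'; lia.
rewrite (toeplitz e zz za (r := Ordinal km) (c := Ordinal kcm)) //=; try lia.
by rewrite (IH (Ordinal km) (Ordinal kcm)) // exprS mulrA.
Qed.

Local Notation S := (antidiag R).
(** The adjoint for the symmetric form [antidiag], see [adjE]. *)
Definition adj m (X : 'M[C]_m) : 'M[C]_m := \matrix_(r, c) X (rev_ord c) (rev_ord r).

Lemma antidiagE m n (X : 'M[C]_(m, n)) r c : (S m *m X) r c = X (rev_ord r) c.
Proof.
rewrite mxE (bigD1 (rev_ord r)) //= mxE /= (_ : (_ == m) = true) ?mul1r; last by have := ltn_ord r; lia.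
rewrite big1 ?addr0 // => k kr; rewrite mxE; case: eqP => [e|]; last by rewrite mul0r.
by case/eqP: kr; apply: val_inj => /=; have := ltn_ord r; lia.
Qed.
Lemma antidiagEr m n (X : 'M[C]_(m, n)) r c : (X *m S n) r c = X r (rev_ord c).
Proof.
rewrite mxE (bigD1 (rev_ord c)) //= mxE /= (_ : (_ == n) = true) ?mulr1; last by have := ltn_ord c; lia.
rewrite big1 ?addr0 // => k kr; rewrite mxE; case: eqP => [e|]; last by rewrite mulr0.
by case/eqP: kr; apply: val_inj => /=; have := ltn_ord c; lia.
Qed.
Lemma antidiag_inv m : S m *m S m = 1%:M.
Proof.
apply/matrixP => r c; rewrite antidiagE !mxE /=; congr (nat_of_bool _)%:R.
by rewrite -val_eqE /=; have := ltn_ord r; have := ltn_ord c; lia.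
Qed.
Lemma adjE m (X : 'M[C]_m) : adj X = S m *m X^T *m S m.
Proof. by apply/matrixP => r c; rewrite antidiagEr antidiagE !mxE. Qed.
Lemma antidiag_sym m : (S m)^T = S m.
Proof. by apply/matrixP => r c; rewrite !mxE addnC. Qed.
Lemma jordan_adj m (a : C) : (J a m)^T *m S m = S m *m J a m.
Proof.
apply/matrixP => r c; rewrite antidiagE antidiagEr !mxE.
rewrite (_ : (rev_ord c == r) = (rev_ord r == c)); last first.
  by apply/eqP/eqP => <-; rewrite rev_ordK.
case: ifP => // _; rewrite /=; congr (if _ then _ else _).
by have := ltn_ord r; have := ltn_ord c; lia.
Qed.

(** Commuting with a Jordan block makes [X] an upper triangular Toeplitz matrix, hence self-adjoint,
    and a skew one must vanish. *)
Lemma commutant_adj0 m (a : C) (X : 'M[C]_m) : X *m J a m = J a m *m X -> X = - adj X -> X = 0.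
Proof.
move=> e Xa; apply: (first_row0 e) => r c r0.
have rm := ltn_ord r; have cm := ltn_ord c.
have E : X *m J a m = 1 *: (J a m *m X) by rewrite scale1r.
have pm : (m.-1 < m)%N by lia.
have := toeplitz_row (r0 := r) (c0 := c) (r := rev_ord c) (c := Ordinal pm) E (mulr1 1) (or_introl (erefl _)) r0.
rewrite expr1n mul1r => h; have := congr1 (fun Z : 'M[C]_m => Z r c) Xa.
rewrite [RHS]mxE [X in - X]mxE (_ : rev_ord r = Ordinal pm); last by apply: val_inj => /=; lia.
rewrite h /=; [|lia] => /eqP; rewrite -addr_eq0 -mulr2n mulrn_eq0 /= => /eqP //.
Qed.

(** Self-adjointness equates the two ends of each diagonal, while the alternating sign makes them
    opposite when the first-row entry is at odd distance from the last column. The even distances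
    remain free, which is the origin of [uphalf m]. *)
Lemma anticommutant_adj m (X : 'M[C]_m) : X *m J 0 m = - (J 0 m *m X) -> X = adj X ->
  (forall (r c : 'I_m), r = 0%N :> nat -> ~~ odd (m.-1 - c) -> X r c = 0) -> X = 0.
Proof.
move=> e Xa h; have E : X *m J 0 m = (-1) *: (J 0 m *m X) by rewrite scaleN1r.
have E' : X *m (- J 0 m) = J 0 m *m X by rewrite mulmxN e opprK.
apply: (first_row0 E') => r c r0.
have rm := ltn_ord r; have cm := ltn_ord c.
have [od|ev] := boolP (odd (m.-1 - c)); last exact: h.
have pm : (m.-1 < m)%N by lia.
have n1 : -1 * -1 = 1 :> C by rewrite mulrNN mulr1.
have := toeplitz_row (r0 := r) (c0 := c) (r := rev_ord c) (c := Ordinal pm) E n1 (or_intror (erefl _)) r0.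
move=> h'; have := congr1 (fun Z : 'M[C]_m => Z r c) Xa.
rewrite [RHS]mxE (_ : rev_ord r = Ordinal pm); last by apply: val_inj => /=; lia.
rewrite h' /=; [|lia]; rewrite -signr_odd (_ : odd (m - c.+1) = true) ?expr1; last by move: od; congr (odd _); lia.
by rewrite mulN1r => /eqP; rewrite -addr_eq0 -mulr2n mulrn_eq0 /= => /eqP.
Qed.
End Jordan.

(** * Counting the intertwiners of canonical blocks *)

Section Bounds.
Variable R : realType.
Local Notation C := (cplx R).
Local Notation J := (@jordan R).

(* The elements of [P] are determined by [d] linear coordinates. *)
Definition det1 m n (P : 'M[C]_(m, n) -> Prop) d := exists w : 'I_d -> 'M[C]_(m, n),
  forall U, P U -> (forall l, \sum_r \sum_c w l r c * U r c = 0) -> U = 0.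

Definition lin2 a b m n (g : 'M[C]_(a, b) -> 'M[C]_(a, b) -> 'M[C]_(m, n)) :=
  forall z X X' Y Y', g (z *: X + X') (z *: Y + Y') = z *: g X Y + g X' Y'.

(* A linear space of pairs of dimension at most [d], presented by [d] equations
   that cut it down to 0; unlike a dimension this needs no subspace structure. *)
Definition bounded a b (Q : 'M[C]_(a, b) -> 'M[C]_(a, b) -> Prop) d :=
  exists f : 'M[C]_(a, b) -> 'M[C]_(a, b) -> 'rV[C]_d,
    lin2 f /\ forall X Y, Q X Y -> f X Y = 0 -> X = 0 /\ Y = 0.

Lemma bounded0 a b (Q : 'M[C]_(a, b) -> 'M[C]_(a, b) -> Prop) :
  (forall X Y, Q X Y -> X = 0 /\ Y = 0) -> bounded Q 0.
Proof.
move=> h; exists (fun _ _ => 0); split=> [z X X' Y Y'|X Y /h] //.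
by rewrite scaler0 addr0.
Qed.

(** Counting in stages: [d] coordinates detect the image under [g], and the kernel of [g] is counted
    separately. *)
Lemma bounded_piece a b m n (Q : 'M[C]_(a, b) -> 'M[C]_(a, b) -> Prop) (g : 'M[C]_(a, b) -> 'M[C]_(a, b) -> 'M[C]_(m, n)) P d d' :
  lin2 g -> (forall X Y, Q X Y -> P (g X Y)) -> det1 P d ->
  bounded (fun X Y => Q X Y /\ g X Y = 0) d' -> bounded Q (d + d').
Proof.
move=> lg QP [w hw] [f [lf hf]].
pose f0 X Y : 'rV[C]_d := \row_l \sum_r \sum_c w l r c * g X Y r c.
exists (fun X Y => row_mx (f0 X Y) (f X Y)); split=> [z X X' Y Y'|X Y qxy].
  rewrite scale_row_mx add_row_mx lf; congr row_mx; apply/rowP => l; rewrite !mxE.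
  rewrite mulr_sumr -big_split; apply: eq_bigr => r _; rewrite mulr_sumr -big_split; apply: eq_bigr => c _.
  by rewrite lg !mxE /= mulrDr mulrCA.
rewrite -[0]row_mx0 => /eq_row_mx[/rowP e0 e1]; apply: hf => //; split=> //.
by apply: hw; [apply: QP | move=> l; have := e0 l; rewrite !mxE].
Qed.

Lemma sum_delta m n (U : 'M[C]_(m, n)) (r0 : 'I_m) (c0 : 'I_n) :
  \sum_r \sum_c (delta_mx r0 c0 : 'M[C]_(m, n)) r c * U r c = U r0 c0.
Proof.
rewrite (bigD1 r0) //= (bigD1 c0) //= mxE !eqxx mul1r !big1 ?addr0 // => [r rr|c cc].
  by rewrite big1 // => c _; rewrite mxE (negPf rr) mul0r.
by rewrite mxE (negPf cc) andbF mul0r.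
Qed.

(** For [m <= n] the coordinates are the [m] entries of the last column, otherwise the [n] entries
    of the first row. *)
Lemma det1_min m n (a b : C) : det1 (fun U : 'M[C]_(m, n) =>
  (exists L, U *m J a n = L *m U) /\ (exists L, U *m L = J b m *m U)) (minn m n).
Proof.
case: (boolP (m <= n)%N) => [mn|nm].
  exists (fun l : 'I_(minn m n) => \matrix_(r, c) (if ((r : nat) == l) && (c.+1 == n) then 1 else 0)) => U [[L e] _] h.
  apply: (last_col0 e) => r c cn; have rl : (r < minn m n)%N by have := ltn_ord r; lia.
  rewrite -[RHS](h (Ordinal rl)) -(sum_delta U r c); apply: eq_bigr => r' _; apply: eq_bigr => c' _.
  rewrite !mxE; congr (_ * _); rewrite -!val_eqE /= (_ : (c'.+1 == n) = ((c' : nat) == c)); last by lia.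
  by case: ifP => //; rewrite ?mulr1n ?mulr0n.
exists (fun l : 'I_(minn m n) => \matrix_(r, c) (if ((r : nat) == 0%N) && ((c : nat) == l) then 1 else 0)) => U [_ [L e]] h.
apply: (first_row0 e) => r c r0; have cl : (c < minn m n)%N by have := ltn_ord c; lia.
rewrite -[RHS](h (Ordinal cl)) -(sum_delta U r c); apply: eq_bigr => r' _; apply: eq_bigr => c' _.
rewrite !mxE; congr (_ * _); rewrite -!val_eqE /= r0.
by case: ifP => //; rewrite ?mulr1n ?mulr0n.
Qed.

(** The coordinates are the first-row entries at even distance from the last column, left free by
    [anticommutant_adj]. *)
Lemma det1_half m : det1 (fun U : 'M[C]_m => U *m J 0 m = - (J 0 m *m U) /\ U = adj U) (uphalf m).
Proof.
exists (fun l => \matrix_(r, c) (if ((r : nat) == 0%N) && (m.-1 - c == l.*2)%N then 1 else 0)) => U [e Ua] h.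
apply: (anticommutant_adj e Ua) => r c r0 ev.
have cm := ltn_ord c.
have cl : ((m.-1 - c)./2 < uphalf m)%N by lia.
rewrite -[RHS](h (Ordinal cl)) -(sum_delta U r c); apply: eq_bigr => r' _; apply: eq_bigr => c' _.
rewrite !mxE; congr (_ * _); rewrite -!val_eqE /= r0.
have -> : (m.-1 - c' == (m.-1 - c)./2.*2)%N = ((c' : nat) == c).
  by have := ltn_ord c'; lia.
by case: ifP => //; rewrite ?mulr1n ?mulr0n.
Qed.

(* The equations on the (i, j) blocks (X, Y) of the transposes of the components of
   an element of g_{0,0}, when its weights on g_{-2,0} and g_{0,+-2} vanish. *)
Definition intertwines a b (A : 'M[C]_a) (B : 'M[C]_b) (X Y : 'M[C]_(a, b)) :=
  X *m B = A *m Y /\ Y *m conjmx B = conjmx A *m X.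

Lemma lin2D a b : lin2 (fun X Y : 'M[C]_(a, b) => X + Y).
Proof. by move=> z X X' Y Y'; rewrite scalerDr addrACA. Qed.
Lemma lin2B a b : lin2 (fun X Y : 'M[C]_(a, b) => X - Y).
Proof. by move=> z X X' Y Y'; rewrite scalerBr opprD addrACA. Qed.

Lemma conj_jordan_real m (a : C) : a \is Num.real -> conjmx (J a m) = J a m.
Proof. by move=> ar; rewrite conj_jordan conj_Creal. Qed.

Lemma hom_real_sum m n (a b : C) : a \is Num.real -> b \is Num.real ->
  forall X Y, intertwines (J a m) (J b n) X Y ->
    (X + Y) *m J b n = J a m *m (X + Y) /\ (X - Y) *m J b n = - (J a m *m (X - Y)).
Proof.
move=> ar br X Y [e1]; rewrite !conj_jordan_real // => e2.
by split; [rewrite mulmxDl e1 e2 mulmxDr addrC | rewrite mulmxBl e1 e2 mulmxBr opprB].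
Qed.

Lemma half_eq0 m n (X Y : 'M[C]_(m, n)) : X + Y = 0 -> X - Y = 0 -> X = 0 /\ Y = 0.
Proof.
move=> e1 e2; have xy : X = Y by apply/eqP; rewrite -subr_eq0 e2.
by move: e1; rewrite xy -mulr2n -scaler_nat => /eqP; rewrite scaler_eq0 pnatr_eq0 /= => /eqP.
Qed.

Lemma anti_eq0 m n (a b : C) (V : 'M[C]_(m, n)) : 0 <= a -> 0 <= b -> (a != 0) || (b != 0) ->
  V *m J b n = - (J a m *m V) -> V = 0.
Proof.
move=> a0 b0 ab e; apply: (sylvester (L := - J a m) (a := b)); last by rewrite mulNmx.
rewrite -opprD -scaleN1r unitmxZ ?unitrN1 // (_ : J a m + b%:M = J a m - (- b)%:M); last by rewrite raddfN opprK.
by rewrite jordan_sub jordan_unit // opprK paddr_eq0 // negb_and.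
Qed.

Lemma bounded_real_same m n (a : C) : 0 < a -> bounded (intertwines (J a m) (J a n)) (minn m n).
Proof.
move=> a0; have ar := gtr0_real a0; rewrite -[minn m n]addn0.
apply: (bounded_piece (g := fun X Y => X + Y) (@lin2D _ _) _ (@det1_min m n a a)).
  by move=> X Y /(hom_real_sum ar ar)[e _]; split; [exists (J a m) | exists (J a n)].
apply: bounded0 => X Y [/(hom_real_sum ar ar)[_ e] e0]; apply: half_eq0 => //.
by apply: anti_eq0 e; rewrite ?ltW // gt_eqF.
Qed.

Lemma bounded_zero m n : bounded (intertwines (J 0 m) (J 0 n)) (minn m n + minn m n).
Proof.
have r0 : (0 : C) \is Num.real by apply: real0.
apply: (bounded_piece (g := fun X Y => X + Y) (@lin2D _ _) _ (@det1_min m n 0 0)).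
  by move=> X Y /(hom_real_sum r0 r0)[e _]; split; [exists (J 0 m) | exists (J 0 n)].
rewrite -[minn m n]addn0; apply: (bounded_piece (g := fun X Y => X - Y) (@lin2B _ _) _ (@det1_min m n 0 0)).
  move=> X Y [/(hom_real_sum r0 r0)[_ e] _]; split; [exists (- J 0 m); by rewrite mulNmx|].
  by exists (- J 0 n); rewrite mulmxN e opprK.
by apply: bounded0 => X Y [[_ e1] e2]; apply: half_eq0.
Qed.

Lemma bounded_real_diff m n (a b : C) : 0 <= a -> 0 <= b -> a != b -> bounded (intertwines (J a m) (J b n)) 0.
Proof.
move=> a0 b0 ab; apply: bounded0 => X Y /(hom_real_sum (ger0_real a0) (ger0_real b0))[e1 e2].
apply: half_eq0; first by apply: sylvesterJ e1; rewrite eq_sym.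
by apply: anti_eq0 e2 => //; apply: contraNT ab; rewrite negb_or !negbK => /andP[/eqP -> /eqP ->].
Qed.

Local Notation Mc a k := (block_mx 0 (J (a ^+ 2) k) 1%:M 0 : 'M[C]_(k + k)).

Lemma conj_block m (a : C) : conjmx (Mc a m) = block_mx 0 (J (a^* ^+ 2) m) 1%:M 0.
Proof.
rewrite /Defs.conjmx map_block_mx !map_mx0 map_mx1; congr (block_mx _ _ _ _).
by rewrite -rmorphXn -conj_jordan.
Qed.

(** Four of the eight corners determine the others, and each of the four intertwines Jordan blocks
    for [a^2], [b^2] or their conjugates. Which of these eigenvalues coincide decides between 0, 2
    and 4 times the minimum of the sizes. *)
Lemma hom_complex m n (a b : C) X Y : intertwines (Mc a m) (Mc b n) X Y ->
  [/\ ulsubmx Y = drsubmx X, drsubmx Y = ulsubmx X, ursubmx X = J (a ^+ 2) m *m dlsubmx Y &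
      ursubmx Y = dlsubmx X *m J (b ^+ 2) n] /\
  [/\ ulsubmx X *m J (b ^+ 2) n = J (a ^+ 2) m *m ulsubmx X,
      drsubmx X *m J (b^* ^+ 2) n = J (a^* ^+ 2) m *m drsubmx X,
      dlsubmx X *m J (b ^+ 2) n = J (a^* ^+ 2) m *m dlsubmx X &
      dlsubmx Y *m J (b^* ^+ 2) n = J (a ^+ 2) m *m dlsubmx Y].
Proof.
case; rewrite !conj_block -[X]submxK -[Y]submxK !mulmx_block.
rewrite !block_mxKul !block_mxKur !block_mxKdl !block_mxKdr !mulmx0 !mul0mx !mulmx1 !mul1mx !add0r !addr0.
by case/eq_block_mx => e1 e2 e3 e4 /eq_block_mx[e5 e6 e7 e8]; split; split; congruence.
Qed.

Lemma hom_real_complex m n (a b : C) X Y : a \is Num.real -> intertwines (J a m) (Mc b n) X Y ->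
  [/\ rsubmx X = J a m *m lsubmx Y, rsubmx Y = J a m *m lsubmx X,
      lsubmx X *m J (b ^+ 2) n = J a m *m J a m *m lsubmx X &
      lsubmx Y *m J (b^* ^+ 2) n = J a m *m J a m *m lsubmx Y].
Proof.
move=> ar; case; rewrite conj_block conj_jordan_real // -[X]hsubmxK -[Y]hsubmxK !mul_row_block !mul_mx_row.
rewrite !row_mxKl !row_mxKr !mulmx0 !mulmx1 !add0r !addr0.
case/eq_row_mx => e1 e2 /eq_row_mx[e3 e4]; split; [exact: e1|exact: e3|move: e2|move: e4]; [rewrite e3|rewrite e1]; rewrite mulmxA //.
Qed.

Lemma hom_complex_real m n (a b : C) X Y : b \is Num.real -> intertwines (Mc a m) (J b n) X Y ->
  [/\ usubmx X = dsubmx Y *m J b n, usubmx Y = dsubmx X *m J b n,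
      dsubmx Y *m (J b n *m J b n) = J (a ^+ 2) m *m dsubmx Y &
      dsubmx X *m (J b n *m J b n) = J (a^* ^+ 2) m *m dsubmx X].
Proof.
move=> br; case; rewrite conj_block conj_jordan_real // -[X]vsubmxK -[Y]vsubmxK !mul_block_col !mul_col_mx.
rewrite !col_mxKu !col_mxKd !mul0mx !mul1mx !add0r !addr0.
by case/eq_col_mx => e1 e2 /eq_col_mx[e3 e4]; split=> //; rewrite mulmxA; [rewrite e4 e1|rewrite e2 e3].
Qed.

Lemma jordan_square_unit m (a b : C) : a ^+ 2 != b -> J a m *m J a m - b%:M \in unitmx.
Proof.
have [c <-] : exists c : C, c ^+ 2 = b by exists (sqrtC b); rewrite sqrtCK.
move=> ab; have -> : J a m *m J a m - (c ^+ 2)%:M = (J a m - c%:M) *m (J a m + c%:M).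
  rewrite mulmxBl !mulmxDr mul_mx_scalar !mul_scalar_mx scale_scalar_mx -expr2.
  by rewrite opprD addrA addrK.
have -> : J a m + c%:M = J a m - (- c)%:M by rewrite raddfN opprK.
move: ab; rewrite eqf_sqr negb_or => /andP[h1 h2].
by rewrite unitmx_mul !jordan_sub !jordan_unit ?subr_eq0.
Qed.

Lemma sylvester_tr m n (a : C) (U : 'M[C]_(m, n)) (L : 'M[C]_n) :
  L - a%:M \in unitmx -> U *m L = J a m *m U -> U = 0.
Proof.
move=> uL e; suff : U^T *m antidiag R m = 0.
  move/(congr1 (mulmx^~ (antidiag R m))); rewrite -mulmxA antidiag_inv mulmx1 mul0mx => /(congr1 trmx).
  by rewrite trmxK trmx0.
apply: (sylvester (L := L^T) (a := a)).
  by rewrite -[L^T - _](_ : (L - a%:M)^T = _) ?unitmx_tr // linearB /= tr_scalar_mx.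
by rewrite -mulmxA -jordan_adj mulmxA -trmx_mul -e trmx_mul mulmxA.
Qed.

Lemma bounded_real_complex m n (a b : C) : a \is Num.real -> b ^+ 2 \isn't Num.real \/ b ^+ 2 < 0 ->
  bounded (intertwines (J a m) (Mc b n)) 0 /\ bounded (intertwines (Mc b n) (J a m)) 0.
Proof.
move=> ar bc; have ne : a ^+ 2 != b ^+ 2.
  case: bc => [bc|bc]; first by apply: contraNneq bc => <-; apply: rpredX.
  by rewrite eq_sym lt_eqF // (lt_le_trans bc) // real_exprn_even_ge0.
have ne' : a ^+ 2 != b^* ^+ 2.
  by apply: contraNneq ne => /(congr1 Num.conj); rewrite !rmorphXn /= conjCK (conj_Creal ar) => ->.
split; apply: bounded0 => X Y.
  case/(hom_real_complex ar) => e1 e2 e3 e4; move: e1 e2.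
  rewrite (sylvester (jordan_square_unit m ne) e3) (sylvester (jordan_square_unit m ne') e4) !mulmx0 => e1 e2.
  rewrite -[X]hsubmxK -[Y]hsubmxK e1 e2 (sylvester (jordan_square_unit m ne) e3).
  by rewrite (sylvester (jordan_square_unit m ne') e4) row_mx0.
case/(hom_complex_real ar) => e1 e2 e3 e4.
have z3 := sylvester_tr (jordan_square_unit m ne) e3; have z4 := sylvester_tr (jordan_square_unit m ne') e4.
by rewrite -[X]vsubmxK -[Y]vsubmxK e1 e2 z3 z4 !mul0mx col_mx0.
Qed.

Lemma lin2ul m n : lin2 (fun X Y : 'M[C]_(m + m, n + n) => ulsubmx X).
Proof. by move=> z X X' Y Y'; apply/matrixP => r c; rewrite !mxE. Qed.
Lemma lin2dr m n : lin2 (fun X Y : 'M[C]_(m + m, n + n) => drsubmx X).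
Proof. by move=> z X X' Y Y'; apply/matrixP => r c; rewrite !mxE. Qed.
Lemma lin2dl m n : lin2 (fun X Y : 'M[C]_(m + m, n + n) => dlsubmx X).
Proof. by move=> z X X' Y Y'; apply/matrixP => r c; rewrite !mxE. Qed.
Lemma lin2dl' m n : lin2 (fun X Y : 'M[C]_(m + m, n + n) => dlsubmx Y).
Proof. by move=> z X X' Y Y'; apply/matrixP => r c; rewrite !mxE. Qed.

Lemma complex_eq0 m n (a b : C) X Y : intertwines (Mc a m) (Mc b n) X Y ->
  ulsubmx X = 0 -> drsubmx X = 0 -> dlsubmx X = 0 -> dlsubmx Y = 0 -> X = 0 /\ Y = 0.
Proof.
case/hom_complex => [[e1 e2 e3 e4] _] z1 z2 z3 z4.
by rewrite -[X]submxK -[Y]submxK e1 e2 e3 e4 z1 z2 z3 z4 mul0mx mulmx0 block_mx0.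
Qed.

Lemma conj_square (a : C) : a ^+ 2 \is Num.real -> a^* ^+ 2 = a ^+ 2.
Proof. by rewrite -rmorphXn => /conj_Creal. Qed.
Lemma conj_square_neq (a : C) : a ^+ 2 \isn't Num.real -> a^* ^+ 2 != a ^+ 2.
Proof. by apply: contraNneq => e; rewrite CrealE rmorphXn e. Qed.

Lemma bounded_complex_diff m n (a b : C) : a ^+ 2 != b ^+ 2 -> a ^+ 2 != b^* ^+ 2 -> bounded (intertwines (Mc a m) (Mc b n)) 0.
Proof.
move=> ab ab'; have cab : a^* ^+ 2 != b^* ^+ 2 by rewrite -!rmorphXn (inj_eq (can_inj conjCK)).
have cab' : a^* ^+ 2 != b ^+ 2 
  by apply: contraNneq ab' => e; rewrite -[a]conjCK -rmorphXn /= e rmorphXn.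
apply: bounded0 => X Y h; have [_ [e1 e2 e3 e4]] := hom_complex h; apply: (complex_eq0 h).
- by apply: sylvesterJ e1; rewrite eq_sym.
- by apply: sylvesterJ e2; rewrite eq_sym.
- by apply: sylvesterJ e3; rewrite eq_sym.
- by apply: sylvesterJ e4; rewrite eq_sym.
Qed.

Lemma bounded_complex_same m n (a : C) : a ^+ 2 \isn't Num.real ->
  bounded (intertwines (Mc a m) (Mc a n)) (minn m n + minn m n).
Proof.
move=> ar; have ne := conj_square_neq ar.
apply: (bounded_piece (@lin2ul _ _) _ (@det1_min m n (a ^+ 2) (a ^+ 2))).
  by move=> X Y /hom_complex[_ [e _ _ _]]; split; [exists (J (a ^+ 2) m)|exists (J (a ^+ 2) n)].
rewrite -[minn m n]addn0; apply: (bounded_piece (@lin2dr _ _) _ (@det1_min m n (a^* ^+ 2) (a^* ^+ 2))).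
  by move=> X Y [/hom_complex[_ [_ e _ _]] _]; split; [exists (J (a^* ^+ 2) m)|exists (J (a^* ^+ 2) n)].
apply: bounded0 => X Y [[h z1] z2]; have [_ [_ _ e3 e4]] := hom_complex h; apply: (complex_eq0 h) => //.
  by apply: sylvesterJ e3; rewrite eq_sym.
by apply: sylvesterJ e4.
Qed.

Lemma bounded_complex_real m n (a : C) : a ^+ 2 \is Num.real ->
  bounded (intertwines (Mc a m) (Mc a n)) (minn m n + (minn m n + (minn m n + minn m n))).
Proof.
move=> ar; have e0 := conj_square ar.
apply: (bounded_piece (@lin2ul _ _) _ (@det1_min m n (a ^+ 2) (a ^+ 2))).
  by move=> X Y /hom_complex[_ [e _ _ _]]; split; [exists (J (a ^+ 2) m)|exists (J (a ^+ 2) n)].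
apply: (bounded_piece (@lin2dr _ _) _ (@det1_min m n (a^* ^+ 2) (a^* ^+ 2))).
  by move=> X Y [/hom_complex[_ [_ e _ _]] _]; split; [exists (J (a^* ^+ 2) m)|exists (J (a^* ^+ 2) n)].
apply: (bounded_piece (@lin2dl _ _) _ (@det1_min m n (a ^+ 2) (a^* ^+ 2))).
  by move=> X Y [[/hom_complex[_ [_ _ e _]] _] _]; split; [exists (J (a^* ^+ 2) m)|exists (J (a ^+ 2) n)].
rewrite -[minn m n]addn0; apply: (bounded_piece (@lin2dl' _ _) _ (@det1_min m n (a^* ^+ 2) (a ^+ 2))).
  by move=> X Y [[[/hom_complex[_ [_ _ _ e]] _] _] _]; split; [exists (J (a ^+ 2) m)|exists (J (a^* ^+ 2) n)].
by apply: bounded0 => X Y [[[[h z1] z2] z3] z4]; apply: (complex_eq0 h).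
Qed.

(** What compatibility with the Hermitian form leaves on a diagonal block; the sign [eps i] cancels,
    see [diag_block]. *)
Definition diag_adj m (X Y : 'M[C]_m) := Y = - adj X.

Lemma adjK m (X : 'M[C]_m) : adj (adj X) = X.
Proof. by apply/matrixP => r c; rewrite !mxE !rev_ordK. Qed.
Lemma adjD m (X Y : 'M[C]_m) : adj (X + Y) = adj X + adj Y.
Proof. by apply/matrixP => r c; rewrite !mxE. Qed.
Lemma adjN m (X : 'M[C]_m) : adj (- X) = - adj X.
Proof. by apply/matrixP => r c; rewrite !mxE. Qed.

Lemma bounded_diag_real m (a : C) : 0 < a ->
  bounded (fun X Y => intertwines (J a m) (J a m) X Y /\ diag_adj X Y) 0.
Proof.
move=> a0; have ar := gtr0_real a0; apply: bounded0 => X Y [/(hom_real_sum ar ar)[e1 e2] ad].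
apply: half_eq0; last by apply: anti_eq0 e2; rewrite ?ltW // gt_eqF.
by apply: commutant_adj0 e1 _; rewrite adjD ad adjN adjK opprB addrC.
Qed.

Lemma bounded_diag_zero m : bounded (fun X Y => intertwines (J 0 m) (J 0 m) X Y /\ diag_adj X Y) (uphalf m).
Proof.
have r0 : (0 : C) \is Num.real by apply: real0.
rewrite -[uphalf m]addn0; apply: (bounded_piece (g := fun X Y => X - Y) (@lin2B _ _) _ (@det1_half m)).
  move=> X Y [/(hom_real_sum r0 r0)[_ e] ad]; split=> //.
  by rewrite adjD adjN ad adjN adjK !opprK addrC.
apply: bounded0 => X Y [[/(hom_real_sum r0 r0)[e _] ad] e0]; apply: half_eq0 => //.
by apply: commutant_adj0 e _; rewrite adjD ad adjN adjK opprB addrC.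
Qed.

Lemma rev_lshift m (r : 'I_m) : rev_ord (lshift m r) = rshift m (rev_ord r).
Proof. by apply: val_inj => /=; have := ltn_ord r; lia. Qed.
Lemma rev_rshift m (r : 'I_m) : rev_ord (rshift m r) = lshift m (rev_ord r).
Proof. by apply: val_inj => /=; have := ltn_ord r; lia. Qed.

(** Skewness kills the two diagonal corners through [commutant_adj0] and ties the lower left corner
    of [Y] to that of [X], so a single corner is left to count. *)
Lemma bounded_diag_complex m (a : C) (d : nat) :
  det1 (fun U : 'M[C]_m => U *m J (a ^+ 2) m = J (a^* ^+ 2) m *m U) d ->
  bounded (fun X Y => intertwines (Mc a m) (Mc a m) X Y /\ diag_adj X Y) d.
Proof.
move=> hd; rewrite -[d]addn0; apply: (bounded_piece (@lin2dl _ _) _ hd).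
  by move=> X Y [/hom_complex[_ []]].
apply: bounded0 => X Y [[h ad] z]; have [[e1 e2 _ _] [e3 e4 _ _]] := hom_complex h.
have a1 : ulsubmx Y = - adj (drsubmx X) by rewrite ad; apply/matrixP => r c; rewrite !mxE !rev_lshift.
have a2 : drsubmx Y = - adj (ulsubmx X) by rewrite ad; apply/matrixP => r c; rewrite !mxE !rev_rshift.
have a3 : dlsubmx Y = - adj (dlsubmx X) by rewrite ad; apply/matrixP => r c; rewrite !mxE rev_lshift rev_rshift.
apply: (complex_eq0 h) => //.
- by apply: commutant_adj0 e3 _; rewrite -a2 e2.
- by apply: commutant_adj0 e4 _; rewrite -a1 e1.
by rewrite a3 z; apply/matrixP => r c; rewrite !mxE oppr0.
Qed.

Lemma bounded_diag_complex_nonreal m (a : C) : a ^+ 2 \isn't Num.real ->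
  bounded (fun X Y => intertwines (Mc a m) (Mc a m) X Y /\ diag_adj X Y) 0.
Proof.
move=> ar; apply: bounded_diag_complex; exists (fun=> 0) => U e _.
by apply: sylvesterJ e; rewrite eq_sym conj_square_neq.
Qed.

Lemma bounded_diag_complex_real m (a : C) :
  bounded (fun X Y => intertwines (Mc a m) (Mc a m) X Y /\ diag_adj X Y) m.
Proof.
apply: bounded_diag_complex; have [w hw] := @det1_min m m (a ^+ 2) (a^* ^+ 2).
move: w hw; rewrite minnn => w hw; exists w => U e; apply: hw.
by split; [exists (J (a^* ^+ 2) m)|exists (J (a ^+ 2) m)].
Qed.

Definition quadrant (a : C) := 0 <= 'Re a /\ 0 <= 'Im a.

Lemma quadrant_real a : quadrant a -> a \is Num.real -> 0 <= a.
Proof. by case=> a0 _ /Creal_ReP ar; rewrite -ar. Qed.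

Lemma square_lt0 (a : C) : a \isn't Num.real -> a ^+ 2 \is Num.real -> a ^+ 2 < 0.
Proof.
move=> ar a2; rewrite real_ltNge ?real0 //; apply: contraNN ar => a0.
have : a ^+ 2 == sqrtC (a ^+ 2) ^+ 2 by rewrite sqrtCK.
by rewrite eqf_sqr => /orP[] /eqP ->; rewrite ?realN ger0_real // sqrtC_ge0.
Qed.

Lemma quadrant_sum0 (x y : C) : 0 <= x -> 0 <= y -> x = - y -> x = 0 /\ y = 0.
Proof.
move=> x0 y0 e; have y00 : y = 0 by apply/eqP; rewrite eq_le y0 andbT -oppr_ge0 -e.
by rewrite e y00 oppr0.
Qed.

(** Two opposite numbers in the closed first quadrant are both 0, so the square determines the root
    there. *)
Lemma quadrant_square a b : quadrant a -> quadrant b -> a != b -> a ^+ 2 != b ^+ 2.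
Proof.
move=> [a0 a1] [b0 b1] ab; rewrite eqf_sqr negb_or ab /=; apply: contraNneq ab => e.
have [r1 r2] : 'Re a = 0 /\ 'Re b = 0 by apply: quadrant_sum0; rewrite // e raddfN.
have [i1 i2] : 'Im a = 0 /\ 'Im b = 0 by apply: quadrant_sum0; rewrite // e raddfN.
by apply/eqP/eqCP; rewrite r1 r2 i1 i2.
Qed.

Lemma quadrant_conj_square a b : quadrant a -> quadrant b -> b \isn't Num.real -> a != b -> a ^+ 2 != b^* ^+ 2.
Proof.
move=> [a0 a1] [b0 b1] br ab; rewrite eqf_sqr negb_or; apply/andP; split; apply/eqP => e.
  have [_ i2] : 'Im a = 0 /\ 'Im b = 0 by apply: quadrant_sum0; rewrite // e Im_conj.
  by move/Creal_ImP: i2; apply/negP.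
have [r1 r2] : 'Re a = 0 /\ 'Re b = 0 by apply: quadrant_sum0; rewrite // e raddfN /= Re_conj.
by move/eqP: ab; apply; apply/eqCP; split; rewrite ?r1 ?r2 // e raddfN /= Im_conj opprK.
Qed.

Lemma nonreal_square (a : C) : a \isn't Num.real -> a ^+ 2 \isn't Num.real \/ a ^+ 2 < 0.
Proof. by move=> ar; case: (boolP (a ^+ 2 \is Num.real)) => a2; [right; apply: square_lt0|left]. Qed.

Definition offdiag (a b : C) m n : nat :=
  if a != b then 0%N else if 0 < a then minn m n
  else if (a ^+ 2 \isn't Num.real) || (a == 0) then (2 * minn m n)%N else (4 * minn m n)%N.

Lemma bounded_offdiag (a b : C) ra rb m n : quadrant a -> quadrant b ->
  (a \is Num.real) = ra -> (b \is Num.real) = rb -> bounded (intertwines (Mblock a ra m) (Mblock b rb n)) (offdiag a b m n).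
Proof.
move=> qa qb; rewrite /offdiag; case: (eqVneq a b) => /= [ab|ab] ea eb; last first.
  case: ra rb ea eb => -[] /= ea eb.
  - by apply: bounded_real_diff => //; apply: quadrant_real.
  - by apply: (bounded_real_complex m n ea (nonreal_square (negbT eb))).1.
  - by apply: (bounded_real_complex n m eb (nonreal_square (negbT ea))).2.
  by apply: bounded_complex_diff; [apply: quadrant_square|apply: quadrant_conj_square; rewrite ?eb].
move: eb; rewrite -ab ea => <-; case: ra ea => ea /=.
  have := quadrant_real qa ea; rewrite le0r => /predU1P[a0|a0]; last by rewrite a0; apply: bounded_real_same.
  by rewrite a0 ltxx eqxx orbT mul2n -addnn; apply: bounded_zero.
have na : (0 < a) = false by apply: contraFF ea => /gtr0_real.
have a0 : (a == 0) = false by apply: contraFF ea => /eqP ->; apply: real0.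
rewrite na a0 orbF; case: ifP => ra.
  by rewrite mul2n -addnn; apply: bounded_complex_same.
by rewrite (_ : 4 * _ = minn m n + (minn m n + (minn m n + minn m n)))%N; [apply: bounded_complex_real; rewrite -[_ \is _]negbK ra|lia].
Qed.

Definition ondiag (a : C) m : nat :=
  if ~~ (a ^+ 2 <= 0) then 0%N else if a ^+ 2 < 0 then m else uphalf m.

Lemma bounded_ondiag (a : C) ra m : quadrant a -> (a \is Num.real) = ra ->
  bounded (fun X Y => intertwines (Mblock a ra m) (Mblock a ra m) X Y /\ diag_adj X Y) (ondiag a m).
Proof.
rewrite /ondiag => qa; case: ra => ea /=.
  have := quadrant_real qa ea; rewrite le0r => /predU1P[a0|a0]; last first.
    by rewrite lt_geF ?exprn_gt0 //=; apply: bounded_diag_real.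
  by rewrite a0 expr0n lexx ltxx /=; apply: bounded_diag_zero.
case: (boolP (a ^+ 2 \is Num.real)) => a2.
  by rewrite ltW ?square_lt0 ?ea //; apply: bounded_diag_complex_real.
rewrite (_ : (a ^+ 2 <= 0) = false); first exact: bounded_diag_complex_nonreal.
by apply: contraNF a2 => /ler0_real.
Qed.
End Bounds.

Section Killers.
Variable F : fieldType.

(** Intersect the kernels one after the other, each lowering the rank by at most [d i]. The
    condition [P i] need not define a subspace: it is only implied by [d i] linear equations. *)
Lemma killers k (I : finType) (d : I -> nat) (P : I -> 'rV[F]_k -> Prop) :
  (forall i, exists W : 'M[F]_(k, d i), forall u, u *m W = 0 -> P i u) ->
  (\sum_i d i < k)%N -> exists2 u, u != 0 & forall i, P i u.
Proof.
move=> hP dk; suff [K [rK hK]] : exists K : 'M[F]_k, (k <= \rank K + \sum_(i <- enum I) d i)%N /\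
    forall u : 'rV_k, (u <= K)%MS -> forall i, i \in enum I -> P i u.
  have K0 : K != 0.
    by apply/eqP => e; move: rK dk; rewrite e mxrank0 add0n big_enum /= => /leq_ltn_trans h /h; rewrite ltnn.
  by have [r rK0 r0] := rowV0Pn K0; exists r => // i; apply: hK; rewrite ?mem_enum.
elim: (enum I) => [|i s [K [rK hK]]].
  by exists 1%:M; rewrite mxrank1 big_nil addn0; split.
have [W hW] := hP i; exists (K :&: kermx W)%MS; split.
  have := mxrank_sum_cap K (kermx W); rewrite mxrank_ker big_cons.
  have := rank_leq_col (K + kermx W)%MS; have := rank_leq_col W; have := rank_leq_row W; lia.
move=> u; rewrite sub_capmx => /andP[uK uW] j; rewrite inE => /predU1P[->|js]; last exact: hK.
by apply: hW; apply/sub_kermxP.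
Qed.
End Killers.

(** * The dimension of g_{0,0} *)

Section Count.
Variable R : realType.
Local Notation C := (cplx R).
Local Notation J := (@jordan R).

Lemma bounded_matrix a b (Q : 'M[C]_(a, b) -> 'M[C]_(a, b) -> Prop) d k (X Y : 'I_k -> 'M[C]_(a, b)) :
  bounded Q d -> exists W : 'M[C]_(k, d), forall u : 'rV_k, u *m W = 0 ->
    Q (\sum_l u 0 l *: X l) (\sum_l u 0 l *: Y l) -> \sum_l u 0 l *: X l = 0 /\ \sum_l u 0 l *: Y l = 0.
Proof.
case=> f [lf hf]; exists (\matrix_l f (X l) (Y l)) => u uW q; apply: hf => //.
rewrite -uW mulmx_sum_row; under [RHS]eq_bigr do rewrite rowK.
elim/big_rec3: _ => [|l x y z _ <-]; last exact: lf.
by have := lf 1 0 0 0 0; rewrite !scale1r !addr0 => /eqP; rewrite -[X in X == _]addr0 (inj_eq (addrI _)) eq_sym => /eqP.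
Qed.

Lemma antidiag_block k : antidiag R (k + k) = block_mx 0 (antidiag R k) (antidiag R k) 0.
Proof.
apply/matrixP => r c; case: (split_ordP r) => r' ->; case: (split_ordP c) => c' ->;
  rewrite ?block_mxEul ?block_mxEur ?block_mxEdl ?block_mxEdr !mxE /=; have := ltn_ord r'; have := ltn_ord c';
  move=> h1 h2.
- by case: eqP => //; lia.
- by congr (nat_of_bool _)%:R; apply/eqP/eqP; lia.
- by congr (nat_of_bool _)%:R; apply/eqP/eqP; lia.
by case: eqP => //; lia.
Qed.

Lemma Mblock_adj (a : C) ra k : (Mblock a ra k)^T *m Nblock R ra k = Nblock R ra k *m Mblock a ra k.
Proof.
case: ra; rewrite /Nblock /=; first exact: jordan_adj.
rewrite antidiag_block tr_block_mx !mulmx_block !trmx0 !trmx1 !mulmx0 !mul0mx !mulmx1 !mul1mx !add0r !addr0.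
by rewrite jordan_adj.
Qed.

Lemma submx_mul_diag p (p_ : 'I_p -> nat) (X : 'M[C]_(\sum_i p_ i)) (D : forall i, 'M[C]_(p_ i)) i j :
  submxblock (X *m \mxdiag_i D i) i j = submxblock X i j *m D j.
Proof. by rewrite -{1}[X]submxblockK mul_mxblock_mxdiag mxblockK. Qed.

Lemma submx_diag_mul p (p_ : 'I_p -> nat) (X : 'M[C]_(\sum_i p_ i)) (D : forall i, 'M[C]_(p_ i)) i j :
  submxblock ((\mxdiag_i D i) *m X) i j = D i *m submxblock X i j.
Proof. by rewrite -{1}[X]submxblockK mul_mxdiag_mxblock mxblockK. Qed.

Lemma mul_mxdiag p (p_ : 'I_p -> nat) (D D' : forall i, 'M[C]_(p_ i)) :
  (\mxdiag_i D i) *m (\mxdiag_i D' i) = \mxdiag_i (D i *m D' i).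
Proof.
rewrite {1}/mxdiag mul_mxblock_mxdiag; apply: eq_mxblock => i j.
by case: eqVneq => [<-|_]; rewrite ?mul0mx ?conform_mx_id.
Qed.

Lemma conj_mxdiag p (p_ : 'I_p -> nat) (D : forall i, 'M[C]_(p_ i)) :
  conjmx (\mxdiag_i D i) = \mxdiag_i (conjmx (D i)).
Proof.
apply/mxblockP => i j.
rewrite -[LHS]/(mxsub _ _ _) /Defs.conjmx -map_mxsub -[mxsub _ _ _]/(submxblock _ i j) !mxblockK.
by case: eqVneq => [<-|_]; rewrite ?conform_mx_id // map_mx0.
Qed.

Variables (gamma : nat) (eps lambda : 'I_gamma -> C) (m : 'I_gamma -> nat).
Hypothesis heps : forall i, eps i = 1 \/ eps i = -1.
Hypothesis hlambda : forall i, 0 <= 'Re (lambda i) /\ 0 <= 'Im (lambda i).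
Local Notation s := (canon_symbol eps lambda m).
Local Notation q := (canon_size lambda m).
Local Notation H := (symH s).
Local Notation A := (symA s).
Local Notation isreal i := (lambda i \is Num.real).
Local Notation Hb i := (eps i *: Nblock R (isreal i) (m i)).
Local Notation Ab i := (Mblock (lambda i) (isreal i) (m i)).
Implicit Types X Y : 'M[C]_q.

Lemma Nblock_inv ra k : Nblock R ra k *m Nblock R ra k = 1%:M.
Proof. exact: antidiag_inv. Qed.
Lemma eps_sqr i : eps i * eps i = 1.
Proof. by case: (heps i) => ->; rewrite ?mulrNN mulr1. Qed.
Lemma eps_neq0 i : eps i != 0.
Proof. by case: (heps i) => ->; rewrite ?oppr_eq0 oner_eq0. Qed.

Lemma canon_symmetric : H^T = H.
Proof. by rewrite /= tr_mxdiag; apply: eq_mxdiag => i; rewrite linearZ /= antidiag_sym. Qed.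

Lemma canon_unit : H \in unitmx.
Proof.
suff e : H *m H = 1%:M by case: (mulmx1_unit e).
rewrite /= mul_mxdiag -mxdiagZ; apply: eq_mxdiag => i.
by rewrite -scalemxAl -scalemxAr scalerA eps_sqr scale1r Nblock_inv.
Qed.

Lemma canon_selfadjoint : A^T *m H = H *m A.
Proof.
rewrite /= tr_mxdiag !mul_mxdiag; apply: eq_mxdiag => i.
by rewrite -scalemxAr -scalemxAl Mblock_adj.
Qed.

Lemma hom_block X Y i j : intertwines A A X Y -> intertwines (Ab i) (Ab j) (submxblock X i j) (submxblock Y i j).
Proof.
case=> e1 e2; have := congr1 (fun Z : 'M[C]_q => submxblock Z i j) e1.
have := congr1 (fun Z : 'M[C]_q => submxblock Z i j) e2.
by rewrite /= !conj_mxdiag !submx_diag_mul !submx_mul_diag.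
Qed.

Lemma skew_block X Y i j : H *m Y = - (X^T *m H) -> Hb i *m submxblock Y i j = - ((submxblock X j i)^T *m Hb j).
Proof.
move/(congr1 (fun Z : 'M[C]_q => submxblock Z i j)).
by rewrite submxblockN /= submx_diag_mul submx_mul_diag tr_submxblock.
Qed.

(** The form ties each block of [Y] to the transposed block of [X], so the pairs [i <= j] determine
    everything; this is why [dtotal] sums over them only. *)
Lemma hom_skew_eq0 X Y : H *m Y = - (X^T *m H) ->
  (forall i j : 'I_gamma, (i <= j)%N -> submxblock X i j = 0 /\ submxblock Y i j = 0) -> X = 0 /\ Y = 0.
Proof.
move=> e h; have inv i : Hb i *m Hb i = 1%:M.
  by rewrite -scalemxAl -scalemxAr scalerA eps_sqr scale1r Nblock_inv.
have Y0 i j : submxblock Y i j = 0.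
  case/orP: (leq_total i j) => ij; first by case: (h i j ij).
  have := skew_block i j e; rewrite (h j i ij).1 trmx0 mul0mx oppr0 => /(congr1 (mulmx (Hb i))).
  by rewrite mulmxA inv mul1mx mulmx0.
split; apply/mxblockP => i j; rewrite submxblock0 //.
have := skew_block j i e; rewrite Y0 mulmx0 => /esym/eqP; rewrite oppr_eq0 => /eqP/(congr1 (mulmx^~ (Hb i))).
by rewrite -mulmxA inv mulmx1 mul0mx => /(congr1 trmx); rewrite trmxK trmx0.
Qed.

Lemma diag_block X Y i : H *m Y = - (X^T *m H) -> diag_adj (submxblock X i i) (submxblock Y i i).
Proof.
move=> /(skew_block i i); rewrite /diag_adj adjE -!scalemxAl -scalemxAr -scalerN => /(scalerI (eps_neq0 i)).
by move/(congr1 (mulmx (Nblock R (isreal i) (m i)))); rewrite mulmxA Nblock_inv mul1mx mulmxN mulmxA.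
Qed.

(** [B] and [D] are the diagonal blocks of an element of [g_{0,0}]; [g], [al] and [be] are, up to
    sign for the last two, its weights on [g_{-2,0}], [g_{0,2}] and [g_{0,-2}]. *)
Definition conformal_derivation (B D : 'M[C]_q) g al be :=
  [/\ B *m H + H *m D^T = g *: H, A^T *m B - D *m A^T = al *: A^T &
      conjmx A^T *m D - B *m conjmx A^T = be *: conjmx A^T].

Lemma dij_offdiag i j : i != j -> dij lambda m i j = offdiag (lambda i) (lambda j) (m i) (m j).
Proof.
move=> ij; rewrite /dij /offdiag (negPf ij) /= ?orbF; case: (eqVneq (lambda i) (lambda j)) => //= _.
case: ifP => // na; case: ifP => // /negbT; rewrite negb_or negbK => /andP[a2 a0].
case: (boolP (lambda i \is Num.real)) => [ar|ar]; last by rewrite square_lt0.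
by move: na; rewrite lt0r a0 (quadrant_real (hlambda i) ar).
Qed.

Lemma dij_ondiag i : dij lambda m i i = ondiag (lambda i) (m i).
Proof. by rewrite /dij /ondiag !eqxx /= minnn; case: ifP => // _; case: ifP => // ->. Qed.

Lemma dtotal_pair : dtotal lambda m =
  (\sum_(x : 'I_gamma * 'I_gamma) if (x.1 <= x.2)%N then dij lambda m x.1 x.2 else 0)%N.
Proof. by rewrite /dtotal pair_big_dep /= big_mkcond; apply: eq_bigr => -[]. Qed.

(** With too many elements, [killers] yields a nonzero combination that passes the [e] weight
    equations and the block conditions for [i <= j]; by [hom_skew_eq0] it is 0, against
    independence. *)
Lemma count_derivations k e (B D : 'I_k -> 'M[C]_q) (t : 'I_e -> 'I_k -> C) :
  (forall c : 'I_k -> C, \sum_l c l *: B l = 0 -> \sum_l c l *: D l = 0 -> forall l, c l = 0) ->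
  (forall c : 'I_k -> C, (forall i, \sum_l c l * t i l = 0) ->
    conformal_derivation (\sum_l c l *: B l) (\sum_l c l *: D l) 0 0 0) ->
  (k <= dtotal lambda m + e)%N.
Proof.
move=> indep der; rewrite leqNgt; apply/negP => lt.
pose X l := (B l)^T; pose Y l := (D l)^T.
have sub (Z : 'I_k -> 'M[C]_q) (u : 'rV_k) i j :
    \sum_l u 0 l *: submxblock (Z l) i j = submxblock (\sum_l u 0 l *: Z l) i j.
  by rewrite submxblock_sum; apply: eq_bigr => l _; apply/matrixP => r c; rewrite !mxE.
pose d (x : 'I_gamma * 'I_gamma + 'I_e) := match x with
  | inl x => if (x.1 <= x.2)%N then dij lambda m x.1 x.2 else 0%N | inr _ => 1%N end.
(* The block conditions are stated under the hypotheses that hold for combinations of weight 0;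
   these become available only once the weight equations are satisfied. *)
pose P (x : 'I_gamma * 'I_gamma + 'I_e) (u : 'rV[C]_k) := match x with
  | inl x => let: Xu := \sum_l u 0 l *: X l in let: Yu := \sum_l u 0 l *: Y l in
      intertwines A A Xu Yu -> H *m Yu = - (Xu^T *m H) -> (x.1 <= x.2)%N ->
      submxblock Xu x.1 x.2 = 0 /\ submxblock Yu x.1 x.2 = 0
  | inr i => \sum_l u 0 l * t i l = 0 end.
have [||u /eqP u0 hu] := @killers C k _ d P.
- case=> [[i j]|i]; last first.
    exists (\col_l t i l) => u uW /=; have := congr1 (fun Z : 'M[C]_1 => Z 0 0) uW.
    rewrite mxE [RHS]mxE => h; rewrite -[RHS]h.
    by apply: eq_bigr => l _; rewrite mxE.
  rewrite /d /P /=; case: (leqP i j) => ij; last by exists 0.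
  have [ie|ne] := eqVneq i j.
    have [W hW] := bounded_matrix (fun l => submxblock (X l) i i) (fun l => submxblock (Y l) i i)
      (bounded_ondiag (m i) (hlambda i) (erefl _)).
    rewrite -ie dij_ondiag; exists W => u /hW; rewrite !sub => h h1 h2 _; apply: h; split.
      exact: hom_block.
    exact: diag_block.
  have [W hW] := bounded_matrix (fun l => submxblock (X l) i j) (fun l => submxblock (Y l) i j)
    (bounded_offdiag (m i) (m j) (hlambda i) (hlambda j) (erefl _) (erefl _)).
  rewrite dij_offdiag //; exists W => u /hW; rewrite !sub => h h1 h2 _; apply: h.
  exact: hom_block.
- by rewrite big_sumType /= sum1_card card_ord -dtotal_pair.
case: u0; apply/rowP => l; rewrite mxE.
have trS (Z : 'I_k -> 'M[C]_q) : \sum_l u 0 l *: (Z l)^T = (\sum_l u 0 l *: Z l)^T.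
  by rewrite linear_sum; apply: eq_bigr => l' _; rewrite linearZ.
have := der (fun l => u 0 l) (fun i => hu (inr i)).
set Bu := \sum_l _; set Du := \sum_l _; rewrite /conformal_derivation !scale0r => -[e1 e2 e3].
have h2 : H *m Du^T = - (Bu^T^T *m H) by rewrite trmxK; apply/eqP; rewrite -addr_eq0 addrC e1.
have h1 : intertwines A A Bu^T Du^T.
  split; apply: trmx_inj; rewrite !trmx_mul !trmxK; first by apply/eqP; rewrite -subr_eq0 e2.
  by rewrite /Defs.conjmx map_trmx in e3 *; apply/eqP; rewrite -subr_eq0 e3.
have [|z1 z2] := hom_skew_eq0 h2.
  by move=> i j ij; have := hu (inl (i, j)); rewrite /P /X /Y !trS; apply.
by apply: (indep (fun l => u 0 l)); apply: trmx_inj; rewrite trmx0.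
Qed.

Lemma Mblock0 (a : C) ra k (r c : 'I_(block_size ra k)) : a = 0 -> (a \is Num.real) = ra -> (c <= r)%N -> Mblock a ra k r c = 0.
Proof.
move=> ->; case: ra r c => r c; rewrite real0 // => _ cr; rewrite mxE; case: eqP => // _; case: eqP => // e.
by move: cr; rewrite -e ltnn.
Qed.

(** All blocks are then strictly upper triangular, and each application of the operator annihilates
    one more trailing coordinate of every block. *)
Lemma canon_nilpotent : (forall i, lambda i = 0) -> nilpotent_op s.
Proof.
move=> l0; exists q => y; rewrite -[LHS]submxrowK -[RHS](mxrow0 (q_ := fun i => block_size (isreal i) (m i))).
apply: eq_mxrow => i; apply/rowP => r; rewrite [RHS]mxE.
suff h k (r' : 'I_(block_size (isreal i) (m i))) : (block_size (isreal i) (m i) <= r' + k)%N -> submxrow (iter k (antilinear_op s) y) i 0 r' = 0.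
  by apply: h; rewrite -[X in (X <= _)%N]add0n leq_add // [leqRHS](bigD1 i) //= leq_addr.
elim: k r' => [|k IH] r'; first by have := ltn_ord r'; lia.
move=> rk; rewrite iterS; set z := iter _ _ _.
have -> : submxrow (antilinear_op s z) i = conjmx (submxrow z i) *m (Ab i)^T.
  rewrite /antilinear_op -[conjmx z]submxrowK /= tr_mxdiag mul_mxrow_mxdiag mxrowK.
  by congr (_ *m _); apply/rowP => c; rewrite !mxE.
rewrite mxE big1 // => c _; rewrite mxE [X in _ * X]mxE.
case: (leqP c r') => cr; first by rewrite Mblock0 ?mulr0.
by rewrite IH ?conjC0 ?mul0r //; lia.
Qed.

Lemma trace_jordan (a : C) k : \tr (J a k) = a *+ k.
Proof. by rewrite /mxtrace (eq_bigr (fun=> a)) ?sumr_const ?card_ord // => i _; rewrite mxE eqxx. Qed.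

Lemma trace_weight k (X P : 'M[C]_k) z : X *m P - P *m X = z *: P -> z * \tr P = 0.
Proof. by move/(congr1 mxtrace); rewrite raddfB /= mxtrace_mulC subrr linearZ. Qed.

(* P = A conj A satisfies [X, P] = (al + be) P and has an eigenvalue a^2 <> 0. *)
Lemma weight_block (a : C) ra k (X Y : 'M[C]_(block_size ra k)) al be : (0 < k)%N -> a != 0 ->
  (a \is Num.real) = ra -> X *m Mblock a ra k - Mblock a ra k *m Y = al *: Mblock a ra k ->
  Y *m conjmx (Mblock a ra k) - conjmx (Mblock a ra k) *m X = be *: conjmx (Mblock a ra k) -> al + be = 0.
Proof.
move=> k0 a0 ea e1 e2; set M := Mblock a ra k in e1 e2; have e : X *m (M *m conjmx M) - (M *m conjmx M) *m X = (al + be) *: (M *m conjmx M).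
  rewrite mulmxA (_ : X *m M = M *m Y + al *: M); last by rewrite -e1 addrC subrK.
  rewrite mulmxDl -!mulmxA (_ : Y *m conjmx M = conjmx M *m X + be *: conjmx M); last by rewrite -e2 addrC subrK.
  rewrite mulmxDr -scalemxAl -scalemxAr [LHS]addrC !addrA addNr add0r -scalerDl.
  by rewrite [be + al]addrC.
have fin c : (al + be) * (c *+ k) = 0 -> c != 0 -> al + be = 0.
  by move/eqP; rewrite mulf_eq0 mulrn_eq0 => /orP[/eqP //|/orP[/eqP k00|->//]]; move: k0; rewrite k00.
case: ra X Y ea @M e1 e2 e => X Y ea M e1 e2.
  rewrite /M /= conj_jordan conj_Creal // => /trace_weight; rewrite /mxtrace.
  rewrite (eq_bigr (fun=> a * a)) => [|i _]; first by rewrite sumr_const card_ord => /fin; apply; rewrite mulf_neq0.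
  have [ik|ik] := eqVneq i.+1 k; first by rewrite mulJ_last // mxE eqxx.
  have ik' : (i.+1 < k)%N by have := ltn_ord i; lia.
  rewrite (@mulJ _ _ _ _ _ i (Ordinal ik')) // !mxE eqxx -[X in _ + X]/(if Ordinal ik' == i then _ else _).
  by rewrite -val_eqE /= gtn_eqF // ifF ?addr0 //; apply/eqP; lia.
rewrite /M /= conj_block -[X]submxK !mulmx_block !mulmx0 !mul0mx !mulmx1 !mul1mx !add0r !addr0.
rewrite scale_block_mx opp_block_mx add_block_mx => /eq_block_mx[e' _ _ _].
move: e'; rewrite mulmx0 mul0mx !addr0 => /trace_weight; rewrite trace_jordan => /fin; apply.
by rewrite expf_neq0.
Qed.

Hypothesis hm : forall i, (0 < m i)%N.

(** Non-nilpotency supplies a block with nonzero eigenvalue, and [weight_block] is applied to the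
    corresponding diagonal blocks. *)
Lemma weight_eq0 B D g al be : conformal_derivation B D g al be -> ~ nilpotent_op s -> al + be = 0.
Proof.
case=> _ e1 e2 nn; have [i li] : exists i, lambda i != 0.
  apply: contrapT => h; apply/nn/canon_nilpotent => i; apply: contrapT => /eqP li.
  by apply: h; exists i.
apply: (@weight_block (lambda i) (isreal i) (m i) (submxblock B^T i i) (submxblock D^T i i)) => //.
  have := congr1 (fun Z : 'M[C]_q => submxblock Z^T i i) e1.
  rewrite !linearB !linearZ /= !trmx_mul !trmxK submxblockB submx_mul_diag submx_diag_mul => ->.
  by apply/matrixP => r c; rewrite -[in RHS](submxblock_diag (fun i => Ab i) i) !mxE.
have ce : (conjmx A^T)^T = \mxdiag_i conjmx (Ab i) by rewrite -conj_mxdiag /Defs.conjmx -map_trmx trmxK.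
have := congr1 (fun Z : 'M[C]_q => submxblock Z^T i i) e2.
rewrite !linearB !linearZ /= !trmx_mul ce submxblockB submx_mul_diag submx_diag_mul => ->.
by apply/matrixP => r c; rewrite -[in RHS](submxblock_diag (fun i => conjmx (Ab i)) i) !mxE.
Qed.

(** The three weights account for the [+ 3]; without nilpotency [be = - al] saves one of them. *)
Theorem derivation_dim k (B D : 'I_k -> 'M[C]_q) (g al be : 'I_k -> C) :
  (forall l, conformal_derivation (B l) (D l) (g l) (al l) (be l)) ->
  (forall c : 'I_k -> C, \sum_l c l *: B l = 0 -> \sum_l c l *: D l = 0 -> forall l, c l = 0) ->
  (k <= dtotal lambda m + 3)%N /\ (~ nilpotent_op s -> (k <= dtotal lambda m + 2)%N).
Proof.
move=> der indep; have lin c : conformal_derivation (\sum_l c l *: B l) (\sum_l c l *: D l)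
    (\sum_l c l * g l) (\sum_l c l * al l) (\sum_l c l * be l).
  split.
  - rewrite linear_sum /= mulmx_sumr mulmx_suml -big_split scaler_suml; apply: eq_bigr => l _.
    by have [e _ _] := der l; rewrite -scalemxAl linearZ /= -scalemxAr -scalerDr e scalerA.
  - rewrite mulmx_sumr mulmx_suml -sumrB scaler_suml; apply: eq_bigr => l _.
    by have [_ e _] := der l; rewrite -scalemxAl -scalemxAr -scalerBr e scalerA.
  rewrite mulmx_sumr mulmx_suml -sumrB scaler_suml; apply: eq_bigr => l _.
  by have [_ _ e] := der l; rewrite -scalemxAl -scalemxAr -scalerBr e scalerA.
split=> [|nn].
  apply: (count_derivations (t := fun (i : 'I_3) l => tnth [tuple g l; al l; be l] i) indep) => c hc.
  move: (lin c); have := hc ord0; have := hc (lift ord0 ord0); have := hc ord_max.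
  by do 3 rewrite (eq_bigr _ (fun l _ => congr1 (fun z => c l * z) (tnth_nth 0 _ _))) /= => ->.
apply: (count_derivations (t := fun (i : 'I_2) l => tnth [tuple g l; al l] i) indep) => c hc.
move: (lin c); have := hc ord0; have := hc ord_max.
do 2 rewrite (eq_bigr _ (fun l _ => congr1 (fun z => c l * z) (tnth_nth 0 _ _))) /= => ->.
by move=> h; have := weight_eq0 h nn; rewrite add0r => e; rewrite e in h.
Qed.
End Count.

(** * Regularity of the symbol *)

Section BlockCommutators.
Variables (F : fieldType) (q : nat).
Implicit Types A B X Y : 'M[F]_q.

Lemma tr_commutator (T U : 'M[F]_q) : (T *m U - U *m T)^T = U^T *m T^T - T^T *m U^T.
Proof. by rewrite linearB /= !trmx_mul. Qed.

Lemma swap_block A B X Y :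
  block_mx 0 1%:M 1%:M 0 *m block_mx A B X Y *m block_mx 0 1%:M 1%:M 0 = block_mx Y X B A.
Proof. by rewrite !mulmx_block !(mulmx0, mul0mx, mulmx1, mul1mx, addr0, add0r). Qed.

Lemma commutator_lower A B X : block_mx A 0 0 B *m block_mx 0 0 X 0 - block_mx 0 0 X 0 *m block_mx A 0 0 B =
  block_mx 0 0 (B *m X - X *m A) 0.
Proof.
by rewrite !mulmx_block !(mulmx0, mul0mx, addr0, add0r) opp_block_mx add_block_mx oppr0 !addr0.
Qed.

Lemma commutator_upper A B X : block_mx A 0 0 B *m block_mx 0 X 0 0 - block_mx 0 X 0 0 *m block_mx A 0 0 B =
  block_mx 0 (A *m X - X *m B) 0 0.
Proof.
by rewrite !mulmx_block !(mulmx0, mul0mx, addr0, add0r) opp_block_mx add_block_mx oppr0 !addr0.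
Qed.

Lemma commutator_diag A B X Y : block_mx A 0 0 B *m block_mx X 0 0 Y - block_mx X 0 0 Y *m block_mx A 0 0 B =
  block_mx (A *m X - X *m A) 0 0 (B *m Y - Y *m B).
Proof.
by rewrite !mulmx_block !(mulmx0, mul0mx, addr0, add0r) opp_block_mx add_block_mx oppr0 !addr0.
Qed.

Lemma commutator_upper_lower X Y :
  block_mx (0 : 'M[F]_q) X (0 : 'M[F]_q) 0 *m block_mx (0 : 'M[F]_q) 0 Y 0
    - block_mx (0 : 'M[F]_q) 0 Y 0 *m block_mx (0 : 'M[F]_q) X (0 : 'M[F]_q) 0 =
  block_mx (X *m Y) 0 0 (- (Y *m X)).
Proof.
by rewrite !mulmx_block !(mulmx0, mul0mx, addr0, add0r) opp_block_mx add_block_mx oppr0 !addr0 add0r.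
Qed.

Lemma lower_lower X Y : block_mx (0 : 'M[F]_q) 0 X (0 : 'M[F]_q) *m block_mx (0 : 'M[F]_q) 0 Y (0 : 'M[F]_q) = 0.
Proof. by rewrite mulmx_block !(mulmx0, mul0mx, addr0, add0r) block_mx0. Qed.
Lemma upper_upper X Y : block_mx (0 : 'M[F]_q) X 0 (0 : 'M[F]_q) *m block_mx (0 : 'M[F]_q) Y 0 (0 : 'M[F]_q) = 0.
Proof. by rewrite mulmx_block !(mulmx0, mul0mx, addr0, add0r) block_mx0. Qed.

Lemma upper_skew X A B : block_mx 0 X 0 0 *m block_mx 0 A B 0 + block_mx 0 A B 0 *m (block_mx 0 X 0 0)^T =
  block_mx (X *m B + A *m X^T) 0 0 0.
Proof. by rewrite tr_block_mx !trmx0 !mulmx_block !(mulmx0, mul0mx, addr0, add0r) add_block_mx !addr0. Qed.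

Lemma lower_skew X A B : block_mx 0 0 X 0 *m block_mx 0 A B 0 + block_mx 0 A B 0 *m (block_mx 0 0 X 0)^T =
  block_mx 0 0 0 (X *m A + B *m X^T).
Proof. by rewrite tr_block_mx !trmx0 !mulmx_block !(mulmx0, mul0mx, addr0, add0r) add_block_mx !addr0. Qed.
End BlockCommutators.

Section Regularity.
Variables (R : realType) (q : nat) (s : symbol R q).
Local Notation C := (cplx R).
Local Notation a := ((symA s)^T).
Implicit Types T U V : 'M[C]_(q + q).

Lemma csp_linear z T U : csp s T -> csp s U -> csp s (z *: T + U).
Proof.
case=> c e [d f]; exists (z * c + d).
by rewrite linearP mulmxDl mulmxDr -scalemxAl -scalemxAr addrACA -scalerDr e f scalerDl scalerA.
Qed.

Lemma csp0 : csp s 0.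
Proof. by exists 0; rewrite mul0mx trmx0 mulmx0 scale0r addr0. Qed.

Lemma csp_commutator T U : csp s T -> csp s U -> csp s (commutator T U).
Proof.
case=> c e [d f]; exists 0; rewrite scale0r /commutator.
set W := sym_bracket s in e f *; have e' : T *m W = c *: W - W *m T^T by rewrite -e addrK.
have f' : U *m W = d *: W - W *m U^T by rewrite -f addrK.
have h T' U' c' d' : T' *m W = c' *: W - W *m T'^T -> U' *m W = d' *: W - W *m U'^T ->
    T' *m U' *m W = d' *: (c' *: W - W *m T'^T) - (c' *: (W *m U'^T) - W *m T'^T *m U'^T).
  by move=> e1 e2; rewrite -mulmxA e2 mulmxBr -scalemxAr e1 mulmxA e1 mulmxBl -scalemxAl.
rewrite mulmxBl (h _ _ _ _ e' f') (h _ _ _ _ f' e').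
rewrite tr_commutator mulmxBr !mulmxA; apply/matrixP => i j.
move: (W *m T^T) (W *m U^T) (W *m T^T *m U^T) (W *m U^T *m T^T) => x y z t.
by rewrite !mxE; ring.
Qed.

Lemma commutatorD T U V : commutator T (U + V) = commutator T U + commutator T V.
Proof. by rewrite /commutator mulmxDr mulmxDl opprD addrACA. Qed.
Lemma commutatorDl T U V : commutator (U + V) T = commutator U T + commutator V T.
Proof. by rewrite /commutator mulmxDr mulmxDl opprD addrACA. Qed.
Lemma commutatorC T U : commutator T U = - commutator U T.
Proof. by rewrite /commutator opprB. Qed.

Lemma commutator_jacobi T U V :
  commutator (commutator T U) V = commutator T (commutator U V) - commutator U (commutator T V).
Proof.
rewrite /commutator !mulmxBl !mulmxBr !mulmxA; apply/matrixP => i j.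
move: (T *m U *m V) (U *m T *m V) (V *m T *m U) (V *m U *m T) (T *m V *m U) (U *m V *m T) => x y z t u v.
by rewrite !mxE; ring.
Qed.

Lemma conj_opE (X : 'M[C]_q) : conj_op (block_mx 0 0 X 0) = block_mx 0 (conjmx X) 0 0.
Proof.
by rewrite /conj_op /Defs.conjmx map_block_mx !map_mx0 swap_block.
Qed.

Hypothesis Hsym : (symH s)^T = symH s.
Hypothesis Hreal : conjmx (symH s) = symH s.
Hypothesis selfadjoint : a *m symH s = symH s *m symA s.

Lemma selfadjoint_csp : csp s (block_mx 0 0 a 0).
Proof.
exists 0; rewrite scale0r /sym_bracket lower_skew trmxK Hsym mulNmx -scalemxAr -scalemxAl selfadjoint.
by rewrite subrr block_mx0.
Qed.

Lemma conj_selfadjoint_csp : csp s (block_mx 0 (conjmx a) 0 0).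
Proof.
have e : conjmx a *m symH s = symH s *m (conjmx a)^T.
  by rewrite -{1}Hreal /Defs.conjmx -map_mxM selfadjoint map_mxM -map_trmx trmxK -/(Defs.conjmx (symH s)) Hreal.
exists 0; rewrite scale0r /sym_bracket upper_skew Hsym mulmxN -scalemxAr -scalemxAl -e.
by rewrite addNr block_mx0.
Qed.
Let cspA := selfadjoint_csp.

Lemma g0p2E T : g0p2 s T <-> exists z, T = block_mx 0 0 (z *: a) 0.
Proof.
split=> [[_ []] // z ->|[z ->]]; first by exists z.
split; last by exists z.
have := csp_linear z cspA csp0; rewrite addr0 scale_block_mx !scaler0.
by [].
Qed.

Lemma g0m2E T : g0m2 s T <-> exists z, T = block_mx 0 (z *: conjmx a) 0 0.
Proof.
split=> [[U /g0p2E[z ->] <-]|[z ->]]; first by rewrite conj_opE; exists z^*; rewrite -map_mxZ.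
exists (block_mx 0 0 (z^* *: a) 0); first by apply/g0p2E; exists z^*.
by rewrite conj_opE /Defs.conjmx map_mxZ /= conjCK.
Qed.

Lemma g0p2_linear z T U : g0p2 s T -> g0p2 s U -> g0p2 s (z *: T + U).
Proof.
move=> /g0p2E[x ->] /g0p2E[y ->]; apply/g0p2E; exists (z * x + y).
by rewrite scale_block_mx add_block_mx !scaler0 !addr0 scalerA scalerDl.
Qed.

Lemma g0m2_linear z T U : g0m2 s T -> g0m2 s U -> g0m2 s (z *: T + U).
Proof.
move=> /g0m2E[x ->] /g0m2E[y ->]; apply/g0m2E; exists (z * x + y).
by rewrite scale_block_mx add_block_mx !scaler0 !addr0 scalerA scalerDl.
Qed.

Lemma g00_linear z T U : g00 s T -> g00 s U -> g00 s (z *: T + U).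
Proof.
have lin V : commutator (z *: T + U) V = z *: commutator T V + commutator U V.
  by rewrite commutatorDl /commutator -scalemxAl -scalemxAr -scalerBr.
case=> [t1 [B [D t2]] t3 t4] [u1 [B' [D' u2]] u3 u4]; split.
- exact: csp_linear.
- by exists (z *: B + B'), (z *: D + D'); rewrite t2 u2 scale_block_mx add_block_mx !scaler0 !addr0.
- by move=> V hV; rewrite lin; apply: g0p2_linear; [apply: t3|apply: u3].
by move=> V hV; rewrite lin; apply: g0m2_linear; [apply: t4|apply: u4].
Qed.

Lemma g00_commutator T U : g00 s T -> g00 s U -> g00 s (commutator T U).
Proof.
case=> [t1 [B [D t2]] t3 t4] [u1 [B' [D' u2]] u3 u4]; split.
- exact: csp_commutator.
- exists (B *m B' - B' *m B), (D *m D' - D' *m D).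
  by rewrite t2 u2 /commutator commutator_diag.
- move=> V hV; rewrite commutator_jacobi addrC -scaleN1r; apply: g0p2_linear; first by apply/u3/t3.
  by apply/t3/u3.
move=> V hV; rewrite commutator_jacobi addrC -scaleN1r; apply: g0m2_linear; first by apply/u4/t4.
by apply/t4/u4.
Qed.

(** The bracket is a multiple of [diag(conj(a) a, - a conj(a))]. Its own brackets with [g_{0,2}] and
    [g_{0,-2}] reproduce the cube and its conjugate, which the hypothesis puts back on the right
    lines. *)
Lemma cube_commutator t T U : a *m conjmx a *m a = t *: a -> g0m2 s T -> g0p2 s U -> g00 s (commutator T U).
Proof.
move=> e /g0m2E[x eT] /g0p2E[y eU].
have e' : conjmx a *m a *m conjmx a = t^* *: conjmx a.
  by have := congr1 (@Defs.conjmx R _ _) e; rewrite /Defs.conjmx !map_mxM map_mxZ /= -/(Defs.conjmx (Defs.conjmx a)) cmxK.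
have eTU : commutator T U = block_mx ((x * y) *: (conjmx a *m a)) 0 0 (- (x * y) *: (a *m conjmx a)).
  rewrite eT eU /commutator commutator_upper_lower.
  by rewrite -!scalemxAl -!scalemxAr !scalerA scaleNr [y * x]mulrC.
split.
- apply: csp_commutator; rewrite ?eT ?eU; last by case: ((g0p2E (block_mx 0 0 (y *: a) 0)).2 (ex_intro _ y (erefl _))).
  by have := csp_linear x conj_selfadjoint_csp csp0; rewrite addr0 scale_block_mx !scaler0.
- by exists ((x * y) *: (conjmx a *m a)), (- (x * y) *: (a *m conjmx a)).
- move=> V /g0p2E[z ->]; apply/g0p2E; exists (- (x * y) * z * t - (x * y) * z * t).
  rewrite eTU /commutator commutator_lower; congr block_mx.
  by rewrite -!scalemxAl -!scalemxAr !scalerA mulmxA e !scalerA scalerBl [z * (x * y)]mulrC.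
move=> V /g0m2E[z ->]; apply/g0m2E; exists ((x * y) * z * t^* + (x * y) * z * t^*).
rewrite eTU /commutator commutator_upper; congr block_mx.
rewrite -!scalemxAl -!scalemxAr !scalerA mulmxA e' !scalerA scalerDl mulrN mulNr scaleNr opprK.
by rewrite [z * (x * y)]mulrC.
Qed.

(** The bracket of [g_{0,-2}] with [g_{0,2}] is handled by [cube_commutator]; the others stay in
    place by the definition of [g_{0,0}]. The contrapositive turns non-regularity of the symbol into
    a condition on matrices. *)
Lemma cube_regular t : a *m conjmx a *m a = t *: a -> regular_symbol s.
Proof.
move=> e T U [X [Y [Z [hX hY hZ ->]]]] [X' [Y' [Z' [hX' hY' hZ' ->]]]].
have add0 V W : g00 s V -> g00 s W -> g00 s (V + W) by move=> h /(g00_linear 1 h); rewrite scale1r.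
have addp V W : g0p2 s V -> g0p2 s W -> g0p2 s (V - W).
  by move=> h h'; rewrite addrC -scaleN1r; apply: g0p2_linear.
have addm V W : g0m2 s V -> g0m2 s W -> g0m2 s (V - W).
  by move=> h h'; rewrite addrC -scaleN1r; apply: g0m2_linear.
have opp0 V : g00 s V -> g00 s (- V).
  by move=> h; have := add0 _ _ (g00_linear (-2) h h) (g00_linear 0 h (g00_linear (-1) h h));
    rewrite scale0r add0r scaleN1r addNr addr0 -[X in _ + X]scale1r -scalerDl (_ : -2 + 1 = -1) ?scaleN1r //; ring.
have mm : commutator X X' = 0.
  case/g0m2E: hX => x ->; case/g0m2E: hX' => x' ->.
  by rewrite /commutator !upper_upper subrr.
have pp : commutator Z Z' = 0.
  case/g0p2E: hZ => x ->; case/g0p2E: hZ' => x' ->.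
  by rewrite /commutator !lower_lower subrr.
exists (commutator Y X' - commutator Y' X), (commutator X Z' + (commutator Y Y' - commutator X' Z)), (commutator Y Z' - commutator Y' Z).
case: hY hY' (hY) (hY') => _ _ y1 y2 [_ _ y1' y2'] hY hY'; split.
- by apply: addm; [apply: y2|apply: y2'].
- apply: (add0); first exact: cube_commutator e _ _.
  by apply: (add0); [apply: g00_commutator|apply/opp0/(cube_commutator e)].
- by apply: addp; [apply: y1|apply: y1'].
rewrite !commutatorD !commutatorDl mm pp (commutatorC X Y') (commutatorC Z X') (commutatorC Z Y').
apply/matrixP => i j; move: (commutator _ _) (commutator _ _) (commutator _ _) (commutator _ _) (commutator _ _) (commutator _ _) (commutator _ _) => x1 x2 x3 x4 x5 x6 x7.
by rewrite !mxE; ring.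
Qed.
End Regularity.

Lemma matrix_linear (F : fieldType) a b (f g h : 'I_a -> 'I_b -> F) z :
  (forall j k, f j k = z * g j k + h j k) ->
  \matrix_(j, k) f j k = z *: (\matrix_(j, k) g j k) + \matrix_(j, k) h j k.
Proof. by move=> e; apply/matrixP => j k; rewrite !mxE. Qed.

(** * Isotropy at a point *)

Section LocalData.
Variables (R : realType) (q : nat).
Local Notation C := (cplx R).
Local Notation N := (2 * q.+1 + 1)%N.
Local Notation T := 'rV[R]_N.
Local Notation vf := (T -> 'rV[C]_N).
Local Notation rcal := (real_calculus R N).

Definition jet (Zr : T -> 'rV[R]_N) (p : T) : 'M[R]_N :=
  \matrix_(j, k) 'D_(delta_mx 0 j) (fun y => Zr y 0 k) p.

Lemma pderiv_real (f : T -> R) j (p : T) : @pderiv R N rcal j (fun y => toC (f y)) p = toC ('D_(delta_mx 0 j) f p).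
Proof.
apply/eqP; rewrite eq_complex; apply/andP; split; first exact: eqxx.
exact/eqP/(derive_cst (0 : R)).
Qed.

Lemma bracket_real (Zr : T -> 'rV[R]_N) (X : vf) (p : T) k :
  @bracket R N rcal (fun y => toCmx (Zr y)) X p 0 k =
  \sum_j (toC (Zr p 0 j) * @pderiv R N rcal j (fun y => X y 0 k) p - X p 0 j * toC (jet Zr p j k)).
Proof.
rewrite mxE; apply: eq_bigr => j _; congr (_ - _); first by rewrite mxE.
have e : (fun y => toCmx (Zr y) 0 k) = (fun y => toC (Zr y 0 k)) by apply/funext => y; rewrite mxE.
congr (_ * _); apply: etrans (congr1 (fun f => @pderiv R N rcal j f p) e) _.
by apply: etrans (pderiv_real _ _ _) _; rewrite mxE.
Qed.

Lemma bracket_vanishing (Zr : T -> 'rV[R]_N) (X : vf) (p : T) : Zr p = 0 ->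
  @bracket R N rcal (fun y => toCmx (Zr y)) X p = - (X p *m toCmx (jet Zr p)).
Proof.
move=> Z0; apply/rowP => k; rewrite bracket_real !mxE -sumrN; apply: eq_bigr => j _.
by rewrite Z0 mxE /toC rmorph0 mul0r sub0r [toCmx _ _ _]mxE.
Qed.

Variables (M : analytic_manifold R N) (S : CR_structure M).

Definition chart_symmetry i (Zr : T -> 'rV[R]_N) :=
  (forall k, smooth (image i) (fun x => Zr x 0 k)) /\
  forall x, image i x -> forall X, @local_section R N rcal (crH S i) x X ->
    (@bracket R N rcal (fun y => toCmx (Zr y)) X x <= crH S i x)%MS.

Variable (s : symbol R q).

(* Invariants at a point of the normalized frame: [ir_h], [ir_al] and [ir_Q]
   are the Levi form, ad_K and the derivative of ad_K along K; [ir_b] and [ir_c]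
   are the components of the linear part of a symmetry vanishing at the point. *)
Record isotropy_rep (i : chart M) (p : T) := IsotropyRep {
  ir_h : 'M[C]_q; ir_al : 'M[C]_q; ir_Q : 'M[C]_q;
  ir_b : 'M[R]_N -> 'M[C]_q; ir_c : 'M[R]_N -> 'cV[C]_q;
  ir_hE : ir_h = (-2 * 'i) *: symH s;
  ir_alE : exists mu, (symA s)^T = mu *: ir_al;
  ir_S : (ir_al *m ir_h)^T = ir_al *m ir_h;
  ir_PS : (ir_al *m conjmx ir_al *m (ir_al *m ir_h))^T = ir_al *m conjmx ir_al *m (ir_al *m ir_h);
  ir_bD : forall x D D', ir_b (x *: D + D') = toC x *: ir_b D + ir_b D';
  ir_cD : forall x D D', ir_c (x *: D + D') = toC x *: ir_c D + ir_c D';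
  ir_sym : forall Zr, chart_symmetry i Zr -> Zr p = 0 -> let b := ir_b (jet Zr p) in
    [/\ exists g, b *m ir_h + ir_h *m (conjmx b)^T = g *: ir_h,
        exists x, ir_al *m b - conjmx b *m ir_al = x *: ir_al
      & forall x, b = x%:M -> x^* = - x -> x != 0 -> exists t, ir_Q = t *: (ir_al *m ir_h)];
  ir_iso : forall Zr, chart_symmetry i Zr -> Zr p = 0 -> ir_b (jet Zr p) = 0 ->
    exceptional ir_h ir_al ir_Q (conjmx (ir_c (jet Zr p))) /\
    (ir_c (jet Zr p) = 0 -> \forall y \near p, Zr y = 0) }.

Hypothesis Hs_unit : symH s \in unitmx.
Hypothesis cspA : csp s (block_mx 0 0 (symA s)^T 0).
Hypothesis irregular : forall t, (symA s)^T *m conjmx (symA s)^T *m (symA s)^T <> t *: (symA s)^T.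

(** The condition is homogeneous in [al], so the unknown factor between [ad_K] and [symA] does not
    matter, and the invertible [h] cancels. *)
Lemma irregular_rescale (al h : 'M[C]_q) mu x : h \in unitmx -> (symA s)^T = mu *: al ->
  al *m conjmx al *m (al *m h) <> x *: (al *m h).
Proof.
move=> hU e; rewrite mulmxA scalemxAl => /(can_inj (mulmxK hU)) e'.
apply: (@irregular (mu * mu^* * x)); rewrite e /Defs.conjmx map_mxZ /=.
rewrite -!scalemxAl -!scalemxAr -!scalemxAl -/(Defs.conjmx al) e' !scalerA.
by rewrite -[X in X *: _ = _]mulrA; congr (_ *: _); ring.
Qed.

(** After this point the argument no longer depends on the frame: the components [b] and [c] are
    linear functions of the 1-jet of a symmetry vanishing at [p]. *)
Lemma isotropy_rep_exists i p (E0 : 'M[C]_(q, N)) (t : 'rV[C]_N) : image i p -> conjmx t = t ->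
  @symbol_iso R N q rcal (cr_dist S i) s p E0 (conjmx E0) t -> inhabited (isotropy_rep i p).
Proof.
move=> ip ct iso; have [U [E [K [W [ad Up Ep KK norm]]]]] := frame_at Hs_unit ip ct iso.
pose F := crF Hs_unit ip ct iso ad Up Ep KK norm.
have hF : hm F = (- 2 * 'i) *: symH s by exact: hm_crF.
have [mu aF] : exists mu : C, (symA s)^T = mu *: alm F by exact: alm_crF.
have nonreg x := irregular_rescale (x := x) (hm_unit F) aF.
pose m (D : 'M[R]_N) a d : C := coef W p (- (fr t E K a p *m toCmx D)) d.
have mD x D D' a d : m (x *: D + D') a d = toC x * m D a d + m D' a d.
  rewrite /m -cofZ -cofD; congr coef; rewrite scalerN -opprD scalemxAr -mulmxDr; congr (- (_ *m _)).
  by apply/matrixP => j k; rewrite !mxE /toC rmorphD rmorphM.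
have sE Zr (hZ : chart_symmetry i Zr) : Zr p = 0 -> forall a,
    gev (sz (crZ Hs_unit ip ct iso ad Up Ep KK norm hZ.1 hZ.2) a) = 0.
  move=> z0 a; rewrite sz_ev z0 /coef (_ : toCmx 0 = 0) ?mul0mx ?mxE //.
  by apply/matrixP => j k; rewrite !mxE.
have bE Zr (hZ : chart_symmetry i Zr) : Zr p = 0 ->
    bv (crZ Hs_unit ip ct iso ad Up Ep KK norm hZ.1 hZ.2) = \matrix_(j, k) m (jet Zr p) (fE j) (fE k).
  move=> z0; apply/matrixP => j k; rewrite [LHS]mxE [RHS]mxE; apply: etrans (sm_ev _ _ _ _ _ _ _ _ _ _ _ _ _) _.
  by rewrite bracket_vanishing.
have cE Zr (hZ : chart_symmetry i Zr) : Zr p = 0 ->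
    ccv (crZ Hs_unit ip ct iso ad Up Ep KK norm hZ.1 hZ.2) = \col_j m (jet Zr p) (fE j) fK.
  move=> z0; apply/colP => j; rewrite [LHS]mxE [RHS]mxE; apply: etrans (sm_ev _ _ _ _ _ _ _ _ _ _ _ _ _) _.
  by rewrite bracket_vanishing.
constructor; apply: (@IsotropyRep i p (hm F) (alm F) (Qm F) (fun D => \matrix_(j, k) m D (fE j) (fE k))
  (fun D => \col_j m D (fE j) fK)).
- exact: hF.
- by exists mu.
- exact: symS.
- exact: (symPS F (@gev_cj R N p)).
- by move=> x D D'; apply: matrix_linear => j k; apply: mD.
- by move=> x D D'; apply: matrix_linear => j k; apply: mD.
- move=> Zr hZ z0; rewrite -(bE Zr hZ z0); set Y := crZ _ _ _ _ _ _ _ _ _ _ _.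
  have Y0 := sE Zr hZ z0; split.
  + by eexists; apply: (isotropy_h (@gev_cj R N p) (@gev_unit R N p) Y0).
  + by eexists; apply: (isotropy_al (@gev_cj R N p) (@gev_unit R N p) Y0).
  + move=> x b0 x1 x2; exact: (isotropy_rotation (@gev_cj R N p) (@gev_unit R N p) nonreg Y0 b0 x1 x2).
move=> Zr hZ z0; rewrite -(bE Zr hZ z0) -(cE Zr hZ z0) => b0; have Y0 := sE Zr hZ z0; split.
  exact: (isotropy_exceptional (@gev_cj R N p) (@gev_unit R N p) nonreg Y0 b0).
exact: (symmetry_zero_near nonreg Y0 b0).
Qed.
End LocalData.

(** * Unique continuation on M *)

Section Global.
Variables (R : realType) (q : nat).
Local Notation C := (cplx R).
Local Notation N := (2 * q.+1 + 1)%N.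
Local Notation T := 'rV[R]_N.
Local Notation rcal := (real_calculus R N).

Lemma Ck_sum n (U : set T) (I : finType) (f : I -> T -> R) : open U ->
  (forall a, Ck n U (f a)) -> Ck n U (fun x => \sum_a f a x).
Proof.
move=> oU h; elim: (index_enum I) => [|a r IH].
  by apply: Ck_ext (Ck_cst n U 0) => // x _; rewrite big_nil.
by apply: Ck_ext (Ck_D oU (h a) IH) => // x _; rewrite big_cons.
Qed.

Lemma limit_eq0 (f : T -> R) (x : T) (A : set T) : {for x, continuous f} ->
  (forall V, nbhs x V -> A `&` V !=set0) -> (forall y, A y -> f y = 0) -> f x = 0.
Proof.
move=> cf hA f0; apply/eqP; apply/negPn/negP => fx.
have nx : 0 < `|f x| by rewrite normr_gt0.
have /cvgrPdist_lt/(_ _ nx)/hA[y [Ay]] := cf.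
by rewrite /= (f0 y Ay) subr0 ltxx.
Qed.

Lemma jet_eq0 (Zr : T -> 'rV[R]_N) x : (\forall y \near x, Zr y = 0) -> jet Zr x = 0.
Proof.
move=> h; apply/matrixP => j k; rewrite !mxE.
rewrite (@near_eq_derive _ _ _ (fun y => Zr y 0 k) (cst 0) x); first by rewrite derive_cst.
by apply: filterS h => y ->; rewrite mxE.
Qed.

Variables (M : analytic_manifold R N) (S : CR_structure M).

Lemma symmetry_chart Z i : infinitesimal_symmetry S Z -> chart_symmetry S i (Z i).
Proof. by case=> -[h _] h'; split=> // x ix X sX; apply: h'. Qed.

Lemma chart_derivable i Zr x j k : chart_symmetry S i Zr -> image i x ->
  derivable (fun y => Zr y 0 k) x (delta_mx 0 j).
Proof. by case=> h _ ix; have [_ h1] := h k 1%N; have [h2 _] := h1 j; apply: h2. Qed.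

Section Combination.
Variables (n : nat) (Z : 'I_n -> chart M -> T -> 'rV[R]_N).
Hypothesis Zs : forall a, infinitesimal_symmetry S (Z a).
Definition combination (c : 'rV[R]_n) i x := \sum_a c 0 a *: Z a i x.

Lemma jet_combination c i x : image i x -> jet (combination c i) x = \sum_a c 0 a *: jet (Z a i) x.
Proof.
move=> ix; apply/matrixP => j k; rewrite summxE mxE.
have -> : (fun y => combination c i y 0 k) = \sum_a (c 0 a \*: (fun y => Z a i y 0 k : R^o)).
  by apply/funext => y; rewrite fct_sumE summxE; apply: eq_bigr => a _; rewrite mxE.
rewrite derive_sum => [|a]; last by apply: derivableZ; apply: chart_derivable (symmetry_chart i (Zs a)) ix.
apply: eq_bigr => a _; rewrite deriveZ; last exact: chart_derivable (symmetry_chart i (Zs a)) ix.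
by rewrite !mxE.
Qed.

Lemma combination_symmetry c : infinitesimal_symmetry S (combination c).
Proof.
split; first split.
- move=> i k n'; have oU : open (image i) by exact: coord_open.
  apply: (@Ck_ext _ _ _ _ (fun x => \sum_a c 0 a * Z a i x 0 k)) => //.
    by move=> x _; rewrite summxE; apply: eq_bigr => a _; rewrite mxE.
  apply: Ck_sum => // a; apply: Ck_M => //; first exact: Ck_cst.
  by have [[h _] _] := Zs a; apply: h.
- move=> i j x ov; rewrite mulmx_suml; apply: eq_bigr => a _.
  by have [[_ h] _] := Zs a; rewrite h // scalemxAl.
move=> i x ix X sX.
suff -> : @bracket R N rcal (fun y => toCmx (combination c i y)) X x =
    \sum_a toC (c 0 a) *: @bracket R N rcal (fun y => toCmx (Z a i y)) X x.
  by apply: summx_sub => a _; apply: scalemx_sub; have [_ h] := Zs a; apply: h.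
apply/rowP => k; rewrite bracket_real summxE.
under [RHS]eq_bigr do rewrite mxE bracket_real mulr_sumr.
rewrite exchange_big; apply: eq_bigr => j _; rewrite jet_combination //.
have -> : combination c i x 0 j = \sum_a c 0 a * Z a i x 0 j by rewrite summxE; apply: eq_bigr => a _; rewrite mxE.
have -> : (\sum_a c 0 a *: jet (Z a i) x) j k = \sum_a c 0 a * jet (Z a i) x j k.
  by rewrite summxE; apply: eq_bigr => a _; rewrite mxE.
rewrite /toC !rmorph_sum mulr_suml mulr_sumr -sumrB; apply: eq_bigr => a _.
have alg (a1 b c1 d e : C) : a1 * b * c1 - d * (a1 * e) = a1 * (b * c1 - d * e) by ring.
by rewrite !rmorphM; exact: alg.
Qed.
End Combination.

Variable (s : symbol R q).
Hypothesis hsymbol : constant_symbol S s.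
Hypothesis Hs_unit : symH s \in unitmx.
Hypothesis cspA : csp s (block_mx 0 0 (symA s)^T 0).
Hypothesis irregular : forall t, (symA s)^T *m conjmx (symA s)^T *m (symA s)^T <> t *: (symA s)^T.

Lemma isotropy_rep_at i p : image i p -> inhabited (isotropy_rep S s i p).
Proof. by move=> ip; have [E [t [ct iso]]] := hsymbol ip; apply: isotropy_rep_exists iso. Qed.

Lemma jet_zero_near i p Zr : image i p -> chart_symmetry S i Zr -> Zr p = 0 -> jet Zr p = 0 ->
  \forall y \near p, Zr y = 0.
Proof.
move=> ip hZ Z0 J0; have [r] := isotropy_rep_at ip.
have b0 : ir_b r 0 = 0.
  have := ir_bD r 1 0 0; rewrite scale1r addr0 /toC rmorph1 scale1r => /eqP.
  by rewrite -[X in X == _]addr0 (inj_eq (addrI _)) eq_sym => /eqP.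
have c0 : ir_c r 0 = 0.
  have := ir_cD r 1 0 0; rewrite scale1r addr0 /toC rmorph1 scale1r => /eqP.
  by rewrite -[X in X == _]addr0 (inj_eq (addrI _)) eq_sym => /eqP.
by have [|_] := ir_iso hZ Z0 (_ : ir_b r (jet Zr p) = 0); rewrite J0 //; apply.
Qed.

Lemma near_coordV i (P : carrier M) (V : set (carrier M)) : dom i P -> nbhs P V ->
  \forall y \near coord i P, V (coordV i y).
Proof.
move=> dP nV; have := coordV_continuous (ex_intro2 _ _ P dP (erefl (coord i P))).
by rewrite /prop_for /continuous_at coordK // => h; exact: h.
Qed.

Lemma near_coord i (P : carrier M) (V : set T) : dom i P -> nbhs (coord i P) V ->
  \forall Q \near P, V (coord i Q).
Proof. by move=> dP nV; have := Defs.coord_continuous dP; rewrite /prop_for /continuous_at => h; exact: h. Qed.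

Lemma dom_near i (P : carrier M) : dom i P -> \forall Q \near P, dom i Q.
Proof. by move=> dP; apply: open_nbhs_nbhs; split=> //; apply: dom_open. Qed.

(** The set [B] of points near which Z vanishes is open. At a point of its closure Z and its first
    derivatives vanish by continuity, and [jet_zero_near] puts that point back in [B]; connectedness
    concludes. *)
Theorem symmetry_unique Z j y : infinitesimal_symmetry S Z -> 
  (exists i p, image i p /\ \forall y \near p, Z i y = 0) -> image j y -> Z j y = 0.
Proof.
move=> hZ [i0 [p0 [ip0 near0]]].
pose B := [set P : carrier M | exists i, dom i P /\ \forall y \near coord i P, Z i y = 0].
(* Vanishing near a point is independent of the chart, by the transformation rule of vector
   fields. *)
have change P i : B P -> dom i P -> \forall y \near coord i P, Z i y = 0.
  move=> [l [dl nl]] di.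
  have n0 : \forall Q \near P, dom l Q /\ Z l (coord l Q) = 0.
    by apply: filterI; [exact: dom_near|exact: (near_coord dl nl)].
  have n1 := near_coordV di n0.
  have n2 : \forall y \near coord i P, image i y by apply: open_nbhs_nbhs; split; [exact: coord_open|exists P].
  apply: filterS (filterI n1 n2) => z [[dz Zz] [Q dQ Qz]]; move: dz Zz; rewrite -Qz coordK // => dz Zz.
  have ov : overlap l i (coord l Q) by exists Q.
  have := hZ.1.2 l i _ ov; by rewrite Zz mul0mx /transition coordK.
have BT : B = [set: carrier M].
  apply: (@carrier_connected _ _ M).
  - by case: ip0 => P dP Pp; exists P, i0; rewrite Pp.
  - exists B; last by rewrite setTI.
    rewrite openE => P [i [di ni]].
    have n1 := near_coord di (nbhs_interior ni).
    by apply: filterS (filterI (dom_near di) n1) => Q [dQ nQ]; exists i.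
  exists B; last by rewrite setTI.
  move=> P clP; have [i di] := dom_cover P; exists i; split=> //.
  pose A := [set y : T | image i y /\ \forall z \near y, Z i z = 0].
  have hA V : nbhs (coord i P) V -> A `&` V !=set0.
    move=> nV; have [Q [BQ [VQ dQ]]] := clP _ (filterI (near_coord di nV) (dom_near di)).
    by exists (coord i Q); split=> //; split; [exists Q|apply: change].
  have hc := symmetry_chart i hZ; have ix : image i (coord i P) by exists P.
  apply: (jet_zero_near ix hc).
    apply/rowP => k; rewrite mxE; apply: (limit_eq0 _ hA (f := fun y => Z i y 0 k)).
      by have [h _] := hc; apply: (Ck_cont (h k 0%N)).
    by move=> z [_ nz]; rewrite (nbhs_singleton nz) mxE.
  apply/matrixP => a k; rewrite [RHS]mxE.
  apply: (limit_eq0 _ hA (f := fun y => jet (Z i) y a k)).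
    have [h _] := hc; have [_ /(_ a)[_ h1]] := h k 1%N.
    have -> : (fun y0 => jet (Z i) y0 a k) = 'D_(delta_mx 0 a) (fun x2 : T => Z i x2 0 k).
      by apply/funext => z; rewrite mxE.
    exact: (h1.1 _ ix).
  by move=> z [_ /jet_eq0 ->]; rewrite mxE.
case=> P dP <-; have BP : B P by rewrite BT.
exact: (nbhs_singleton (change P j BP dP)).
Qed.
End Global.

(** * The dimension bound *)

Section RealFamilies.
Variable R : realType.
Local Notation C := (cplx R).

(** If [c] kills both the [B l] and their conjugates, then [c] and [conj c] both kill the [B l],
    hence so do the real and imaginary parts of [c]. *)
Lemma complexify k a b (B : 'I_k -> 'M[C]_(a, b)) :
  (forall u : 'I_k -> R, \sum_l toC (u l) *: B l = 0 -> forall l, u l = 0) ->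
  forall c : 'I_k -> C, \sum_l c l *: B l = 0 -> \sum_l c l *: conjmx (B l) = 0 -> forall l, c l = 0.
Proof.
move=> indep c c1 /(congr1 (@Defs.conjmx R _ _)) c2.
have {c2} c2 : \sum_l (c l)^* *: B l = 0.
  rewrite -[RHS](_ : conjmx 0 = 0); last by rewrite /Defs.conjmx map_mx0.
  rewrite -c2; apply/matrixP => x y; rewrite mxE !summxE rmorph_sum; apply: eq_bigr => l _.
  by rewrite !mxE rmorphM /= conjCK.
have reC (z : C) : z = toC (complex.Re z) + 'i * toC (complex.Im z).
  by case: z => x y; apply/eqP; rewrite eq_complex /=; apply/andP; split; apply/eqP; ring.
have twoRe (z : C) : 2 * toC (complex.Re z) = z + z^*.
  by case: z => x y; apply/eqP; rewrite eq_complex /=; apply/andP; split; apply/eqP; ring.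
have two : 2 != 0 :> C by rewrite pnatr_eq0.
have re0 l : complex.Re (c l) = 0.
  apply: (indep (fun l => complex.Re (c l))); apply: (scalerI two); rewrite scaler0.
  rewrite -[RHS](_ : \sum_l c l *: B l + \sum_l (c l)^* *: B l = 0); last by rewrite c1 c2 addr0.
  rewrite -big_split [LHS]scaler_sumr; apply: eq_bigr => l' _.
  by rewrite /= scalerA -scalerDl twoRe.
have im0 l : complex.Im (c l) = 0.
  apply: (indep (fun l => complex.Im (c l))); apply: (scalerI (@neq0Ci C)); rewrite scaler0.
  rewrite -[RHS]c1 scaler_sumr; apply: eq_bigr => l' _; rewrite scalerA; congr (_ *: _).
  by rewrite [RHS]reC re0 /toC rmorph0 add0r.
by move=> l; rewrite [c l]reC re0 im0 /toC rmorph0 mulr0 addr0.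
Qed.

Variables (gamma : nat) (eps lambda : 'I_gamma -> C) (m : 'I_gamma -> nat).
Hypothesis heps : forall i, eps i = 1 \/ eps i = -1.
Hypothesis hlambda : forall i, 0 <= 'Re (lambda i) /\ 0 <= 'Im (lambda i).
Hypothesis hm : forall i, (0 < m i)%N.
Local Notation s := (canon_symbol eps lambda m).
Local Notation q := (canon_size lambda m).

Lemma canon_real : conjmx (symH s) = symH s.
Proof.
rewrite /= conj_mxdiag; apply: eq_mxdiag => i; apply/matrixP => r c; rewrite !mxE rmorphM /= conjC_nat.
by case: (heps i) => ->; rewrite ?rmorphN rmorph1.
Qed.

Definition real_derivation (B : 'M[C]_q) :=
  (exists g, B *m symH s + symH s *m (conjmx B)^T = g *: symH s) /\
  (exists x, (symA s)^T *m B - conjmx B *m (symA s)^T = x *: (symA s)^T).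

(** Take [D = conj B]: the equation for [be] is then the conjugate of the one for [al], and
    [complexify] provides the independence of the pairs. *)
Lemma real_derivation_dim k (B : 'I_k -> 'M[C]_q) :
  (forall u : 'I_k -> R, \sum_l toC (u l) *: B l = 0 -> forall l, u l = 0) ->
  (forall l, real_derivation (B l)) ->
  (k <= dtotal lambda m + 3)%N /\ (~ nilpotent_op s -> (k <= dtotal lambda m + 2)%N).
Proof.
move=> indep der; have [g hg] := choice (fun l => (der l).1); have [x hx] := choice (fun l => (der l).2).
apply: (derivation_dim heps hlambda hm (B := B) (D := fun l => conjmx (B l)) (g := g) (al := x) (be := fun l => (x l)^*)).
  move=> l; split; [exact: hg|exact: hx|].
  have := congr1 (@Defs.conjmx R _ _) (hx l).
  by rewrite /Defs.conjmx map_mxB !map_mxM map_mxZ /= -/(Defs.conjmx (Defs.conjmx (B l))) cmxK.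
exact: complexify.
Qed.
End RealFamilies.

Section Bound.
Variables (R : realType) (q : nat).
Local Notation C := (cplx R).
Local Notation N := (2 * q.+1 + 1)%N.
Variables (M : analytic_manifold R N) (S : CR_structure M) (s : symbol R q).
Hypothesis hsymbol : constant_symbol S s.
Hypothesis Hs_unit : symH s \in unitmx.
Hypothesis cspA : csp s (block_mx 0 0 (symA s)^T 0).
Hypothesis irregular : forall t, (symA s)^T *m conjmx (symA s)^T *m (symA s)^T <> t *: (symA s)^T.
Variable Dg : nat.
Hypothesis Dg_bound : forall k (B : 'I_k -> 'M[C]_q),
  (forall u : 'I_k -> R, \sum_l toC (u l) *: B l = 0 -> forall l, u l = 0) ->
  (forall l, (exists g, B l *m symH s + symH s *m (conjmx (B l))^T = g *: symH s) /\
    exists x, (symA s)^T *m B l - conjmx (B l) *m (symA s)^T = x *: (symA s)^T) -> (k <= Dg)%N.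
Variables (n : nat) (Z : 'I_n -> chart M -> 'rV[R]_N -> 'rV[R]_N).
Hypothesis Zs : forall a, infinitesimal_symmetry S (Z a).
Hypothesis indep : forall c : 'I_n -> R,
  (forall i x, image i x -> \sum_a c a *: Z a i x = 0) -> forall a, c a = 0.
Variables (i : chart M) (p : 'rV[R]_N).
Hypothesis ip : image i p.
Variable r : isotropy_rep S s i p.
Implicit Type c : 'rV[R]_n.

Let V : 'M[R]_(n, N) := \matrix_a Z a i p.
Let D c := jet (combination Z c i) p.
Let b c := ir_b r (D c).
Let e c := ir_c r (D c).

Lemma value_combination c : combination Z c i p = c *m V.
Proof. by rewrite mulmx_sum_row; apply: eq_bigr => a _; rewrite rowK. Qed.

Lemma D_linear x c c' : D (x *: c + c') = x *: D c + D c'.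
Proof.
rewrite /D !(jet_combination Zs) // scaler_sumr -big_split; apply: eq_bigr => a _.
by rewrite !mxE scalerDl scalerA.
Qed.
Lemma b_linear x c c' : b (x *: c + c') = toC x *: b c + b c'.
Proof. by rewrite /b D_linear ir_bD. Qed.
Lemma e_linear x c c' : e (x *: c + c') = toC x *: e c + e c'.
Proof. by rewrite /e D_linear ir_cD. Qed.

Lemma sym c : chart_symmetry S i (combination Z c i).
Proof. exact/symmetry_chart/combination_symmetry. Qed.

Lemma combination_eq0 c : (\forall y \near p, combination Z c i y = 0) -> c = 0.
Proof.
move=> nc; apply/rowP => a; rewrite [RHS]mxE; apply: (indep (c := fun a => c 0 a)) => j x jx.
apply: (symmetry_unique hsymbol Hs_unit cspA irregular (combination_symmetry Zs c)) jx.
by exists i, p.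
Qed.

Lemma isotropy_eq0 c : c *m V = 0 -> b c = 0 -> e c = 0 -> c = 0.
Proof.
rewrite -value_combination => c0 bc ec; apply: combination_eq0.
by have [_] := ir_iso (sym c) c0 bc; apply.
Qed.

Lemma h_unit : ir_h r \in unitmx.
Proof. by rewrite ir_hE unitmxZ // unitfE mulf_neq0 ?neq0Ci // oppr_eq0 pnatr_eq0. Qed.

Lemma b_derivation c : c *m V = 0 ->
  (exists g, b c *m symH s + symH s *m (conjmx (b c))^T = g *: symH s) /\
  exists x, (symA s)^T *m b c - conjmx (b c) *m (symA s)^T = x *: (symA s)^T.
Proof.
rewrite -value_combination => c0; have [[g eg] [x ex] _] := @ir_sym _ _ _ _ _ _ _ r _ (sym c) c0.
split; [exists g|exists x].
  have t0 : -2 * 'i != 0 :> C by rewrite mulf_neq0 ?neq0Ci // oppr_eq0 pnatr_eq0.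
  move: eg; rewrite ir_hE -scalemxAr -scalemxAl -scalerDr [RHS]scalerA [g * _]mulrC -[RHS]scalerA => e1.
  by apply: (scalerI t0); exact: e1.
have [mu ->] := ir_alE r; rewrite -scalemxAl -scalemxAr -scalerBr scalerA mulrC -scalerA.
by congr (_ *: _); exact: ex.
Qed.

Lemma sum_rows k (W : 'M[R]_(k, n)) (u : 'I_k -> R) :
  \sum_l toC (u l) *: b (row l W) = b (\sum_l u l *: row l W).
Proof.
have b0 : b 0 = 0.
  have := b_linear 1 0 0; rewrite scale1r addr0 /toC rmorph1 scale1r => /eqP.
  by rewrite -[X in X == _]addr0 (inj_eq (addrI _)) eq_sym => /eqP.
by elim/big_rec2: _ => [|l x y _ ->]; rewrite ?b0 // b_linear.
Qed.

Section Kernel.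
Variables (k : nat) (W : 'M[R]_(n, k)).
Hypothesis WV : forall c, c *m W = 0 -> c *m V = 0.
Hypothesis b_inj : forall c, c *m W = 0 -> b c = 0 -> c = 0.
Local Notation Y := (row_base (kermx W)).

Lemma kernel_comb (u : 'I_(\rank (kermx W)) -> R) : (\sum_l u l *: row l Y) *m W = 0.
Proof.
rewrite mulmx_suml big1 // => l _; rewrite -scalemxAl.
have /sub_kermxP -> : (row l Y <= kermx W)%MS by rewrite (submx_trans (row_sub l _)) // eq_row_base.
by rewrite scaler0.
Qed.

Lemma kernel_indep (u : 'I_(\rank (kermx W)) -> R) : \sum_l u l *: row l Y = 0 -> forall l, u l = 0.
Proof.
move=> e0 l; have : (\row_l u l) *m Y = 0.
  by rewrite mulmx_sum_row -[RHS]e0; apply: eq_bigr => l' _; rewrite mxE.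
by rewrite -(mul0mx _ Y) => /(row_free_inj (row_base_free _))/rowP/(_ l); rewrite !mxE.
Qed.

Lemma kernel_row l : row l Y *m W = 0.
Proof. by apply/sub_kermxP; rewrite (submx_trans (row_sub l _)) // eq_row_base. Qed.

Lemma kernel_size : (n <= \rank (kermx W) + k)%N.
Proof. by rewrite mxrank_ker; have := rank_leq_col W; have := rank_leq_row W; lia. Qed.

(** [W] imposes [k] real conditions that include vanishing at [p]; on the symmetries that remain,
    [b] is injective with values in a real form of [g_{0,0}]. *)
Lemma kernel_le : (n <= k + Dg)%N.
Proof.
have := kernel_size; have : (\rank (kermx W) <= Dg)%N; last by lia.
apply: (Dg_bound (B := fun l => b (row l Y))) => [u|l]; last exact/b_derivation/WV/kernel_row.
rewrite sum_rows => e0; apply: kernel_indep; apply: b_inj e0; exact: kernel_comb.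
Qed.

Lemma kernel_lt : (forall x c, c *m W = 0 -> b c = x%:M -> x^* = - x -> x = 0) -> (n.+1 <= k + Dg)%N.
Proof.
move=> rot; have := kernel_size; have : ((\rank (kermx W)).+1 <= Dg)%N; last by lia.
pose B l := if unlift ord0 l is Some l' then b (row l' Y) else ('i : C)%:M.
apply: (Dg_bound (B := B)) => [u|l].
  rewrite big_ord_recl /B unlift_none; under eq_bigr do rewrite liftK.
  rewrite (sum_rows _ (fun l => u (lift ord0 l))) scale_scalar_mx => e0.
  have bE : b (\sum_l u (lift ord0 l) *: row l Y) = (- (toC (u ord0) * 'i))%:M.
    by rewrite raddfN; apply/eqP; rewrite -addr_eq0 addrC e0.
  have z0 := rot _ _ (kernel_comb _) bE.
  have u0 : u ord0 = 0.
    have : toC (u ord0) * 'i == 0.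
      rewrite -oppr_eq0; apply/eqP/z0; rewrite rmorphN rmorphM /= conjCi mulrN !opprK.
      by congr (_ * _); apply/eqP; rewrite eq_complex /= oppr0 !eqxx.
    by rewrite mulf_eq0 (negPf (@neq0Ci C)) orbF => /eqP /(congr1 (fun z : C => complex.Re z)).
  have ul : forall l, u (lift ord0 l) = 0.
    apply: (@kernel_indep (fun l => u (lift ord0 l))); apply: b_inj (kernel_comb _) _.
    by rewrite bE u0 /toC rmorph0 mul0r oppr0 raddf0.
  by move=> l; case: (unliftP ord0 l) => [l'|] ->.
rewrite /B; case: (unlift ord0 l) => [l'|]; first exact/b_derivation/WV/kernel_row.
have cE : conjmx ('i : C)%:M = - ('i : C)%:M :> 'M[C]_q.
  by apply/matrixP => j l'; rewrite !mxE; case: (j == l'); rewrite ?mulr1n ?mulr0n ?conjCi ?conjC0 ?oppr0.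
(* The weights of the rotation [i Id]: it preserves the Levi form and multiplies [ad_K] by [2i]. *)
split; [exists 0|exists ('i + 'i)].
  by rewrite cE linearN /= tr_scalar_mx mulmxN mul_mx_scalar mul_scalar_mx subrr scale0r.
by rewrite cE mulNmx opprK mul_mx_scalar mul_scalar_mx scalerDl.
Qed.
End Kernel.

(* If [c <> 0] and both its value and [b c] vanish, a further coordinate of the
   symmetries is used to kill the line of [c], and i Id is added to the linear parts
   of the remaining ones; it is independent of them by [exceptional_Q]. *)
Theorem symmetries_le : (n <= N + Dg)%N.
Proof.
have [[c [c0 cV bc]]|no] := pselect (exists c, [/\ c != 0, c *m V = 0 & b c = 0]); last first.
  apply: (@kernel_le _ V) => // c cV bc; apply: contrapT => /eqP c0.
  by apply: no; exists c.
have nonreg x : ir_al r *m map_mx Num.conj (ir_al r) *m (ir_al r *m ir_h r) <> x *: (ir_al r *m ir_h r).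
  by have [mu ea] := ir_alE r; apply: (irregular_rescale irregular h_unit ea).
have exc c1 : c1 *m V = 0 -> b c1 = 0 -> exceptional (ir_h r) (ir_al r) (ir_Q r) (conjmx (e c1)).
  by rewrite -value_combination => v0 b0; have [] := ir_iso (sym c1) v0 b0.
have conj0 c1 : c1 != 0 -> c1 *m V = 0 -> b c1 = 0 -> conjmx (e c1) != 0.
  move=> n0 v0 b0; apply: contraNneq n0 => /(congr1 (@Defs.conjmx R _ _)); rewrite cmxK.
  by rewrite /Defs.conjmx map_mx0 => e0; apply/eqP/isotropy_eq0.
have [a ca] : exists a, c 0 a != 0.
  by apply/rV0Pn.
pose W : 'M[R]_(n, N + 1) := row_mx V (delta_mx a 0).
have WE c1 : c1 *m W = 0 -> c1 *m V = 0 /\ c1 0 a = 0.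
  rewrite mul_mx_row => eW; have [-> ea] : c1 *m V = 0 /\ c1 *m delta_mx a 0 = 0 :> 'M[R]_1.
    by apply/eq_row_mx; rewrite eW row_mx0.
  by split=> //; have := congr1 (fun X : 'M[R]_1 => X 0 0) ea; rewrite -colE !mxE.
(* On the right the 1 is the extra coordinate in [W]; on the left it is the rotation added to the
   family. *)
suff : (n.+1 <= N + 1 + Dg)%N by lia.
apply: (@kernel_lt _ W) => [c1 /WE[]|c1 /WE[v1 a1] b1|x c1 /WE[v1 _] bx xi] //.
  apply: contrapT => /eqP n1.
  have [z zr ez] := exceptional_line h_unit (ir_S r) (ir_PS r) nonreg (conj0 _ n1 v1 b1) (conj0 _ c0 cV bc)
    (exc _ v1 b1) (exc _ cV bc).
  have ec : e c = z *: e c1.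
    by have := congr1 (@Defs.conjmx R _ _) ez; rewrite cmxK /Defs.conjmx map_mxZ /= zr -/(Defs.conjmx (Defs.conjmx (e c1))) cmxK.
  have zE : z = toC (complex.Re z).
    move: zr; case: (z) => x y /eqP; rewrite eq_complex /= eqxx /= => /eqP yy; apply/eqP.
    rewrite eq_complex /= eqxx /=; apply/eqP; lra.
  (* As [z] is real, this real combination has vanishing value, [b] and [e], so it is 0; but its
     coordinate [a] is that of [c], chosen nonzero. *)
  have : (- complex.Re z) *: c1 + c = 0.
    apply: isotropy_eq0.
    - by rewrite mulmxDl -scalemxAl v1 cV scaler0 addr0.
    - by rewrite b_linear b1 bc scaler0 addr0.
    by rewrite e_linear ec /toC rmorphN /= -/(toC _) -zE scaleNr addNr.
  move=> /rowP/(_ a); rewrite !mxE a1 mulr0 add0r => c00.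
  by move: ca; rewrite c00 eqxx.
apply/eqP/negPn/negP => x0; rewrite -value_combination in v1.
have [_ _ /(_ x bx xi x0)[t Qt]] := @ir_sym _ _ _ _ _ _ _ r _ (sym c1) v1.
exact: (exceptional_Q (ir_S r) (ir_PS r) nonreg (conj0 _ c0 cV bc) (exc _ cV bc) Qt).
Qed.
End Bound.

Theorem theorem4p4 (R : realType) (gamma : nat)
    (eps lambda : 'I_gamma -> cplx R) (m : 'I_gamma -> nat)
    (heps : forall i, eps i = 1 \/ eps i = -1)
    (hm : forall i, (0 < m i)%N)
    (hlambda : forall i, 0 <= 'Re (lambda i) /\ 0 <= 'Im (lambda i))
    (hnonregular : ~ regular_symbol (canon_symbol eps lambda m))
    (M : analytic_manifold R (2 * (canon_size lambda m).+1 + 1))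
    (S : CR_structure M)
    (hsymbol : constant_symbol S (canon_symbol eps lambda m))
    (g0red : set 'M[cplx R]_(canon_size lambda m + canon_size lambda m))
    (hreduced : constant_reduced_symbol S (canon_symbol eps lambda m) g0red) :
  let n := (canon_size lambda m).+1 in
  (~ nilpotent_op (canon_symbol eps lambda m) ->
     symmetry_dim_le S (dtotal lambda m + 2 * n + 3)) /\
  (nilpotent_op (canon_symbol eps lambda m) ->
     symmetry_dim_le S (dtotal lambda m + 2 * n + 4)).
Proof.
move=> n; set s := canon_symbol eps lambda m in hnonregular hsymbol hreduced *.
have Hsym := canon_symmetric eps lambda m; have Hreal := canon_real lambda m heps.
have sa := canon_selfadjoint eps lambda m; have Hu := canon_unit lambda m heps.
have cspA := selfadjoint_csp Hsym sa.
have irregular t : (symA s)^T *m conjmx (symA s)^T *m (symA s)^T <> t *: (symA s)^T.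
  by move=> e; apply: hnonregular; apply: (cube_regular Hsym Hreal sa e).
(* The isotropy is counted at a real point of the complexified piece. *)
have [i [c _]] := hreduced; have [x /cm_chart ix] := cm_real_point c.
have [r] := isotropy_rep_at hsymbol Hu cspA irregular ix.
have main Dg : (forall k (B : 'I_k -> 'M[cplx R]_(canon_size lambda m)),
    (forall u : 'I_k -> R, \sum_l toC (u l) *: B l = 0 -> forall l, u l = 0) ->
    (forall l, real_derivation eps (B l)) -> (k <= Dg)%N) -> symmetry_dim_le S (2 * n + 1 + Dg).
  move=> h k Z Zs indep.
  exact: (symmetries_le hsymbol Hu cspA irregular h Zs indep ix r).
split=> nil.
  rewrite (_ : _ + _ = 2 * n + 1 + (dtotal lambda m + 2))%N; last by lia.
  by apply: main => k B h1 h2; apply: (real_derivation_dim heps hlambda hm h1 h2).2.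
rewrite (_ : _ + _ = 2 * n + 1 + (dtotal lambda m + 3))%N; last by lia.
by apply: main => k B h1 h2; apply: (real_derivation_dim heps hlambda hm h1 h2).1.
Qed.
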